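(* For each $\xi>0$, there exists $Q=Q(\xi)\in\mathbb{R}$ such that $$\lambda_n = 2^{-(1-\xi Q)n+o(n)}\quad\text{as } n\to\infty.$$ Furthermore, $\xi\mapsto Q(\xi)$ is a continuous, non-increasing function on $(0,\infty)$ and $$\frac1\xi-\sqrt{2d}\le Q(\xi)\le \frac1\xi+\sqrt2,\qquad \forall \xi>0.$$
   Context: Fix an integer $d\ge 2$. For $x\in\mathbb{R}^d$ and $r>0$ let $B_r(x)=x+(-r,r)^d$. Fix a smooth function $\mathfrak K:\mathbb{R}^d\to[0,\infty)$ and $\mathfrak r_0>0$ such that $\mathfrak K$ is radially symmetric (its value depends only on the Euclidean norm of the argument), $\mathfrak K$ is supported in $B_{\mathfrak r_0}(0)$, and $\int_{\mathbb{R}^d}\mathfrak K(x)^2dx=1$. Let $W$ be a space-time white noise on $\mathbb{R}^d\times(0,\infty)$, i.e. the Gaussian random generalized function such that for $f\in L^2(\mathbb{R}^d\times(0,\infty))$, $\int f\,dW$ is centered Gaussian with variance $\|f\|_{L^2}^2$. For integers $n\ge1$ let $$h_n(x)=\int_{\mathbb{R}^d}\int_{2^{-n}}^1\mathfrak K\Big(\frac{y-x}{t}\Big)t^{-\frac{d+1}{2}}W(dy,dt),$$ taken to be its smooth modification. For $\xi>0$ let $$D_n(z,w)=\inf_{P:z\to w}\int_0^1e^{\xi h_n(P(t))}|P'(t)|\,dt,\qquad z,w\in\mathbb{R}^d,$$ where the infimum is over piecewise continuously differentiable paths $P:[0,1]\to\mathbb{R}^d$ from $z$ to $w$. Let $D_n(0,e_1;B_2(0))$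 be the infimum of the $D_n$-lengths of paths joining $0$ and $e_1=(1,0,\dots,0)$ inside the box $B_2(0)$, and let $\lambda_n$ (which depends on $\xi$) be the median of $D_n(0,e_1;B_2(0))$. *)

(* Defs.v *)
From HB Require Import structures.
From mathcomp Require Import all_boot all_order all_algebra.
From mathcomp Require Import all_classical all_reals all_analysis.

Set Implicit Arguments.
Unset Strict Implicit.
Unset Printing Implicit Defensive.

Import Order.TTheory GRing.Theory Num.Theory.
Import numFieldNormedType.Exports.

Local Open Scope classical_set_scope.
Local Open Scope ring_scope.

Definition measure_matrix_display : measure_display -> measure_display.
Proof. exact. Qed.

Section measurable_matrix.
Context {d} {T : measurableType d} (m n : nat).

(* For T = R this is the Borel sigma-algebra of R^(m * n). *)
Definition matrix_cylinders : set (set 'M[T]_(m, n)) :=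
  [set A | exists i j, exists2 B : set T, measurable B &
     A = [set M : 'M[T]_(m, n) | B (M i j)]].

Let mx_set0 : <<s matrix_cylinders >> set0.
Proof. exact: sigma_algebra0. Qed.

Let mx_setC A : <<s matrix_cylinders >> A -> <<s matrix_cylinders >> (~` A).
Proof. exact: sigma_algebraC. Qed.

Let mx_bigcup (F : _^nat) : (forall i, <<s matrix_cylinders >> (F i)) ->
  <<s matrix_cylinders >> (\bigcup_i (F i)).
Proof. exact: sigma_algebra_bigcup. Qed.

HB.instance Definition _ := @isMeasurable.Build (measure_matrix_display d)
  'M[T]_(m, n) <<s matrix_cylinders >> mx_set0 mx_setC mx_bigcup.

End measurable_matrix.

Lemma measurable_coord d (T : measurableType d) m n (i : 'I_m) (j : 'I_n) :
  measurable_fun setT (fun M : 'M[T]_(m, n) => M i j).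
Proof.
move=> _ B mB; rewrite setTI; apply: sub_sigma_algebra.
by exists i, j, B.
Qed.

Lemma measurable_fun_matrixP d d' (X : measurableType d)
    (T : measurableType d') m n (f : X -> 'M[T]_(m, n)) :
  (forall i j, measurable_fun setT (fun x => f x i j)) -> measurable_fun setT f.
Proof.
move=> mf; apply: (@measurability _ _ _ _ _ _ (@matrix_cylinders _ T m n)) => //.
move=> _ [_ [i [j [B mB ->]]] <-].
by have := mf i j measurableT B mB.
Qed.

Section lebesgue_measure_rV.
Context {R : realType}.

Definition rV_cons n (xv : R * 'rV[R]_n) : 'rV[R]_n.+1 :=
  \row_i if unlift ord0 i is Some j then xv.2 ord0 j else xv.1.
Definition rV_uncons n (v : 'rV[R]_n.+1) : R * 'rV[R]_n :=
  (v ord0 ord0, \row_j v ord0 (lift ord0 j)).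

Lemma rV_consK n : cancel (@rV_cons n) (@rV_uncons n).
Proof.
move=> [x v]; rewrite /rV_uncons /rV_cons mxE unlift_none; congr (_, _).
by apply/rowP => j; rewrite !mxE liftK.
Qed.

Lemma rV_unconsK n : cancel (@rV_uncons n) (@rV_cons n).
Proof.
move=> v; apply/rowP => i; rewrite mxE.
by case: unliftP => [j ->|->] //=; rewrite mxE.
Qed.

Lemma measurable_rV_cons n : measurable_fun setT (@rV_cons n).
Proof.
apply: measurable_fun_matrixP => i j.
under eq_fun do rewrite mxE.
case: (unlift ord0 j) => [k|]; last exact: measurable_fst.
exact: (measurableT_comp (@measurable_coord _ R 1 n ord0 k) measurable_snd).
Qed.

Lemma measurable_rV_uncons n : measurable_fun setT (@rV_uncons n).
Proof.
apply/measurable_fun_pairP; split; first exact: measurable_coord.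
apply: measurable_fun_matrixP => i j.
under eq_fun do rewrite /= mxE.
exact: measurable_coord.
Qed.

Section succ.
Variables (n : nat) (m : {sigma_finite_measure set 'rV[R]_n -> \bar R}).

Definition lebesgue_succ : set 'rV[R]_n.+1 -> \bar R :=
  pushforward (lebesgue_measure \x m)%E (@rV_cons n).

Let succ0 : lebesgue_succ set0 = 0%E.
Proof. by rewrite /lebesgue_succ /pushforward preimage_set0 measure0. Qed.

Let succ_ge0 A : (0 <= lebesgue_succ A)%E.
Proof. by rewrite /lebesgue_succ /pushforward measure_ge0. Qed.

Let succ_sigma_additive : semi_sigma_additive lebesgue_succ.
Proof.
have mf := @measurable_rV_cons n.
exact: (@measure_semi_sigma_additive _ _ _
  (pushforward (lebesgue_measure \x m)%E (@rV_cons n))).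
Qed.

HB.instance Definition _ := isMeasure.Build _ _ _ lebesgue_succ
  succ0 succ_ge0 succ_sigma_additive.

Let succ_sigma_finite : sigma_finite setT lebesgue_succ.
Proof.
have /sigma_finiteP[F [TF ndF Foo]] := sigma_finiteT (@lebesgue_measure R).
have /sigma_finiteP[G [TG ndG Goo]] := sigma_finiteT m.
exists (fun k => @rV_uncons n @^-1` (F k `*` G k)).
  rewrite -preimage_bigcup (_ : \bigcup_k _ = setT) ?preimage_setT//.
  apply/seteqP; split=> // -[x v] _.
  have [k _ Fkx] : (\bigcup_k F k) x by rewrite -TF.
  have [l _ Glv] : (\bigcup_k G k) v by rewrite -TG.
  exists (maxn k l) => //; split => /=.
    by move: x Fkx; exact/subsetPset/ndF/leq_maxl.
  by move: v Glv; exact/subsetPset/ndG/leq_maxr.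
move=> k; have [mF Fkoo] := Foo k; have [mG Gkoo] := Goo k.
split.
  rewrite -[X in measurable X]setTI.
  by apply: measurable_rV_uncons => //; exact: measurableX.
rewrite /lebesgue_succ /pushforward -comp_preimage.
rewrite (_ : _ \o _ = id) ?preimage_id; last first.
  by apply/funext => x /=; rewrite rV_consK.
by rewrite product_measure1E// lte_mul_pinfty// ge0_fin_numE.
Qed.

HB.instance Definition _ := Measure_isSigmaFinite.Build _ _ _ lebesgue_succ
  succ_sigma_finite.

End succ.

(* Lebesgue measure on R^n: the n-fold product of the one-dimensional one. *)
Fixpoint lebesgue_rV n : {sigma_finite_measure set 'rV[R]_n -> \bar R} :=
  if n is n'.+1 then lebesgue_succ (lebesgue_rV n') else \d_(0 : 'rV[R]_0).

Lemma lebesgue_rV_box n (A : 'I_n -> set R) : (forall i, measurable (A i)) ->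
  lebesgue_rV n [set v : 'rV[R]_n | forall i, A i (v ord0 i)] =
  (\prod_(i < n) lebesgue_measure (A i))%E.
Proof.
have mbox k (B : 'I_k -> set R) : (forall i, measurable (B i)) ->
    measurable [set v : 'rV[R]_k | forall i, B i (v ord0 i)].
  move=> mB; rewrite (_ : [set v | _] =
    \bigcap_(i in [set: 'I_k]) [set v : 'rV[R]_k | B i (v ord0 i)]); last first.
    by apply/seteqP; split=> [v Bv i _|v Bv i]; [exact: Bv|exact: (Bv i I)].
  apply: fin_bigcap_measurable => // i _.
  have := @measurable_coord _ R 1 k ord0 i measurableT _ (mB i).
  by rewrite setTI.
elim: n A => [|n IH] A mA.
  rewrite big_ord0 /= diracE mem_set//= => -[].
  by [].
rewrite big_ord_recl -IH; last by move=> i; exact: mA.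
rewrite -product_measure1E; [|exact: mA|]; last first.
  exact: (mbox _ _ (fun i => mA (lift ord0 i))).
rewrite /= /lebesgue_succ /pushforward.
apply: (congr1 (lebesgue_measure \x lebesgue_rV n)%E).
apply/seteqP; split=> -[x v] /=.
  move=> Av; split; first by move: (Av ord0); rewrite mxE unlift_none.
  by move=> i; move: (Av (lift ord0 i)); rewrite mxE liftK.
move=> [Ax Av] i; rewrite mxE; case: unliftP => [j ->|->] //=.
Qed.

End lebesgue_measure_rV.

Section smooth_functions.
Context {R : realType} {d : nat}.
Implicit Types (f : 'rV[R]_d -> R) (s : seq 'I_d).

Fixpoint iter_partial s f : 'rV[R]_d -> R :=
  if s is i :: s' then 'D_(delta_mx ord0 i) (iter_partial s' f) else f.

Definition smooth f : Prop := forall s,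
  continuous (iter_partial s f) /\
  forall x i, derivable (iter_partial s f) x (delta_mx ord0 i).

End smooth_functions.

(* The library's norm `|x| on 'rV[R]_d is the sup norm, so that
   ball x r is the open box x + (-r, r)^d. *)
Definition euclid_norm {R : realType} {d : nat} (x : 'rV[R]_d) : R :=
  Num.sqrt (\sum_i x ord0 i ^+ 2).

Definition radial {R : realType} {d : nat} (K : 'rV[R]_d -> R) : Prop :=
  forall x y, euclid_norm x = euclid_norm y -> K x = K y.

Section white_noise.
Context {R : realType} (d : nat).

Definition spacetime : set ('rV[R]_d * R) := [set z | 0 < z.2].

Definition sqr_integral (f : 'rV[R]_d * R -> R) : \bar R :=
  (\int[lebesgue_rV d \x lebesgue_measure]_(z in spacetime)
     (f z ^+ 2)%:E)%E.

Definition L2_spacetime (f : 'rV[R]_d * R -> R) : Prop :=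
  measurable_fun spacetime f /\ (sqr_integral f < +oo)%E.

(* The library's normal_prob 0 s is not Gaussian when s = 0. *)
Definition centered_normal (s : R) : set R -> \bar R :=
  if s == 0 then \d_(0 : R) else normal_prob 0 s.

Context {dO : measure_display} {Omega : measurableType dO}.
Variable P : probability Omega R.

(* W f stands for the integral of f against the noise; linearity makes the
   family (W f) jointly Gaussian. *)
Record white_noise (W : ('rV[R]_d * R -> R) -> {RV P >-> R}) : Prop := {
  white_noise_law : forall f, L2_spacetime f ->
    forall A : set R, measurable A -> distribution P (W f) A =
      centered_normal (Num.sqrt (fine (sqr_integral f))) A;
  white_noise_linear : forall (a : R) f g,
    L2_spacetime f -> L2_spacetime g ->
    {ae P, forall w, W (fun z => a * f z + g z) w = a * W f w + W g w} }.

Definition field_kernel (K : 'rV[R]_d -> R) (n : nat) (x : 'rV[R]_d)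
    (z : 'rV[R]_d * R) : R :=
  if 2 ^- n <= z.2 <= 1 then
    K ((z.2)^-1 *: (z.1 - x)) * z.2 `^ (- (d.+1%:R / 2))
  else 0.

Definition smooth_modification (W : ('rV[R]_d * R -> R) -> {RV P >-> R})
    (K : 'rV[R]_d -> R) (n : nat) (h : Omega -> 'rV[R]_d -> R) : Prop :=
  (forall w, smooth (h w)) /\
  forall x, measurable_fun setT (fun w => h w x) /\
    {ae P, forall w, h w x = W (field_kernel K n x) w}.

End white_noise.

Section exponential_metric.
Context {R : realType} {d : nat}.
Implicit Types (p : R -> 'rV[R]_d) (U : set 'rV[R]_d).

(* For continuous p this says that p is C^1 on [a, b] with one-sided derivatives at the ends. *)
Definition C1_piece p (a b : R) : Prop := exists g : R -> 'rV[R]_d,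
  {within `[a, b], continuous g} /\
  {in `]a, b[, forall t : R, is_derive t (1 : R) p (g t)}.

Definition piecewise_C1 p : Prop := {within `[0, 1], continuous p} /\
  exists s : seq R, itv_partition 0 1 s /\
    forall i, (i < size s)%N -> C1_piece p (nth 0 (0 :: s) i) (nth 0 s i).

Definition path_in U (z w : 'rV[R]_d) : set (R -> 'rV[R]_d) :=
  [set p | [/\ piecewise_C1 p, p 0 = z, p 1 = w &
               forall t : R, t \in `[0, 1] -> U (p t)]].

Definition exp_length (xi : R) (h : 'rV[R]_d -> R) p : R :=
  \int[lebesgue_measure]_(t in `[0, 1])
    (expR (xi * h (p t)) * euclid_norm (derive1 p t)).

Definition exp_dist (xi : R) (h : 'rV[R]_d -> R) (z w : 'rV[R]_d) U : R :=
  inf [set exp_length xi h p | p in path_in U z w].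

Definition e1 : 'rV[R]_d := \row_i (val i == 0%N)%:R.

End exponential_metric.

Definition is_median {R : realType} {dO : measure_display}
    {Omega : measurableType dO} (P : probability Omega R) (X : Omega -> R)
    (m : R) : Prop :=
  ((2^-1)%:E <= P [set w | (X w <= m)%R])%E /\
  ((2^-1)%:E <= P [set w | (m <= X w)%R])%E.

(* Main.v *)
Require Import Defs.
From HB Require Import structures.
From mathcomp Require Import all_boot all_order all_algebra.
From mathcomp Require Import all_classical all_reals all_analysis.
From mathcomp Require Import perm measurable_realfun.
From mathcomp Require Import ring lra zify.

Set Implicit Arguments.
Unset Strict Implicit.
Unset Printing Implicit Defensive.

Import Order.TTheory GRing.Theory Num.Theory.
Import numFieldNormedType.Exports.

Local Open Scope classical_set_scope.
Local Open Scope ring_scope.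

(** Why the exponent exists. The field [h n] varies by [O(sqrt n)] only over distances
    [2^-n], outside an event of probability at most [2^-n / 16] ([field_oscillation], by
    chaining). Up to factors [exp (O(sqrt n))], the distance [D_n(0, e_1; B_2(0))] is therefore
    [2^-n] times the lattice cost [T_n] ([field_crossing]): the least sum of [exp (xi * h_n)]
    over paths of king moves in [2^-n * Z^d] from 0 to [e_1] inside the box
    ([exp_dist_le_crossing], [crossing_le_exp_dist]). So everything can be read off from [T_n],
    which depends on finitely many values of the field. That the distance itself is a random
    variable follows by describing it through countably many discrete paths
    ([measurable_exp_dist]).

    The white noise enters through Gaussian families only: finitely many random variables all of
    whose linear combinations are Gaussian, with variances given by a quadratic form [Q]. Such
    a family has its law determined by [Q] ([gaussian_family_law], from the Cramer-Wold theorem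
    [cramer_wold]), and two families whose quadratic forms add up are independent
    ([gaussian_family_indep]). For values of the field, [Q] is the square of an [L^2] norm of
    kernels on a band of scales. Changes of variables in this norm show that [h_(n+m) - h_n] near a
    point is a scaled copy of [h_m], and kernels with disjoint supports give independence.

    Medians describe typical values because [ln T_n] is concentrated: rotating one copy of the
    field into an independent one, [passage_concentration] bounds its fluctuations by the
    maximal variance [n * ln 2] alone, so they are [O(sqrt n)].

    Near submultiplicativity. Let [L n = 2^n * lambda_n]. Take a cheapest path for the coarse
    field [h_n] and replace each of its edges by a path of the fine lattice that is cheap for
    [h_(n+m) - h_n]. By scaling the cost of a single edge has the law of [T_m]
    ([edge_cost_law]), and by concentration it rarely exceeds [exp (O(q^5)) * L m], where
    [n + m <= q^6]. There are too many edges for it never to do so. However, parallel slabs at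
    distance of the order of [2^-n] are independent, so with high probability every coarse site
    has, in each coordinate direction, a slab among [q^2] nearby ones that contains no expensive
    edge ([clear_slabs]). Travelling within these slabs connects neighbouring coarse sites along cheap
    edges only ([detour]), and all this gives
    [L (n + m) <= exp (C * q^5) * L n * L m] ([submultiplicative]). With [q] close to
    [(n + m)^(1/6)] the sequence [ln (L n)] is subadditive up to [O((n + m)^(5/6))], and
    [ln (L n) / n] converges ([near_subadditive_limit]) to a limit [growth xi].

    The number [Q xi] is [growth xi / (xi * ln 2)]. A union bound over the sites of
    the box, whose number is of order [2^(d * n)], bounds the field by [c * n * ln 2] for every
    [c > sqrt (2 * d)], which gives the lower bound ([growth_ge]); over the sites of the segment
    from 0 to [e_1], of order [2^n], any [c > sqrt 2] suffices, which gives the upper bound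
    ([growth_le]). The ratio [growth xi / xi] is
    nonincreasing because [l^p] norms are nonincreasing in [p] ([growth_power]), and [growth] is
    Lipschitz because the field on the box is [O(n)] ([growth_lipschitz]). *)

(** * Means of bounded functions *)
Section bounded_expectation.
Context {R : realType} {dO : measure_display} {Omega : measurableType dO}.
Variable P : probability Omega R.
Implicit Types f g : Omega -> R.

Definition bounded_meas f := measurable_fun setT f /\
  exists M : R, forall w, `|f w| <= M.

Definition Ex f : R := \int[P]_w f w.

Lemma bounded_meas_integrable f : bounded_meas f ->
  P.-integrable setT (EFin \o f).
Proof.
case=> mf [M fM]; apply: measurable_bounded_integrable => //.
  by rewrite -ge0_fin_numE//; exact: fin_num_measure.
exists M; split; first exact: num_real.
by move=> x Mx w _; exact: le_trans (fM w) (ltW Mx).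
Qed.

Lemma bounded_measD f g : bounded_meas f -> bounded_meas g ->
  bounded_meas (fun w => f w + g w).
Proof.
move=> [mf [M fM]] [mg [N gN]]; split; first exact: measurable_funD.
by exists (M + N) => w; rewrite (le_trans (ler_normD _ _))// lerD.
Qed.

Lemma bounded_measM f g : bounded_meas f -> bounded_meas g ->
  bounded_meas (fun w => f w * g w).
Proof.
move=> [mf [M fM]] [mg [N gN]]; split; first exact: measurable_funM.
by exists (M * N) => w; rewrite normrM ler_pM.
Qed.

Lemma bounded_meas_cst c : bounded_meas (fun=> c).
Proof. by split => //; exists `|c|. Qed.

Lemma ExD f g : bounded_meas f -> bounded_meas g ->
  Ex (fun w => f w + g w) = Ex f + Ex g.
Proof. by move=> bf bg; rewrite /Ex RintegralD//; exact: bounded_meas_integrable. Qed.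

Lemma ExZ c f : bounded_meas f -> Ex (fun w => c * f w) = c * Ex f.
Proof. by move=> bf; rewrite /Ex RintegralZl//; exact: bounded_meas_integrable. Qed.

Lemma eq_Ex f g : f =1 g -> Ex f = Ex g.
Proof. by move=> fg; congr Ex; exact/funext. Qed.

Lemma Ex_indic A : measurable A -> (Ex \1_A)%:E = P A.
Proof.
move=> mA; rewrite /Ex /Rintegral integral_indic// setIT fineK//.
exact: fin_num_measure.
Qed.

Lemma Ex_cvg (f_ : nat -> Omega -> R) f (M : R) :
  (forall n, measurable_fun setT (f_ n)) -> (forall n w, `|f_ n w| <= M) ->
  (forall w, f_ n w @[n --> \oo] --> f w) -> Ex (f_ n) @[n --> \oo] --> Ex f.
Proof.
move=> mf fM cf; apply: fine_cvg.
have bf : bounded_meas f.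
  split; first by apply: measurable_fun_cvg mf _ => w _; exact: cf.
  exists M => w; have /cvg_norm cn := cf w.
  rewrite -(cvg_lim _ cn)//; apply: limr_le; first by apply/cvg_ex; eexists; exact: cn.
  by near=> n; exact: fM.
rewrite fineK; last first.
  exact: integrable_fin_num (bounded_meas_integrable bf).
apply: (@dominated_cvg _ _ _ P setT _ _ _ (cst M%:E)) => //.
- by move=> n; apply/measurable_EFinP.
- move=> w _; apply: cvg_EFin; last exact: cf.
  by near=> n.
- by apply: (@bounded_meas_integrable (fun=> M)); exact: bounded_meas_cst.
- by move=> n w _ /=; rewrite lee_fin.
Unshelve. all: by end_near. Qed.

End bounded_expectation.

(** The sigma-algebra generated by the coordinates is the one on which the law of a family of
    random variables is tested. *)
Definition cylinders (R : realType) (I : Type) : set (set (I -> R)) :=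
  [set A | exists i, exists2 B : set R, measurable B &
     A = [set x : I -> R | B (x i)]].

Definition paramspace (R : realType) (I : Type) :=
  g_sigma_algebraType (@cylinders R I).

Lemma measurable_param (R : realType) (I : Type) (i : I) :
  measurable_fun setT (fun x : paramspace R I => x i).
Proof.
move=> _ B mB; rewrite setTI; apply: sub_sigma_algebra.
by exists i, B.
Qed.

Lemma measurable_fun_param (R : realType) (I : Type) d (T : measurableType d)
    (X : I -> T -> R) : (forall i, measurable_fun setT (X i)) ->
  measurable_fun setT (fun w => (fun i => X i w) : paramspace R I).
Proof.
move=> mX; apply: (@measurability _ _ _ (paramspace R I) _ _ (@cylinders R I)) => //.
move=> _ [_ [i [B mB ->]] <-].
exact: (mX i measurableT B mB).
Qed.

(** * A polynomial step *)
Section smoothstep.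
Context {R : realType}.

(** Being a polynomial, [sstep] can be composed with elements of an algebra of functions; its
    iterates converge to the indicator of ]1/2, 1] on [0, 1], except at the fixed point 1/2. *)
Definition sstep (v : R) := v * (v * (3 - 2 * v)).

Lemma sstep01 v : 0 <= v <= 1 -> 0 <= sstep v <= 1.
Proof.
move=> /andP[v0 v1]; rewrite /sstep; apply/andP; split; first by nra.
have : 0 <= (1 - v) * (1 - v) * (1 + 2 * v).
  by rewrite mulr_ge0 ?mulr_ge0 ?subr_ge0//; lra.
by nra.
Qed.

Lemma iter_sstep01 k v : 0 <= v <= 1 -> 0 <= iter k sstep v <= 1.
Proof. by move=> v01; elim: k => //= k; exact: sstep01. Qed.

Lemma iter_sstep_small v : 0 <= v < 2^-1 -> iter k sstep v @[k --> \oo] --> (0 : R).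
Proof.
move=> /andP[v0 v1]; set r := v * (3 - 2 * v).
have r0 : 0 <= r by rewrite /r; nra.
have r1 : r < 1 by rewrite /r; nra.
have H k : 0 <= iter k sstep v <= v * r ^+ k.
  elim: k => [|k /andP[IH0 IH1]] /=; first by rewrite expr0 mulr1 v0 lexx.
  have xv : iter k sstep v <= v.
    apply: (le_trans IH1); rewrite ler_piMr// exprn_ile1//; exact: ltW.
  rewrite /sstep; set x := iter k sstep v in IH0 IH1 xv *.
  apply/andP; split; first by nra.
  rewrite exprSr (mulrA v); apply: ler_pM => //; first by nra.
  by rewrite /r; nra.
apply: (@squeeze_cvgr _ _ _ _ (fun=> 0) (fun k => v * r ^+ k)).
- by near=> k; exact: H.
- exact: cvg_cst.
- rewrite -[X in _ --> X](mulr0 v); apply: cvgMr; apply: cvg_expr.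
  by rewrite ger0_norm.
Unshelve. all: by end_near. Qed.

Lemma iter_sstep_half k : iter k sstep (2^-1 : R) = 2^-1.
Proof. by elim: k => //= k ->; rewrite /sstep; field. Qed.

Lemma iter_sstep_sym k v : iter k sstep (1 - v) = 1 - iter k sstep v.
Proof. by elim: k => //= k ->; rewrite /sstep; ring. Qed.

Lemma iter_sstep_large v : 2^-1 < v <= 1 -> iter k sstep v @[k --> \oo] --> (1 : R).
Proof.
move=> v01; have := @iter_sstep_small (1 - v).
have -> : 0 <= 1 - v < 2^-1 by apply/andP; split; lra.
move=> /(_ isT) h.
rewrite (_ : (fun k => _) = (fun k => 1 - iter k sstep (1 - v))); last first.
  by apply/funext => k; rewrite iter_sstep_sym; ring.
rewrite -[X in _ --> X]subr0; apply: cvgB => //; exact: cvg_cst.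
Qed.

End smoothstep.

(** * Cramer-Wold: one-dimensional characteristic functions determine laws *)
Section cramer_wold.
Context {R : realType} (I : finType).
Context {d1 d2 : measure_display} {O1 : measurableType d1} {O2 : measurableType d2}.
Variables (P1 : probability O1 R) (P2 : probability O2 R).
Variables (X1 : I -> O1 -> R) (X2 : I -> O2 -> R).
Hypothesis mX1 : forall i, measurable_fun setT (X1 i).
Hypothesis mX2 : forall i, measurable_fun setT (X2 i).
Let S := paramspace R I.
Implicit Types (f g : S -> R) (a : I -> R).

Definition lincomb a (x : I -> R) : R := \sum_i a i * x i.

Hypothesis X12 : forall a c,
  Ex P1 (fun w => cos (lincomb a (X1 ^~ w) + c)) =
  Ex P2 (fun w => cos (lincomb a (X2 ^~ w) + c)).

Lemma measurable_lincomb a : measurable_fun setT (fun x : S => lincomb a x).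
Proof.
apply: measurable_sum => i; apply: measurable_funM => //.
exact: measurable_param.
Qed.

Lemma measurable_cosine a c :
  measurable_fun setT (fun x : S => cos (lincomb a x + c)).
Proof.
apply: measurableT_comp.
  by apply: continuous_measurable_fun; exact: continuous_cos.
by apply: measurable_funD => //; exact: measurable_lincomb.
Qed.

Let bounded_on f := measurable_fun setT f /\ exists M, forall x, `|f x| <= M.

(* [same_law f] says that [f] times any trigonometric function has the same mean under both
   laws; [multiplier] is the algebra of functions that preserve this class. *)
Let same_law f := bounded_on f /\ forall a c,
  Ex P1 (fun w => f (X1 ^~ w) * cos (lincomb a (X1 ^~ w) + c)) =
  Ex P2 (fun w => f (X2 ^~ w) * cos (lincomb a (X2 ^~ w) + c)).

Let multiplier g := bounded_on g /\
  forall f, same_law f -> same_law (fun x => f x * g x).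

Let bounded_on_cosine a c : bounded_on (fun x : S => cos (lincomb a x + c)).
Proof. by split; [exact: measurable_cosine|exists 1 => x; exact: cos_max]. Qed.

Let bounded_onM f g : bounded_on f -> bounded_on g ->
  bounded_on (fun x => f x * g x).
Proof.
move=> [mf [M fM]] [mg [N gN]]; split; first exact: measurable_funM.
by exists (M * N) => w; rewrite normrM ler_pM.
Qed.

Let bounded_onD f g : bounded_on f -> bounded_on g ->
  bounded_on (fun x => f x + g x).
Proof.
move=> [mf [M fM]] [mg [N gN]]; split; first exact: measurable_funD.
by exists (M + N) => w; rewrite (le_trans (ler_normD _ _))// lerD.
Qed.

Let bounded1 f : bounded_on f -> bounded_meas (fun w => f (X1 ^~ w)).
Proof.
move=> [mf [M fM]]; split; last by exists M.
by apply: (measurableT_comp mf); exact: measurable_fun_param.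
Qed.

Let bounded2 f : bounded_on f -> bounded_meas (fun w => f (X2 ^~ w)).
Proof.
move=> [mf [M fM]]; split; last by exists M.
by apply: (measurableT_comp mf); exact: measurable_fun_param.
Qed.

Let same_lawD f g : same_law f -> same_law g -> same_law (fun x => f x + g x).
Proof.
move=> [bf fE] [bg gE]; split; first exact: bounded_onD.
move=> a c; have bc := bounded_on_cosine a c.
have H1 := bounded1 (bounded_onM bf bc); have H2 := bounded2 (bounded_onM bf bc).
have H3 := bounded1 (bounded_onM bg bc); have H4 := bounded2 (bounded_onM bg bc).
under eq_Ex do rewrite mulrDl; under [RHS]eq_Ex do rewrite mulrDl.
by rewrite !ExD// fE gE.
Qed.

Let same_lawZ k f : same_law f -> same_law (fun x => k * f x).
Proof.
move=> [bf fE]; split.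
  by apply: bounded_onM => //; split=> //; exists `|k|.
move=> a c; have bc := bounded_on_cosine a c.
have H1 := bounded1 (bounded_onM bf bc); have H2 := bounded2 (bounded_onM bf bc).
under eq_Ex do rewrite -mulrA; under [RHS]eq_Ex do rewrite -mulrA.
by rewrite !ExZ// fE.
Qed.

Let same_law_cvg (f_ : nat -> S -> R) f (M : R) : (forall n, same_law (f_ n)) ->
  (forall n x, `|f_ n x| <= M) -> (forall x, f_ n x @[n --> \oo] --> f x) ->
  same_law f.
Proof.
move=> sf fM cf; split.
  split; first by apply: measurable_fun_cvg (fun n => (sf n).1.1) _ => w _; exact: cf.
  exists M => w; have /cvg_norm cn := cf w.
  rewrite -(cvg_lim _ cn)//; apply: limr_le; first by apply/cvg_ex; eexists; exact: cn.
  by near=> n; exact: fM.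
move=> a c; have bc := bounded_on_cosine a c.
have c1 : Ex P1 (fun w => f_ n (X1 ^~ w) * cos (lincomb a (X1 ^~ w) + c)) @[n --> \oo] -->
  Ex P1 (fun w => f (X1 ^~ w) * cos (lincomb a (X1 ^~ w) + c)).
  apply: (@Ex_cvg _ _ _ _ _ _ M).
  - by move=> n; exact: (bounded1 (bounded_onM (sf n).1 bc)).1.
  - by move=> n w; rewrite normrM -[leRHS]mulr1 ler_pM// cos_max.
  - by move=> w; apply: cvgMl; exact: cf.
have c2 : Ex P2 (fun w => f_ n (X2 ^~ w) * cos (lincomb a (X2 ^~ w) + c)) @[n --> \oo] -->
  Ex P2 (fun w => f (X2 ^~ w) * cos (lincomb a (X2 ^~ w) + c)).
  apply: (@Ex_cvg _ _ _ _ _ _ M).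
  - by move=> n; exact: (bounded2 (bounded_onM (sf n).1 bc)).1.
  - by move=> n w; rewrite normrM -[leRHS]mulr1 ler_pM// cos_max.
  - by move=> w; apply: cvgMl; exact: cf.
move: c1; under eq_fun do rewrite (sf _).2.
by move=> c1; exact: (cvg_unique _ c1 c2).
Unshelve. all: by end_near. Qed.

Let multiplier_cst k : multiplier (fun=> k).
Proof.
split; first by split=> //; exists `|k|.
move=> f sf; under eq_fun do rewrite mulrC; exact: same_lawZ.
Qed.

Let multiplierM g g' : multiplier g -> multiplier g' -> multiplier (fun x => g x * g' x).
Proof.
move=> [bg Mg] [bg' Mg']; split; first exact: bounded_onM.
by move=> f sf; under eq_fun do rewrite mulrA; apply: Mg'; exact: Mg.
Qed.

Let multiplierD g g' : multiplier g -> multiplier g' -> multiplier (fun x => g x + g' x).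
Proof.
move=> [bg Mg] [bg' Mg']; split; first exact: bounded_onD.
by move=> f sf; under eq_fun do rewrite mulrDr; apply: same_lawD; [exact: Mg|exact: Mg'].
Qed.

Let multiplier_cvg (g_ : nat -> S -> R) g (M : R) : (forall n, multiplier (g_ n)) ->
  (forall n x, `|g_ n x| <= M) -> (forall x, g_ n x @[n --> \oo] --> g x) ->
  multiplier g.
Proof.
move=> sg gM cg; split.
  split; first by apply: measurable_fun_cvg (fun n => (sg n).1.1) _ => w _; exact: cg.
  exists M => w; have /cvg_norm cn := cg w.
  rewrite -(cvg_lim _ cn)//; apply: limr_le; first by apply/cvg_ex; eexists; exact: cn.
  by near=> n; exact: gM.
move=> f sf; have [[_ [N fN]] _] := sf.
apply: (@same_law_cvg (fun n x => f x * g_ n x) _ (N * M)).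
- by move=> n; exact: (sg n).2.
- by move=> n x; rewrite normrM ler_pM.
- by move=> x; apply: cvgMr; exact: cg.
Unshelve. all: by end_near. Qed.

Let lincombD a b x : lincomb (fun i => a i + b i) x = lincomb a x + lincomb b x.
Proof. by rewrite /lincomb -big_split/=; apply: eq_bigr => i _; rewrite mulrDl. Qed.

Let lincombN a x : lincomb (fun i => - a i) x = - lincomb a x.
Proof. by rewrite /lincomb -sumrN; apply: eq_bigr => i _; rewrite mulNr. Qed.

(** Products of cosines are sums of cosines. *)
Let multiplier_cosine a c : multiplier (fun x => cos (lincomb a x + c)).
Proof.
split; first exact: bounded_on_cosine.
move=> f [bf fE]; split; first by apply: bounded_onM => //; exact: bounded_on_cosine.
move=> a' c'.
have prod (x : I -> R) : f x * cos (lincomb a x + c) * cos (lincomb a' x + c') =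
    2^-1 * (f x * cos (lincomb (fun i => a i + a' i) x + (c + c'))) +
    2^-1 * (f x * cos (lincomb (fun i => a i + - a' i) x + (c - c'))).
  rewrite lincombD lincombD lincombN.
  rewrite (_ : _ + (c + c') = (lincomb a x + c) + (lincomb a' x + c')); last by ring.
  rewrite (_ : _ + (c - c') = (lincomb a x + c) - (lincomb a' x + c')); last by ring.
  set A := lincomb a x + c; set B := lincomb a' x + c'.
  by rewrite (cosD A B) (cosB A B); field.
under eq_Ex do rewrite prod; under [RHS]eq_Ex do rewrite prod.
have b1 := bounded1 (bounded_onM bf (bounded_on_cosine (fun i => a i + a' i) (c + c'))).
have b2 := bounded2 (bounded_onM bf (bounded_on_cosine (fun i => a i + a' i) (c + c'))).
have b3 := bounded1 (bounded_onM bf (bounded_on_cosine (fun i => a i + - a' i) (c - c'))).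
have b4 := bounded2 (bounded_onM bf (bounded_on_cosine (fun i => a i + - a' i) (c - c'))).
have hb d (O : measurableType d) (P : probability O R) (g : O -> R) :
   bounded_meas g -> bounded_meas (fun w => 2^-1 * g w).
  by move=> bg; apply: bounded_measM => //; exact: bounded_meas_cst.
by rewrite !ExD ?ExZ ?fE//; exact: hb.
Qed.

Let multiplier_sstep k g : multiplier g -> multiplier (fun x => iter k sstep (g x)).
Proof.
move=> Mg; elim: k => //= k IH; apply: multiplierM => //; apply: multiplierM => //.
apply: multiplierD; first exact: multiplier_cst.
have -> : (fun x => - (2 * iter k sstep (g x))) = (fun x => -2 * iter k sstep (g x)).
  by apply/funext => x; ring.
by apply: multiplierM => //; exact: multiplier_cst.
Qed.

(* The value 1/2 at 0 is the fixed point of the polynomial step. *)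
Let heavi (v : R) : R := if 0 < v then 1 else if v == 0 then 2^-1 else 0.

Let multiplier_heavi_sin i (s t : R) : multiplier (fun x => heavi (sin (s * (x i - t)))).
Proof.
pose v (x : S) : R := 2^-1 * (1 + sin (s * (x i - t))).
have v01 x : 0 <= v x <= 1.
  have := sin_le1 (s * (x i - t)); have := sin_geN1 (s * (x i - t)).
  by rewrite /v => h1 h2; apply/andP; split; lra.
have Mv : multiplier v.
  apply: multiplierM; first exact: multiplier_cst.
  apply: multiplierD; first exact: multiplier_cst.
  have := @multiplier_cosine (fun j => if j == i then s else 0) (- s * t - pi / 2).
  congr multiplier; apply/funext => x.
  rewrite /lincomb (bigD1 i)//= eqxx big1 ?addr0; last first.
    by move=> j /negbTE ->; rewrite mul0r.
  rewrite (_ : _ + _ = s * (x i - t) - pi / 2); last by ring.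
  by rewrite cosB cos_pihalf sin_pihalf mulr0 mulr1 add0r.
apply: (@multiplier_cvg (fun k x => iter k sstep (v x)) _ 1).
- by move=> k; exact: multiplier_sstep.
- move=> k x; have /andP[h0 h1] := iter_sstep01 k (v01 x).
  by rewrite ger0_norm.
- move=> x; rewrite /heavi; have /andP[h0 h1] := v01 x.
  have [sp|sn|s0] := ltgtP 0 (sin (s * (x i - t))).
  + by apply: iter_sstep_large; rewrite h1 andbT /v; lra.
  + apply: iter_sstep_small; rewrite h0 /v/=; lra.
  + have -> : v x = 2^-1 by rewrite /v -s0 addr0 mulr1.
    by under eq_fun do rewrite iter_sstep_half; exact: cvg_cst.
Qed.

(** Zooming in on 0 removes the other zeros of the sine. *)
Let multiplier_heavi i (t : R) : multiplier (fun x => heavi (x i - t)).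
Proof.
apply: (@multiplier_cvg (fun j x => heavi (sin (2^-1 ^+ j * (x i - t)))) _ 1).
- by move=> j; exact: multiplier_heavi_sin.
- by move=> j x; rewrite /heavi; case: ifP => _; [|case: ifP => _]; rewrite ger0_norm//; lra.
move=> x; have small : \forall j \near \oo, `|2^-1 ^+ j * (x i - t)| < 1.
  have : 2^-1 ^+ j * (x i - t) @[j --> \oo] --> (0 : R).
    rewrite -[X in _ --> X](mul0r (x i - t)); apply: cvgMl; apply: cvg_expr.
    by rewrite ger0_norm//; lra.
  by move/cvgr0_norm_lt; exact.
apply: cvg_near_cst; near=> j.
have : `|2^-1 ^+ j * (x i - t)| < 1 by near: j.
rewrite ltr_norml => /andP[y1 y2].
have p2 : 0 < 2^-1 ^+ j :> R by rewrite exprn_gt0.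
rewrite /heavi; have [sp|sn|s0] := ltgtP 0 (x i - t).
- have y0 : 0 < 2^-1 ^+ j * (x i - t) by exact: mulr_gt0.
  by rewrite sin2_gt0// y0 /= (lt_trans y2)//; lra.
- have y0 : 0 < - (2^-1 ^+ j * (x i - t)) by rewrite -mulrN mulr_gt0// oppr_gt0.
  have : 0 < sin (- (2^-1 ^+ j * (x i - t))) by rewrite sin2_gt0// y0 /=; lra.
  rewrite sinN oppr_gt0 => sn0.
  by rewrite ltNge (ltW sn0)/= lt_eqF.
- by rewrite -s0 mulr0 sin0 ltxx eqxx.
Unshelve. all: by end_near. Qed.

Let sets : set (set S) := [set A | multiplier \1_A].

(** For [y] in {0, 1/2, 1} the polynomial [y * (2 * y - 1)] is 1 at 1 and vanishes elsewhere. *)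
Let sets_ray i (t : R) : sets [set x | x i > t].
Proof.
rewrite /sets/=.
have -> : \1_[set x : S | t < x i] =
    (fun x : S => heavi (x i - t) * (2 * heavi (x i - t) + -1)).
  apply/funext => x; rewrite indicE /heavi subr_gt0 subr_eq0.
  have -> : (x \in [set x : S | t < x i]) = (t < x i).
    by apply/idP/idP => [/set_mem//|tx]; exact: mem_set.
  by case: (ltgtP t (x i)) => _ /=; field.
apply: multiplierM; first exact: multiplier_heavi.
apply: multiplierD; last exact: multiplier_cst.
by apply: multiplierM; [exact: multiplier_cst|exact: multiplier_heavi].
Qed.

Let setsC A : sets A -> sets (~` A).
Proof.
rewrite /sets/= => MA.
have -> : \1_(~` A) = (fun x : S => 1 + -1 * \1_A x :> R).
  apply/funext => x; rewrite !indicE in_setC; case: (x \in A) => /=; ring.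
apply: multiplierD; first exact: multiplier_cst.
by apply: multiplierM => //; exact: multiplier_cst.
Qed.

Let setsI A B : sets A -> sets B -> sets (A `&` B).
Proof.
rewrite /sets/= => MA MB; rewrite indicI; exact: multiplierM.
Qed.

Let setsU A B : sets A -> sets B -> sets (A `|` B).
Proof.
by move=> MA MB; rewrite -(setCK (A `|` B)) setCU; apply: setsC; apply: setsI; exact: setsC.
Qed.

Let sets0 : sets set0.
Proof. by rewrite /sets/= indic0; exact: multiplier_cst. Qed.

Let sets_bigcup (F : nat -> set S) : (forall n, sets (F n)) -> sets (\bigcup_n F n).
Proof.
move=> sF.
have sU n : sets (\big[setU/set0]_(k < n) F k).
  by elim: n => [|n IH]; [rewrite big_ord0|rewrite big_ord_recr/=; exact: setsU].
apply: (@multiplier_cvg (fun n => \1_(\big[setU/set0]_(k < n) F k)) _ 1).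
- exact: sU.
- by move=> n x; rewrite indicE; case: (_ \in _); rewrite ?normr1 ?normr0.
move=> x; rewrite indicE.
have [[k _ Fk]|nF] := pselect ((\bigcup_n F n) x).
  rewrite mem_set; last by exists k.
  apply: cvg_near_cst; exists k.+1 => // n /= kn.
  rewrite indicE mem_set// -bigcup_mkord; by exists k.
rewrite memNset//; apply: cvg_near_cst; near=> n.
rewrite indicE memNset// -bigcup_mkord => -[k _ Fk].
by apply: nF; exists k.
Unshelve. all: by end_near. Qed.

Let sets_measurable A : measurable A -> sets A.
Proof.
have sB i (B : set R) : measurable B -> sets [set x | B (x i)].
  have -> : @measurable _ R = <<s @RGenOInfty.G R >>.
    exact: RGenOInfty.measurableE.
  move: B; apply: smallest_sub.
  - split.
    + exact: sets0.
    + by move=> B sB; rewrite setTD; exact: setsC.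
    + move=> F sF; rewrite (_ : mkset _ = \bigcup_n [set x : S | F n (x i)]).
        exact: sets_bigcup.
      by apply/seteqP; split => x [n _ ?]; exists n.
  - move=> _ [t ->]; have := sets_ray i t; congr sets.
    by apply/seteqP; split => x /=; rewrite in_itv/= andbT.
move: A; apply: smallest_sub.
- split; first exact: sets0.
  + by move=> B; rewrite setTD; exact: setsC.
  + exact: sets_bigcup.
- by move=> _ [i [B mB ->]]; exact: sB.
Qed.

(** The trigonometric functions [cos (a . x + c)] are closed under products,
    so multiplication by them preserves the class of functions with the same
    mean under both laws; so does multiplication by a bounded pointwise limit,
    and iterating the smooth step function on [sin] yields half-spaces. *)
Theorem cramer_wold (A : set S) : measurable A ->
  P1 [set w | A (X1 ^~ w)] = P2 [set w | A (X2 ^~ w)].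
Proof.
move=> mA; have [[mf _] MA] := sets_measurable mA.
have s1 : same_law (fun=> 1).
  split; first by split => //; exists 1 => x; rewrite normr1.
  by move=> a c; under eq_Ex do rewrite mul1r; under [RHS]eq_Ex do rewrite mul1r; exact: X12.
have [_ /(_ (fun=> 0) 0)] := MA _ s1.
have lin0 x : lincomb (fun=> 0) x = 0 by rewrite /lincomb big1// => i _; rewrite mul0r.
under eq_Ex do rewrite lin0 addr0 cos0 mulr1 mul1r.
under [RHS]eq_Ex do rewrite lin0 addr0 cos0 mulr1 mul1r.
move=> H; rewrite -!Ex_indic.
- by congr EFin; exact: H.
- by rewrite -[X in measurable X]setTI; exact: (measurable_fun_param mX2).
- by rewrite -[X in measurable X]setTI; exact: (measurable_fun_param mX1).
Qed.

End cramer_wold.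

Import HBNNSimple.

(** * Gaussian means *)
Section density.
Context d (T : measurableType d) (R : realType).
Variables (mu nu : {measure set T -> \bar R}) (g : T -> R).
Hypothesis mg : measurable_fun setT g.
Hypothesis g0 : forall x, 0 <= g x.
Hypothesis nuE : forall A, measurable A ->
  nu A = (\int[mu]_(x in A) (g x)%:E)%E.

Lemma ge0_integral_density (F : T -> \bar R) : measurable_fun setT F ->
  (forall x, (0 <= F x)%E) ->
  (\int[nu]_x F x = \int[mu]_x (F x * (g x)%:E))%E.
Proof.
move=> mF F0; pose f_ := nnsfun_approx measurableT mF.
transitivity (limn (fun n => \int[nu]_x (f_ n x)%:E))%E.
  rewrite -monotone_convergence//=.
  - apply: eq_integral => x _; apply/esym/cvg_lim => //.
    by apply: cvg_nnsfun_approx.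
  - by move=> n; exact/measurable_EFinP.
  - by move=> n x _; rewrite lee_fin.
  - by move=> x _ a b ab; rewrite lee_fin//; exact/lefP/nd_nnsfun_approx.
rewrite [X in limn X](_ : _ = (fun n => \int[mu]_x ((f_ n x)%:E * (g x)%:E)))%E.
  rewrite -monotone_convergence//.
  - apply: eq_integral => x _; apply/cvg_lim => //.
    apply: cvgeMr; first by [].
    by apply: cvg_nnsfun_approx.
  - by move=> n; apply: emeasurable_funM; exact/measurable_EFinP.
  - by move=> n x _; rewrite mule_ge0// lee_fin.
  - by move=> x _ a b ab; rewrite lee_wpmul2r ?lee_fin//; exact/lefP/nd_nnsfun_approx.
apply/funext => n.
transitivity (\sum_(k \in range (f_ n))
    \int[nu]_x (k * \1_(f_ n @^-1` [set k]) x)%:E)%E.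
  under eq_integral do rewrite fimfunE -fsumEFin//.
  rewrite ge0_integral_fsum//.
  - by move=> y; exact/measurable_EFinP/measurable_funM.
  - by move=> y x _; rewrite nnfun_muleindic_ge0.
transitivity (\sum_(k \in range (f_ n))
    \int[mu]_x ((k * \1_(f_ n @^-1` [set k]) x)%:E * (g x)%:E))%E; last first.
  rewrite -ge0_integral_fsum//; last 2 first.
  - by move=> y; apply: emeasurable_funM; [exact/measurable_EFinP/measurable_funM|exact/measurable_EFinP].
  - by move=> y x _; rewrite mule_ge0// ?nnfun_muleindic_ge0// lee_fin.
  apply: eq_integral => x _.
  rewrite [in RHS]fimfunE -fsumEFin//.
  rewrite ge0_mule_fsuml// => r; exact: nnfun_muleindic_ge0.
apply: eq_fsbigr => r _; rewrite integralZl_indic_nnsfun// integral_indic// setIT nuE//.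
under [RHS]eq_integral do rewrite EFinM -muleA.
have [r0|r0] := leP 0 r; last first.
  rewrite preimage_nnfun0// integral_set0 mule0.
  rewrite integral0_eq// => x _; rewrite indic0 mul0e mule0//.
rewrite ge0_integralZl//; last 2 first.
- by apply: emeasurable_funM; exact/measurable_EFinP.
- by move=> x _; rewrite mule_ge0// lee_fin.
congr (_ * _)%E; rewrite integral_mkcond; apply: eq_integral => x _.
rewrite patchE indicE; case: ifP => _; by rewrite ?mul1e ?mul0e.
Qed.

End density.

Section affine_change_of_variable.
Context {R : realType}.
Local Notation mu := (@lebesgue_measure R).

Lemma measurable_affine (c b : R) :
  measurable_fun setT (fun x : measurableTypeR R => c * x + b : measurableTypeR R).
Proof. by apply: measurable_funD => //; apply: measurable_funM. Qed.

Lemma lebesgue_measure_affine (c b : R) (A : set R) : 0 < c -> measurable A ->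
  mu A = (c%:E * mu ((fun x => c * x + b)%R @^-1` A))%E.
Proof.
move=> c0 mA; pose cn : {nonneg R} := NngNum (ltW c0).
pose f := (fun x => c * x + b : measurableTypeR R) : measurableTypeR R -> measurableTypeR R.
have mf : measurable_fun setT f by exact: measurable_affine.
pose push : {measure set (measurableTypeR R) -> \bar R} :=
  measure_function_pushforward__canonical__measure_function_Measure mu mf.
have := @lebesgue_measure_unique R (mscale cn push).
move=> /(_ _ A mA); rewrite /mscale/= /push/=; apply => _ [[p q] _ <-].
rewrite /mscale/= /pushforward.
have -> : f @^-1` `]p, q]%classic = `](p - b) / c, (q - b) / c]%classic.
  apply/seteqP; split=> x /=; rewrite !in_itv/= /f ltr_pdivrMr// ler_pdivlMr//.
    by move=> /andP[h1 h2]; apply/andP; split; lra.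
  by move=> /andP[h1 h2]; apply/andP; split; lra.
rewrite !lebesgue_measure_itv/= !lte_fin ltr_pM2r ?invr_gt0// ltrD2r.
case: ifP => _; last by rewrite mule0.
by rewrite -!EFinD -EFinM; congr EFin; field; rewrite gt_eqF.
Qed.

Lemma ge0_integral_affine (c b : R) (F : R -> \bar R) : 0 < c ->
  measurable_fun setT F -> (forall x, (0 <= F x)%E) ->
  (\int[mu]_x F x = c%:E * \int[mu]_x F (c * x + b)%R)%E.
Proof.
move=> c0 mF F0; pose cn : {nonneg R} := NngNum (ltW c0).
pose f := (fun x => c * x + b : measurableTypeR R) : measurableTypeR R -> measurableTypeR R.
have mf : measurable_fun setT f by exact: measurable_affine.
pose push : {measure set (measurableTypeR R) -> \bar R} :=
  measure_function_pushforward__canonical__measure_function_Measure mu mf.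
transitivity (\int[mscale cn push]_x F x)%E.
  by apply: eq_measure_integral => A mA _; exact: lebesgue_measure_affine.
rewrite ge0_integral_mscale//=; congr (_ * _)%E.
by rewrite ge0_integral_pushforward.
Qed.

Lemma ge0_integral_shift (b : R) (F : R -> \bar R) :
  measurable_fun setT F -> (forall x, (0 <= F x)%E) ->
  (\int[mu]_x F x = \int[mu]_x F (x + b)%R)%E.
Proof.
move=> mF F0; rewrite (ge0_integral_affine b ltr01 mF F0) mul1e.
by apply: eq_integral => x _; rewrite mul1r.
Qed.

End affine_change_of_variable.

(* [R] and [measurableTypeR R] have the same measurable sets under two displays. *)
Lemma measurable_EFin_leb {R : realType} (f : R -> R) :
  measurable_fun setT f ->
  measurable_fun (setT : set (measurableTypeR R)) (fun x => (f x)%:E).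
Proof.
move=> mf.
have : measurable_fun (setT : set R) (EFin \o f) by exact/measurable_EFinP.
by [].
Qed.

#[local] Opaque integral.

Section gaussian_mean.
Context {R : realType}.
Local Notation mu := (@lebesgue_measure R).
Local Notation RL := (measurableTypeR R).

(** The mean of [F] under the centred Gaussian law of standard deviation [s]. For [s = 0] this is
    the Dirac mass at 0, which has no density and needs its own clause. *)
Definition gmean (s : R) (F : R -> \bar R) : \bar R :=
  (if s == 0%R then F 0%R else \int[mu]_x (F x * (normal_pdf 0 s x)%:E))%E.

Lemma gmean0E F : gmean 0 F = F 0.
Proof. by rewrite /gmean eqxx. Qed.

Lemma gmeanE s F : s != 0 ->
  gmean s F = (\int[mu]_x (F x * (normal_pdf 0 s x)%:E))%E.
Proof. by rewrite /gmean => /negbTE ->. Qed.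

Lemma gmean_law dO (Omega : measurableType dO) (P : probability Omega R)
    (X : {RV P >-> R}) (s : R) (F : R -> \bar R) :
  (forall A, measurable A -> distribution P X A = centered_normal s A) ->
  measurable_fun setT F -> (forall x, (0 <= F x)%E) ->
  (\int[P]_w (F (X w)) = gmean s F)%E.
Proof.
move=> lawX mF F0.
have <- := @ge0_integral_distribution _ _ _ _ _ P X F mF F0.
have [s0|s0] := eqVneq s 0.
  rewrite s0 gmean0E; transitivity (\int[\d_(0%R : R)]_x F x)%E; last first.
    by rewrite integral_dirac// diracT mul1e.
  apply: eq_measure_integral => A mA _; rewrite [LHS]lawX//.
  by rewrite /centered_normal s0 eqxx.
have mid : measurable_fun setT (fun x : RL => x : R) by [].
rewrite (gmeanE _ s0) (@ge0_integral_density _ _ _ (pushforward mu (fun x : RL => x : R))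
  (distribution P X) (normal_pdf 0 s))//.
- rewrite ge0_integral_pushforward//.
    apply: emeasurable_funM; first exact: mF.
    by apply/measurable_EFinP; exact: measurable_normal_pdf.
  by move=> y _; rewrite mule_ge0// lee_fin// normal_pdf_ge0.
- exact: measurable_normal_pdf.
- exact: normal_pdf_ge0.
- move=> A mA; rewrite [LHS]lawX// /centered_normal (negbTE s0).
  rewrite ge0_integral_pushforward//.
    by apply: measurable_funTS; apply/measurable_EFinP; exact: measurable_normal_pdf.
  by move=> y _; rewrite lee_fin normal_pdf_ge0.
Qed.

Lemma gmean_ge0 s F : (forall x, (0 <= F x)%E) -> (0 <= gmean s F)%E.
Proof.
move=> F0; have [->|s0] := eqVneq s 0; first by rewrite gmean0E.
rewrite gmeanE//; apply: integral_ge0 => x _.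
by rewrite mule_ge0// lee_fin normal_pdf_ge0.
Qed.

Lemma measurable_gmean s (F : R -> \bar R) : measurable_fun setT F ->
  (forall x, (0 <= F x)%E) ->
  measurable_fun setT (fun x : R => gmean s (fun y => F (x + y))).
Proof.
move=> mF F0; have [->|s0] := eqVneq s 0.
  by under eq_fun do rewrite gmean0E addr0.
under eq_fun do rewrite (gmeanE _ s0).
pose G (p : RL * RL) : \bar R := (F (p.1 + p.2)%R * (normal_pdf 0 s p.2)%:E)%E.
have mG : measurable_fun setT G.
  have m1 : measurable_fun setT (fun p : R * R => p.1) by exact: measurable_fst.
  have m2 : measurable_fun setT (fun p : R * R => p.2) by exact: measurable_snd.
  have : measurable_fun setT (G : R * R -> \bar R); last by [].
  apply: emeasurable_funM.
    by apply: (measurableT_comp mF); exact: measurable_funD.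
  apply/measurable_EFinP; exact: (measurableT_comp (measurable_normal_pdf 0 s) m2).
have G0 p : (0 <= G p)%E by rewrite mule_ge0// lee_fin normal_pdf_ge0.
exact (measurable_fun_fubini_tonelli_F G mG G0).
Qed.

Let normal_peak_identity (a b p q : R) : q != 0 ->
  a * p *+ 2 * (b * p *+ 2) = q * p *+ 2 * (a * b / q * p *+ 2).
Proof. by move=> q0; field. Qed.

Lemma normal_pdf_conv (s t z x : R) : 0 < s -> 0 < t ->
  normal_pdf 0 s x * normal_pdf 0 t (z - x) =
  normal_pdf 0 (Num.sqrt (s ^+ 2 + t ^+ 2)) z *
  normal_pdf (s ^+ 2 * z / (s ^+ 2 + t ^+ 2)) (s * t / Num.sqrt (s ^+ 2 + t ^+ 2)) x.
Proof.
move=> s0 t0; set r := Num.sqrt _.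
have rr0 : 0 < s ^+ 2 + t ^+ 2 by rewrite addr_gt0// exprn_gt0.
have r0 : 0 < r by rewrite sqrtr_gt0.
have r2 : r ^+ 2 = s ^+ 2 + t ^+ 2 by rewrite sqr_sqrtr// ltW.
have st0 : 0 < s * t / r by rewrite divr_gt0// mulr_gt0.
rewrite !normal_pdfE ?gt_eqF//= mulrACA [RHS]mulrACA; congr (_ * _).
  rewrite /normal_peak -!invfM -!sqrtrM ?mulrn_wge0 ?mulr_ge0 ?sqr_ge0 ?pi_ge0 ?(ltW r0) ?(ltW s0) ?(ltW t0)//.
  congr (Num.sqrt _)^-1.
  have -> : (s * t / r) ^+ 2 = (s ^+ 2 * t ^+ 2) * (r ^+ 2)^-1.
    by rewrite !exprMn exprVn.
  have : r ^+ 2 != 0 by rewrite r2 gt_eqF.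
  by move: (r ^+ 2) (s ^+ 2) (t ^+ 2) => q a b q0; exact: normal_peak_identity.
rewrite /normal_fun -!expRD; congr expR.
have e1 : (s * t / r) ^+ 2 = s ^+ 2 * t ^+ 2 / (s ^+ 2 + t ^+ 2).
  by rewrite exprMn exprVn exprMn r2.
rewrite e1 r2; field.
by rewrite !gt_eqF.
Qed.

(** The convolution of two Gaussian densities is a Gaussian density; the degenerate cases make
    the formula hold for all variances. *)
Lemma gmean_conv (s t : R) (F : R -> \bar R) : 0 <= s -> 0 <= t ->
  measurable_fun setT F -> (forall x, (0 <= F x)%E) ->
  gmean s (fun x => gmean t (fun y => F (x + y))) =
  gmean (Num.sqrt (s ^+ 2 + t ^+ 2)) F.
Proof.
move=> s0 t0 mF F0.
have [->|sn0] := eqVneq s 0.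
  rewrite expr0n add0r sqrtr_sqr (ger0_norm t0) gmean0E.
  by congr gmean; apply/funext => y; rewrite add0r.
have sp : 0 < s by rewrite lt_neqAle eq_sym sn0.
have [->|tn0] := eqVneq t 0.
  rewrite expr0n addr0 sqrtr_sqr (ger0_norm s0).
  by congr gmean; apply/funext => x; rewrite gmean0E addr0.
have tp : 0 < t by rewrite lt_neqAle eq_sym tn0.
set r := Num.sqrt _.
have rp : 0 < r by rewrite sqrtr_gt0 addr_gt0// exprn_gt0.
rewrite (gmeanE _ sn0) (gmeanE F (lt0r_neq0 rp)).
under eq_integral do rewrite (gmeanE _ tn0).
pose G (p : RL * RL) : \bar R :=
  (F p.2 * (normal_pdf 0 s p.1 * normal_pdf 0 t (p.2 - p.1))%:E)%E.
have mG : measurable_fun setT G.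
  have m1 : measurable_fun setT (fun p : R * R => p.1) by exact: measurable_fst.
  have m2 : measurable_fun setT (fun p : R * R => p.2) by exact: measurable_snd.
  have : measurable_fun setT (G : R * R -> \bar R); last by [].
  apply: emeasurable_funM; first exact: (measurableT_comp mF m2).
  apply/measurable_EFinP; apply: measurable_funM.
    exact: (measurableT_comp (measurable_normal_pdf 0 s) m1).
  apply: (measurableT_comp (measurable_normal_pdf 0 t)).
  exact: measurable_funB.
have G0 p : (0 <= G p)%E by rewrite mule_ge0// lee_fin !mulr_ge0// normal_pdf_ge0.
have T1 := fubini_tonelli1 (m1 := mu) (m2 := mu) G mG G0.
have T2 := fubini_tonelli2 (m1 := mu) (m2 := mu) G mG G0.
transitivity (\int[mu \x mu]_z G z)%E; [rewrite T1|rewrite T2].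
- apply: eq_integral => x _; rewrite /fubini_F /G/=.
  transitivity (\int[mu]_y ((F y * (normal_pdf 0 t (y - x))%:E) * (normal_pdf 0 s x)%:E))%E;
    last by apply: eq_integral => y _; rewrite -muleA -EFinM (mulrC (normal_pdf 0 t _)).
  have mFt : measurable_fun (setT : set RL) (fun y => F y * (normal_pdf 0 t (y - x))%:E)%E.
    have : measurable_fun (setT : set R) (fun y => F y * (normal_pdf 0 t (y - x))%:E)%E; last by [].
    apply: emeasurable_funM => //; apply/measurable_EFinP.
    apply: (measurableT_comp (measurable_normal_pdf 0 t)).
    exact: measurable_funB.
  have Ft0 y : (0 <= F y * (normal_pdf 0 t (y - x))%:E)%E.
    by rewrite mule_ge0// lee_fin normal_pdf_ge0.
  have nx0 : (0 <= (normal_pdf 0 s x)%:E)%E by rewrite lee_fin normal_pdf_ge0.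
  rewrite (ge0_integralZr mu measurableT mFt (fun y _ => Ft0 y) nx0).
  rewrite [in RHS](ge0_integral_shift x mFt Ft0).
  by under [in RHS]eq_integral do rewrite addrK (addrC _ x).
- apply: eq_integral => z _; rewrite /fubini_G /G/=.
  under eq_integral do rewrite normal_pdf_conv// EFinM muleA.
  rewrite (ge0_integralZl mu measurableT (measurable_EFin_leb (measurable_normal_pdf _ _)))//.
  + by rewrite integral_normal_pdf mule1.
  + by move=> y _; rewrite lee_fin normal_pdf_ge0.
  + by rewrite mule_ge0// lee_fin normal_pdf_ge0.
Qed.

(** Completing the square. *)
Lemma normal_pdf_expR (s b x : R) : s != 0 ->
  expR (b * x) * normal_pdf 0 s x =
  expR ((b * s) ^+ 2 / 2) * normal_pdf (b * s ^+ 2) s x.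
Proof.
move=> s0; rewrite !normal_pdfE//= mulrCA [RHS]mulrCA; congr (_ * _).
by rewrite /normal_fun -!expRD; congr expR; field.
Qed.

Lemma gmean_expR (s b : R) :
  gmean s (fun x => (expR (b * x))%:E) = (expR ((b * s) ^+ 2 / 2))%:E.
Proof.
have [->|s0] := eqVneq s 0.
  by rewrite gmean0E !mulr0 expr0n mul0r.
rewrite (gmeanE _ s0).
under eq_integral do rewrite -EFinM normal_pdf_expR// EFinM.
rewrite ge0_integralZl//; last 2 first.
- by apply: measurable_EFin_leb; exact: measurable_normal_pdf.
- by move=> y _; rewrite lee_fin normal_pdf_ge0.
by rewrite integral_normal_pdf mule1.
Qed.

End gaussian_mean.

#[local] Opaque gmean.

(** * Gaussian families *)
Section gaussian_family.
Context {R : realType}.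

(** Joint Gaussianity is expressed through linear combinations: [Q a] is the variance of
    [lincomb a X]. Testing against nonnegative functions [F] avoids integrability conditions. *)
Definition gaussian_family {I : finType} {dO : measure_display}
    {Omega : measurableType dO} (P : probability Omega R) (X : I -> Omega -> R)
    (Q : (I -> R) -> R) : Prop :=
  [/\ forall i, measurable_fun setT (X i),
      forall a, 0 <= Q a &
      forall a (F : R -> \bar R), measurable_fun setT F ->
        (forall x, (0 <= F x)%E) ->
        (\int[P]_w F (lincomb a (X ^~ w)) = gmean (Num.sqrt (Q a)) F)%E].

Lemma measurable_lincombX {I : finType} {dO : measure_display}
    {Omega : measurableType dO} (X : I -> Omega -> R) a :
  (forall i, measurable_fun setT (X i)) ->
  measurable_fun setT (fun w => lincomb a (X ^~ w)).
Proof. by move=> mX; apply: measurable_sum => i; exact: measurable_funM. Qed.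

Lemma measurable_cos : measurable_fun setT (@cos R).
Proof. by apply: continuous_measurable_fun; exact: continuous_cos. Qed.

(* Adding 1 makes the cosine nonnegative, so that the defining property applies. *)
Lemma gaussian_family_cos {I : finType} {dO : measure_display}
    {Omega : measurableType dO} (P : probability Omega R) (X : I -> Omega -> R) Q a c :
  gaussian_family P X Q ->
  (Ex P (fun w => cos (lincomb a (X ^~ w) + c)))%:E =
  (gmean (Num.sqrt (Q a)) (fun x => (1 + cos (x + c))%:E) - 1)%E.
Proof.
move=> [mX _ gX].
have mc : measurable_fun setT (fun x : R => cos (x + c)).
  by apply: (measurableT_comp measurable_cos); exact: measurable_funD.
have bc : bounded_meas (fun w => cos (lincomb a (X ^~ w) + c)).
  split; first by apply: (measurableT_comp mc); exact: measurable_lincombX.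
  by exists 1 => w; exact: cos_max.
have b1 : bounded_meas (fun w => 1 + cos (lincomb a (X ^~ w) + c)).
  by apply: bounded_measD => //; exact: bounded_meas_cst.
rewrite -gX; last 2 first.
- by apply/measurable_EFinP; exact: measurable_funD.
- by move=> x; rewrite lee_fin; have := cos_geN1 (x + c); lra.
have -> : (\int[P]_w (1 + cos (lincomb a (X ^~ w) + c))%:E =
   (Ex P (fun w => (1 + cos (lincomb a (X ^~ w) + c))%R))%:E)%E.
  rewrite /Ex /Rintegral fineK//.
  exact: integrable_fin_num (bounded_meas_integrable P b1).
rewrite ExD//; last exact: bounded_meas_cst.
have -> : Ex P (fun=> 1) = 1.
  transitivity (fine (P setT)); last by rewrite probability_setT.
  by rewrite /Ex Rintegral_cst// mul1r.
by rewrite EFinD addeAC subee// add0e.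
Qed.

(** All means of [cos (a . X + c)] are functions of [Q a], and they determine the law. *)
Lemma gaussian_family_law {I : finType} {d1 d2 : measure_display}
    {O1 : measurableType d1} {O2 : measurableType d2}
    (P1 : probability O1 R) (P2 : probability O2 R)
    (X1 : I -> O1 -> R) (X2 : I -> O2 -> R) Q (A : set (paramspace R I)) :
  gaussian_family P1 X1 Q -> gaussian_family P2 X2 Q -> measurable A ->
  P1 [set w | A (X1 ^~ w)] = P2 [set w | A (X2 ^~ w)].
Proof.
move=> g1 g2 mA; apply: cramer_wold => //.
- by have [] := g1.
- by have [] := g2.
- move=> a c; apply: EFin_inj.
  by rewrite (gaussian_family_cos a c g1) (gaussian_family_cos a c g2).
Qed.

Definition pair_field {I J : finType} {O1 O2 : Type} (X1 : I -> O1 -> R)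
    (X2 : J -> O2 -> R) (k : I + J) (w : O1 * O2) : R :=
  match k with inl i => X1 i w.1 | inr j => X2 j w.2 end.

Lemma lincomb_sum {I J : finType} (a : I + J -> R) (x : I + J -> R) :
  lincomb a x = lincomb (a \o inl) (x \o inl) + lincomb (a \o inr) (x \o inr).
Proof. by rewrite /lincomb big_sumType. Qed.

Lemma gaussian_family_prod {I J : finType} {d1 d2 : measure_display}
    {O1 : measurableType d1} {O2 : measurableType d2}
    (P1 : probability O1 R) (P2 : probability O2 R)
    (X1 : I -> O1 -> R) (X2 : J -> O2 -> R) Q1 Q2 :
  gaussian_family P1 X1 Q1 -> gaussian_family P2 X2 Q2 ->
  gaussian_family (P1 \x P2)%E (pair_field X1 X2)
    (fun a => Q1 (a \o inl) + Q2 (a \o inr)).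
Proof.
move=> [mX1 Q1ge0 g1] [mX2 Q2ge0 g2]; split.
- by move=> [i|j] /=; [apply: (measurableT_comp (mX1 i))|apply: (measurableT_comp (mX2 j))].
- by move=> a; rewrite addr_ge0.
move=> a F mF F0.
have mA := measurable_lincombX (a \o inl) mX1.
have mB := measurable_lincombX (a \o inr) mX2.
pose G (w : O1 * O2) : \bar R :=
  F (lincomb (a \o inl) (X1 ^~ w.1) + lincomb (a \o inr) (X2 ^~ w.2)).
have mG : measurable_fun setT G.
  apply: (measurableT_comp mF); apply: measurable_funD.
    exact: (measurableT_comp mA measurable_fst).
  exact: (measurableT_comp mB measurable_snd).
transitivity (\int[P1 \x P2]_w G w)%E.
  by apply: eq_integral => w _; rewrite lincomb_sum.
rewrite (fubini_tonelli1 (m1 := P1) (m2 := P2) G mG (fun _ => F0 _)).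
transitivity (\int[P1]_w1 gmean (Num.sqrt (Q2 (a \o inr)))
   (fun y => F (lincomb (a \o inl) (X1 ^~ w1) + y)%R))%E.
  apply: eq_integral => w1 _; rewrite /fubini_F /G/=.
  rewrite -g2//; apply: (measurableT_comp mF); exact: measurable_funD.
have mgm := @measurable_gmean R (Num.sqrt (Q2 (a \o inr))) F mF F0.
rewrite (g1 (a \o inl) _ mgm (fun x => gmean_ge0 _ (fun y => F0 _))).
rewrite (gmean_conv (sqrtr_ge0 _) (sqrtr_ge0 _) mF F0).
by rewrite (sqr_sqrtr (Q1ge0 _)) (sqr_sqrtr (Q2ge0 _)).
Qed.

Lemma gaussian_family_lin {I J : finType} {dO : measure_display}
    {Omega : measurableType dO} (P : probability Omega R) (X : I -> Omega -> R) Q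
    (B : J -> I -> R) : gaussian_family P X Q ->
  gaussian_family P (fun j w => lincomb (B j) (X ^~ w))
    (fun a => Q (fun i => \sum_j a j * B j i)).
Proof.
move=> [mX Q0 gX]; split => //; first by move=> j; exact: measurable_lincombX.
move=> a F mF F0; rewrite -gX//; apply: eq_integral => w _; congr F.
rewrite /lincomb; under eq_bigr do rewrite mulr_sumr.
rewrite exchange_big/=; apply: eq_bigr => i _; rewrite mulr_suml.
by apply: eq_bigr => j _; rewrite mulrA.
Qed.

Lemma gaussian_family_expR {I : finType} {dO : measure_display}
    {Omega : measurableType dO} (P : probability Omega R) (X : I -> Omega -> R) Q a b :
  gaussian_family P X Q ->
  (\int[P]_w (expR (b * lincomb a (X ^~ w)))%:E = (expR (b ^+ 2 * Q a / 2))%:E)%E.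
Proof.
move=> [mX Q0 gX].
rewrite (gX a (fun x => (expR (b * x))%:E)).
- by rewrite gmean_expR exprMn sqr_sqrtr.
- apply/measurable_EFinP; apply: (measurableT_comp (@measurable_expR R)).
  exact: measurable_funM.
- by move=> x; rewrite lee_fin expR_ge0.
Qed.

End gaussian_family.

(** * First-passage costs and their concentration *)
Section fpp.
Context {R : realType} (I : finType).
Implicit Types (S : {set I}) (C : {set {set I}}) (x : I -> R).

Definition cost (xi : R) S x : R := \sum_(i in S) expR (xi * x i).

(** The set [S0] serves as the default of the minimum; it is meant to belong to [C]. *)
Definition passage (xi : R) C S0 x : R :=
  \big[Order.min/cost xi S0 x]_(S in C) cost xi S x.

Lemma passage_le xi C S0 x S : S \in C -> passage xi C S0 x <= cost xi S x.
Proof. by move=> SC; apply: ge_bigmin_seq => //; exact: mem_index_enum. Qed.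

Lemma passage_attained xi C S0 x : S0 \in C ->
  exists2 S, S \in C & passage xi C S0 x = cost xi S x.
Proof.
move=> S0C; rewrite /passage.
elim/big_ind : _ => [|a b [Sa SaC ->] [Sb SbC ->]|S SC].
- by exists S0.
- by case: (leP (cost xi Sa x) (cost xi Sb x)) => _; [exists Sa|exists Sb].
- by exists S.
Qed.

Lemma cost_gt0 xi S x : S != finset.set0 -> 0 < cost xi S x.
Proof.
move=> /set0Pn[i iS]; rewrite /cost (bigD1 i)//=.
by rewrite ltr_pwDl ?expR_gt0// sumr_ge0// => j _; exact: expR_ge0.
Qed.

Lemma passage_gt0 xi C S0 x : S0 \in C -> finset.set0 \notin C -> 0 < passage xi C S0 x.
Proof.
move=> S0C C0; have [S SC ->] := passage_attained xi x S0C.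
by apply: cost_gt0; apply: contraNneq C0 => <-.
Qed.

Lemma measurable_cost d (T : measurableType d) (X : I -> T -> R) xi S :
  (forall i, measurable_fun setT (X i)) ->
  measurable_fun setT (fun w => cost xi S (X ^~ w)).
Proof.
move=> mX; rewrite /cost.
under eq_fun do rewrite big_mkcond/=.
apply: measurable_sum => i; case: (i \in S) => //.
by apply: (measurableT_comp (@measurable_expR R)); exact: measurable_funM.
Qed.

Lemma measurable_passage d (T : measurableType d) (X : I -> T -> R) xi C S0 :
  (forall i, measurable_fun setT (X i)) ->
  measurable_fun setT (fun w => passage xi C S0 (X ^~ w)).
Proof.
move=> mX; rewrite /passage.
suff H (r : seq {set I}) : measurable_fun setT
    (fun w => \big[Order.min/cost xi S0 (X ^~ w)]_(S <- r | S \in C) cost xi S (X ^~ w)).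
  exact: H.
elim: r => [|S r IH]; first by under eq_fun do rewrite big_nil; exact: measurable_cost.
under eq_fun do rewrite big_cons.
case: (S \in C) => //.
by apply: measurable_minr => //; exact: measurable_cost.
Qed.

End fpp.

Section elementary.
Context {R : realType}.

Lemma expR_convex0 (p a : R) : 0 <= p <= 1 -> expR (p * a) <= p * expR a + (1 - p).
Proof.
move=> /andP[p0 p1]; set m := p * a.
have h1 : expR a >= expR m * (1 + (a - m)).
  have -> : expR a = expR m * expR (a - m) by rewrite -expRD; congr expR; ring.
  by rewrite ler_pM2l ?expR_gt0// expR_ge1Dx.
have h2 : 1 >= expR m * (1 + (- m)).
  rewrite -[leRHS](_ : expR m * expR (- m) = 1); last by rewrite -expRD subrr expR0.
  by rewrite [leRHS]/= ler_wpM2l ?expR_ge0// expR_ge1Dx.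
have h3 : p * (expR m * (1 + (a - m))) + (1 - p) * (expR m * (1 + (- m))) <=
   p * expR a + (1 - p) * 1.
  by apply: lerD; apply: ler_wpM2l => //; lra.
have -> : expR m = p * (expR m * (1 + (a - m))) + (1 - p) * (expR m * (1 + (- m))).
  rewrite /m; ring.
by move: h3; rewrite mulr1.
Qed.

Lemma expR_mean (N : nat) (y : nat -> R) : (0 < N)%N ->
  expR (N%:R^-1 * \sum_(k < N) y k) <= N%:R^-1 * \sum_(k < N) expR (y k).
Proof.
move=> N0; set m := N%:R^-1 * _.
have Nn0 : N%:R != 0 :> R by rewrite pnatr_eq0 -lt0n.
have h k : expR (y k) >= expR m * (1 + (y k - m)).
  have -> : expR (y k) = expR m * expR (y k - m) by rewrite -expRD; congr expR; ring.
  by rewrite ler_pM2l ?expR_gt0// expR_ge1Dx.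
have : N%:R^-1 * \sum_(k < N) (expR m * (1 + (y k - m))) <=
       N%:R^-1 * \sum_(k < N) expR (y k).
  by rewrite ler_wpM2l ?invr_ge0//; apply: ler_sum => k _; exact: h.
apply: le_trans; rewrite -mulr_sumr big_split/= sumrB.
rewrite !sumr_const card_ord.
have -> : \sum_(k < N) y k = N%:R * m by rewrite /m mulrA divff ?mul1r.
rewrite -mulr_natr mul1r -(mulr_natr m) (mulrC m) subrr addr0 mulrCA mulVf// mulr1.
exact: lexx.
Qed.

(** Jensen for the convex function [t |-> t^q]. On the right-hand side the variables [u i] appear
    one at a time, so that only their individual variances will matter. *)
Lemma expR_ln_mean (I : finType) (S : {set I}) (w u : I -> R) (q : R) :
  (forall i, i \in S -> 0 < w i) -> \sum_(i in S) w i = 1 -> 1 <= q ->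
  expR (q * ln (\sum_(i in S) w i * expR (u i))) <=
  \sum_(i in S) w i * expR (q * u i).
Proof.
move=> w0 w1 q1; set Z := \sum_(i in S) w i * _.
have q0 : 0 < q by exact: lt_le_trans q1.
have Z0 : 0 < Z.
  have [S0|/set0Pn[j jS]] := eqVneq S finset.set0.
    by move: w1; rewrite S0 big_set0 => /esym/eqP; rewrite oner_eq0.
  rewrite /Z (bigD1 j)//= ltr_pwDl ?mulr_gt0 ?expR_gt0 ?w0//.
  by rewrite sumr_ge0// => i /andP[iS _]; rewrite mulr_ge0 ?expR_ge0// ltW// w0.
set m := ln Z.
have mE : expR m = Z by rewrite lnK// posrE.
have h i : expR (q * m) * (1 + q * (expR (u i - m) - 1)) <= expR (q * u i).
  have -> : expR (q * u i) = expR (q * m) * expR (q * (u i - m)).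
    by rewrite -expRD; congr expR; ring.
  rewrite ler_pM2l ?expR_gt0//.
  have p01 : 0 <= q^-1 <= 1 by rewrite invr_ge0 (ltW q0)/= invf_le1.
  have := expR_convex0 (q * (u i - m)) p01.
  rewrite mulrA mulVf ?gt_eqF// mul1r => H.
  have := ler_wpM2l (ltW q0) H.
  rewrite (_ : q * (q^-1 * _ + _) = expR (q * (u i - m)) + q - 1); first by lra.
  by field; rewrite gt_eqF.
have : \sum_(i in S) w i * (expR (q * m) * (1 + q * (expR (u i - m) - 1))) <=
       \sum_(i in S) w i * expR (q * u i).
  by apply: ler_sum => i iS; rewrite ler_wpM2l// ltW// w0.
apply: le_trans.
have -> : \sum_(i in S) w i * (expR (q * m) * (1 + q * (expR (u i - m) - 1))) =
   expR (q * m) * (1 - q) * \sum_(i in S) w i +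
   expR (q * m) * q * expR (- m) * \sum_(i in S) w i * expR (u i).
  rewrite !mulr_sumr -big_split/=; apply: eq_bigr => i _.
  rewrite expRD; ring.
rewrite w1 -/Z -mE -!mulrA -expRD addNr expR0 !mulr1 -mulrDr.
by rewrite -[leLHS]mulr1 ler_pM2l ?expR_gt0//; lra.
Qed.

Lemma sin_ge0_le (x : R) : 0 <= x -> sin x <= x.
Proof.
move=> x0; have [c _] := @MVT_segment R sin cos 0 x x0
  (fun y _ => is_derive_sin y) (continuous_subspaceT (@continuous_sin R)).
rewrite sin0 !subr0 => ->.
by rewrite ler_piMl// cos_le1.
Qed.

Lemma onem_cos_le (x : R) : 0 <= x <= 2 -> 1 - cos x <= x ^+ 2 / 2.
Proof.
move=> /andP[x0 x2].
have -> : cos x = 1 - 2 * sin (x / 2) ^+ 2.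
  have -> : cos x = cos (x / 2 + x / 2) by congr cos; field.
  rewrite cosD -!expr2; have := cos2Dsin2 (x / 2); lra.
have h := sin_ge0_le (divr_ge0 x0 (ler0n R 2)).
have h0 : 0 <= sin (x / 2).
  have [->|xn0] := eqVneq x 0; first by rewrite mul0r sin0.
  by apply: ltW; apply: sin2_gt0; apply/andP; split; [rewrite divr_gt0// lt_neqAle eq_sym xn0|lra].
have : sin (x / 2) ^+ 2 <= (x / 2) ^+ 2 by rewrite ler_pXn2r// ?nnegrE//; lra.
by rewrite exprMn; lra.
Qed.

End elementary.

Section gaussian_tail.
Context {R : realType} {dO : measure_display} {Omega : measurableType dO}.
Variable P : probability Omega R.

Lemma markov_expR (X : Omega -> R) (t : R) : measurable_fun setT X ->
  (P [set w | (t <= X w)%R] <= (expR (- t))%:E * \int[P]_w (expR (X w))%:E)%E.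
Proof.
move=> mX; have mE : measurable_fun setT (fun w => (expR (X w))%:E).
  by apply/measurable_EFinP; exact: (measurableT_comp (@measurable_expR R)).
have := @le_integral_abse _ _ _ P setT measurableT _ (expR t) mE (expR_gt0 _).
rewrite setTI.
have -> : [set w | ((expR t)%:E <= `|(expR (X w))%:E|)%E] = [set w | t <= X w].
  apply/seteqP; split=> w /=; rewrite lee_fin ger0_norm ?expR_ge0// ler_expR//.
have -> : (\int[P]_w `|(expR (X w))%:E| = \int[P]_w (expR (X w))%:E)%E.
  by apply: eq_integral => w _; rewrite gee0_abs// lee_fin expR_ge0.
move=> h; rewrite -[leLHS]mul1e.
have -> : 1%E = ((expR (- t))%:E * (expR t)%:E)%E :> \bar R.
  by rewrite -EFinM -expRD addNr expR0.
by rewrite -muleA lee_wpmul2l// lee_fin expR_ge0.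
Qed.

(** Chernoff bound, at the optimal exponent [t / v]. *)
Lemma gaussian_tail1 (X : Omega -> R) (v t : R) : measurable_fun setT X ->
  (forall b, (\int[P]_w (expR (b * X w))%:E <= (expR (b ^+ 2 * v / 2))%:E)%E) ->
  0 < v -> 0 <= t ->
  (P [set w | (t <= X w)%R] <= (expR (- (t ^+ 2 / (2 * v))))%:E)%E.
Proof.
move=> mX gX v0 t0; have [->|tn0] := eqVneq t 0.
  rewrite expr0n mul0r oppr0 expR0; apply: probability_le1.
  by rewrite -[X in measurable X]setTI; exact: measurable_fun_le.
have tp : 0 < t by rewrite lt_neqAle eq_sym tn0.
have mbX : measurable_fun setT (fun w => t / v * X w) by exact: measurable_funM.
have := markov_expR (t / v * t) mbX.
have -> : [set w | t / v * t <= t / v * X w] = [set w | t <= X w].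
  by apply/seteqP; split=> w /=; rewrite ler_pM2l// divr_gt0.
move=> h; apply: (le_trans h).
apply: (@le_trans _ _ ((expR (- (t / v * t)))%:E * (expR ((t / v) ^+ 2 * v / 2))%:E)%E).
  by rewrite lee_wpmul2l ?lee_fin ?expR_ge0.
rewrite -EFinM -expRD lee_fin ler_expR le_eqVlt; apply/orP; left; apply/eqP.
by field; rewrite gt_eqF.
Qed.

Lemma gaussian_tail (X : Omega -> R) (v t : R) : measurable_fun setT X ->
  (forall b, (\int[P]_w (expR (b * X w))%:E <= (expR (b ^+ 2 * v / 2))%:E)%E) ->
  0 < v -> 0 <= t ->
  (P [set w | (t <= `|X w|)%R] <= (2 * expR (- (t ^+ 2 / (2 * v))))%:E)%E.
Proof.
move=> mX gX v0 t0.
have m1 : measurable [set w | t <= X w].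
  by rewrite -[X in measurable X]setTI; exact: measurable_fun_le.
have mN : measurable_fun setT (fun w => - X w) by exact: measurableT_comp.
have m2 : measurable [set w | t <= - X w].
  by rewrite -[X in measurable X]setTI; exact: measurable_fun_le.
have -> : [set w | t <= `|X w|] = [set w | t <= X w] `|` [set w | t <= - X w].
  apply/seteqP; split=> w /=; rewrite lerNr ler_normr lerNr; last by case=> ->; rewrite ?orbT.
  by move=> /orP[]; [left|right].
apply: (le_trans (measureU2 _ m1 m2)).
rewrite mulr2n mulrDl mul1r EFinD; apply: leeD.
  exact: gaussian_tail1.
apply: gaussian_tail1 => // b.
have -> : (\int[P]_w (expR (b * - X w))%:E = \int[P]_w (expR ((- b) * X w))%:E)%E.
  by apply: eq_integral => w _; rewrite mulrN mulNr.
by rewrite -(sqrrN b).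
Qed.

End gaussian_tail.

Section rotation.
Context {R : realType} {dO : measure_display} {Omega : measurableType dO}.
Variables (P : probability Omega R) (I : finType).
Variables (X : I -> Omega -> R) (Q : (I -> R) -> R).
Hypothesis gX : gaussian_family P X Q.
Hypothesis Qrot : forall a b c s, c ^+ 2 + s ^+ 2 = 1 ->
  Q (fun i => c * a i - s * b i) + Q (fun i => s * a i + c * b i) = Q a + Q b.

Lemma delta_sum (i : I) (c : R) (x : I -> R) : \sum_j (c * (j == i)%:R) * x j = c * x i.
Proof.
rewrite (bigD1 i)//= eqxx mulr1 big1 ?addr0// => j /negbTE ->.
by rewrite mulr0 mul0r.
Qed.

Definition rotated (c s : R) (k : I + I) (w : Omega * Omega) : R :=
  match k with
  | inl i => c * X i w.1 + s * X i w.2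
  | inr i => - s * X i w.1 + c * X i w.2
  end.

(** The covariance of two independent copies is invariant under rotations of the pair. *)
Lemma gaussian_family_rotated c s : c ^+ 2 + s ^+ 2 = 1 ->
  gaussian_family (P \x P)%E (rotated c s)
    (fun a => Q (a \o inl) + Q (a \o inr)).
Proof.
move=> cs.
pose B (k l : I + I) : R := match k, l with
  | inl i, inl j => c * (j == i)%:R
  | inl i, inr j => s * (j == i)%:R
  | inr i, inl j => - s * (j == i)%:R
  | inr i, inr j => c * (j == i)%:R end.
have := gaussian_family_lin B (gaussian_family_prod gX gX).
have -> : (fun (j : I + I) (w : Omega * Omega) => lincomb (B j) (pair_field X X ^~ w)) = rotated c s.
  apply/funext => -[i|i]; apply/funext => w;
    by rewrite lincomb_sum /lincomb /B/= (delta_sum i _ (X ^~ w.1)) (delta_sum i _ (X ^~ w.2)).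
have -> // : (fun a : I + I -> R => Q ((fun i => \sum_j a j * B j i) \o inl) +
     Q ((fun i => \sum_j a j * B j i) \o inr)) = (fun a => Q (a \o inl) + Q (a \o inr)).
apply/funext => a; rewrite -(Qrot (a \o inl) (a \o inr) cs); congr (Q _ + Q _).
- apply/funext => i /=; rewrite big_sumType/= -mulNr; congr (_ + _).
    rewrite -(delta_sum i _ (a \o inl)); apply: eq_bigr => j _ /=.
    by rewrite eq_sym mulrC.
  rewrite -(delta_sum i _ (a \o inr)); apply: eq_bigr => j _ /=.
  by rewrite eq_sym mulrC.
- apply/funext => i /=; rewrite big_sumType/=; congr (_ + _).
    rewrite -(delta_sum i _ (a \o inl)); apply: eq_bigr => j _ /=.
    by rewrite eq_sym mulrC.
  rewrite -(delta_sum i _ (a \o inr)); apply: eq_bigr => j _ /=.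
  by rewrite eq_sym mulrC.
Qed.

End rotation.

Lemma gaussian_family_integral {R : realType} {I : finType} {d1 d2 : measure_display}
    {O1 : measurableType d1} {O2 : measurableType d2}
    (P1 : probability O1 R) (P2 : probability O2 R)
    (X1 : I -> O1 -> R) (X2 : I -> O2 -> R) Q (G : paramspace R I -> \bar R) :
  gaussian_family P1 X1 Q -> gaussian_family P2 X2 Q ->
  measurable_fun setT G -> (forall x, (0 <= G x)%E) ->
  (\int[P1]_w G (X1 ^~ w) = \int[P2]_w G (X2 ^~ w))%E.
Proof.
move=> g1 g2 mG G0; have [mX1 _ _] := g1; have [mX2 _ _] := g2.
have m1 := measurable_fun_param mX1; have m2 := measurable_fun_param mX2.
transitivity (\int[pushforward P1 (fun w => (X1 ^~ w) : paramspace R I)]_x G x)%E.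
  by rewrite ge0_integral_pushforward.
transitivity (\int[pushforward P2 (fun w => (X2 ^~ w) : paramspace R I)]_x G x)%E; last first.
  by rewrite ge0_integral_pushforward.
apply: eq_measure_integral => A mA _; rewrite /pushforward.
exact: gaussian_family_law g1 g2 mA.
Qed.

Lemma integral_prob_cst {R : realType} {dO : measure_display} {Omega : measurableType dO}
  (P : probability Omega R) (r : R) : (\int[P]_w r%:E = r%:E)%E.
Proof.
transitivity (r%:E * P setT)%E; first by rewrite integral_cst.
by rewrite probability_setT mule1.
Qed.

Section concentration.
Context {R : realType} {dO : measure_display} {Omega : measurableType dO}.
Variables (P : probability Omega R) (I : finType).
Variables (X : I -> Omega -> R) (Q : (I -> R) -> R).
Hypothesis gX : gaussian_family P X Q.
Hypothesis Qrot : forall a b c s, c ^+ 2 + s ^+ 2 = 1 ->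
  Q (fun i => c * a i - s * b i) + Q (fun i => s * a i + c * b i) = Q a + Q b.
Variables (v : R) (xi : R) (C : {set {set I}}) (S0 : {set I}).
Hypotheses (v0 : 0 < v) (xi0 : 0 < xi).
Hypothesis Qv : forall i, Q (fun j => (j == i)%:R) <= v.
Hypotheses (S0C : S0 \in C) (C0 : finset.set0 \notin C).

Let T := passage xi C S0.
Let F x := ln (T x).
Let mX i : measurable_fun setT (X i). Proof. by have [] := gX. Qed.
Let T0 x : 0 < T x. Proof. exact: passage_gt0. Qed.

Let mgf i b : (\int[P]_w (expR (b * X i w))%:E <= (expR (b ^+ 2 * v / 2))%:E)%E.
Proof.
have := gaussian_family_expR (fun j => (j == i)%:R) b gX.
have -> : (fun w => (expR (b * lincomb (fun j => (j == i)%:R) (X ^~ w)))%:E) =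
  (fun w => (expR (b * X i w))%:E).
  apply/funext => w; congr (expR (b * _))%:E.
  by have := delta_sum i 1 (X ^~ w); rewrite mul1r /lincomb; under eq_bigr do rewrite mul1r.
by move=> ->; rewrite lee_fin ler_expR ler_pM2r ?invr_gt0// ler_wpM2l// sqr_ge0.
Qed.

Let measurable_expX i b : measurable_fun setT (fun w => (expR (b * X i w))%:E).
Proof.
by apply/measurable_EFinP; apply: (measurableT_comp (@measurable_expR R)); exact: measurable_funM.
Qed.

(* [E k] bounds [exp (- k * x i)] for all [i] at once, by convexity of the exponential. Its mean
   is [1 + O(k)]: crude in the number of sites, but [k] will tend to 0. *)
Let E (k : R) (x : I -> R) := 1 + k * \sum_i (expR (1 * x i) + expR (-1 * x i)).

Let E_ge k x i : 0 <= k <= 1 -> expR (k * - x i) <= E k x.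
Proof.
move=> k01; have /andP[k0 _] := k01.
have h := expR_convex0 (- x i) k01.
apply: (le_trans h).
have : k * expR (- x i) <= k * \sum_i (expR (1 * x i) + expR (-1 * x i)).
  rewrite ler_wpM2l// (bigD1 i)//= mulN1r -addrA.
  have : 0 <= \sum_(j | j != i) (expR (1 * x j) + expR (-1 * x j)).
    by rewrite sumr_ge0// => j _; rewrite addr_ge0 ?expR_ge0.
  by have := expR_ge0 (1 * x i); lra.
rewrite /E; lra.
Qed.

Let mean_E k : 0 <= k ->
  (\int[P]_w (E k (X ^~ w))%:E <= (1 + k * (#|I|%:R * (2 * expR (v / 2))))%:E)%E.
Proof.
move=> k0; rewrite /E.
have mS : measurable_fun setT (fun w => (\sum_i (expR (1 * X i w) + expR (-1 * X i w)))%:E).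
  apply/measurable_EFinP; apply: measurable_sum => i.
  by apply: measurable_funD; apply: (measurableT_comp (@measurable_expR R)); exact: measurable_funM.
have S_ge0 w : 0 <= \sum_i (expR (1 * X i w) + expR (-1 * X i w)).
  by rewrite sumr_ge0// => i _; rewrite addr_ge0 ?expR_ge0.
under eq_integral do rewrite EFinD EFinM.
rewrite ge0_integralD//; last first.
- by apply: emeasurable_funM.
- by move=> w _; rewrite mule_ge0// lee_fin.
rewrite (integral_prob_cst P) EFinD leeD2l//.
rewrite ge0_integralZl//; last by move=> w _; rewrite lee_fin.
rewrite EFinM lee_wpmul2l ?lee_fin//.
have -> : (\int[P]_w (\sum_i (expR (1 * X i w) + expR (-1 * X i w)))%:E =
  \int[P]_w (\sum_i ((expR (1 * X i w))%:E + (expR (-1 * X i w))%:E)))%E.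
  by apply: eq_integral => w _; rewrite -sumEFin; apply: eq_bigr => i _; rewrite EFinD.
rewrite ge0_integral_sum//; last 2 first.
- by move=> i; apply: emeasurable_funD; exact: measurable_expX.
- by move=> i w _; rewrite adde_ge0// lee_fin expR_ge0.
apply: (@le_trans _ _ (\sum_(i : I) (2 * expR (v / 2))%:E)%E); last first.
  by rewrite sumEFin lee_fin sumr_const -(mulr_natl (2 * expR (v / 2))).
apply: lee_sum => i _.
have hge b w : (0 <= (expR (b * X i w))%:E)%E by rewrite lee_fin expR_ge0.
rewrite (ge0_integralD P measurableT (fun w _ => hge 1 w) (measurable_expX i 1)
  (fun w _ => hge (-1) w) (measurable_expX i (-1))).
rewrite mulr2n mulrDl mul1r EFinD; apply: leeD; apply: (le_trans (mgf _ _)).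
  by rewrite expr1n mul1r.
by rewrite sqrrN expr1n mul1r.
Qed.

(** The set [S] that is optimal for [x] is a candidate for [c * x + s * y]: the ratio of the two
    costs is at most a mean of [exp (xi * ((c - 1) * x i + s * y i))] with weights the shares of
    the sites in the optimal cost. Jensen brings the power [q] inside this mean. *)
Let step_bound (c s q : R) (x y : I -> R) (S : {set I}) : 1 <= q ->
  0 <= q * xi * (1 - c) <= 1 -> S \in C -> T x = cost xi S x ->
  expR (q * (F (fun i => c * x i + s * y i) - F x)) <=
  E (q * xi * (1 - c)) x *
    \sum_(i in S) (expR (xi * x i) / T x) * expR (q * xi * s * y i).
Proof.
move=> q1 k01 SC TS; have q0 : 0 <= q by lra.
pose w i := expR (xi * x i) / T x.
pose u i := xi * ((c - 1) * x i + s * y i).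
have w0 i : i \in S -> 0 < w i by move=> _; rewrite divr_gt0 ?expR_gt0.
have w1 : \sum_(i in S) w i = 1.
  by rewrite -mulr_suml -/(cost xi S x) -TS divff// gt_eqF.
have h1 : F (fun i => c * x i + s * y i) - F x <= ln (\sum_(i in S) w i * expR (u i)).
  rewrite /F -ln_div ?posrE//.
  have cE : cost xi S (fun i => c * x i + s * y i) / T x = \sum_(i in S) w i * expR (u i).
    rewrite /cost mulr_suml; apply: eq_bigr => i _.
    rewrite mulrAC -expRD; congr (expR _ / _); rewrite /u; ring.
  rewrite -cE ler_ln ?posrE ?divr_gt0 ?cost_gt0//; last first.
    by apply: contraNneq C0 => <-.
  by rewrite ler_pM2r ?invr_gt0// passage_le.
apply: (@le_trans _ _ (expR (q * ln (\sum_(i in S) w i * expR (u i))))).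
  by rewrite ler_expR ler_wpM2l.
apply: (le_trans (expR_ln_mean u w0 w1 q1)).
rewrite mulr_sumr; apply: ler_sum => i iS.
have -> : expR (q * u i) = expR (q * xi * (1 - c) * - x i) * expR (q * xi * s * y i).
  by rewrite -expRD; congr expR; rewrite /u; ring.
rewrite mulrA [leRHS]mulrA ler_wpM2r ?expR_ge0//.
rewrite -/(w i) mulrC ler_wpM2r ?(ltW (w0 _ iS))//.
exact: E_ge.
Qed.

Let measurable_F (J : Type) d (O : measurableType d) (Y : I -> O -> R) :
  (forall i, measurable_fun setT (Y i)) -> measurable_fun setT (fun w => F (Y ^~ w)).
Proof.
by move=> mY; apply: (measurableT_comp (@measurable_ln R)); exact: measurable_passage.
Qed.

(** Given the first copy, the optimal set and its weights are fixed, and the second copy only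
    enters through the exponential moments of single sites. *)
Let step_mean (c s q : R) : 1 <= q -> 0 <= q * xi * (1 - c) <= 1 ->
  (\int[P \x P]_w (expR (q * (F (fun i => c * X i w.1 + s * X i w.2)
       - F (fun i => X i w.1))))%:E <=
  ((1 + q * xi * (1 - c) * (#|I|%:R * (2 * expR (v / 2)))) *
    expR ((q * xi * s) ^+ 2 * v / 2))%:E)%E.
Proof.
move=> q1 k01; have /andP[k0 _] := k01.
pose H (w : Omega * Omega) := expR (q * (F (fun i => c * X i w.1 + s * X i w.2)
       - F (fun i => X i w.1))).
have mH : measurable_fun setT (EFin \o H).
  apply/measurable_EFinP; apply: (measurableT_comp (@measurable_expR R)).
  apply: measurable_funM => //; apply: measurable_funB.
    apply: (@measurable_F unit _ _ (fun i w => c * X i w.1 + s * X i w.2)) => i.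
    by apply: measurable_funD; apply: measurable_funM => //;
      [exact: (measurableT_comp (mX i) measurable_fst)|exact: (measurableT_comp (mX i) measurable_snd)].
  apply: (@measurable_F unit _ _ (fun i w => X i w.1)) => i.
  exact: (measurableT_comp (mX i) measurable_fst).
rewrite (fubini_tonelli1 (m1 := P) (m2 := P) (EFin \o H) mH (fun _ => expR_ge0 _)).
set B := expR ((q * xi * s) ^+ 2 * v / 2).
have E_ge0 w1 : 0 <= E (q * xi * (1 - c)) (X ^~ w1).
  apply: addr_ge0 => //; apply: mulr_ge0 => //; apply: sumr_ge0 => i _.
  by apply: addr_ge0; exact: expR_ge0.
have mE : measurable_fun setT (fun w1 => (E (q * xi * (1 - c)) (X ^~ w1))%:E).
  apply/measurable_EFinP; apply: measurable_funD => //; apply: measurable_funM => //.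
  apply: measurable_sum => i; apply: measurable_funD;
    by apply: (measurableT_comp (@measurable_expR R)); exact: measurable_funM.
have B0 : (0 <= B%:E)%E by rewrite lee_fin expR_ge0.
apply: (@le_trans _ _ (\int[P]_w1 ((E (q * xi * (1 - c)) (X ^~ w1))%:E * B%:E))%E); last first.
  rewrite (ge0_integralZr P measurableT mE (fun w1 _ => E_ge0 w1) B0).
  by rewrite EFinM lee_wpmul2r//; exact: mean_E.
have mEB : measurable_fun setT (fun w1 => (E (q * xi * (1 - c)) (X ^~ w1))%:E * B%:E)%E.
  by apply: emeasurable_funM.
apply: ge0_le_integral => //.
- by move=> w1 _; apply: integral_ge0 => w2 _; rewrite lee_fin expR_ge0.
- exact: (measurable_fun_fubini_tonelli_F (EFin \o H) mH (fun _ => expR_ge0 _)).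
move=> w1 _; rewrite /fubini_F.
have [S SC TS] := passage_attained xi (X ^~ w1) S0C.
set e := E _ _.
pose w i := expR (xi * X i w1) / T (X ^~ w1).
have w0 i : 0 <= w i by rewrite divr_ge0 ?expR_ge0// ltW.
have sumw : \sum_(i in S) w i = 1.
  by rewrite -mulr_suml -/(cost xi S (X ^~ w1)) -TS divff// gt_eqF.
have mG i : measurable_fun setT (fun w2 => ((w i)%:E * (expR (q * xi * s * X i w2))%:E)%E).
  by apply: emeasurable_funM.
pose G w2 := (e%:E * \sum_(i in S) ((w i)%:E * (expR (q * xi * s * X i w2))%:E))%E.
have G_ge0 w2 i : (0 <= (w i)%:E * (expR (q * xi * s * X i w2))%:E)%E.
  by rewrite -EFinM lee_fin mulr_ge0 ?expR_ge0.
have msum : measurable_fun setT (fun w2 => \sum_(i in S) ((w i)%:E * (expR (q * xi * s * X i w2))%:E))%E.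
  under eq_fun do rewrite -big_enum/=; apply: emeasurable_sum => i.
  exact: mG.
apply: (@le_trans _ _ (\int[P]_w2 G w2)%E).
  apply: ge0_le_integral => //.
  - by move=> w2 _; rewrite lee_fin expR_ge0.
  - apply/measurable_EFinP; apply: (measurableT_comp (@measurable_expR R)).
    apply: measurable_funM => //; apply: measurable_funB => //.
      apply: (@measurable_F unit _ _ (fun i w2 => c * X i w1 + s * X i w2)) => i.
      by apply: measurable_funD => //; exact: measurable_funM.
    apply: (@measurable_F unit _ _ (fun i w2 => X i w1)) => i; exact: measurable_cst.
  - by apply: emeasurable_funM.
  - move=> w2 _; rewrite /G/= /H/=.
    have := step_bound s (X ^~ w2) q1 k01 SC TS.
    rewrite -lee_fin => h; apply: (le_trans h).
    rewrite EFinM /e -sumEFin.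
    by rewrite lee_wpmul2l ?lee_fin.
rewrite /G (ge0_integralZl P measurableT msum); last 2 first.
- by move=> w2 _; apply: sume_ge0 => i _; exact: G_ge0.
- by rewrite lee_fin; exact: E_ge0.
rewrite lee_wpmul2l ?lee_fin ?E_ge0//.
under eq_integral do rewrite -big_enum/=.
rewrite ge0_integral_sum//.
apply: (@le_trans _ _ (\sum_(i <- enum S) (w i * B)%:E)%E).
  apply: lee_sum => i _.
  rewrite (ge0_integralZl P measurableT (measurable_expX i (q * xi * s))); last 2 first.
  - by move=> w2 _; rewrite lee_fin expR_ge0.
  - by rewrite lee_fin.
  by rewrite (EFinM (w i) B) lee_wpmul2l ?lee_fin//; exact: mgf.
by rewrite sumEFin big_enum/= -mulr_suml sumw mul1r.
Qed.

(** The pair of field and derivative at a point of the rotation has the law of two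
    independent copies, so every step of the interpolation looks like the first one. *)
Let step_transfer (q c sn a b a' b' : R) : 1 <= q ->
  0 <= q * xi * (1 - c) <= 1 -> a ^+ 2 + b ^+ 2 = 1 ->
  a' = c * a - sn * b -> b' = c * b + sn * a ->
  (\int[P \x P]_w (expR (q * (F (fun i => a' * X i w.1 + b' * X i w.2)
       - F (fun i => a * X i w.1 + b * X i w.2))))%:E <=
  ((1 + q * xi * (1 - c) * (#|I|%:R * (2 * expR (v / 2)))) *
    expR ((q * xi * sn) ^+ 2 * v / 2))%:E)%E.
Proof.
move=> q1 k01 ab a'E b'E.
pose G (z : paramspace R (I + I)) : \bar R :=
  (expR (q * (F (fun i => c * z (inl i) + sn * z (inr i)) - F (fun i => z (inl i)))))%:E.
have mG : measurable_fun setT G.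
  apply/measurable_EFinP; apply: (measurableT_comp (@measurable_expR R)).
  apply: measurable_funM => //; apply: measurable_funB.
    apply: (@measurable_F unit _ _ (fun i (z : paramspace R (I + I)) => c * z (inl i) + sn * z (inr i))) => i.
    by apply: measurable_funD; apply: measurable_funM => //; exact: measurable_param.
  apply: (@measurable_F unit _ _ (fun i (z : paramspace R (I + I)) => z (inl i))) => i.
  exact: measurable_param.
have G_ge0 z : (0 <= G z)%E by rewrite lee_fin expR_ge0.
have g1 := gaussian_family_rotated gX Qrot ab.
have one : (1 : R) ^+ 2 + 0 ^+ 2 = 1 by rewrite expr1n expr0n addr0.
have g0 := gaussian_family_rotated gX Qrot one.
have GI := gaussian_family_integral g1 g0 mG G_ge0.
have G1 w : (expR (q * (F (fun i => a' * X i w.1 + b' * X i w.2)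
       - F (fun i => a * X i w.1 + b * X i w.2))))%:E = G (rotated X a b ^~ w).
  have e : (fun i => a' * X i w.1 + b' * X i w.2) =
     (fun i => c * rotated X a b (inl i) w + sn * rotated X a b (inr i) w).
    by apply/funext => i; rewrite /rotated a'E b'E; ring.
  by rewrite e.
have G2 w : G (rotated X 1 0 ^~ w) =
    (expR (q * (F (fun i => c * X i w.1 + sn * X i w.2) - F (fun i => X i w.1))))%:E.
  have e1 : (fun i => rotated X 1 0 (inl i) w) = fun i => X i w.1.
    by apply/funext => i; rewrite /rotated mul0r mul1r addr0.
  have e2 : (fun i => c * rotated X 1 0 (inl i) w + sn * rotated X 1 0 (inr i) w) =
    fun i => c * X i w.1 + sn * X i w.2.
    by apply/funext => i; rewrite /rotated oppr0 !mul0r !mul1r add0r addr0.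
  by rewrite /G e1 e2.
rewrite (eq_integral _ _ (fun w _ => G1 w)).
rewrite GI (eq_integral _ _ (fun w _ => G2 w)).
exact: step_mean.
Qed.

Let pihalf_le2 : @pi R / 2 <= 2.
Proof. by have /andP[_ /ltW] := @pihalf_02 R. Qed.

(** The rotation leads from the first copy to the second in [N] steps of angle [pi / (2 * N)].
    By Jensen the exponential of [s] times the total increment is at most the average of the
    exponentials of [q = s * N] times the single increments. In a single step the sine is of
    order [1 / N], so that [q * sin] stays bounded, whereas [q * (1 - cos)] is of order [1 / N]
    and disappears in the limit; for large [N] its contribution is a factor at most 2. *)
Lemma passage_ratio_mgf (s : R) : 0 < s ->
  (\int[P \x P]_w (expR (s * (F (X ^~ w.2) - F (X ^~ w.1))))%:E <=
   (2 * expR (2 * s ^+ 2 * xi ^+ 2 * v))%:E)%E.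
Proof.
move=> s0; set M := #|I|%:R * (2 * expR (v / 2)).
have M0 : 0 <= M by rewrite mulr_ge0// mulr_ge0// expR_ge0.
(* The first term ensures [1 <= q], the second makes the mean of the error term [E] at most 2. *)
pose bnd := s^-1 + 2 * s * xi * (M + 1) + 1.
pose N := (Num.truncn bnd).+1.
have Nb : bnd < N%:R by exact: truncnS_gt.
have sV0 : 0 < s^-1 by rewrite invr_gt0.
have K0 : 0 <= 2 * s * xi * (M + 1) by rewrite !mulr_ge0// ?addr_ge0 ?(ltW s0) ?(ltW xi0).
have N0 : 0 < N%:R :> R by rewrite ltr0n.
pose delta : R := pi / 2 / N%:R.
have d0 : 0 <= delta by rewrite !divr_ge0// pi_ge0.
have d2 : delta <= 2 / N%:R by rewrite ler_pM2r ?invr_gt0// pihalf_le2.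
have N1 : 1 <= N%:R :> R by rewrite ler1n.
have d2' : delta <= 2 by apply: (le_trans d2); rewrite ler_pdivrMr//; lra.
pose q := s * N%:R.
have q1 : 1 <= q.
  have : s * s^-1 <= s * N%:R by rewrite ler_pM2l//; rewrite /bnd in Nb; lra.
  by rewrite divff ?gt_eqF.
have q0 : 0 < q by lra.
pose c := cos delta; pose sn := sin delta.
have c1 : 0 <= 1 - c by rewrite subr_ge0 cos_le1.
have qx0 : 0 <= q * xi by rewrite mulr_ge0 ?ltW.
have kM : q * xi * (1 - c) * (M + 1) <= 1.
  have h1 : 1 - c <= delta ^+ 2 / 2 by apply: onem_cos_le; rewrite d0.
  have h2 : delta ^+ 2 / 2 <= 2 / N%:R ^+ 2.
    have : delta ^+ 2 <= (2 / N%:R) ^+ 2 by rewrite ler_pXn2r// ?nnegrE ?divr_ge0.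
    rewrite (_ : (2 / N%:R) ^+ 2 = 4 * N%:R ^- 2); last by field; rewrite gt_eqF.
    by move: (N%:R ^- 2) => z; lra.
  have h3 : q * xi * (1 - c) <= q * xi * (2 / N%:R ^+ 2) by rewrite ler_wpM2l//; lra.
  apply: (@le_trans _ _ (q * xi * (2 / N%:R ^+ 2) * (M + 1))).
    by rewrite ler_wpM2r ?addr_ge0.
  have -> : q * xi * (2 / N%:R ^+ 2) * (M + 1) = 2 * s * xi * (M + 1) / N%:R.
    by rewrite /q; field; rewrite gt_eqF.
  by rewrite ler_pdivrMr// mul1r; rewrite /bnd in Nb; lra.
have k0 : 0 <= q * xi * (1 - c) by rewrite mulr_ge0.
have k1 : q * xi * (1 - c) <= 1 by nra.
have k01 : 0 <= q * xi * (1 - c) <= 1 by rewrite k0.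
have sn0 : 0 <= sn <= delta.
  rewrite sin_ge0_le// andbT.
  apply: sin_ge0_pi; rewrite d0/=.
  exact: le_trans d2' (pi_ge2 R).
pose Z k i (w : Omega * Omega) :=
  cos (k%:R * delta) * X i w.1 + sin (k%:R * delta) * X i w.2.
pose D k w := F (Z k.+1 ^~ w) - F (Z k ^~ w).
have ZN : Z N = (fun i w => X i w.2).
  apply/funext => i; apply/funext => w; rewrite /Z.
  have -> : N%:R * delta = pi / 2 by rewrite /delta; field; rewrite gt_eqF.
  by rewrite cos_pihalf sin_pihalf mul0r mul1r add0r.
have Z0 : Z 0%N = (fun i w => X i w.1).
  apply/funext => i; apply/funext => w; rewrite /Z mul0r cos0 sin0.
  by rewrite mul0r mul1r addr0.
have tele w : F (X ^~ w.2) - F (X ^~ w.1) = \sum_(k < N) D k w.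
  rewrite -(big_mkord xpredT (fun k => D k w)) /D.
  by rewrite (telescope_sumr (fun k => F (Z k ^~ w)))// ZN Z0.
have meanD k : (\int[P \x P]_w (expR (q * D k w))%:E <=
    (2 * expR (2 * s ^+ 2 * xi ^+ 2 * v))%:E)%E.
  have ca : cos (k.+1%:R * delta) = c * cos (k%:R * delta) - sn * sin (k%:R * delta).
    by rewrite -natr1 mulrDl mul1r cosD mulrC (mulrC sn).
  have sa : sin (k.+1%:R * delta) = c * sin (k%:R * delta) + sn * cos (k%:R * delta).
    by rewrite -natr1 mulrDl mul1r sinD mulrC (mulrC sn).
  have h := step_transfer q1 k01 (cos2Dsin2 (k%:R * delta)) ca sa.
  apply: (le_trans h); rewrite lee_fin.
  apply: ler_pM; rewrite ?expR_ge0//.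
  - by rewrite addr_ge0// mulr_ge0.
  - by rewrite -/M; move: kM; rewrite mulrDr; lra.
  - have /andP[s1 s2] := sn0.
    have h0 : 0 <= q * xi * sn by rewrite mulr_ge0.
    have h1 : q * xi * sn <= 2 * s * xi.
      apply: (@le_trans _ _ (q * xi * (2 / N%:R))).
        by rewrite ler_wpM2l// (le_trans s2).
      rewrite le_eqVlt; apply/orP; left; apply/eqP; rewrite /q; field.
      by rewrite gt_eqF.
    have : (q * xi * sn) ^+ 2 <= (2 * s * xi) ^+ 2.
      by rewrite ler_pXn2r// ?nnegrE//; lra.
    rewrite ler_expR => h2.
    have : (q * xi * sn) ^+ 2 * v <= (2 * s * xi) ^+ 2 * v by rewrite ler_pM2r.
    by rewrite !exprMn; lra.
have mD k : measurable_fun setT (fun w => (expR (q * D k w))%:E).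
  apply/measurable_EFinP; apply: (measurableT_comp (@measurable_expR R)).
  apply: measurable_funM => //; apply: measurable_funB;
    (apply: (@measurable_F unit) => i;
    apply: measurable_funD; apply: measurable_funM => //;
    [exact: (measurableT_comp (mX i) measurable_fst)|exact: (measurableT_comp (mX i) measurable_snd)]).
have NV0 : (0 <= (N%:R^-1 : R)%:E)%E by rewrite lee_fin invr_ge0.
have mS : measurable_fun setT (fun w => \sum_(k < N) (expR (q * D k w))%:E)%E.
  by apply: emeasurable_sum => k; exact: mD.
apply: (@le_trans _ _ (\int[P \x P]_w (N%:R^-1%:E * \sum_(k < N) (expR (q * D k w))%:E))%E).
  apply: ge0_le_integral => //.
  - apply/measurable_EFinP; apply: (measurableT_comp (@measurable_expR R)).
    apply: measurable_funM => //; apply: measurable_funB; apply: (@measurable_F unit) => i.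
      exact: (measurableT_comp (mX i) measurable_snd).
    exact: (measurableT_comp (mX i) measurable_fst).
  - by apply: emeasurable_funM.
  - move=> w _; rewrite tele sumEFin -EFinM lee_fin.
    have := expR_mean (fun k => q * D k w) (ltn0Sn _ : (0 < N)%N).
    rewrite -mulr_sumr; have -> // : N%:R^-1 * (q * \sum_(k < N) D k w) = s * \sum_(k < N) D k w.
    by rewrite /q; field; rewrite gt_eqF.
rewrite (ge0_integralZl _ measurableT mS); last 2 first.
- by move=> w _; apply: sume_ge0 => k _; rewrite lee_fin expR_ge0.
- by [].
rewrite ge0_integral_sum//.
apply: (@le_trans _ _ (N%:R^-1%:E * \sum_(k < N) (2 * expR (2 * s ^+ 2 * xi ^+ 2 * v))%:E)%E).
  by rewrite lee_wpmul2l//; apply: lee_sum => k _; exact: meanD.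
set cc := 2 * expR _.
rewrite sumEFin -EFinM lee_fin sumr_const card_ord -(mulr_natl cc N) mulrA mulVf ?gt_eqF// mul1r.
exact: lexx.
Qed.

(** The two events in two independent copies force the ratio of the costs above [exp t], which
    is unlikely by the exponential moments of the ratio. Only the maximal variance enters,
    neither the number of sites nor the number of sets. *)
Theorem passage_concentration (A t : R) : 0 < A -> 0 < t ->
  (P [set w | (T (X ^~ w) <= A)%R] * P [set w | (A * expR t <= T (X ^~ w))%R] <=
   (2 * expR (- (t ^+ 2 / (8 * xi ^+ 2 * v))))%:E)%E.
Proof.
move=> A0 t0.
have mT : measurable_fun setT (fun w => T (X ^~ w)) by exact: measurable_passage.
have m1 : measurable [set w | T (X ^~ w) <= A].
  by rewrite -[X in measurable X]setTI; exact: measurable_fun_le.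
have m2 : measurable [set w | A * expR t <= T (X ^~ w)].
  by rewrite -[X in measurable X]setTI; exact: measurable_fun_le.
rewrite -product_measure1E//.
have xv0 : 0 < xi ^+ 2 * v by rewrite mulr_gt0// exprn_gt0.
(* The minimum of [2 * s ^+ 2 * xi ^+ 2 * v - s * t]. *)
pose s := t / (4 * (xi ^+ 2 * v)).
have s0 : 0 < s by rewrite divr_gt0// mulr_gt0.
have mF2 : measurable_fun setT (fun w : Omega * Omega => s * (F (X ^~ w.2) - F (X ^~ w.1))).
  apply: measurable_funM => //; apply: measurable_funB; apply: (@measurable_F unit) => i.
    exact: (measurableT_comp (mX i) measurable_snd).
  exact: (measurableT_comp (mX i) measurable_fst).
apply: (@le_trans _ _ ((P \x P)%E [set w | s * t <= s * (F (X ^~ w.2) - F (X ^~ w.1))])).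
  apply: le_measure; rewrite ?inE.
  - exact: measurableX.
  - by rewrite -[X in measurable X]setTI; exact: measurable_fun_le.
  - move=> [w1 w2] /= [h1 h2]; rewrite ler_pM2l// lerBrDl /F.
    rewrite -[X in _ + X <= _]expRK -lnM ?posrE ?expR_gt0// ler_ln ?posrE ?mulr_gt0 ?expR_gt0//.
    by apply: le_trans h2; rewrite ler_pM2r ?expR_gt0.
apply: (le_trans (markov_expR _ (s * t) mF2)).
apply: (@le_trans _ _ ((expR (- (s * t)))%:E * (2 * expR (2 * s ^+ 2 * xi ^+ 2 * v))%:E)%E).
  by rewrite lee_wpmul2l ?lee_fin ?expR_ge0//; exact: passage_ratio_mgf.
rewrite -EFinM lee_fin mulrCA ler_pM2l// -expRD ler_expR le_eqVlt; apply/orP; left; apply/eqP.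
by rewrite /s; field; rewrite !gt_eqF.
Qed.

End concentration.

#[local] Opaque gmean.

(** * Independence of uncorrelated Gaussian families *)
Section independence.
Context {R : realType} {dO : measure_display} {Omega : measurableType dO}.
Variables (P : probability Omega R) (I J : finType).

Definition join_field (X : I -> Omega -> R) (Y : J -> Omega -> R) (k : I + J) w : R :=
  match k with inl i => X i w | inr j => Y j w end.

Variables (X : I -> Omega -> R) (Y : J -> Omega -> R).
Variables (Q1 : (I -> R) -> R) (Q2 : (J -> R) -> R).
Hypothesis gXY : gaussian_family P (join_field X Y)
  (fun a => Q1 (a \o inl) + Q2 (a \o inr)).
Hypotheses (gX : gaussian_family P X Q1) (gY : gaussian_family P Y Q2).

(** A product of independent copies of the two families is a Gaussian family with the same
    quadratic form, hence with the same joint law. *)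
Lemma gaussian_family_indep (A : set (paramspace R I)) (B : set (paramspace R J)) :
  measurable A -> measurable B ->
  (P ([set w | A (X ^~ w)] `&` [set w | B (Y ^~ w)]) =
   P [set w | A (X ^~ w)] * P [set w | B (Y ^~ w)])%E.
Proof.
move=> mA mB; have [mX _ _] := gX; have [mY _ _] := gY.
have mAX : measurable [set w | A (X ^~ w)].
  by rewrite -[X in measurable X]setTI; exact: (measurable_fun_param mX).
have mBY : measurable [set w | B (Y ^~ w)].
  by rewrite -[X in measurable X]setTI; exact: (measurable_fun_param mY).
rewrite -product_measure1E//.
pose AB : set (paramspace R (I + J)) :=
  [set z | A (fun i => z (inl i))] `&` [set z | B (fun j => z (inr j))].
have mAB : measurable AB.
  apply: measurableI.
    rewrite -[X in measurable X]setTI.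
    exact: (measurable_fun_param (fun i => measurable_param (inl i : I + J))).
  rewrite -[X in measurable X]setTI.
  exact: (measurable_fun_param (fun j => measurable_param (inr j : I + J))).
exact: (gaussian_family_law gXY (gaussian_family_prod gX gY) mAB).
Qed.

End independence.

(** * The Gaussian families of a white noise *)
Section square_integrable.
Context {R : realType} {d : nat}.
Local Notation Z := ('rV[R]_d * R)%type.
Local Notation ZL := ('rV[R]_d * measurableTypeR R)%type.
Local Notation mu := (lebesgue_rV d \x lebesgue_measure)%E.
Local Notation stm := (@spacetime R d).
Implicit Types f g : Z -> R.

Lemma measurable_spacetime : measurable (@spacetime R d).
Proof.
have := @measurable_snd _ _ 'rV[R]_d R measurableT `]0, +oo[%classic (measurable_itv _).
rewrite setTI; congr measurable; apply/seteqP; split => z /=; rewrite in_itv/= andbT//.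
Qed.

Definition l2norm2 f : R := fine (sqr_integral f).

Lemma sqr_integral_ge0 f : (0 <= sqr_integral f)%E.
Proof. by apply: integral_ge0 => z _; rewrite lee_fin sqr_ge0. Qed.

Lemma l2norm2_ge0 f : 0 <= l2norm2 f.
Proof. by rewrite fine_ge0// sqr_integral_ge0. Qed.

Lemma l2norm2E f : L2_spacetime f -> (l2norm2 f)%:E = sqr_integral f.
Proof. by move=> [_ f2]; rewrite fineK// ge0_fin_numE// sqr_integral_ge0. Qed.

Lemma measurable_sqr f : measurable_fun stm f ->
  measurable_fun (stm : set ZL) (fun z => (f z ^+ 2)%:E).
Proof.
move=> mf; have : measurable_fun (stm : set Z) (fun z => (f z ^+ 2)%:E); last by [].
by apply/measurable_EFinP; exact: measurable_funX.
Qed.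

Lemma L2_lin (a : R) f g : L2_spacetime f -> L2_spacetime g ->
  L2_spacetime (fun z => a * f z + g z).
Proof.
move=> [mf f2] [mg g2].
have mh : measurable_fun stm (fun z => a * f z + g z).
  by apply: measurable_funD => //; exact: measurable_funM.
split => //.
apply: (@le_lt_trans _ _ (\int[mu]_(z in stm)
    ((2 * a ^+ 2)%:E * (f z ^+ 2)%:E + 2%:E * (g z ^+ 2)%:E))%E).
  apply: ge0_le_integral => //.
  - exact: measurable_spacetime.
  - by move=> z _; rewrite lee_fin sqr_ge0.
  - exact: measurable_sqr.
  - by apply: emeasurable_funD; apply: emeasurable_funM => //; exact: measurable_sqr.
  - move=> z _; rewrite -!EFinM -EFinD lee_fin.
    have := sqr_ge0 (a * f z - g z); rewrite sqrrB !exprMn; rewrite sqrrD exprMn.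
    by set u := f z; set w := g z; lra.
rewrite ge0_integralD//=; last 5 first.
- exact: measurable_spacetime.
- by move=> z _; rewrite -EFinM lee_fin mulr_ge0 ?sqr_ge0// mulr_ge0 ?sqr_ge0.
- by apply: emeasurable_funM => //; exact: measurable_sqr.
- by move=> z _; rewrite -EFinM lee_fin mulr_ge0 ?sqr_ge0.
- by apply: emeasurable_funM => //; exact: measurable_sqr.
rewrite !ge0_integralZl//; try exact: measurable_spacetime; try exact: measurable_sqr;
  try (by move=> z _; rewrite lee_fin sqr_ge0); try (by rewrite lee_fin mulr_ge0// sqr_ge0).
by rewrite lte_add_pinfty// lte_mul_pinfty// ?lee_fin// mulr_ge0// sqr_ge0.
Qed.

Lemma sqr_integralD f g : L2_spacetime f -> L2_spacetime g ->
  (sqr_integral f + sqr_integral g =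
   \int[mu]_(z in stm) ((f z ^+ 2)%:E + (g z ^+ 2)%:E))%E.
Proof.
move=> [mf _] [mg _]; have ms : measurable (stm : set ZL) := measurable_spacetime.
have pos (k : Z -> R) z : stm z -> (0 <= (k z ^+ 2)%:E)%E.
  by move=> _; rewrite lee_fin sqr_ge0.
by rewrite (ge0_integralD _ ms (pos f) (measurable_sqr mf) (pos g) (measurable_sqr mg)).
Qed.

Lemma L2_0 : L2_spacetime (fun _ : Z => 0 : R).
Proof.
split; first exact: measurable_cst.
by rewrite /sqr_integral; under eq_integral do rewrite expr0n; rewrite integral0.
Qed.

(** The cross terms cancel. *)
Lemma l2norm2_rotate f g (c s : R) : c ^+ 2 + s ^+ 2 = 1 ->
  L2_spacetime f -> L2_spacetime g ->
  l2norm2 (fun z => c * f z - s * g z) + l2norm2 (fun z => s * f z + c * g z) =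
  l2norm2 f + l2norm2 g.
Proof.
move=> cs Lf Lg; have L0 := L2_0.
have Lg' : L2_spacetime (fun z => - s * g z).
  have := L2_lin (- s) Lg L0; congr L2_spacetime; apply/funext => z; exact: addr0.
have Lg2 : L2_spacetime (fun z => c * g z).
  have := L2_lin c Lg L0; congr L2_spacetime; apply/funext => z; exact: addr0.
have L1 : L2_spacetime (fun z => c * f z - s * g z).
  have := L2_lin c Lf Lg'; congr L2_spacetime; apply/funext => z; by rewrite mulNr.
have L2 : L2_spacetime (fun z => s * f z + c * g z) by exact: L2_lin.
apply: EFin_inj; rewrite !EFinD !l2norm2E// !sqr_integralD//.
apply: eq_integral => z _; rewrite -!EFinD; congr EFin.
rewrite sqrrB sqrrD !exprMn.
have -> : s ^+ 2 = 1 - c ^+ 2 by rewrite -cs; ring.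
ring.
Qed.

Lemma l2norm2_disjoint f g : L2_spacetime f -> L2_spacetime g ->
  (forall z, f z * g z = 0) ->
  l2norm2 (fun z => f z + g z) = l2norm2 f + l2norm2 g.
Proof.
move=> Lf Lg fg.
have L1 : L2_spacetime (fun z => f z + g z).
  have := L2_lin 1 Lf Lg; congr L2_spacetime; apply/funext => z; by rewrite mul1r.
apply: EFin_inj; rewrite EFinD !l2norm2E// sqr_integralD// /sqr_integral.
apply: eq_integral => z _; rewrite -!EFinD; congr EFin.
by rewrite sqrrD fg mul0rn addr0.
Qed.

(** The kernel whose integral against the white noise is a given linear combination. *)
Definition combine {I : finType} (f : I -> Z -> R) (a : I -> R) (z : Z) : R :=
  \sum_i a i * f i z.

Lemma L2_sum (I : Type) (r : seq I) (f : I -> Z -> R) (a : I -> R) :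
  (forall i, L2_spacetime (f i)) -> L2_spacetime (fun z => \sum_(i <- r) a i * f i z).
Proof.
move=> Lf; elim: r => [|i r IH]; first by under eq_fun do rewrite big_nil; exact: L2_0.
by under eq_fun do rewrite big_cons; exact: L2_lin.
Qed.

Lemma L2_combine {I : finType} (f : I -> Z -> R) a :
  (forall i, L2_spacetime (f i)) -> L2_spacetime (combine f a).
Proof. exact: L2_sum. Qed.

Lemma combine_rotate {I : finType} (f : I -> Z -> R) (a b : I -> R) (c s : R) :
  (forall i, L2_spacetime (f i)) -> c ^+ 2 + s ^+ 2 = 1 ->
  l2norm2 (combine f (fun i => c * a i - s * b i)) +
  l2norm2 (combine f (fun i => s * a i + c * b i)) =
  l2norm2 (combine f a) + l2norm2 (combine f b).
Proof.
move=> Lf cs; rewrite -(l2norm2_rotate cs (L2_combine a Lf) (L2_combine b Lf)).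
congr (l2norm2 _ + l2norm2 _); apply/funext => z; rewrite /combine !mulr_sumr.
  by rewrite -sumrB; apply: eq_bigr => i _; ring.
by rewrite -big_split/=; apply: eq_bigr => i _; ring.
Qed.

Lemma combine_join {I J : finType} (f : I -> Z -> R) (g : J -> Z -> R) a :
  (forall i, L2_spacetime (f i)) -> (forall j, L2_spacetime (g j)) ->
  (forall i j z, f i z * g j z = 0) ->
  l2norm2 (combine (fun k : I + J => match k with inl i => f i | inr j => g j end) a) =
  l2norm2 (combine f (a \o inl)) + l2norm2 (combine g (a \o inr)).
Proof.
move=> Lf Lg fg; rewrite -l2norm2_disjoint; last 3 first.
- exact: L2_combine.
- exact: L2_combine.
- move=> z; rewrite /combine mulr_suml big1// => i _.
  rewrite mulr_sumr big1// => j _; rewrite mulrACA fg mulr0//.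
by congr l2norm2; apply/funext => z; rewrite /combine big_sumType.
Qed.

End square_integrable.

Section white_noise_family.
Context {R : realType} {d : nat} {dO : measure_display} {Omega : measurableType dO}.
Variable P : probability Omega R.
Local Notation Z := ('rV[R]_d * R)%type.
Variable W : (Z -> R) -> {RV P >-> R}.
Hypothesis W_noise : white_noise W.

Lemma white_noise0 : {ae P, forall w, W (fun=> 0) w = 0}.
Proof.
have := white_noise_linear W_noise 1 (@L2_0 R d) (@L2_0 R d).
apply: filterS => w; rewrite (_ : (fun z : Z => 1 * 0 + 0) = fun=> 0); last first.
  by apply/funext => z; rewrite mulr0 addr0.
by rewrite mul1r => /eqP; rewrite -subr_eq0 opprD addrA subrr sub0r oppr_eq0 => /eqP.
Qed.

Lemma white_noise_sum (I : Type) (r : seq I) (f : I -> Z -> R) (X : I -> Omega -> R) (a : I -> R) :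
  (forall i, L2_spacetime (f i)) ->
  (forall i, {ae P, forall w, X i w = W (f i) w}) ->
  {ae P, forall w, W (fun z => \sum_(i <- r) a i * f i z) w = \sum_(i <- r) a i * X i w}.
Proof.
move=> Lf Xf; elim: r => [|i r IH].
  apply: filterS white_noise0 => w Ww.
  rewrite big_nil -[RHS]Ww; congr (W _ w); apply/funext => z; by rewrite big_nil.
have := white_noise_linear W_noise (a i) (Lf i) (L2_sum r a Lf).
move: (Xf i) IH; apply: filterS3 => w Xw IH lin.
rewrite big_cons -IH Xw -lin; congr (W _ w); apply/funext => z; by rewrite big_cons.
Qed.

(** By linearity of the noise a linear combination of the [X i] is the noise of one kernel. *)
Lemma white_noise_gaussian_family {I : finType} (f : I -> Z -> R) (X : I -> Omega -> R) :
  (forall i, L2_spacetime (f i)) -> (forall i, measurable_fun setT (X i)) ->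
  (forall i, {ae P, forall w, X i w = W (f i) w}) ->
  gaussian_family P X (fun a => l2norm2 (combine f a)).
Proof.
move=> Lf mX Xf; split => //.
  by move=> a; exact: l2norm2_ge0.
move=> a F mF F0.
have ae := white_noise_sum (index_enum I) a Lf Xf.
rewrite -(gmean_law (white_noise_law W_noise (L2_combine a Lf)) mF F0).
apply: ae_eq_integral => //.
- by apply: (measurableT_comp mF); exact: measurable_lincombX.
- exact: (measurableT_comp mF).
- by apply: filterS ae => w e _; rewrite /lincomb -e.
Qed.

End white_noise_family.

(** * Changes of variables in R^d *)
Section rV_norm.
Context {R : realType} {d : nat}.
Implicit Types v : 'rV[R]_d.

Lemma rV_coord_le v i : `|v ord0 i| <= `|v|.
Proof.
rewrite [leRHS](_ : _ = mx_norm v)// mx_normrE.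
exact: (le_bigmax _ (fun ij : 'I_1 * 'I_d => `|v ij.1 ij.2|) (ord0, i)).
Qed.

Lemma rV_norm_le v e : 0 <= e -> (forall i, `|v ord0 i| <= e) -> `|v| <= e.
Proof.
move=> e0 h; rewrite [leLHS](_ : _ = mx_norm v)// mx_normrE.
by apply/bigmax_leP; split => // -[i j] _ /=; rewrite ord1.
Qed.

Lemma rV_norm_lt v e : 0 < e -> (forall i, `|v ord0 i| < e) -> `|v| < e.
Proof.
move=> e0 h; rewrite [ltLHS](_ : _ = mx_norm v)// mx_normrE.
by apply/bigmax_ltP; split => // -[i j] _ /=; rewrite ord1.
Qed.

End rV_norm.

Section lebesgue_rV_affine.
Context {R : realType} {d : nat}.
Local Notation mu := (@lebesgue_measure R).
Local Notation V := 'rV[R]_d.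
Local Notation nu := (@lebesgue_rV R d).

Definition rV_box (A : 'I_d -> set R) : set V := [set v | forall i, A i (v ord0 i)].

Lemma measurable_rV_box A : (forall i, measurable (A i)) -> measurable (rV_box A).
Proof.
move=> mA; rewrite (_ : rV_box A =
    \bigcap_(i in [set: 'I_d]) [set v : V | A i (v ord0 i)]); last first.
  by apply/seteqP; split=> [v Bv i _|v Bv i]; [exact: Bv|exact: (Bv i I)].
apply: fin_bigcap_measurable => // i _.
have := @measurable_coord _ R 1 d ord0 i measurableT _ (mA i).
by rewrite setTI.
Qed.

(** Permuting coordinates by an involution is included, as this is the part of the orthogonal
    group that maps the lattice to itself. *)
Definition rV_affine (c : R) (s : 'I_d -> 'I_d) (b v : V) : V :=
  \row_i (c * v ord0 (s i) + b ord0 i).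

Lemma measurable_rV_affine c s b : measurable_fun setT (rV_affine c s b).
Proof.
apply: measurable_fun_matrixP => i j; rewrite ord1.
under eq_fun do rewrite mxE.
by apply: measurable_funD => //; apply: measurable_funM => //; exact: measurable_coord.
Qed.

(** Both sides are measures that agree on boxes, a class that generates the sigma-algebra and is
    closed under intersections. *)
Lemma lebesgue_rV_affine c s b (A : set V) : 0 < c -> involutive s -> measurable A ->
  nu A = ((c ^+ d)%:E * nu (rV_affine c s b @^-1` A))%E.
Proof.
move=> c0 sK mA; pose cn : {nonneg R} := NngNum (exprn_ge0 d (ltW c0)).
pose push : {measure set V -> \bar R} :=
  measure_function_pushforward__canonical__measure_function_Measure nu
    (measurable_rV_affine c s b).
pose G : set (set V) := [set B | exists2 A, (forall i, measurable (A i)) & B = rV_box A].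
pose g (k : nat) := rV_box (fun=> `[- k%:R, k%:R]%classic).
have Gg k : G (g k) by exists (fun=> `[- k%:R, k%:R]%classic).
apply: (@g_sigma_algebra_measure_unique _ R V G _ g _ _ nu (mscale cn push)).
- by move=> _ [B mB ->]; exact: measurable_rV_box.
- by move=> k; exact: Gg.
- apply/seteqP; split => // v _; exists (Num.truncn `|v|).+1 => // i.
  rewrite /= in_itv/= -ler_norml; apply: (le_trans (rV_coord_le v i)).
  exact/ltW/truncnS_gt.
- move=> _ _ [B mB ->] [C mC ->]; exists (fun i => B i `&` C i).
    by move=> i; exact: measurableI.
  by apply/seteqP; split => v; [move=> [h1 h2] i; split|move=> h; split => i; have [] := h i].
- move=> _ [B mB ->].
  change (nu (rV_box B) = ((c ^+ d)%:E * nu (rV_affine c s b @^-1` rV_box B))%E).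
  rewrite (_ : _ @^-1` _ = rV_box (fun j =>
      (fun x => c * x + b ord0 (s j)) @^-1` B (s j))); last first.
    apply/seteqP; split => v h j.
      by have := h (s j); rewrite /= mxE sK.
    by have := h (s j); rewrite /= sK mxE.
  rewrite !lebesgue_rV_box//; last first.
    move=> j; rewrite -[X in measurable X]setTI.
    exact: (measurable_affine _ _ measurableT (mB _)).
  under eq_bigr => i _ do rewrite (lebesgue_measure_affine (b ord0 i) c0 (mB i)).
  rewrite big_split/= prodEFin prodr_const card_ord; congr (_ * _)%E.
  by rewrite (reindex_inj (can_inj sK)).
- move=> k.
  have E : nu (g k) = _ := lebesgue_rV_box (fun i : 'I_d => measurable_itv `[- k%:R, k%:R]).
  suff : (nu (g k) < +oo)%E by [].
  rewrite E lebesgue_measure_itv/= lte_fin.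
  by case: ifP => _; rewrite -?EFinD prodEFin ltry.
- suff -> : <<s G >> = measurable by [].
  apply/seteqP; split; first by apply: smallest_sub; [exact: sigma_algebra_measurable|
    move=> _ [B mB ->]; exact: measurable_rV_box].
  apply: smallest_sub; first exact: smallest_sigma_algebra.
  move=> _ [i [j [B mB ->]]]; apply: sub_sigma_algebra.
  exists (fun k => if k == j then B else setT); first by move=> k; case: ifP.
  apply/seteqP; split => v /=; rewrite ord1.
    by move=> h k; case: ifPn => // /eqP ->.
  by move=> /(_ j); rewrite eqxx.
Qed.

Lemma ge0_integral_rV_affine c s b (F : V -> \bar R) : 0 < c -> involutive s ->
  measurable_fun setT F -> (forall x, (0 <= F x)%E) ->
  (\int[nu]_x F x = (c ^+ d)%:E * \int[nu]_x F (rV_affine c s b x))%E.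
Proof.
move=> c0 sK mF F0; pose cn : {nonneg R} := NngNum (exprn_ge0 d (ltW c0)).
pose push : {measure set V -> \bar R} :=
  measure_function_pushforward__canonical__measure_function_Measure nu
    (measurable_rV_affine c s b).
transitivity (\int[mscale cn push]_x F x)%E.
  by apply: eq_measure_integral => A mA _; exact: lebesgue_rV_affine.
rewrite ge0_integral_mscale//; congr (_ * _)%E.
rewrite ge0_integral_pushforward//; exact: measurable_rV_affine.
Qed.

End lebesgue_rV_affine.

Section continuous_measurable_rV.
Context {R : realType} {d : nat}.
Local Notation V := 'rV[R]_d.

Definition dyadic_point (k : nat) (z : {ffun 'I_d -> int}) : V := \row_i ((z i)%:~R / 2 ^+ k).

Definition dyadic_round (k : nat) (v : V) : V :=
  \row_i ((Num.floor (2 ^+ k * v ord0 i))%:~R / 2 ^+ k).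

Lemma dyadic_round_cvg v : dyadic_round k v @[k --> \oo] --> v.
Proof.
apply/cvgrPdist_le => e e0; near=> k.
apply: rV_norm_le; first exact: ltW.
move=> i; rewrite !mxE.
have p0 : (0 : R) < 2 ^+ k by rewrite exprn_gt0.
have /andP[f1 f2] := floor_itv (2 ^+ k * v ord0 i).
apply: (@le_trans _ _ (2 ^- k)).
  rewrite ler_norml; apply/andP; split.
    rewrite lerBrDr -(ler_pM2l p0) mulrDr mulrN divff ?gt_eqF// mulrCA divff ?gt_eqF// mulr1.
      lra.
  rewrite lerBlDr -(ler_pM2l p0) mulrDr divff ?gt_eqF// mulrCA divff ?gt_eqF// mulr1.
  by move: f2; rewrite intrD addrC => /ltW.
near: k.
have := @cvg_geometric R 1 2^-1.
rewrite ger0_norm// invf_lt1// ltr1n => /(_ isT) /cvgrPdist_le /(_ _ e0).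
apply: filterS => k; rewrite /geometric/= mul1r sub0r normrN exprVn.
by apply: le_trans; exact: ler_norm.
Unshelve. all: by end_near. Qed.

(** The sigma-algebra of R^d is the one generated by the coordinates; a continuous function is
    the limit of its composites with dyadic rounding, which take constant values on cells. *)
Lemma continuous_measurable_rV (f : V -> R) : continuous f -> measurable_fun setT f.
Proof.
move=> cf; apply: (@measurable_fun_cvg _ _ _ _ (fun k v => f (dyadic_round k v))); last first.
  by move=> v _; apply: (@cvg_comp _ _ _ (fun k => dyadic_round k v) f _ _ _ (@dyadic_round_cvg v)); exact: cf.
move=> k _ B mB; rewrite setTI.
pose cell (z : {ffun 'I_d -> int}) := rV_box (fun i : 'I_d =>
  `[(z i)%:~R / 2 ^+ k : R, (z i + 1)%:~R / 2 ^+ k[%classic).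
have p0 : (0 : R) < 2 ^+ k by rewrite exprn_gt0.
rewrite (_ : _ @^-1` _ = \bigcup_(z : {ffun 'I_d -> int})
    (if asbool (B (f (dyadic_point k z))) then cell z else set0)).
  apply: countable_bigcupT_measurable; first exact: countableP.
  by move=> z; case: ifP => // _; apply: measurable_rV_box.
apply/seteqP; split => v.
  move=> Bv; pose z := [ffun i => Num.floor (2 ^+ k * v ord0 i)].
  exists z => //; have -> : dyadic_point k z = dyadic_round k v.
    by apply/rowP => i; rewrite !mxE ffunE.
  rewrite asboolT// => i; rewrite /= in_itv/= ffunE.
  by rewrite ler_pdivrMr// ltr_pdivlMr// !(mulrC (v _ _)) floor_itv.
move=> [z _]; case: asboolP => // Bz cv; rewrite /preimage/=.
suff -> : dyadic_round k v = dyadic_point k z by [].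
apply/rowP => i; rewrite !mxE; congr (_%:~R / _).
apply/eqP; rewrite floor_eq; have := cv i.
by rewrite /= !in_itv/= ler_pdivrMr// ltr_pdivlMr// !(mulrC (v _ _)).
Qed.

End continuous_measurable_rV.

(** * Kernels on bands of scales *)
Section kernels.
Context {R : realType} {d : nat}.
Local Notation V := 'rV[R]_d.
Local Notation Z := ('rV[R]_d * R)%type.
Local Notation ZL := ('rV[R]_d * measurableTypeR R)%type.
Local Notation RL := (measurableTypeR R).
Local Notation mu := (@lebesgue_measure R).
Local Notation nu := (@lebesgue_rV R d).
Variable (K : V -> R).
Hypothesis cK : continuous K.

(** The part of the field at [x] that comes from the scales in [I]. *)
Definition band_kernel (I : interval R) (x : V) (z : Z) : R :=
  if z.2 \in I then K (z.2^-1 *: (z.1 - x)) * z.2 `^ (- (d.+1%:R / 2)) else 0.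

(** The integral over space at scale 1; scaling reduces every scale to it. *)
Definition overlap (J : finType) (a : J -> R) (p : J -> V) : \bar R :=
  (\int[nu]_u ((\sum_j a j * K (u - p j)) ^+ 2)%:E)%E.

Lemma measurable_K : measurable_fun setT K.
Proof. exact: continuous_measurable_rV. Qed.

Lemma measurable_shiftK (p : V) : measurable_fun setT (fun u : V => K (u - p)).
Proof.
have -> : (fun u : V => K (u - p)) = K \o rV_affine 1 id (- p).
  by apply/funext => u /=; congr K; apply/rowP => i; rewrite !mxE mul1r.
by apply: (measurableT_comp measurable_K); exact: measurable_rV_affine.
Qed.

Lemma measurable_sum_shiftK (J : finType) (a : J -> R) (p : J -> V) :
  measurable_fun setT (fun u : V => \sum_j a j * K (u - p j)).
Proof.
apply: measurable_sum => j; apply: measurable_funM => //.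
exact: measurable_shiftK.
Qed.

Lemma measurable_overlap_density (J : finType) (a : J -> R) (p : J -> V) :
  measurable_fun setT (fun u : V => ((\sum_j a j * K (u - p j)) ^+ 2)%:E).
Proof.
by apply/measurable_EFinP; apply: measurable_funX; exact: measurable_sum_shiftK.
Qed.

Lemma overlap_ge0 (J : finType) (a : J -> R) (p : J -> V) : (0 <= overlap a p)%E.
Proof. by apply: integral_ge0 => u _; rewrite lee_fin sqr_ge0. Qed.

Lemma overlap_shift (J : finType) (a : J -> R) (p : J -> V) b :
  overlap a (fun j => p j + b) = overlap a p.
Proof.
rewrite /overlap (ge0_integral_rV_affine b ltr01 (s := id))//; last 2 first.
- exact: measurable_overlap_density.
- by move=> x; rewrite lee_fin sqr_ge0.
rewrite expr1n mul1e; apply: eq_integral => u _; congr (_ ^+ 2)%:E.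
apply: eq_bigr => j _; congr (_ * K _); apply/rowP => i; rewrite !mxE mul1r; ring.
Qed.

Definition swap_coords (s : 'I_d -> 'I_d) (v : V) : V := \row_i v ord0 (s i).

Lemma overlap_swap (J : finType) (a : J -> R) (p : J -> V) s : involutive s ->
  (forall v, K (swap_coords s v) = K v) ->
  overlap a (fun j => swap_coords s (p j)) = overlap a p.
Proof.
move=> sK Ks; rewrite /overlap (ge0_integral_rV_affine 0 ltr01 sK)//; last 2 first.
- exact: measurable_overlap_density.
- by move=> x; rewrite lee_fin sqr_ge0.
rewrite expr1n mul1e; apply: eq_integral => u _; congr (_ ^+ 2)%:E.
apply: eq_bigr => j _; congr (_ * _); rewrite -[RHS]Ks; congr K.
by apply/rowP => i; rewrite !mxE mul1r addr0.
Qed.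

(* Writing the inverse as a real power makes measurability in the scale evident. *)
Let band_ext (I : interval R) (x : V) (z : Z) : R :=
  K (z.2 `^ (-1) *: (z.1 - x)) * z.2 `^ (- (d.+1%:R / 2)) * \1_[set` I] z.2.

Let band_extE I x : (forall t, t \in I -> 0 < t) -> band_kernel I x = band_ext I x.
Proof.
move=> I0; apply/funext => z; rewrite /band_kernel /band_ext indicE mem_setE.
case: ifPn => zI; last by rewrite mulr0.
by rewrite mulr1 powR_inv1// ltW// I0.
Qed.

Lemma measurable_band_kernel I x : (forall t, t \in I -> 0 < t) ->
  measurable_fun setT (band_kernel I x).
Proof.
move=> I0; rewrite band_extE//.
have pw (p : R) : measurable_fun setT (fun z : Z => z.2 `^ p).
  exact: (measurableT_comp (measurable_powR p) measurable_snd).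
apply: measurable_funM.
  apply: measurable_funM => //; apply: (measurableT_comp measurable_K).
  apply: measurable_fun_matrixP => i j; under eq_fun do rewrite !mxE.
  apply: measurable_funM => //; apply: measurable_funD => //.
  exact: (measurableT_comp (@measurable_coord _ R 1 d i j) measurable_fst).
exact: (measurableT_comp (measurable_indic (measurable_itv I)) measurable_snd).
Qed.

(** The contribution of the scale [t] to the variance. The factors [t^d] from the change of
    variables and [t^-(d+1)] from the kernel leave [1 / t]: this is what makes the field
    logarithmic. *)
Definition band_density (J : finType) (I : interval R) (a : J -> R) (x : J -> V) (t : R) : \bar R :=
  if t \in I then ((t^-1)%:E * overlap a (fun j => t^-1 *: x j))%E else 0%E.

Let G (J : finType) I (a : J -> R) (x : J -> V) (z : ZL) : \bar R :=
  ((combine (fun j => band_kernel I (x j)) a z) ^+ 2)%:E.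

Let G0 (J : finType) I (a : J -> R) (x : J -> V) z : (0 <= G I a x z)%E.
Proof. by rewrite lee_fin sqr_ge0. Qed.

Let mG (J : finType) I (a : J -> R) (x : J -> V) : (forall t, t \in I -> 0 < t) ->
  measurable_fun (setT : set ZL) (G I a x).
Proof.
move=> I0; have : measurable_fun (setT : set Z) (G I a x); last by [].
apply/measurable_EFinP; apply: measurable_funX; apply: measurable_sum => j.
by apply: measurable_funM => //; exact: measurable_band_kernel.
Qed.

Let G_density (J : finType) I (a : J -> R) (x : J -> V) (t : R) :
  (forall t, t \in I -> 0 < t) -> fubini_G nu (G I a x) t = band_density I a x t.
Proof.
move=> I0; rewrite /fubini_G /G /band_density /combine /band_kernel/=.
case: ifPn => tI; last first.
  rewrite (eq_integral (fun=> 0%E)) ?integral0// => y _.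
  by rewrite big1 ?expr0n// => j _; rewrite mulr0.
have t0 := I0 _ tI.
rewrite (ge0_integral_rV_affine 0 t0 (s := id))//; last 2 first.
- apply/measurable_EFinP; apply: measurable_funX; apply: measurable_sum => j.
  apply: measurable_funM => //; apply: measurable_funM => //.
  have -> : (fun y : V => K (t^-1 *: (y - x j))) = K \o rV_affine t^-1 id (- (t^-1 *: x j)).
    by apply/funext => y /=; congr K; apply/rowP => i; rewrite !mxE mulrBr.
  by apply: (measurableT_comp measurable_K); exact: measurable_rV_affine.
- by move=> y; rewrite lee_fin sqr_ge0.
have e0 : (0 <= (t^-1 / t ^+ d)%:E)%E by rewrite lee_fin mulr_ge0// invr_ge0 ?exprn_ge0// ltW.
rewrite (eq_integral (fun u : V => (t^-1 / t ^+ d)%:E *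
    ((\sum_j a j * K (u - t^-1 *: x j)) ^+ 2)%:E)%E); last first.
  move=> u _; rewrite -EFinM; congr EFin.
  have -> : t^-1 / t ^+ d = (t `^ (- (d.+1%:R / 2))) ^+ 2.
    rewrite -[in RHS]powR_mulrn ?powR_ge0// -powRrM mulNr divfK ?pnatr_eq0// powRN.
    by rewrite powR_mulrn ?ltW// exprS invfM.
  rewrite -exprMn; congr (_ ^+ 2); rewrite mulr_sumr; apply: eq_bigr => j _.
  have -> : K (t^-1 *: (rV_affine t id 0 u - x j)) = K (u - t^-1 *: x j).
    by congr K; apply/rowP => i; rewrite !mxE addr0 mulrBr mulrA mulVf ?gt_eqF// mul1r.
  by rewrite mulrA mulrC mulrA.
rewrite (ge0_integralZl nu measurableT (measurable_overlap_density _ _)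
  _ e0); last by move=> u _; rewrite lee_fin sqr_ge0.
rewrite muleA -EFinM; congr (_%:E * _)%E.
by rewrite mulrCA divff ?mulr1// gt_eqF// exprn_gt0.
Qed.


Lemma measurable_band_density (J : finType) I (a : J -> R) (x : J -> V) :
  (forall t, t \in I -> 0 < t) ->
  measurable_fun (setT : set RL) (band_density I a x).
Proof.
move=> I0; have -> : band_density I a x = fubini_G nu (G I a x).
  by apply/funext => t; rewrite G_density.
exact: (measurable_fun_fubini_tonelli_G (G I a x) (mG a x I0) (G0 I a x)).
Qed.

Lemma band_density_ge0 (J : finType) I (a : J -> R) (x : J -> V) t :
  (forall t, t \in I -> 0 < t) -> (0 <= band_density I a x t)%E.
Proof.
move=> I0; rewrite /band_density; case: ifPn => // /I0 t0.
by rewrite mule_ge0 ?overlap_ge0// lee_fin invr_ge0 ltW.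
Qed.

(** Fubini, integrating over space first. *)
Lemma sqr_integral_band (J : finType) (a : J -> R) (x : J -> V) I :
  (forall t, t \in I -> 0 < t) ->
  sqr_integral (combine (fun j => band_kernel I (x j)) a) =
  (\int[mu]_t band_density I a x t)%E.
Proof.
move=> I0; transitivity (\int[nu \x mu]_z G I a x z)%E.
  rewrite /sqr_integral integral_mkcond; apply: eq_integral => z _.
  rewrite patchE; case: ifPn => // zs.
  rewrite /G /combine big1 ?expr0n// => j _; rewrite /band_kernel ifF ?mulr0//.
  by apply/negP => /I0 z0; move/negP: zs; apply; rewrite inE.
rewrite (fubini_tonelli2 (m1 := nu) (m2 := mu) (G I a x) (mG a x I0) (G0 I a x)).
by apply: eq_integral => t _; exact: G_density.
Qed.

(** The measure [dt / t] is invariant under scaling, and Lebesgue measure under translations. *)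
Lemma sqr_integral_band_scale (J : finType) (a : J -> R) (x : J -> V) I I' (c : R) (b : V) :
  0 < c -> (forall t, t \in I -> 0 < t) -> (forall t, (c * t \in I') = (t \in I)) ->
  sqr_integral (combine (fun j => band_kernel I' (c *: x j + b)) a) =
  sqr_integral (combine (fun j => band_kernel I (x j)) a).
Proof.
move=> c0 I0 II'; have I'0 t : t \in I' -> 0 < t.
  have -> : t = c * (t / c) by rewrite mulrC divfK// gt_eqF.
  by rewrite II' => /I0 h; rewrite mulr_gt0.
rewrite (sqr_integral_band _ _ I0) (sqr_integral_band _ _ I'0).
rewrite (ge0_integral_affine 0 c0 (measurable_band_density a (fun j => c *: x j + b) I'0)
  (fun t => band_density_ge0 a _ t I'0)).
rewrite -(ge0_integralZl mu measurableT); last 3 first.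
- have : measurable_fun (setT : set R) (band_density I' a (fun j => c *: x j + b) \o
     (fun t => c * t + 0)); last by [].
  apply: (measurableT_comp (measurable_band_density a _ I'0)).
  exact: measurable_affine.
- by move=> t _; exact: band_density_ge0.
- exact: ltW.
apply: eq_integral => t _; rewrite addr0 /band_density II'; case: ifPn => [tI|_]; last by rewrite mule0.
have t0 := I0 _ tI; rewrite muleA -EFinM invfM mulrA divff ?gt_eqF// mul1r; congr (_ * _)%E.
rewrite -[RHS](overlap_shift _ _ (t^-1 / c *: b)); congr overlap; apply/funext => j.
by rewrite scalerDr scalerA mulrAC mulVf ?gt_eqF// mul1r (mulrC t^-1).
Qed.

Lemma sqr_integral_band_swap (J : finType) (a : J -> R) (x : J -> V) I s :
  (forall t, t \in I -> 0 < t) -> involutive s ->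
  (forall v, K (swap_coords s v) = K v) ->
  sqr_integral (combine (fun j => band_kernel I (swap_coords s (x j))) a) =
  sqr_integral (combine (fun j => band_kernel I (x j)) a).
Proof.
move=> I0 sK Ks; rewrite (sqr_integral_band _ _ I0) (sqr_integral_band _ _ I0).
apply: eq_integral => t _.
rewrite /band_density; case: ifP => _; last by [].
congr (_ * _)%E.
rewrite -[RHS](overlap_swap _ _ sK Ks); congr overlap; apply/funext => j.
by apply/rowP => i; rewrite !mxE.
Qed.

(** The two bands differ by a single scale, and the measure of scales has no atoms. *)
Lemma sqr_integral_band_bndr (J : finType) (a : J -> R) (x : J -> V) (b c : R) : 0 < b ->
  sqr_integral (combine (fun j => band_kernel `[b, c[ (x j)) a) =
  sqr_integral (combine (fun j => band_kernel `[b, c] (x j)) a).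
Proof.
move=> b0.
have I0 t : t \in `[b, c[ -> 0 < t by rewrite in_itv/= => /andP[h _]; exact: lt_le_trans h.
have I1 t : t \in `[b, c] -> 0 < t by rewrite in_itv/= => /andP[h _]; exact: lt_le_trans h.
rewrite (sqr_integral_band _ _ I0) (sqr_integral_band _ _ I1).
have E (i : interval R) : (forall t, t \in i -> t \in `[b, c]) ->
  (\int[mu]_t band_density i a x t = \int[mu]_(t in [set` i]) band_density `[b, c] a x t)%E.
  move=> ii; rewrite [RHS]integral_mkcond; apply: eq_integral => t _.
  rewrite patchE mem_setE /band_density; case: ifPn => // /ii -> //.
rewrite (E `[b, c[) ?(E `[b, c])//; last first.
  by move=> t; rewrite !in_itv/= => /andP[-> /ltW].
apply: integral_itv_bndo_bndc.
have : measurable_fun (setT : set R) (band_density `[b, c] a x) by exact: measurable_band_density.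
by apply: measurable_funS.
Qed.

End kernels.

(** * Estimates on kernels *)
Section inverse_powers.
Context {R : realType}.
Local Notation mu := (@lebesgue_measure R).

Let antiderivative (f F : R -> R) (b c : R) : 0 < b -> b < c ->
  (forall x : R, 0 < x -> {for x, continuous f}) ->
  (forall x : R, 0 < x -> is_derive x (1 : R) F (f x)) ->
  (\int[mu]_(t in `[b, c]) (f t)%:E)%E = (F c - F b)%:E.
Proof.
move=> b0 bc cf dF; have c0 := lt_trans b0 bc.
have cF x : 0 < x -> {for x, continuous F}.
  move=> /dF [d1 _]; apply: differentiable_continuous; exact/derivable1_diffP.
rewrite (continuous_FTC2 (F := F) bc) ?EFinB//.
- apply: continuous_in_subspaceT => x; rewrite inE/= in_itv/= => /andP[bx _].
  by apply: cf; exact: lt_le_trans bx.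
- split.
  + move=> x; rewrite in_itv/= => /andP[bx _]; have [] := dF x (lt_trans b0 bx); done.
  + by apply: cvg_at_right_filter; exact: cF.
  + by apply: cvg_at_left_filter; exact: cF.
- move=> x; rewrite in_itv/= => /andP[bx _].
  by rewrite derive1E; apply: derive_val; exact: dF (lt_trans b0 bx).
Qed.

Lemma integral_inv (b c : R) : 0 < b -> b < c ->
  (\int[mu]_(t in `[b, c]) (t^-1)%:E)%E = (ln c - ln b)%:E.
Proof.
move=> b0 bc; rewrite (antiderivative (F := @ln R) b0 bc)//.
  by move=> x x0; apply: inv_continuous; rewrite gt_eqF.
Qed.

Lemma integral_inv3 (b c : R) : 0 < b -> b < c ->
  (\int[mu]_(t in `[b, c]) (t^-1 ^+ 3)%:E)%E = ((b^-1 ^+ 2 - c^-1 ^+ 2) / 2)%:E.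
Proof.
move=> b0 bc; pose F (t : R) : R := - (t^-1 ^+ 2 / 2).
have E : F = (- 2^-1) *: ((fun y : R => y^-1) ^+ 2).
  by apply/funext => t; rewrite /F -mulrN mulrC.
have cf (x : R) : 0 < x -> {for x, continuous (fun t : R => t^-1 ^+ 3)}.
  move=> x0; have cV : {for x, continuous (fun t : R => t^-1)}.
    by apply: inv_continuous; rewrite gt_eqF.
  exact: (continuousM cV (continuousM cV cV)).
have dF (x : R) : 0 < x -> is_derive x (1 : R) F (x^-1 ^+ 3).
  move=> x0; rewrite E.
  have x1 : is_derive x (1 : R) (fun y : R => y^-1) (- x ^- 2 *: 1).
    by apply: is_deriveV; rewrite gt_eqF.
  apply: (is_derive_eq (is_deriveZ (- 2^-1) (is_deriveX 2 x1))).
  by rewrite /GRing.scale/=; field; rewrite gt_eqF.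
rewrite (antiderivative b0 bc cf dF) /F; congr EFin; lra.
Qed.

End inverse_powers.

Section lipschitz.
Context {R : realType} {d : nat}.
Local Notation V := 'rV[R]_d.
Variables (K : V -> R) (r0 : R).
Hypotheses (K_smooth : smooth K)
  (K_supp : forall x : V, ~ ball (0 : V) r0 x -> K x = 0).

Lemma smooth_continuous : continuous K.
Proof. by have [] := K_smooth [::]. Qed.

Let partial (j : 'I_d) : V -> R := 'D_(delta_mx ord0 j) K.

Let continuous_partial j : continuous (partial j).
Proof. by have [] := K_smooth [:: j]. Qed.

Let derivable_partial x j : derivable K x (delta_mx ord0 j).
Proof. by have [_ h] := K_smooth [::]; exact: h. Qed.

Let box (r : R) : set V := [set v | forall i, `[- r, r]%classic (v ord0 i)].

Let compact_box r : compact (box r).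
Proof. exact: (rV_compact (fun=> @segment_compact R _ _)). Qed.

Let partial_out j x : ~ box `|r0| x -> partial j x = 0.
Proof.
move=> xb; rewrite /partial.
have cb : closed (box `|r0|).
  by apply: compact_closed; [exact: norm_hausdorff|exact: compact_box].
rewrite (@near_eq_derive _ _ _ _ (cst 0 : V -> R)) ?derive_cst//.
have : nbhs x (~` box `|r0|) by apply: open_nbhs_nbhs; split => //; exact: closed_openC.
apply: filterS => y yb; apply: K_supp => /= yr; apply: yb => i.
rewrite /= in_itv/= -ler_norml; move: yr; rewrite -ball_normE/= sub0r normrN => yr.
apply: (le_trans (rV_coord_le y i)); apply: (le_trans (ltW yr)); exact: ler_norm.
Qed.

(** A partial derivative is continuous and vanishes off a compact box. *)
Let partial_bounded : exists2 M, 0 <= M & forall j x, `|partial j x| <= M.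
Proof.
have bj j : exists2 M, 0 <= M & forall x, `|partial j x| <= M.
  have [c _ cm] : exists2 c, c \in box `|r0| & forall t, t \in box `|r0| -> `|partial j t| <= `|partial j c|.
    apply: (@EVT_max_rV R d (fun v => `|partial j v|)).
    - by exists 0 => i; rewrite /= in_itv/= mxE oppr_le0 normr_ge0.
    - exact: compact_box.
    - apply: continuous_subspaceT => x; apply: (@continuous_comp _ _ _ (partial j) (fun u => `|u|)).
        exact: continuous_partial.
      exact: norm_continuous.
  exists `|partial j c| => // x.
  have [xb|xb] := pselect (box `|r0| x); first by apply: cm; rewrite inE.
  by rewrite partial_out// normr0.
have [M hM] := choice (fun j => let: ex_intro2 m m0 h := bj j in ex_intro (fun m => 0 <= m /\ forall x, `|partial j x| <= m) m (conj m0 h)).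
exists (\sum_j M j); first by apply: sumr_ge0 => j _; have [] := hM j.
move=> j x; have [m0 h] := hM j; apply: (le_trans (h x)).
by rewrite (bigD1 j)//= lerDl; apply: sumr_ge0 => i _; have [] := hM i.
Qed.

Let lipschitz_coord M : (forall j x, `|partial j x| <= M) ->
  forall j x (t : R), `|K (x + t *: delta_mx ord0 j) - K x| <= M * `|t|.
Proof.
move=> hM j x.
pose g (t : R) := K (x + t *: delta_mx ord0 j).
have dg (t : R) : is_derive t (1 : R) g (partial j (x + t *: delta_mx ord0 j)).
  have E : (fun h : R => h^-1 *: ((g \o shift t) (h *: (1 : R)) - g t)) =
    (fun h : R => h^-1 *: ((K \o shift (x + t *: delta_mx ord0 j)) (h *: delta_mx ord0 j)
       - K (x + t *: delta_mx ord0 j))).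
    apply/funext => h; rewrite /g /=; congr (_ *: (K _ - _)).
    by rewrite [h *: 1]mulr1 scalerDl addrCA.
  split; first by rewrite /derivable E; exact: derivable_partial.
  by rewrite /partial /derive E.
have cg : continuous g.
  by move=> t; apply: differentiable_continuous; apply/derivable1_diffP; have [] := dg t.
have main (a b : R) : a <= b -> `|g b - g a| <= M * (b - a).
  move=> ab; have [c _ ->] := MVT_segment ab (fun x _ => dg x)
    (continuous_subspaceT cg).
  by rewrite normrM (ger0_norm (x := b - a)) ?subr_ge0// ler_wpM2r ?subr_ge0.
move=> t; have -> : K x = g 0 by rewrite /g scale0r addr0.
rewrite -/(g t).
have [t0|t0] := leP 0 t; first by rewrite (ger0_norm t0); have := main _ _ t0; rewrite subr0.
by rewrite distrC (ltr0_norm t0); have := main _ _ (ltW t0); rewrite sub0r.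
Qed.

Lemma smooth_lipschitz : exists2 L, 0 <= L & forall x y : V, `|K x - K y| <= L * `|x - y|.
Proof.
have [M M0 hM] := partial_bounded.
exists (d%:R * M); first by rewrite mulr_ge0.
(* The coordinates of [y] are replaced one at a time by those of [x]. *)
move=> x y; pose p (k : nat) : V := \row_i (if (i < k)%N then x ord0 i else y ord0 i).
have -> : K x - K y = \sum_(0 <= k < d) (K (p k.+1) - K (p k)).
  rewrite telescope_sumr//; congr (K _ - K _); apply/rowP => i; rewrite mxE//.
  by rewrite ltn_ord.
rewrite big_mkord; apply: (le_trans (ler_norm_sum _ _ _)).
rewrite -mulrA -[X in _ <= X * _](_ : \sum_(k < d) 1 = _); last first.
  by rewrite sumr_const card_ord.
rewrite mulr_suml; apply: ler_sum => k _; rewrite mul1r.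
have -> : p k.+1 = p k + (x ord0 k - y ord0 k) *: delta_mx ord0 k.
  apply/rowP => i; rewrite !mxE eqxx/= ltnS leq_eqVlt -(inj_eq val_inj).
  have [/val_inj ->|ik] /= := eqVneq (val i) (val k); last by rewrite mulr0 addr0.
  by rewrite ltnn mulr1 subrKC.
apply: (le_trans (lipschitz_coord hM _ _ _)); rewrite ler_wpM2l//.
by have := rV_coord_le (x - y) k; rewrite !mxE.
Qed.

End lipschitz.

Section kernel_estimates.
Context {R : realType} {d : nat}.
Local Notation V := 'rV[R]_d.
Local Notation Z := ('rV[R]_d * R)%type.
Local Notation RL := (measurableTypeR R).
Local Notation mu := (@lebesgue_measure R).
Local Notation nu := (@lebesgue_rV R d).
Variables (K : V -> R) (r0 : R).
Hypotheses (r0_gt0 : 0 < r0) (K_smooth : smooth K)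
  (K_supp : forall x : V, ~ ball (0 : V) r0 x -> K x = 0)
  (K_norm : (\int[nu]_x (K x ^+ 2)%:E = 1)%E).

Let cK : continuous K := smooth_continuous K_smooth.

Lemma combine_delta (J : finType) (f : J -> Z -> R) i :
  combine f (fun j => (j == i)%:R) = f i.
Proof.
apply/funext => z; rewrite /combine (bigD1 i)//= eqxx mul1r big1 ?addr0// => j /negbTE ->.
by rewrite mul0r.
Qed.

Let pos_itv (b c : R) : 0 < b -> forall t, t \in `[b, c] -> 0 < t.
Proof. by move=> b0 t; rewrite in_itv/= => /andP[h _]; exact: lt_le_trans h. Qed.

Let pos_itvo (b c : R) : 0 < b -> forall t, t \in `[b, c[ -> 0 < t.
Proof. by move=> b0 t; rewrite in_itv/= => /andP[h _]; exact: lt_le_trans h. Qed.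

Let sqr_integral_single (b c : R) x : 0 < b -> b < c ->
  sqr_integral (band_kernel K `[b, c] x) = (ln c - ln b)%:E.
Proof.
move=> b0 bc.
have -> : band_kernel K `[b, c] x =
    combine (fun _ : unit => band_kernel K `[b, c] x) (fun j => (j == tt)%:R).
  by rewrite combine_delta.
rewrite (sqr_integral_band cK _ _ (pos_itv b0)) -(integral_inv b0 bc) [RHS]integral_mkcond.
apply: eq_integral => t _; rewrite patchE mem_setE /band_density.
case: ifP => _; last by [].
rewrite -[RHS]mule1; congr (_ * _)%E.
rewrite -K_norm -(overlap_shift cK _ _ (- (t^-1 *: x))) /overlap.
apply: eq_integral => u _; rewrite (bigD1 tt)//= big1 ?addr0; last by case.
by rewrite mul1r subrr subr0.
Qed.

Let band_bndr (b c : R) x : 0 < b ->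
  sqr_integral (band_kernel K `[b, c[ x) = sqr_integral (band_kernel K `[b, c] x).
Proof.
move=> b0; have := @sqr_integral_band_bndr R d K cK unit (fun j => (j == tt)%:R) (fun=> x) b c b0.
by rewrite !(combine_delta _ tt).
Qed.

(** A single point has overlap 1 at every scale, and the integral of [1 / t] remains. *)
Lemma l2norm2_band (b c : R) x : 0 < b -> b < c ->
  l2norm2 (band_kernel K `[b, c] x) = ln c - ln b.
Proof. by move=> b0 bc; rewrite /l2norm2 sqr_integral_single. Qed.

Lemma L2_band (b c : R) x : 0 < b -> b < c -> L2_spacetime (band_kernel K `[b, c] x).
Proof.
move=> b0 bc; split; last by rewrite sqr_integral_single// ltry.
exact: measurable_funS (measurable_band_kernel cK x (pos_itv b0)).
Qed.

Lemma L2_bando (b c : R) x : 0 < b -> b < c -> L2_spacetime (band_kernel K `[b, c[ x).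
Proof.
move=> b0 bc; split; last by rewrite band_bndr// sqr_integral_single// ltry.
exact: measurable_funS (measurable_band_kernel cK x (pos_itvo b0)).
Qed.

Let supp_box (p : V) : set V := rV_box (fun i => `]p ord0 i - r0, p ord0 i + r0[%classic).

Let nu_supp_box p : nu (supp_box p) = ((2 * r0) ^+ d)%:E.
Proof.
have E : nu (supp_box p) = _ :=
  lebesgue_rV_box (fun i : 'I_d => measurable_itv `]p ord0 i - r0, p ord0 i + r0[).
rewrite E (eq_bigr (fun=> (2 * r0)%:E)); last first.
  move=> i _; rewrite lebesgue_measure_itv/= lte_fin.
  rewrite ifT; last by rewrite ltrD2l; apply: (lt_trans _ r0_gt0); rewrite oppr_lt0.
  by rewrite -EFinB; congr EFin; lra.
by rewrite prodEFin prodr_const card_ord.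
Qed.

Let K_out (u p : V) : ~ supp_box p u -> K (u - p) = 0.
Proof.
move=> h; apply: K_supp => hb; apply: h => i.
move: hb; rewrite -ball_normE/= sub0r normrN => hb.
have := le_lt_trans (rV_coord_le (u - p) i) hb.
by rewrite !mxE ltr_norml /= in_itv/= => /andP[h1 h2]; apply/andP; split; lra.
Qed.

Let sgn2 (b : bool) : R := if b then 1 else -1.

Let overlap_diff_le L : (forall x y : V, `|K x - K y| <= L * `|x - y|) ->
  forall p : bool -> V,
  (overlap K sgn2 p <= ((L * `|p true - p false|) ^+ 2 * (2 * (2 * r0) ^+ d))%:E)%E.
Proof.
move=> hL p; set c := L * _.
have mb b : measurable (supp_box (p b)) by exact: measurable_rV_box.
have mI b : measurable_fun setT (fun u : V => (\1_(supp_box (p b)) u)%:E : \bar R).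
  by apply/measurable_EFinP; exact: measurable_indic.
apply: (@le_trans _ _ (\int[nu]_u ((c ^+ 2)%:E * ((\1_(supp_box (p true)) u)%:E + (\1_(supp_box (p false)) u)%:E)))%E).
  apply: ge0_le_integral => //.
  - by move=> u _; rewrite lee_fin sqr_ge0.
  - exact: measurable_overlap_density.
  - by apply: emeasurable_funM => //; apply: emeasurable_funD.
  move=> u _; rewrite -EFinD -EFinM lee_fin big_bool/= mul1r mulN1r.
  set k := _ ^+ 2; have kc : k <= c ^+ 2.
    have : `|K (u - p true) - K (u - p false)| <= c.
      apply: (le_trans (hL _ _)); rewrite /c (_ : _ - _ = p false - p true) ?(distrC (p true))//.
      by apply/rowP => i; rewrite !mxE; ring.
    by rewrite /k ler_norml => /andP[h1 h2]; nra.
  rewrite !indicE; have c2 := sqr_ge0 c.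
  have [t1|t1] := pselect (supp_box (p true) u).
    rewrite (mem_set t1) mulrDr mulr1; apply: (le_trans kc).
    by rewrite lerDl mulr_ge0.
  have [t2|t2] := pselect (supp_box (p false) u); last first.
    by rewrite /k (K_out t1) (K_out t2) subrr expr0n mulr_ge0// addr_ge0.
  by rewrite (mem_set t2) memNset// add0r mulr1.
rewrite ge0_integralZl//; last 3 first.
- by apply: emeasurable_funD.
- by move=> u _; rewrite -EFinD lee_fin addr_ge0.
- by rewrite lee_fin sqr_ge0.
rewrite ge0_integralD//; try (by move=> u _; rewrite lee_fin).
have nb b : (\int[nu]_x (\1_(supp_box (p b)) x)%:E = ((2 * r0) ^+ d)%:E)%E.
  by rewrite integral_indic// setIT; exact: nu_supp_box.
rewrite !nb -EFinD -EFinM lee_fin.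
by set q := _ ^+ d; rewrite le_eqVlt; apply/orP; left; apply/eqP; ring.
Qed.

(** At scale [t] the two kernels are translates by [(x - y) / t], so that the Lipschitz bound
    gives a density of order [|x - y|^2 / t^3]; its integral is dominated by the smallest
    scale. *)
Lemma l2norm2_band_diff : exists2 C : R, 0 <= C & forall (b c : R) (x y : V),
  0 < b -> b < c ->
  l2norm2 (fun z => band_kernel K `[b, c] x z - band_kernel K `[b, c] y z) <=
  C * `|x - y| ^+ 2 / b ^+ 2.
Proof.
have [L L0 hL] := smooth_lipschitz K_smooth K_supp.
pose D := L ^+ 2 * (2 * (2 * r0) ^+ d).
have D0 : 0 <= D by rewrite mulr_ge0 ?sqr_ge0// mulr_ge0// exprn_ge0// mulr_ge0// ltW.
exists D => // b c x y b0 bc.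
pose p (k : bool) := if k then x else y.
have -> : (fun z => band_kernel K `[b, c] x z - band_kernel K `[b, c] y z) =
    combine (fun k => band_kernel K `[b, c] (p k)) sgn2.
  by apply/funext => z; rewrite /combine big_bool/= mul1r mulN1r.
have c0 := lt_trans b0 bc.
set e := `|x - y|.
suff : (sqr_integral (combine (fun k => band_kernel K `[b, c] (p k)) sgn2) <=
    (D * e ^+ 2 / b ^+ 2)%:E)%E.
  rewrite /l2norm2; case: (sqr_integral _) (sqr_integral_ge0 (combine (fun k => band_kernel K `[b, c] (p k)) sgn2)) => //= [r|] _ //.
rewrite (sqr_integral_band cK _ _ (pos_itv b0)).
have m3 : measurable_fun (`[b, c]%classic : set RL) (fun t : RL => ((t : R)^-1 ^+ 3)%:E).
  have : measurable_fun (`[b, c]%classic : set R) (fun t : R => (t^-1 ^+ 3)%:E); last by [].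
  apply/measurable_EFinP; apply: measurable_funX.
  apply: (@eq_measurable_fun _ _ _ _ _ (@powR R ^~ (-1))).
    by move=> t; rewrite mem_setE => /(pos_itv b0) t0; rewrite powR_inv1// ltW.
  exact: measurable_funS (@measurable_powR R (-1)).
rewrite [leLHS](_ : _ = \int[mu]_(t in `[b, c]) band_density K `[b, c] sgn2 p t)%E; last first.
  rewrite [RHS]integral_mkcond; apply: eq_integral => t _; rewrite patchE mem_setE /band_density.
  by case: ifP.
apply: (@le_trans _ _ (\int[mu]_(t in `[b, c]) ((D * e ^+ 2)%:E * (t^-1 ^+ 3)%:E))%E).
  apply: ge0_le_integral.
  - exact: measurable_itv.
  - by move=> t _; exact: band_density_ge0 (pos_itv b0).
  - exact: measurable_funS (measurable_band_density cK _ _ (pos_itv b0)).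
  - exact: (emeasurable_funM (measurable_cst _) m3).
  - move=> t /= tbc; rewrite /band_density tbc.
    have t0 := pos_itv b0 tbc; have it0 : 0 <= t^-1 by rewrite invr_ge0 ltW.
    apply: (le_trans (lee_wpmul2l _ (overlap_diff_le hL _))); first by rewrite lee_fin.
    rewrite -!EFinM lee_fin/= -scalerBr normrZ (ger0_norm it0) -/e /D.
    by rewrite le_eqVlt; apply/orP; left; apply/eqP; ring.
rewrite (ge0_integralZl mu (measurable_itv _) m3); last 2 first.
- by move=> t /(pos_itv b0) t0; rewrite lee_fin exprn_ge0// invr_ge0 ltW.
- by rewrite lee_fin mulr_ge0 ?sqr_ge0.
have De0 : 0 <= D * e ^+ 2 by rewrite mulr_ge0// sqr_ge0.
rewrite (integral_inv3 b0 bc) -EFinM lee_fin; apply: ler_wpM2l; first exact: De0.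
have := sqr_ge0 c^-1; have : 0 <= b^-1 ^+ 2 by exact: sqr_ge0.
rewrite exprVn; lra.
Qed.

(** At every scale below [c] the two supports lie in boxes of radius less than [r0 * c] around
    [x] and [y]. *)
Lemma band_disjoint (b c : R) (x y : V) (i : 'I_d) : 0 < b ->
  2 * r0 * c <= `|x ord0 i - y ord0 i| ->
  forall z : Z, band_kernel K `[b, c[ x z * band_kernel K `[b, c[ y z = 0.
Proof.
move=> b0 far z; rewrite /band_kernel; case: ifPn => [tI|_]; last by rewrite mul0r.
have t0 := pos_itvo b0 tI; move: tI; rewrite in_itv/= => /andP[_ tc].
have [h1|h1] := pselect (ball (0 : V) r0 (z.2^-1 *: (z.1 - x))); last by rewrite K_supp// !mul0r.
have [h2|h2] := pselect (ball (0 : V) r0 (z.2^-1 *: (z.1 - y))); last first.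
  by rewrite [X in _ * (X * _)]K_supp// mul0r mulr0.
exfalso; move: h1 h2; rewrite -ball_normE/= !sub0r !normrN => h1 h2.
have {h1} := le_lt_trans (rV_coord_le _ i) h1; have {h2} := le_lt_trans (rV_coord_le _ i) h2.
have it0 : 0 < z.2^-1 by rewrite invr_gt0.
rewrite !mxE !normrM !(gtr0_norm it0) !(mulrC z.2^-1) !ltr_pdivrMr//.
set p := z.1 _ _ => h1 h2.
have : `|x ord0 i - y ord0 i| <= `|p - x ord0 i| + `|p - y ord0 i|.
  by rewrite (distrC p (x _ _)) (le_trans _ (ler_normD _ _))// addrA subrK.
have : r0 * z.2 <= r0 * c by rewrite ler_wpM2l ?ltW.
lra.
Qed.

Lemma field_kernelE n x : field_kernel K n x = band_kernel K `[2 ^- n, 1] x.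
Proof. by apply/funext => z; rewrite /field_kernel /band_kernel in_itv. Qed.

Lemma band_kernel_split (a b : R) x z : a < b -> b <= 1 ->
  band_kernel K `[a, 1] x z = band_kernel K `[a, b[ x z + band_kernel K `[b, 1] x z.
Proof.
move=> ab b1; rewrite /band_kernel !in_itv/=.
have [h|h] := ltP z.2 b.
  have -> : z.2 <= 1 by lra.
  by rewrite !andbT addr0.
have -> : a <= z.2 by lra.
by rewrite andbF/= add0r.
Qed.

(** Permuting coordinates preserves the Euclidean norm. *)
Lemma radial_swap (s : 'I_d -> 'I_d) (v : V) : radial K -> involutive s ->
  K (swap_coords s v) = K v.
Proof.
move=> rK sK; apply: rK; rewrite /euclid_norm; congr Num.sqrt.
rewrite (reindex_inj (can_inj sK)); apply: eq_bigr => i _; by rewrite mxE sK.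
Qed.

End kernel_estimates.

(** * Chains of points *)
Section euclid.
Context {R : realType} {d : nat}.
Implicit Types v w : 'rV[R]_d.

Lemma euclid_norm_ge0 v : 0 <= euclid_norm v.
Proof. exact: sqrtr_ge0. Qed.

Let sq_ge0 v : 0 <= \sum_i v ord0 i ^+ 2.
Proof. by apply: sumr_ge0 => i _; exact: sqr_ge0. Qed.

Lemma euclid_normE v : euclid_norm v ^+ 2 = \sum_i v ord0 i ^+ 2.
Proof. by rewrite sqr_sqrtr. Qed.

Lemma euclid_norm_scale (c : R) v : euclid_norm (c *: v) = `|c| * euclid_norm v.
Proof.
rewrite /euclid_norm -sqrtr_sqr -sqrtrM ?sqr_ge0//; congr Num.sqrt.
by rewrite mulr_sumr; apply: eq_bigr => i _; rewrite mxE exprMn.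
Qed.

Lemma coord_le_euclid v i : `|v ord0 i| <= euclid_norm v.
Proof.
rewrite -sqrtr_sqr ler_sqrt//; rewrite (bigD1 i)//= lerDl.
by apply: sumr_ge0 => j _; exact: sqr_ge0.
Qed.

Lemma euclid_le_norm v : euclid_norm v <= d%:R * `|v|.
Proof.
rewrite -[leRHS]ger0_norm; last by rewrite mulr_ge0.
rewrite -sqrtr_sqr ler_sqrt ?sqr_ge0// exprMn.
apply: (@le_trans _ _ (\sum_(i < d) `|v| ^+ 2)).
  apply: ler_sum => i _; rewrite -real_normK ?num_real//.
  by rewrite lerXn2r ?nnegrE// rV_coord_le.
rewrite sumr_const card_ord -[leLHS]mulr_natl; apply: ler_wpM2r; first exact: sqr_ge0.
by rewrite -natrX ler_nat; case: d => // n; rewrite expnS expn1 leq_pmulr.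
Qed.

Lemma euclid_normD v w : euclid_norm (v + w) <= euclid_norm v + euclid_norm w.
Proof.
set a := euclid_norm v; set b := euclid_norm w.
have a0 : 0 <= a := euclid_norm_ge0 v; have b0 : 0 <= b := euclid_norm_ge0 w.
have [a00|an0] := eqVneq a 0.
  suff -> : v = 0 by rewrite add0r lerDr.
  apply/rowP => i; rewrite mxE; apply/eqP; rewrite -normr_le0.
  by apply: (le_trans (coord_le_euclid v i)); rewrite -/a a00.
have [b00|bn0] := eqVneq b 0.
  suff -> : w = 0 by rewrite addr0 lerDl.
  apply/rowP => i; rewrite mxE; apply/eqP; rewrite -normr_le0.
  by apply: (le_trans (coord_le_euclid w i)); rewrite -/b b00.
have ap : 0 < a by rewrite lt_def an0.
have bp : 0 < b by rewrite lt_def bn0.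
rewrite -[leRHS]ger0_norm ?addr_ge0// -sqrtr_sqr ler_sqrt ?sqr_ge0//.
have cs : \sum_i v ord0 i * w ord0 i <= a * b.
  apply: (@le_trans _ _ (\sum_i (v ord0 i ^+ 2 * (b / a) + w ord0 i ^+ 2 * (a / b)) / 2)).
    apply: ler_sum => i _; rewrite -subr_ge0.
    set x := v _ _; set y := w _ _.
    have -> : (x ^+ 2 * (b / a) + y ^+ 2 * (a / b)) / 2 - x * y =
      (x * b - y * a) ^+ 2 / (2 * a * b) by field; rewrite an0 bn0.
    by rewrite mulr_ge0 ?sqr_ge0// invr_ge0 !mulr_ge0.
  rewrite -mulr_suml big_split/= -!mulr_suml -!euclid_normE -/a -/b.
  by rewrite le_eqVlt; apply/orP; left; apply/eqP; field; rewrite an0 bn0.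
rewrite (eq_bigr (fun i => v ord0 i ^+ 2 + (v ord0 i * w ord0 i) * 2 + w ord0 i ^+ 2)); last first.
  by move=> i _; rewrite mxE; ring.
rewrite !big_split/= -mulr_suml -!euclid_normE -/a -/b.
set c := \sum_i _ in cs *; nra.
Qed.

End euclid.

Lemma uniformly_continuous {R : realType} {T W : normedModType R} (A : set T) (f : T -> W) :
  compact A -> {within A, continuous f} -> forall e : R, 0 < e ->
  exists2 dl : R, 0 < dl & forall x y, A x -> A y -> `|x - y| < dl -> `|f x - f y| < e.
Proof.
move=> /compact_near_coveringP cA cf e e0.
pose P (dl : R) (x : T) := A x -> forall y, A y -> `|x - y| < dl -> `|f x - f y| < e.
have : \forall dl \near (0 : R)^'+, A `<=` P dl.
  apply: cA => x Ax.
  have e2 : 0 < e / 2 by rewrite divr_gt0.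
  have /cvgrPdist_lt /(_ _ e2) := (subspace_continuousP A f).1 cf x Ax.
  move=> /nbhs_ballP[r /= r0 hr].
  have r2 : 0 < r / 2 by rewrite divr_gt0.
  exists (ball x (r / 2), [set dl : R | dl < r / 2]).
    split; first exact: nbhsx_ballx.
    by apply: nbhs_right_lt.
  move=> [x' dl] /= [xx' dlr] Ax' y Ay x'y.
  have b1 : ball x r x'.
    by apply: le_ball xx'; lra.
  have b2 : ball x r y.
    rewrite (splitr r); apply: (ball_triangle xx').
    by rewrite -ball_normE/=; exact: lt_trans dlr.
  have h1 := hr _ b1 Ax'; have h2 := hr _ b2 Ay.
  rewrite -(subrKA (f x)) (le_lt_trans (ler_normD _ _))// (splitr e).
  by rewrite ltrD// distrC.
move=> [r /= r0 hr]; exists (r / 2); first by rewrite divr_gt0.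
move=> x y Ax Ay xy; have : P (r / 2) x.
  apply: hr => //=; last by rewrite divr_gt0.
  by rewrite sub0r normrN ger0_norm ?divr_ge0 ?ltW// gtr_pMr ?invf_lt1 ?ltr1n.
exact.
Qed.

(** A chain is a discrete path, for which the cost is a Riemann sum of the length. Unlike
    infima over all curves, infima over chains of dyadic points are countable. *)
Section chains.
Context {R : realType} {d : nat}.
Local Notation V := 'rV[R]_d.
Local Notation mu := (@lebesgue_measure R).
Variables (xi : R) (h : V -> R).

(** Freezing the weight at the starting point makes the cost depend on finitely many values of
    the field. *)
Definition segment_cost (u v : V) : R := expR (xi * h u) * euclid_norm (v - u).

Fixpoint chain_cost (z : V) (s : seq V) : R :=
  if s is v :: s' then segment_cost z v + chain_cost v s' else 0.

Definition fine_chain (eta : R) (U : set V) (z w : V) (s : seq V) : Prop :=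
  [/\ last z s = w, path (fun u v => `|v - u| <= eta) z s & forall v, v \in s -> U v].

Lemma chain_cost_cat z s1 s2 :
  chain_cost z (s1 ++ s2) = chain_cost z s1 + chain_cost (last z s1) s2.
Proof. by elim: s1 z => [z|v s1 IH z] /=; rewrite ?add0r// IH addrA. Qed.

Lemma chain_cost_ge0 z s : 0 <= chain_cost z s.
Proof.
elim: s z => [//|v s IH z] /=; rewrite addr_ge0//.
by apply: mulr_ge0; [exact: expR_ge0|exact: euclid_norm_ge0].
Qed.

Lemma fine_chain_cat eta U z w y s1 s2 : fine_chain eta U z w s1 ->
  fine_chain eta U w y s2 -> fine_chain eta U z y (s1 ++ s2).
Proof.
move=> [l1 p1 m1] [l2 p2 m2]; split.
- by rewrite last_cat l1.
- by rewrite cat_path p1 l1.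
- by move=> v; rewrite mem_cat => /orP[/m1|/m2].
Qed.

Hypothesis ch : continuous h.
Variable p : R -> V.

(** The integrand of the length. The speed [g] is a parameter because on a piece of the path it
    is a continuous function on the closed interval, while [derive1 p] need not be one. *)
Definition speed_weight (g : R -> V) (t : R) : R := expR (xi * h (p t)) * euclid_norm (g t).

Let f := speed_weight (derive1 p).

Lemma speed_weight_ge0 g t : 0 <= speed_weight g t.
Proof. by apply: mulr_ge0; [exact: expR_ge0|exact: euclid_norm_ge0]. Qed.

Lemma continuous_euclid : continuous (@euclid_norm R d).
Proof.
suff h0 (v : ('rV[R]_d : normedModType R)) : euclid_norm x @[x --> v] --> (euclid_norm v : R).
  exact: h0.
have FF : Filter (nbhs v) := nbhs_filter v.
apply/(@cvgrPdist_lt _ _ _ (nbhs v) FF) => e e0.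
have r0 : 0 < e / d.+1%:R by rewrite divr_gt0.
apply/nbhs_ballP; exists (e / d.+1%:R) => //= w.
rewrite -ball_normE/= => vw.
have key (x y : V) : euclid_norm x - euclid_norm y <= d%:R * `|x - y|.
  rewrite lerBlDr -[X in euclid_norm X <= _](subrK y).
  by apply: (le_trans (euclid_normD _ _)); rewrite lerD2r euclid_le_norm.
apply: (@le_lt_trans _ _ (d%:R * `|v - w|)).
  by rewrite ler_norml key andbT lerNl opprB (le_trans (key _ _))// distrC.
apply: (@le_lt_trans _ _ (d.+1%:R * `|v - w|)); first by rewrite ler_wpM2r// ler_nat.
by rewrite mulrC -ltr_pdivlMr.
Qed.

Lemma continuous_weight (A : set R) g : {within A, continuous p} -> {within A, continuous g} ->
  {within A, continuous (speed_weight g)}.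
Proof.
move=> cp cg t; apply: cvgM.
  apply: (@within_continuous_comp _ _ _ A p (fun v => expR (xi * h v))) => //.
  move=> v _; apply: (@continuous_comp _ _ _ (fun v => xi * h v) expR).
    by apply: continuousM; [exact: cst_continuous|exact: ch].
  exact: continuous_expR.
apply: (@within_continuous_comp _ _ _ A g (@euclid_norm R d)) => // v _.
exact: continuous_euclid.
Qed.

(** On the open piece the derivative is [g], and the two end points form a null set. *)
Lemma piece_integrable (a b : R) (g : R -> V) : a < b -> {within `[a, b], continuous p} ->
  {within `[a, b], continuous g} ->
  {in `]a, b[, forall t : R, is_derive t (1 : R) p (g t)} ->
  mu.-integrable `[a, b] (EFin \o f) /\
  forall s t, a <= s -> s < t -> t <= b ->
    \int[mu]_(x in `[s, t]) f x = \int[mu]_(x in `[s, t]) speed_weight g x.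
Proof.
move=> ab cp cg dg.
have cF := continuous_weight cp cg.
have iF : mu.-integrable `[a, b] (EFin \o speed_weight g).
  by apply: continuous_compact_integrable => //; exact: segment_compact.
have mF : measurable_fun `[a, b] (speed_weight g).
  by have /measurable_int/measurable_EFinP := iF.
have fF : {in `]a, b[, f =1 speed_weight g}.
  by move=> t tab; have [_ dt] := dg t tab; rewrite /f /speed_weight derive1E dt.
have sub s t : a <= s -> t <= b -> `]s, t[%classic `<=` `]a, b[%classic.
  move=> as_ tb x /=; rewrite !in_itv/= => /andP[h1 h2].
  by rewrite (le_lt_trans as_ h1) (lt_le_trans h2 tb).
have mFo s t : a <= s -> t <= b -> measurable_fun `]s, t[ (speed_weight g).
  move=> as_ tb; apply: (measurable_funS _ _ mF); first exact: measurable_itv.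
  by move=> x /(sub _ _ as_ tb) /=; rewrite !in_itv/= => /andP[/ltW -> /ltW ->].
have mfo s t : a <= s -> t <= b -> measurable_fun `]s, t[ f.
  move=> as_ tb; apply: (eq_measurable_fun (speed_weight g)); last exact: mFo.
  by move=> x; rewrite inE => /(sub _ _ as_ tb) h1; rewrite fF.
have E s t : a <= s -> s < t -> t <= b ->
    (\int[mu]_(x in `[s, t]) (f x)%:E = \int[mu]_(x in `[s, t]) (speed_weight g x)%:E)%E.
  move=> as_ st tb; apply: eq_integral_itv_bounded; [exact: mfo|exact: mFo|].
  by move=> x xst; apply: fF; apply: (sub _ _ as_ tb).
split.
  apply/integrableP; split.
    by apply/measurable_EFinP; apply: (measurable_fun_itv_cc (b0 := false) (b1 := true)); exact: mfo.
  have /integrableP[_] := iF; rewrite (_ : (\int[mu]_(x in `[a, b]) `|(EFin \o f) x|)%E =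
    (\int[mu]_(x in `[a, b]) (f x)%:E)%E); last first.
    by apply: eq_integral => x _; rewrite /= ger0_norm; [|exact: speed_weight_ge0].
  rewrite E//; congr (_ < _)%E; apply: eq_integral => x _; rewrite /= ger0_norm//.
  by apply: mulr_ge0; [exact: expR_ge0|exact: euclid_norm_ge0].
by move=> s t as_ st tb; rewrite /Rintegral E.
Qed.

Lemma integrable_glue (a b c : R) : a <= c -> c <= b -> mu.-integrable `[a, c] (EFin \o f) ->
  mu.-integrable `[c, b] (EFin \o f) -> mu.-integrable `[a, b] (EFin \o f).
Proof.
move=> ac cb i1 i2.
have E : `[a, b]%classic = `[a, c]%classic `|` `]c, b]%classic.
  apply/seteqP; split => x /=; rewrite !in_itv/=.
    by move=> /andP[-> ->]/=; rewrite andbT; have [h1|h1] := leP x c; [left|right].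
  by case=> /andP[h1 h2]; apply/andP; split; lra.
have i3 : mu.-integrable `]c, b] (EFin \o f).
  by apply: integrableS i2 => // x /=; rewrite !in_itv/= => /andP[/ltW -> ->].
have mU : measurable_fun (`[a, c]%classic `|` `]c, b]%classic) (EFin \o f).
  by apply/measurable_funU => //; split; [exact: measurable_int i1|exact: measurable_int i3].
rewrite E; apply/integrableP; split => //.
rewrite ge0_integral_setU//; last 2 first.
- exact: measurableT_comp.
- apply/disj_setPS => x [] /=; rewrite !in_itv/= => /andP[_ h1] /andP[h2 _]; lra.
by apply: lte_add_pinfty; [have /integrableP[] := i1|have /integrableP[] := i3].
Qed.

Lemma Rintegral_split (a b c : R) : a <= c -> c <= b -> mu.-integrable `[a, b] (EFin \o f) ->
  \int[mu]_(x in `[a, b]) f x = \int[mu]_(x in `[a, c]) f x + \int[mu]_(x in `[c, b]) f x.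
Proof.
move=> ac cb i1; apply/eqP; rewrite addrC -subr_eq; apply/eqP.
rewrite (Rintegral_itvB (x := c) i1) ?bnd_simp//.
apply: Rintegral_itv_obnd_cbnd; apply: integrableS i1 => // x /=.
by rewrite !in_itv/= => /andP[h1 ->]; rewrite andbT; lra.
Qed.

Variable U : set V.

Definition cheap_chain (eta e s t : R) : Prop :=
  exists2 c, fine_chain eta U (p s) (p t) c &
    chain_cost (p s) c <= \int[mu]_(x in `[s, t]) f x + e * (t - s).

(* The error is proportional to the duration, so that it adds up under concatenation. *)
Let cheap_glue eta e (a b c : R) : a <= c -> c <= b -> mu.-integrable `[a, b] (EFin \o f) ->
  cheap_chain eta e a c -> cheap_chain eta e c b -> cheap_chain eta e a b.
Proof.
move=> ac cb i1 [s1 m1 h1] [s2 m2 h2]; exists (s1 ++ s2); first exact: fine_chain_cat m1 m2.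
rewrite chain_cost_cat (Rintegral_split ac cb i1); have [-> _ _] := m1.
by move: h1 h2; set x := Rintegral _ _ _; set y := Rintegral _ _ _; lra.
Qed.

(** Over a short time the speed is nearly constant: the mean value theorem, applied to each
    coordinate, bounds the displacement by the speed at the initial time up to a small error,
    and uniform continuity compares the integral with the initial value of the integrand. *)
Let cheap_piece eta e (a b : R) (g : R -> V) : 0 < eta -> 0 < e -> a < b ->
  {within `[a, b], continuous p} -> {within `[a, b], continuous g} ->
  {in `]a, b[, forall t : R, is_derive t (1 : R) p (g t)} ->
  (forall t, t \in `[a, b] -> U (p t)) ->
  exists2 dl : R, 0 < dl & forall s t, a <= s -> s < t -> t <= b -> t - s < dl ->
    cheap_chain eta e s t.
Proof.
move=> eta0 e0 ab cp cg dg pU.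
have cF := continuous_weight cp cg.
have [iF fF] := piece_integrable ab cp cg dg.
have cE : {within `[a, b], continuous (fun t => expR (xi * h (p t)))}.
  move=> t; apply: (@within_continuous_comp _ _ _ _ p (fun v => expR (xi * h v))) => //.
  move=> v _; apply: (@continuous_comp _ _ _ (fun v => xi * h v) expR).
    by apply: continuousM; [exact: cst_continuous|exact: ch].
  exact: continuous_expR.
have [m _ hm] := EVT_max (ltW ab) cE; set M := expR _ in hm.
have M0 : 0 < M by exact: expR_gt0.
have e2 : 0 < e / 2 by rewrite divr_gt0.
(* The speed is within [e1] in each coordinate; [d] coordinates and a weight at most [M]
   turn this into [e / 2]. *)
pose e1 := e / (2 * d.+1%:R * M).
have e10 : 0 < e1 by rewrite divr_gt0// !mulr_gt0.
have kab := @segment_compact R a b.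
have [d1 d10 h1] := uniformly_continuous kab cF e2.
have [d2 d20 h2] := uniformly_continuous kab cg e10.
have [d3 d30 h3] := uniformly_continuous kab cp eta0.
exists (Num.min d1 (Num.min d2 d3)); first by rewrite !lt_min d10 d20.
move=> s t as_ st tb; rewrite !lt_min => /and3P[ts1 ts2 ts3].
have sab : s \in `[a, b] by rewrite in_itv/= as_ (le_trans (ltW st)).
have tab : t \in `[a, b] by rewrite in_itv/= tb andbT (le_trans as_)// ltW.
have near_s x : x \in `[s, t] -> x \in `[a, b] /\ `|s - x| <= t - s.
  rewrite !in_itv/= => /andP[sx xt]; rewrite (le_trans as_ sx) (le_trans xt tb).
  by split => //; rewrite distrC ger0_norm ?subr_ge0// lerD2r.
exists [:: p t].
  split => //; last by move=> v; rewrite inE => /eqP ->; exact: pU.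
  rewrite /= andbT ltW//; apply: h3 => //.
  by rewrite ger0_norm// subr_ge0 ltW.
rewrite /= addr0 /segment_cost fF//.
have lowI : (speed_weight g s - e / 2) * (t - s) <= \int[mu]_(x in `[s, t]) speed_weight g x.
  have -> : (speed_weight g s - e / 2) * (t - s) =
      \int[mu]_(x in `[s, t]) (cst (speed_weight g s - e / 2) x).
    have E : lebesgue_measure `[s, t]%classic = (t - s)%:E by rewrite lebesgue_measure_itv/= lte_fin st.
    rewrite Rintegral_cst//; congr (_ * _); rewrite -[LHS]/(fine (t - s)%:E).
    by congr fine; exact/esym/E.
  apply: le_Rintegral => //.
  - apply: continuous_compact_integrable; first exact: segment_compact.
    by apply: continuous_subspaceT => x; exact: cst_continuous.
  - apply: continuous_compact_integrable; first exact: segment_compact.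
    by apply: continuous_subspaceW cF => x /= /near_s[].
  move=> x /= /near_s[xab sx]; have := h1 _ _ sab xab (le_lt_trans sx ts1).
  by rewrite ltr_norml => /andP[_ h4]; rewrite /cst; lra.
have up : euclid_norm (p t - p s) <= (t - s) * (euclid_norm (g s) + d%:R * e1).
  have mv j : exists c, c \in `[s, t] /\ p t ord0 j - p s ord0 j = g c ord0 j * (t - s).
    have dj x : x \in `]s, t[ -> is_derive x (1 : R) (fun y => p y ord0 j) (g x ord0 j).
      rewrite in_itv/= => /andP[sx xt]; have xab : x \in `]a, b[.
        by rewrite in_itv/= (le_lt_trans as_ sx) (lt_le_trans xt tb).
      have [dp vp] := dg x xab; have dpj := (derivable_mxP p x 1).1 dp ord0 j.
      by split => //; rewrite -vp (derive_mx dp) mxE.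
    have cj : {within `[s, t], continuous (fun y => p y ord0 j)}.
      apply: (@within_continuous_comp _ _ _ _ p (fun v : V => v ord0 j)).
        by move=> v _; exact: coord_continuous.
      by apply: continuous_subspaceW cp => x /= /near_s[].
    by have [c cst_ E] := MVT_segment (ltW st) dj cj; exists c.
  have [c hc] := choice mv.
  pose w : V := \row_j g (c j) ord0 j.
  have -> : p t - p s = (t - s) *: w.
    by apply/rowP => j; rewrite !mxE; have [_ ->] := hc j; rewrite mulrC.
  rewrite euclid_norm_scale gtr0_norm ?subr_gt0// ler_pM2l ?subr_gt0//.
  have -> : w = g s + (w - g s) by rewrite addrC subrK.
  apply: (le_trans (euclid_normD _ _)); rewrite lerD2l (le_trans (euclid_le_norm _))//.
  rewrite ler_wpM2l//; apply: rV_norm_le; first exact: ltW.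
  move=> j; rewrite !mxE; have [cst_ _] := hc j; have [cab sc] := near_s _ cst_.
  have := h2 _ _ sab cab (le_lt_trans sc ts2); rewrite -normrN opprB => h4.
  by apply: le_trans (ltW h4); have := rV_coord_le (g (c j) - g s) j; rewrite !mxE.
have Es : expR (xi * h (p s)) <= M by exact: hm.
have Me : M * (d%:R * e1) <= e / 2.
  rewrite /e1 (_ : M * _ = e / 2 * (d%:R / d.+1%:R)); last first.
    have D0 : (0 : R) < d.+1%:R by rewrite ltr0n.
    move: (d.+1%:R : R) (d%:R : R) D0 M0 => D D' D0; move: (M) => m' m0.
    by field; rewrite !gt_eqF.
  by rewrite -[leRHS]mulr1 ler_pM2l// ler_pdivrMr ?ltr0n// mul1r ler_nat.
have ts0 : 0 < t - s by rewrite subr_gt0.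
have de0 : 0 <= d%:R * e1 by rewrite mulr_ge0// ltW.
apply: (@le_trans _ _ (expR (xi * h (p s)) * ((t - s) * (euclid_norm (g s) + d%:R * e1)))).
  by rewrite ler_wpM2l// expR_ge0.
move: lowI Me Es; rewrite /speed_weight; move: (expR _) (expR_gt0 (xi * h (p s))) => E E0.
move: (Rintegral _ _ _) (euclid_norm (g s)) => I G lowI Me Es.
have : E * (d%:R * e1) <= e / 2 by apply: le_trans Me; rewrite ler_wpM2r.
by move: (d%:R * e1) => q; nra.
Qed.

Let cheap_subdivide eta e (a b dl : R) : a < b -> 0 < dl ->
  mu.-integrable `[a, b] (EFin \o f) ->
  (forall s t, a <= s -> s < t -> t <= b -> t - s < dl -> cheap_chain eta e s t) ->
  cheap_chain eta e a b.
Proof.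
move=> ab dl0 i1 hl; pose N := (Num.truncn ((b - a) / dl)).+1.
have N0 : (0 : R) < N%:R by rewrite ltr0n.
have ba : 0 < b - a by rewrite subr_gt0.
pose st := (b - a) / N%:R; have st0 : 0 < st by rewrite divr_gt0.
have std : st < dl.
  rewrite /st ltr_pdivrMr// mulrC -ltr_pdivrMr//; exact: truncnS_gt.
have stN : a + N%:R * st = b by rewrite /st mulrC divfK ?gt_eqF//; lra.
suff key k : (k < N)%N -> cheap_chain eta e a (a + k.+1%:R * st).
  by rewrite -[in X in cheap_chain _ _ _ X]stN; apply: key.
have le_b j : (j <= N)%N -> a + j%:R * st <= b.
  by move=> jN; rewrite -stN lerD2l ler_pM2r// ler_nat.
elim: k => [|k IH] kN.
  apply: hl => //; rewrite ?mul1r ?ltrDl//; last by rewrite addrC addKr.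
  by have := le_b 1%N kN; rewrite mul1r.
have ak : a <= a + k.+1%:R * st by rewrite lerDl mulr_ge0// ltW.
have kk : a + k.+1%:R * st < a + k.+2%:R * st by rewrite ltrD2l ltr_pM2r// ltr_nat.
apply: (cheap_glue ak (ltW kk)).
- apply: integrableS i1 => // x /=; rewrite !in_itv/= => /andP[-> h1]/=.
  exact: le_trans h1 (le_b _ kN).
- by apply: IH; exact: ltnW.
- apply: hl => //; first exact: le_b.
  rewrite [ltLHS](_ : _ = st)//.
  have -> : k.+2%:R = k.+1%:R + 1 :> R by rewrite natr1.
  ring.
Qed.

Let cheap_partition eta e (s : seq R) (a b c : R) : 0 < eta -> 0 < e ->
  itv_partition a b (c :: s) -> {within `[a, b], continuous p} ->
  (forall i, (i < size (c :: s))%N -> C1_piece p (nth 0 (a :: c :: s) i) (nth 0 (c :: s) i)) ->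
  (forall t, t \in `[a, b] -> U (p t)) ->
  mu.-integrable `[a, b] (EFin \o f) /\ cheap_chain eta e a b.
Proof.
move=> eta0 e0; elim: s a c => [|c' s IH] a c part cp hs pU.
  have [/andP[ac _] /eqP/= cb] := part; rewrite -cb in cp pU *.
  have [g [cg dg]] := hs 0%N isT.
  have [iF _] := piece_integrable ac cp cg dg; split => //.
  have [dl dl0 hl] := cheap_piece eta0 e0 ac cp cg dg pU.
  exact: cheap_subdivide ac dl0 iF hl.
have part' := itv_partition_cons part; have cb := itv_partition_le part'.
have [/andP[ac _] _] := part.
have subl : `[a, c]%classic `<=` `[a, b]%classic.
  by move=> x /=; rewrite !in_itv/= => /andP[-> h1]; exact: le_trans h1 cb.
have subr : `[c, b]%classic `<=` `[a, b]%classic.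
  by move=> x /=; rewrite !in_itv/= => /andP[h1 ->]; rewrite andbT (le_trans _ h1)// ltW.
have [i2 c2] := IH c c' part' (continuous_subspaceW subr cp)
  (fun i hi => hs i.+1 hi) (fun t ht => pU t (subr t ht)).
have cpl := continuous_subspaceW subl cp.
have [g [cg dg]] := hs 0%N isT.
have [i1 _] := piece_integrable ac cpl cg dg.
have [dl dl0 hl] := cheap_piece eta0 e0 ac cpl cg dg (fun t ht => pU t (subl t ht)).
have c1 := cheap_subdivide ac dl0 i1 hl.
have i3 := integrable_glue (ltW ac) cb i1 i2; split => //.
exact: cheap_glue (ltW ac) cb i3 c1 c2.
Qed.

Lemma path_cheap_chain (z w : V) (eta e : R) : 0 < eta -> 0 < e -> path_in U z w p ->
  exists2 c, fine_chain eta U z w c & chain_cost z c <= exp_length xi h p + e.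
Proof.
move=> eta0 e0 [[cp [s [part hs]]] p0 p1 pU].
case: s part hs => [|c s] part hs.
  by have /eqP := itv_partition_nil part; rewrite eq_sym oner_eq0.
have [_ [l m1 m2]] := cheap_partition eta0 e0 part cp hs pU.
exists l; first by rewrite -p0 -p1.
by rewrite -p0; move: m2; rewrite subr0 mulr1.
Qed.

End chains.

(** * Polygons *)
Section polygon.
Context {R : realType} {d : nat}.
Local Notation V := 'rV[R]_d.
Local Notation mu := (@lebesgue_measure R).
Variables (xi : R) (h : V -> R) (M : nat) (Z : nat -> V) (B : nat -> R).
Hypotheses (ch : continuous h) (M0 : (0 < M)%N).

(* Clamping each step to [0, 1] gives a single formula for all pieces: steps already made
   count fully, steps to come do not count. *)
Definition unit_clamp (x : R) : R := Num.min (Num.max x 0) 1.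

Definition polygon (t : R) : V :=
  Z 0%N + \sum_(k < M) unit_clamp (M%:R * t - k%:R) *: (Z k.+1 - Z k).

Let MR : (0 : R) < M%:R. Proof. by rewrite ltr0n. Qed.

Let kM (k : nat) : R := k%:R / M%:R.

Lemma polygonE k (t : R) : (k < M)%N -> kM k <= t <= kM k.+1 ->
  polygon t = Z k + (M%:R * t - k%:R) *: (Z k.+1 - Z k).
Proof.
rewrite /kM ler_pdivrMr// ler_pdivlMr// mulrC => kltM /andP[h1 h2].
rewrite -natr1 in h2.
rewrite /polygon (bigID (fun i : 'I_M => (i < k)%N))/=.
rewrite (eq_bigr (fun i : 'I_M => Z i.+1 - Z i)); last first.
  move=> i ik; rewrite /unit_clamp.
  have ik1 : i%:R + 1 <= k%:R :> R by rewrite natr1 ler_nat.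
  rewrite (max_idPl _); last by lra.
  by rewrite (min_idPr _) ?scale1r//; lra.
rewrite [X in _ + (X + _)](_ : _ = Z k - Z 0%N); last first.
  rewrite -(big_ord_widen_cond M predT (fun i => Z i.+1 - Z i) (ltnW kltM))/=.
  by rewrite -(telescope_sumr _ (leq0n k)) big_mkord.
rewrite (bigD1 (Ordinal kltM)) ?ltnn//= big1 ?addr0; last first.
  move=> i /andP[ik /eqP/val_eqP/= ine]; rewrite /unit_clamp.
  have ik1 : k%:R + 1 <= i%:R :> R.
    by rewrite natr1 ler_nat ltn_neqAle eq_sym ine leqNgt.
  rewrite (max_idPr _); last by lra.
  by rewrite (min_idPl _) ?scale0r.
rewrite addrA [Z 0%N + _]addrC subrK; congr (_ + _ *: _).
rewrite /unit_clamp (max_idPl _); last by lra.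
by rewrite (min_idPl _)//; lra.
Qed.

Lemma polygon_start : polygon 0 = Z 0%N.
Proof.
rewrite (polygonE (k := 0))//; first by rewrite mulr0 subrr scale0r addr0.
by rewrite /kM mul0r lexx/= divr_ge0.
Qed.

Lemma polygon_end : polygon 1 = Z M.
Proof.
have [k Mk] : exists k, M = k.+1 by case: (M) M0 => // k _; exists k.
have E : kM M = 1 by rewrite /kM divff// gt_eqF.
rewrite (polygonE (k := k)); first last.
- by rewrite -Mk E lexx andbT -E /kM ler_pM2r ?invr_gt0// ler_nat Mk.
- by rewrite Mk.
by rewrite mulr1 Mk -natr1 addrAC subrr add0r scale1r addrC subrK.
Qed.

Lemma continuous_polygon : continuous polygon.
Proof.
have cc (k : nat) : continuous (fun t : R => unit_clamp (M%:R * t - k%:R) *: (Z k.+1 - Z k)).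
  move=> t; apply: (@continuous_comp _ _ _ (fun t : R => unit_clamp (M%:R * t - k%:R)) (fun c : R => c *: (Z k.+1 - Z k))).
    apply: continuous_min; last exact: cst_continuous.
    apply: continuous_max; last exact: cst_continuous.
    apply: continuousB; last exact: cst_continuous.
    exact: mulrl_continuous.
  exact: scalel_continuous.
have cs n : continuous (fun t : R => \sum_(k < n) unit_clamp (M%:R * t - k%:R) *: (Z k.+1 - Z k)).
  elim: n => [|n IH] t.
    by under eq_fun do rewrite big_ord0; exact: cst_continuous.
  under eq_fun do rewrite big_ord_recr/=.
  by apply: cvgD; [exact: IH|exact: cc].
by move=> t; apply: cvgD; [exact: cst_continuous|exact: cs].
Qed.

Lemma is_derive_affine (z v : V) (m c t : R) :
  is_derive t (1 : R) (fun t : R => z + (m * t - c) *: v) (m *: v).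
Proof.
have E : (h^-1 *: (((fun t : R => z + (m * t - c) *: v) \o shift t) (h *: (1 : R)) -
    (z + (m * t - c) *: v))) @[h --> (0 : R)^'] --> m *: v.
  apply: cvg_near_cst; near=> k.
  have k0 : k != 0 by near: k; exact: nbhs_dnbhs_neq.
  rewrite /= [k *: 1]mulr1 opprD addrACA subrr add0r -scalerBl scalerA; congr (_ *: _).
  by rewrite mulrDr; field.
split; first exact: cvgP E.
by apply: cvg_lim => //; exact: norm_hausdorff.
Unshelve. all: by end_near. Qed.

Let pieceP k : (k < M)%N ->
  {in `]kM k, kM k.+1[, forall t : R, is_derive t (1 : R) polygon (M%:R *: (Z k.+1 - Z k))}.
Proof.
move=> kltM t tk.
apply: (near_eq_is_derive _ (is_derive_affine (Z k) (Z k.+1 - Z k) M%:R k%:R t)).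
have := near_in_itvoo tk; apply: filterS => s; rewrite in_itv/= => /andP[/ltW h1 /ltW h2].
by rewrite (polygonE kltM)// h1.
Qed.

Let kM_lt k : kM k < kM k.+1.
Proof. by rewrite /kM ltr_pM2r ?invr_gt0// ltr_nat. Qed.

Lemma polygon_piecewise : piecewise_C1 polygon.
Proof.
split; first by apply: continuous_subspaceT; exact: continuous_polygon.
exists [seq kM i | i <- iota 1 M]; split.
  have k0 : kM 0 = 0 by rewrite /kM mul0r.
  split; first last.
    rewrite -k0 last_map (_ : last 0%N (iota 1 M) = M); first by rewrite /kM divff// gt_eqF.
    by case: (M) M0 => // n _; rewrite (last_nth 0%N) size_iota [LHS]nth_iota.
  rewrite -k0; apply: (@homo_path _ _ kM ltn); last first.
    by have := iota_ltn_sorted 0 M.+1.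
  by move=> i j ij; rewrite /kM ltr_pM2r ?invr_gt0// ltr_nat.
rewrite size_map size_iota => i iM.
have -> : nth 0 (0 :: [seq kM i | i <- iota 1 M]) i = kM i.
  case: i iM => [|i] iM /=; first by rewrite /kM mul0r.
  by rewrite (nth_map 0%N) ?size_iota ?nth_iota// ltnW.
rewrite (nth_map 0%N) ?size_iota// nth_iota//.
exists (fun=> M%:R *: (Z i.+1 - Z i)); split; last exact: pieceP.
by apply: continuous_subspaceT => t; exact: cst_continuous.
Qed.

Variable U : set V.
Hypotheses (ZU : forall k (c : R), (k < M)%N -> 0 <= c <= 1 -> U (Z k + c *: (Z k.+1 - Z k)))
  (hB : forall k (c : R), (k < M)%N -> 0 <= c <= 1 -> expR (xi * h (Z k + c *: (Z k.+1 - Z k))) <= B k).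

Let locate (t : R) : 0 <= t <= 1 -> exists2 k, (k < M)%N & kM k <= t <= kM k.+1.
Proof.
move=> /andP[t0 t1]; have [t1'|t1'] := eqVneq t 1.
  have [k Mk] : exists k, M = k.+1 by case: (M) M0 => // k _; exists k.
  exists k; first by rewrite Mk.
  have E : kM M = 1 by rewrite /kM divff// gt_eqF.
  by rewrite t1' -Mk E lexx andbT -E Mk ltW.
have tlt : t < 1 by rewrite lt_neqAle t1'.
have Mt0 : 0 <= M%:R * t by rewrite mulr_ge0.
have /andP[h1 h2] := truncn_itv Mt0.
exists (Num.truncn (M%:R * t)).
  by rewrite -(ltr_nat R); apply: (le_lt_trans h1); rewrite gtr_pMr.
by rewrite /kM ler_pdivrMr// ler_pdivlMr// (mulrC t) h1 ltW.
Qed.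

Let local_param k (t : R) : kM k <= t <= kM k.+1 -> 0 <= M%:R * t - k%:R <= 1.
Proof.
rewrite /kM ler_pdivrMr// ler_pdivlMr// -natr1 mulrC => /andP[h1 h2].
by apply/andP; split; lra.
Qed.

Let f := speed_weight xi h polygon (derive1 polygon).

Let length_le k : (k < M)%N -> mu.-integrable `[0, kM k.+1] (EFin \o f) /\
  \int[mu]_(x in `[0, kM k.+1]) f x <= \sum_(i < k.+1) B i * euclid_norm (Z i.+1 - Z i).
Proof.
have cp (A : set R) : {within A, continuous polygon}.
  by apply: continuous_subspaceT; exact: continuous_polygon.
have cc (A : set R) (v : V) : {within A, continuous (fun _ : R => v)}.
  by apply: continuous_subspaceT => t; exact: cst_continuous.
have one i : (i < M)%N -> mu.-integrable `[kM i, kM i.+1] (EFin \o f) /\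
    \int[mu]_(x in `[kM i, kM i.+1]) f x <= B i * euclid_norm (Z i.+1 - Z i).
  move=> iM; have [i1 E] := piece_integrable xi ch (kM_lt i) (cp _) (cc _ _) (pieceP iM).
  split => //; rewrite E//.
  have -> : B i * euclid_norm (Z i.+1 - Z i) =
      \int[mu]_(x in `[kM i, kM i.+1]) (cst (B i * (M%:R * euclid_norm (Z i.+1 - Z i))) x).
    have E1 : lebesgue_measure `[kM i, kM i.+1]%classic = (M%:R^-1)%:E.
      rewrite lebesgue_measure_itv/= lte_fin kM_lt -EFinB; congr EFin.
      by rewrite /kM -mulrBl -natrB// subSnn mul1r.
    transitivity (B i * (M%:R * euclid_norm (Z i.+1 - Z i)) * fine (M%:R^-1 : R)%:E).
      by rewrite /=; field; rewrite gt_eqF.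
    by rewrite Rintegral_cst//; congr (_ * _); congr fine; exact/esym/E1.
  apply: le_Rintegral => //.
  - apply: continuous_compact_integrable; first exact: segment_compact.
    exact: continuous_weight.
  - apply: continuous_compact_integrable; first exact: segment_compact.
    by apply: continuous_subspaceT => x; exact: cst_continuous.
  move=> x /= xi1; rewrite in_itv/= in xi1.
  rewrite /speed_weight (polygonE iM xi1) euclid_norm_scale ger0_norm// ler_wpM2r//.
    by rewrite mulr_ge0// euclid_norm_ge0.
  by apply: hB => //; exact: local_param.
elim: k => [|k IH] kltM.
  have [i1 l1] := one _ kltM.
  have k0 : kM 0 = 0 by rewrite /kM mul0r.
  by rewrite k0 in i1 l1; rewrite big_ord1.
have [i1 l1] := IH (ltnW kltM); have [i2 l2] := one _ kltM.
have k0 : 0 <= kM k.+1 by rewrite divr_ge0.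
have i3 := integrable_glue k0 (ltW (kM_lt _)) i1 i2; split => //.
by rewrite (Rintegral_split k0 (ltW (kM_lt _)) i3) big_ord_recr/= lerD.
Qed.

(** On each piece the weight is at most [B k] and the speed is constant. *)
Lemma polygon_length : path_in U (Z 0%N) (Z M) polygon /\
  exp_length xi h polygon <= \sum_(i < M) B i * euclid_norm (Z i.+1 - Z i).
Proof.
split.
  split; [exact: polygon_piecewise|exact: polygon_start|exact: polygon_end|].
  move=> t; rewrite in_itv/= => /locate[k kltM tk]; rewrite (polygonE kltM tk).
  by apply: ZU => //; exact: local_param.
have [k Mk] : exists k, M = k.+1 by case: (M) M0 => // k _; exists k.
have E : kM M = 1 by rewrite /kM divff// gt_eqF.
have kltM : (k < M)%N by rewrite Mk.
by have [_] := length_le kltM; rewrite -Mk E.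
Qed.

End polygon.

(** * The distance and chains *)
Section distance.
Context {R : realType} {d : nat}.
Local Notation V := 'rV[R]_d.
Variables (xi : R) (h : V -> R) (r : R).
Hypothesis (ch : continuous h).
Let U : set V := ball (0 : V) r.

Lemma ball_segment (x y : V) (c : R) : U x -> U y -> 0 <= c <= 1 -> U (x + c *: (y - x)).
Proof.
rewrite /U -ball_normE/= !sub0r !normrN => x2 y2 /andP[c0 c1].
have -> : x + c *: (y - x) = (1 - c) *: x + c *: y.
  by rewrite scalerBr scalerBl scale1r addrA addrAC.
apply: (le_lt_trans (ler_normD _ _)).
rewrite !normrZ (ger0_norm c0) ger0_norm ?subr_ge0//.
have [cc|cc] := eqVneq c 1; first by rewrite cc subrr mul0r add0r mul1r.
have : (1 - c) * `|x| < (1 - c) * r by rewrite ltr_pM2l// subr_gt0 lt_neqAle cc.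
have : c * `|y| <= c * r by rewrite ler_wpM2l// ltW.
lra.
Qed.

Lemma exp_length_ge0 p : 0 <= exp_length xi h p.
Proof. apply: Rintegral_ge0 => t _; apply: mulr_ge0; [exact: expR_ge0|exact: euclid_norm_ge0]. Qed.

Let lengths z w := [set exp_length xi h p | p in path_in U z w].

Let lengths_lb z w : has_lbound (lengths z w).
Proof. by exists 0 => _ [p _ <-]; exact: exp_length_ge0. Qed.

Lemma chain_costE z (c : seq V) : chain_cost xi h z c =
  \sum_(i < size c) expR (xi * h (nth 0 (z :: c) i)) *
    euclid_norm (nth 0 (z :: c) i.+1 - nth 0 (z :: c) i).
Proof.
elim: c z => [z|v c IH z]; first by rewrite big_ord0.
by rewrite /= big_ord_recl/= IH.
Qed.

(** The segments joining the points of the chain form an admissible path, along which the weight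
    differs from its value at the last vertex by the oscillation of the field. *)
Lemma exp_dist_le_chain eta om z w c : (0 < size c)%N -> U z -> fine_chain eta U z w c ->
  (forall x y, U x -> U y -> `|y - x| <= eta -> xi * h y <= xi * h x + om) ->
  exp_dist xi h z w U <= expR om * chain_cost xi h z c.
Proof.
move=> c0 Uz [lc pc Uc] osc; pose Z k : V := nth 0 (z :: c) k.
have UZ k : (k <= size c)%N -> U (Z k).
  by case: k => [|k] kc //; apply: Uc; exact: mem_nth.
have step k : (k < size c)%N -> `|Z k.+1 - Z k| <= eta.
  by move=> kc; have /(pathP 0)/(_ k kc) := pc.
pose B k := expR (om + xi * h (Z k)).
have [] := @polygon_length R d xi h (size c) Z B ch c0 U.
- by move=> k t kc t01; apply: ball_segment => //; [exact/UZ/ltnW|exact: UZ].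
- move=> k t kc t01; rewrite /B ler_expR [om + _]addrC; apply: osc; first exact/UZ/ltnW.
    by apply: ball_segment => //; [exact/UZ/ltnW|exact: UZ].
  rewrite addrAC subrr add0r normrZ; have /andP[t0 t1] := t01; rewrite ger0_norm//.
  by apply: (le_trans _ (step _ kc)); rewrite ler_piMl.
have -> : Z (size c) = w by rewrite /Z -last_nth.
move=> pp le; apply: (@le_trans _ _ (exp_length xi h (polygon (size c) Z))).
  by apply: ge_inf; [exact: lengths_lb|exists (polygon (size c) Z)].
apply: (le_trans le); rewrite chain_costE mulr_sumr; apply: ler_sum => k _.
by rewrite /B expRD mulrA.
Qed.

Lemma exp_dist_chain eta e z w : U z -> U w -> 0 < eta -> 0 < e ->
  exists2 c, fine_chain eta U z w c & chain_cost xi h z c <= exp_dist xi h z w U + e.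
Proof.
move=> Uz Uw eta0 e0; have e2 : 0 < e / 2 by rewrite divr_gt0.
have ne : lengths z w !=set0.
  pose Z k : V := if k is 0%N then z else w.
  have [] := @polygon_length R d 0 h 1 Z (fun=> 1) ch isT U.
  - by move=> [|//] t _ t01; exact: ball_segment.
  - by move=> k t _ _; rewrite mul0r expR0.
  by move=> pp _; exists (exp_length xi h (polygon 1 Z)); exists (polygon 1 Z).
have [_ [p pp <-] lt] := inf_adherent e2 (conj ne (lengths_lb z w)).
have [c fc cc] := path_cheap_chain xi ch eta0 e2 pp; exists c => //.
have {}lt : exp_length xi h p < exp_dist xi h z w U + e / 2 := lt.
lra.
Qed.

Lemma chain_cost_lower m z w c : (forall x, U x -> m <= expR (xi * h x)) -> 0 <= m -> U z ->
  (forall v, v \in c -> U v) -> last z c = w -> m * `|w - z| <= chain_cost xi h z c.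
Proof.
move=> hm m0; elim: c z => [z _ _ /= ->|v c IH z Uz Uc /= lw].
  by rewrite subrr normr0 mulr0.
have Uv : U v by apply: Uc; rewrite mem_head.
have {}IH := IH v Uv (fun x xc => Uc x (mem_behead (s := v :: c) xc)) lw.
have -> : w - z = (v - z) + (w - v) by rewrite [RHS]addrC addrA subrK.
apply: (@le_trans _ _ (m * `|v - z| + m * `|w - v|)); first by rewrite -mulrDr ler_wpM2l// ler_normD.
apply: lerD => //; rewrite /segment_cost; apply: ler_pM => //; first exact: hm.
by apply: rV_norm_le; [exact: euclid_norm_ge0|move=> i; exact: coord_le_euclid].
Qed.

Let compact_ball : compact [set v : V | forall i, `[- r, r]%classic (v ord0 i)].
Proof. exact: (rV_compact (fun=> @segment_compact R _ _)). Qed.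

Let ball_box (v : V) : U v -> [set v : V | forall i, `[- r, r]%classic (v ord0 i)] v.
Proof.
rewrite /U -ball_normE/= sub0r normrN => vr i.
by rewrite /= in_itv/= -ler_norml (le_trans (rV_coord_le _ _))// ltW.
Qed.

(** The field is bounded below on the closed box, hence every chain costs at least a constant
    times the distance of its ends. *)
Lemma exp_dist_gt0 z w : U z -> U w -> z != w -> 0 < exp_dist xi h z w U.
Proof.
move=> Uz Uw zw.
have [x0 _ hx] : exists2 c, c \in [set v : V | forall i, `[- r, r]%classic (v ord0 i)] &
    forall t, t \in [set v : V | forall i, `[- r, r]%classic (v ord0 i)] ->
      expR (xi * h c) <= expR (xi * h t).
  apply: (@EVT_min_rV R d (fun v => expR (xi * h v))).
  - by exists z; exact: ball_box.
  - exact: compact_ball.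
  - apply: continuous_subspaceT => v.
    apply: (@continuous_comp _ _ _ (fun v => xi * h v) expR).
      by apply: continuousM; [exact: cst_continuous|exact: ch].
    exact: continuous_expR.
set m := expR _ in hx.
have m0 : 0 < m by exact: expR_gt0.
have D0 : 0 < m * `|w - z| by rewrite mulr_gt0// normr_gt0 subr_eq0 eq_sym.
have e0 : 0 < m * `|w - z| / 2 by rewrite divr_gt0.
have [c [lc _ Uc] cc] := exp_dist_chain Uz Uw ltr01 e0.
have := chain_cost_lower (fun x Ux => hx x (mem_set (ball_box Ux))) (ltW m0) Uz Uc lc.
by move: cc D0; move: (m * `|w - z|) => D; lra.
Qed.

Let round_cvg_norm (v : V) (u : V) :
  `|dyadic_round m v - dyadic_round m u| @[m --> \oo] --> `|v - u|.
Proof. by apply: cvg_norm; apply: cvgB; exact: dyadic_round_cvg. Qed.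

Let round_path eta z c : 0 < eta -> path (fun u v => `|v - u| <= eta / 2) z c ->
  \forall m \near \oo, path (fun u v => `|v - u| <= eta) (dyadic_round m z)
    [seq dyadic_round m v | v : V <- c].
Proof.
move=> eta0; elim: c z => [z _|v c IH z /= /andP[zv vc]]; first exact: nearW.
have h1 : `|v - z| < eta by apply: (le_lt_trans zv); rewrite ltr_pdivrMr// ltr_pMr// ltr1n.
have h4 : \forall m \near \oo, `|dyadic_round m v - dyadic_round m z| < eta.
  exact: (cvgr_lt _ (@round_cvg_norm v z) _ h1).
move: h4; apply: filter_app; apply: filterS (IH v vc) => m h2 h3.
by rewrite h2 andbT ltW.
Qed.

Let round_in (c : seq V) : (forall v, v \in c -> U v) ->
  \forall m \near \oo, forall v, v \in [seq dyadic_round m v | v : V <- c] -> U v.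
Proof.
elim: c => [_|v c IH Uc]; first exact: nearW.
have Uv : U v by apply: Uc; rewrite mem_head.
have h1 : `|v| < r by move: Uv; rewrite /U -ball_normE/= sub0r normrN.
have h2 : \forall m \near \oo, `|dyadic_round m v| < r.
  exact: (cvgr_lt _ (cvg_norm (@dyadic_round_cvg _ _ v)) _ h1).
have h3 := IH (fun x xc => Uc x (mem_behead (s := v :: c) xc)).
move: h2; apply: filter_app; apply: filterS h3 => m h3 h2 u.
rewrite inE => /orP[/eqP ->|]; last exact: h3.
by rewrite /U -ball_normE/= sub0r normrN.
Qed.

Let round_cost z c : chain_cost xi h (dyadic_round m z) [seq dyadic_round m v | v : V <- c]
  @[m --> \oo] --> chain_cost xi h z c.
Proof.
elim: c z => [z|v c IH z] /=; first exact: cvg_cst.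
apply: cvgD; last exact: IH.
apply: cvgM.
  apply: (@cvg_comp _ _ _ (fun m => dyadic_round m z) (fun v => expR (xi * h v)) _ _ _
    (@dyadic_round_cvg _ _ z)).
  apply: (@continuous_comp _ _ _ (fun v => xi * h v) expR).
    by apply: continuousM; [exact: cst_continuous|exact: ch].
  exact: continuous_expR.
apply: (@cvg_comp _ _ _ (fun m => dyadic_round m v - dyadic_round m z) (@euclid_norm R d) _ (nbhs (v - z))).
  by apply: cvgB; exact: dyadic_round_cvg.
exact: continuous_euclid.
Qed.

(** Dyadic points are coded by integers, so that there are countably many such chains. *)
Definition dyadic_chain (k m : nat) (z w : V) (c : seq {ffun 'I_d -> int}) : Prop :=
  fine_chain k.+1%:R^-1 U z w [seq dyadic_point m x | x <- c].

Let small_inv (e : R) : 0 < e -> exists k : nat, k.+1%:R^-1 < e.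
Proof.
move=> e0; exists (Num.truncn e^-1).
by rewrite invf_plt ?posrE// truncnS_gt.
Qed.

(** Rounding a fine chain to a fine dyadic grid changes its cost little. Conversely, on a
    sufficiently fine chain the field oscillates so little between neighbours that the polygon
    through it costs less than [a]; the gap [1 / (j + 1)] must not depend on the fineness [k]
    for this. The right-hand side is a countable combination of conditions on finitely many
    values of the field. *)
Lemma exp_dist_ltP z w a : U z -> U w -> z != w ->
  (forall m, dyadic_round m z = z) -> (forall m, dyadic_round m w = w) ->
  exp_dist xi h z w U < a <->
  exists j : nat, forall k : nat, exists m : nat, exists c : seq {ffun 'I_d -> int},
    dyadic_chain k m z w c /\
    chain_cost xi h z [seq dyadic_point m x | x <- c] < a - j.+1%:R^-1.
Proof.
move=> Uz Uw zw rz rw; split => [Xa|[j hj]].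
  have e0 : 0 < (a - exp_dist xi h z w U) / 2 by rewrite divr_gt0// subr_gt0.
  have [j hj] := small_inv e0; exists j => k.
  have eta0 : (0 : R) < k.+1%:R^-1 by rewrite invr_gt0.
  have eta2 : (0 : R) < k.+1%:R^-1 / 2 by rewrite divr_gt0.
  have [c [lc pc Uc] cc] := exp_dist_chain Uz Uw eta2 e0.
  have cb : chain_cost xi h z c < a - j.+1%:R^-1 by move: hj cc e0; move: (exp_dist _ _ _ _ _) (j.+1%:R^-1) => X q; lra.
  have n1 := round_path eta0 pc; have n2 := round_in Uc.
  have n3 : \forall m \near \oo, chain_cost xi h (dyadic_round m z) [seq dyadic_round m v | v : V <- c]
      < a - j.+1%:R^-1 by exact: (cvgr_lt _ (@round_cost z c) _ cb).
  have [m [[h1 h2] h3]] := filter_ex (filterI (filterI n1 n2) n3).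
  exists m, [seq [ffun i => Num.floor (2 ^+ m * v ord0 i)] | v : V <- c].
  have E : [seq dyadic_point m x | x <- [seq [ffun i => Num.floor (2 ^+ m * v ord0 i)] | v : V <- c]] =
      [seq dyadic_round m v | v : V <- c].
    rewrite -map_comp; apply: eq_map => v /=; apply/rowP => i.
    by rewrite !mxE ffunE.
  rewrite /dyadic_chain E; rewrite rz in h1 h3; split => //; split => //.
  by rewrite -[in LHS](rz m) last_map lc.
have [m0 [c0 [_ cc0]]] := hj 0%N.
have b0 : 0 < a - j.+1%:R^-1 by apply: (le_lt_trans _ cc0); exact: chain_cost_ge0.
have ji : (0 : R) < j.+1%:R^-1 by rewrite invr_gt0.
set b := a - _ in b0 hj.
have a0 : 0 < a by rewrite -(subr0 a) (lt_trans b0)// /b ler_ltB.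
(* The admissible oscillation: it multiplies costs by at most [a / b]. *)
have om0 : 0 < ln (a / b) by rewrite ln_gt0// ltr_pdivlMr// mul1r /b gtrBl.
have cB : {within [set v : V | forall i, `[- r, r]%classic (v ord0 i)], continuous (fun v => xi * h v)}.
  apply: continuous_subspaceT => v.
  by apply: continuousM; [exact: cst_continuous|exact: ch].
have [dl dl0 hdl] := uniformly_continuous compact_ball cB om0.
have [k hk] := small_inv dl0.
have [m [c [fc cc]]] := hj k.
have c1 : (0 < size [seq (dyadic_point m x : V) | x <- c])%N.
  by case: c fc {cc} => // -[/= zw' _ _]; rewrite zw' eqxx in zw.
apply: (le_lt_trans (exp_dist_le_chain (om := ln (a / b)) c1 Uz fc _)).
  move=> x y Ux Uy xy; have := hdl _ _ (ball_box Uy) (ball_box Ux) (le_lt_trans xy hk).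
  by move=> /ltW; rewrite ler_norml lerBlDl => /andP[_]; exact.
rewrite lnK ?posrE ?divr_gt0//.
rewrite -[ltRHS](_ : a / b * b = a); last by rewrite divfK// gt_eqF.
by rewrite ltr_pM2l// divr_gt0.
Qed.

End distance.

Section distance_measurable.
Context {R : realType} {d : nat} {dO : measure_display} {Omega : measurableType dO}.
Local Notation V := 'rV[R]_d.
Variables (xi : R) (h : Omega -> V -> R) (r : R) (z w : V).
Hypotheses (ch : forall o, continuous (h o)) (mh : forall x, measurable_fun setT (fun o => h o x))
  (zr : ball (0 : V) r z) (wr : ball (0 : V) r w) (zw : z != w)
  (rz : forall m, dyadic_round m z = z) (rw : forall m, dyadic_round m w = w).

Lemma measurable_exp_dist :
  measurable_fun setT (fun o => exp_dist xi (h o) z w (ball (0 : V) r)).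
Proof.
have mc (z' : V) (c : seq V) : measurable_fun setT (fun o => chain_cost xi (h o) z' c).
  elim: c z' => [z'|v c IH z'] /=; first exact: measurable_cst.
  apply: measurable_funD => //; apply: measurable_funM; last exact: measurable_cst.
  by apply: (measurableT_comp (@measurable_expR R)); apply: measurable_funM.
apply: (measurability (@RGenInftyO.G R)).
  exact: RGenInftyO.measurableE.
move=> _ [_ [a ->] <-]; rewrite setTI.
have -> : (fun o => exp_dist xi (h o) z w (ball (0 : V) r)) @^-1` `]-oo, a[ =
    \bigcup_(j : nat) \bigcap_(k : nat) \bigcup_(mc : nat * seq {ffun 'I_d -> int})
      [set o | dyadic_chain r k mc.1 z w mc.2 /\
        chain_cost xi (h o) z [seq dyadic_point mc.1 x | x <- mc.2] < a - j.+1%:R^-1].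
  apply/seteqP; split => o /=; rewrite in_itv/=.
    move=> /(@exp_dist_ltP R d xi (h o) r (@ch o) z w a zr wr zw rz rw) [j hj]; exists j => // k _.
    by have [m [c hmc]] := hj k; exists (m, c).
  move=> [j _ hj]; apply/(@exp_dist_ltP R d xi (h o) r (@ch o) z w a zr wr zw rz rw); exists j => k.
  by have [[m c] _ hmc] := hj k I; exists m, c.
apply: bigcupT_measurable => j; apply: bigcapT_measurable => k.
apply: countable_bigcupT_measurable; first exact: countableP.
move=> [m c] /=.
have [D|D] := pselect (dyadic_chain r k m z w c); last first.
  rewrite (_ : [set _ | _] = set0)//.
  by apply/seteqP; split => o // [].
rewrite (_ : [set _ | _] = (fun o => chain_cost xi (h o) z [seq dyadic_point m x | x <- c]) @^-1`
    `]-oo, a - j.+1%:R^-1[); last first.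
  by apply/seteqP; split => o /=; rewrite in_itv/=; [case|].
rewrite -[X in measurable X]setTI; exact: mc.
Qed.

End distance_measurable.

(** * The lattice *)
Section lattice.
Variable d : nat.

Definition site := {ffun 'I_d -> int}.

Definition king (u v : site) : bool := [forall i, `|u i - v i| <= 1].

(** With [N] sites per unit length, these are the sites in the open box of radius 2. *)
Definition in_box (N : nat) (u : site) : bool := [forall i, `|u i| < (2 * N)%:Z].

(** Encodes the coordinates from [1 - 2 * N] to [2 * N - 1]. *)
Definition box (N : nat) := {ffun 'I_d -> 'I_(4 * N).-1}.

Definition box_site (N : nat) (f : box N) : site := [ffun i => (f i)%:Z - (2 * N).-1%:Z].

Definition axis_site (i : 'I_d) (N : nat) : site := [ffun j => if j == i then N%:Z else 0].

Lemma box_site_inj N : injective (@box_site N).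
Proof.
move=> f g fg; apply/ffunP => i; apply: val_inj.
by have := congr1 (fun u : site => u i) fg; rewrite /= !ffunE => /addIr [].
Qed.

Lemma in_box_site N (f : box N) : in_box N (box_site f).
Proof.
apply/forallP => i; rewrite ffunE; have := ltn_ord (f i).
case: N f => [|N] f h; first by move: (f i) h => [].
rewrite ltr_norml; apply/andP; split; lia.
Qed.

Lemma box_siteP N (u : site) : in_box N u -> exists f : box N, box_site f = u.
Proof.
move=> /forallP uN.
have h i : (`|(u i + (2 * N).-1%:Z)%R|%N < (4 * N).-1)%N.
  have := uN i; rewrite ltr_norml => /andP[h1 h2]; lia.
exists [ffun i => Ordinal (h i)]; apply/ffunP => i; rewrite !ffunE/=.
have := uN i; rewrite ltr_norml => /andP[h1 h2]; lia.
Qed.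

Lemma king_refl u : king u u.
Proof. by apply/forallP => i; rewrite subrr. Qed.

Lemma king_sym u v : king u v = king v u.
Proof. by apply: eq_forallb => i; rewrite distrC. Qed.

Definition king_path N (a b : site) (s : seq site) : bool :=
  [&& path king a s, last a s == b & all (in_box N) (a :: s)].

Lemma axis_king_path N (i : 'I_d) : (0 < N)%N ->
  king_path N (axis_site i 0) (axis_site i N) [seq axis_site i k | k <- iota 1 N].
Proof.
move=> N0; apply/and3P; split.
- have : path (fun k l => l == k.+1) 0%N (iota 1 N).
    by elim: N {N0} 0%N => //= N IH m; rewrite eqxx/= IH.
  apply: homo_path => k l /eqP ->; apply/forallP => j; rewrite !ffunE.
  by case: ifP => _; lia.
- rewrite last_map (last_nth 0%N) size_iota; case: N N0 => // n _.
  by rewrite [nth _ _ _](@nth_iota 0 1 n.+1 n).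
- apply/allP => u; rewrite inE => /orP[/eqP ->|/mapP[k]].
    by apply/forallP => j; rewrite ffunE; case: ifP => _; lia.
  rewrite mem_iota => kN ->; apply/forallP => j; rewrite ffunE; case: ifP => _; lia.
Qed.

Section first_passage.
Context {R : realType} (xi : R) (i0 : 'I_d) (N : nat).
Hypothesis N0 : (0 < N)%N.

Definition sites_cost (phi : site -> R) (s : seq site) : R := \sum_(u <- s) expR (xi * phi u).

(** All sets of sites that contain a path, not only the paths themselves: since weights are
    positive this does not change the minimal cost, and the whole box becomes an explicit
    element. *)
Definition connecting : {set {set box N}} :=
  [set S : {set box N} | `[< exists s, king_path N (axis_site i0 0) (axis_site i0 N) s /\
    forall u, u \in axis_site i0 0 :: s -> exists2 f, f \in S & box_site f = u >] ]%SET.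

Lemma full_connecting : [set: box N]%SET \in connecting.
Proof.
rewrite inE; apply/asboolP; exists [seq axis_site i0 k | k <- iota 1 N].
have kp := axis_king_path i0 N0; split => // u us.
have /and3P[_ _ /allP /(_ _ us) /box_siteP[f fu]] := kp.
by exists f.
Qed.

Lemma set0_connecting : finset.set0 \notin connecting.
Proof.
apply/negP; rewrite inE => /asboolP[s [_ /(_ (axis_site i0 0))]].
by rewrite mem_head => /(_ isT)[f]; rewrite inE.
Qed.

Definition crossing (phi : site -> R) : R :=
  passage xi connecting [set: box N]%SET (fun f => phi (box_site f)).

Lemma crossing_gt0 phi : 0 < crossing phi.
Proof. by apply: passage_gt0; [exact: full_connecting|exact: set0_connecting]. Qed.

Lemma sum_uniq_sub (T : eqType) (s1 s2 : seq T) (F : T -> R) : uniq s1 -> {subset s1 <= s2} ->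
  (forall x, 0 <= F x) -> \sum_(x <- s1) F x <= \sum_(x <- s2) F x.
Proof.
elim: s1 s2 => [|x s1 IH] s2 /=; first by move=> _ _ F0; rewrite big_nil sumr_ge0.
move=> /andP[xs1 us1] sub F0; have xs2 : x \in s2 by apply: sub; rewrite mem_head.
rewrite big_cons (big_rem x xs2)/= lerD2l; apply: IH => // y ys1.
have ys2 : y \in s2 by apply: sub; rewrite inE ys1 orbT.
have yx : y != x by apply: contraNneq xs1 => <-.
have := perm_mem (perm_to_rem xs2) y.
by rewrite ys2 inE (negbTE yx)/= => <-.
Qed.

Lemma crossing_le phi s : king_path N (axis_site i0 0) (axis_site i0 N) s ->
  crossing phi <= sites_cost phi (axis_site i0 0 :: s).
Proof.
move=> kp; set s' := _ :: s; pose S : {set box N} := [set f | box_site f \in s']%SET.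
apply: (@le_trans _ _ (cost xi S (fun f => phi (box_site f)))).
  apply: passage_le; rewrite inE; apply/asboolP; exists s; split => // u us.
  have /and3P[_ _ /allP /(_ _ us) /box_siteP[f fu]] := kp.
  by exists f => //; rewrite inE fu.
rewrite /cost /sites_cost -big_enum/= -(big_map (@box_site N) xpredT (fun u => expR (xi * phi u))).
apply: sum_uniq_sub.
- by rewrite map_inj_uniq ?enum_uniq//; exact: box_site_inj.
- by move=> u /mapP[f]; rewrite mem_enum inE => fs ->.
- by move=> u; exact: expR_ge0.
Qed.

(** A cheapest set contains a path, and erasing its loops makes each site count once. *)
Lemma crossing_attained phi : exists s,
  [/\ king_path N (axis_site i0 0) (axis_site i0 N) s, uniq (axis_site i0 0 :: s) &
      sites_cost phi (axis_site i0 0 :: s) <= crossing phi].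
Proof.
have [S SC E] := passage_attained xi (fun f => phi (box_site f)) full_connecting.
rewrite /crossing E {E}.
move: SC; rewrite inE => /asboolP[s [/and3P[ps /eqP ls bs] sS]].
case/shortenP: ps ls => s' ps' us' sub ls.
have sub' u : u \in axis_site i0 0 :: s' -> u \in axis_site i0 0 :: s.
  by rewrite !inE => /orP[->//|/sub ->]; rewrite orbT.
exists s'; split => //.
  apply/and3P; split => //; first exact/eqP.
  by apply/allP => u /sub' us; exact: (allP bs).
rewrite /cost /sites_cost -big_enum/= -(big_map (@box_site N) xpredT (fun u => expR (xi * phi u))).
apply: sum_uniq_sub => // u /sub' /sS[f fS <-]; apply: map_f.
by rewrite mem_enum.
Qed.

End first_passage.

Section links.
Context {R : realType}.
Variables (P : site -> Prop) (F : site -> R).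
Hypothesis F0 : forall u, 0 <= F u.

(** The starting point of the path is not paid for, so that costs add up under concatenation. *)
Definition link (a b : site) (c : R) : Prop := exists s,
  [/\ path king a s, last a s = b, forall u, u \in a :: s -> P u & \sum_(u <- s) F u <= c].

Lemma link_refl a : P a -> link a a 0.
Proof. by move=> Pa; exists [::]; split => // [u|]; rewrite ?inE ?big_nil// => /eqP ->. Qed.

Lemma link_trans a b e c1 c2 : link a b c1 -> link b e c2 -> link a e (c1 + c2).
Proof.
move=> [s1 [p1 l1 P1 h1]] [s2 [p2 l2 P2 h2]]; exists (s1 ++ s2); split.
- by rewrite cat_path p1 l1.
- by rewrite last_cat l1.
- move=> u; rewrite -cat_cons mem_cat => /orP[/P1//|us2]; apply: P2.
  by rewrite inE us2 orbT.
- by rewrite big_cat/= lerD.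
Qed.

Lemma link_le a b c1 c2 : c1 <= c2 -> link a b c1 -> link a b c2.
Proof. by move=> c12 [s [p l Ps h]]; exists s; split => //; exact: le_trans h c12. Qed.

(** Sites are those of the lattice refined [M] times; [w] and its neighbour in direction [j] are
    joined by a path of cost at most [B]. Here both end points are paid for, so that the path
    can be traversed in both directions. *)
Definition good_edge (M : nat) (B : R) (w : site) (j : 'I_d) : Prop := exists s,
  [/\ path king [ffun k => M%:Z * w k] s,
      last [ffun k => M%:Z * w k] s = [ffun k => M%:Z * (w k + (k == j)%:Z)],
      forall u, u \in [ffun k => M%:Z * w k] :: s -> P u &
      \sum_(u <- [ffun k => M%:Z * w k] :: s) F u <= B].

Lemma good_edge_link M B w j : good_edge M B w j ->
  link [ffun k => M%:Z * w k] [ffun k => M%:Z * (w k + (k == j)%:Z)] B /\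
  link [ffun k => M%:Z * (w k + (k == j)%:Z)] [ffun k => M%:Z * w k] B.
Proof.
set a := [ffun k => M%:Z * w k]; move=> [s [p l Ps h]]; split.
  exists s; split => //; apply: le_trans h; by rewrite big_cons lerDr.
case/lastP: s p l Ps h => [|s b] p l Ps h.
  by exists [::]; rewrite -l; split => //; apply: le_trans h; rewrite big_nil sumr_ge0.
rewrite last_rcons in l; rewrite -l in p Ps h *.
exists (rcons (rev s) a); split.
- have := rev_path king a (rcons s b); rewrite last_rcons belast_rcons rev_cons => ->.
  by rewrite (eq_path (e' := king))// => u v; rewrite king_sym.
- by rewrite last_rcons.
- move=> u; rewrite inE mem_rcons inE mem_rev => h1; apply: Ps.
  by rewrite inE mem_rcons inE; case/or3P: h1 => ->; rewrite ?orbT.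
- apply: le_trans h; rewrite -cats1 big_cat/= big_cons big_nil addr0 big_cons addrC lerD2l.
  rewrite (perm_big s) ?perm_rev//= -cats1 big_cat/= lerDl big_cons big_nil addr0; exact: F0.
Qed.

Definition l1dist (a b : site) : nat := \sum_i `|a i - b i|%N.

(** An induction on the distance: one coordinate at a time is moved by one towards its target,
    which keeps the walk in the box spanned by the two ends. *)
Lemma axis_route M B (a b : site) : 0 <= B -> P [ffun k => M%:Z * a k] ->
  (forall (w : site) j, (forall k, Num.min (a k) (b k) <= w k <= Num.max (a k) (b k)) ->
    w j < Num.max (a j) (b j) -> a j != b j -> good_edge M B w j) ->
  link [ffun k => M%:Z * a k] [ffun k => M%:Z * b k] ((l1dist a b)%:R * B).
Proof.
move=> B0; move: {2}(l1dist a b) (erefl (l1dist a b)) => n.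
elim: n a => [|n IH] a ab Pa good.
  have -> : b = a.
    apply/ffunP => i; apply/eqP; rewrite eq_sym -subr_eq0 -absz_eq0.
    by move/eqP: ab; rewrite /l1dist sum_nat_eq0 => /forallP/(_ i).
  by rewrite (_ : l1dist a a = 0%N) ?mul0r; [exact: link_refl|
    rewrite /l1dist big1// => i _; rewrite subrr].
have [j jab] : exists j, a j != b j.
  apply/existsP; rewrite -negb_forall; apply/negP => /forallP h.
  by move: ab; rewrite /l1dist big1// => i _; rewrite (eqP (h i)) subrr.
pose e : int := if a j < b j then 1 else -1.
pose a' : site := [ffun k => a k + (if k == j then e else 0)].
have a'n : l1dist a' b = n.
  move: ab; rewrite /l1dist (bigD1 j)//= => ab.
  rewrite (bigD1 j)//= ffunE eqxx (eq_bigr (fun i => `|a i - b i|%N)); last first.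
    by move=> i /negbTE ij; rewrite ffunE ij addr0.
  move: ab; set q := (\sum_(i | _) _)%N; rewrite /e; case: ifPn => h ab; lia.
have box' k : Num.min (a k) (b k) <= Num.min (a' k) (b k) /\
    Num.max (a' k) (b k) <= Num.max (a k) (b k).
  rewrite ffunE /e; case: eqP => [->|_]; last by rewrite addr0.
  by case: ifPn => h; lia.
have step : link [ffun k => M%:Z * a k] [ffun k => M%:Z * a' k] B.
  have [h|h] := ltP (a j) (b j).
    have g : good_edge M B a j.
      by apply: good => // [k|]; lia.
    have [+ _] := good_edge_link g; congr (link _ _ _); apply/ffunP => k; rewrite !ffunE /e h.
    by case: eqP.
  have g : good_edge M B a' j.
    apply: good => // [k|].
      rewrite ffunE /e ltNge h/=; case: eqP => [->|_]; lia.
    by rewrite ffunE eqxx /e ifN -?leNgt//; lia.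
  have [_ +] := good_edge_link g; congr (link _ _ _); apply/ffunP => k; rewrite !ffunE /e ltNge h/=.
  by case: eqP => _; rewrite ?addr0 ?subrK.
have -> : (l1dist a b)%:R * B = B + (l1dist a' b)%:R * B.
  by rewrite a'n ab -natr1 mulrDl mul1r addrC.
apply: (link_trans step); apply: IH => //.
  by have [s [_ <- Ps _]] := step; apply: Ps; exact: mem_last.
move=> w k hw wk a'k; apply: good.
- move=> l; have := hw l; have [h1 h2] := box' l; lia.
- by have [_ h2] := box' k; lia.
- move: a'k; rewrite ffunE; case: (k =P j) => [->|_]//; by rewrite addr0.
Qed.

End links.

End lattice.

(** * Lattice points and rounding *)
Section rounding.
Context {R : realType}.

(** Rounding towards 0 maps the open box of radius 2 to itself. *)
Definition round0 (y : R) : int := if 0 <= y then Num.floor y else - Num.floor (- y).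

Let intlt (a b : int) : a%:~R < b%:~R :> R -> a < b.
Proof. by rewrite ltr_int. Qed.

Let round0P (y : R) :
  (0 <= y /\ 0 <= (round0 y)%:~R :> R /\ (round0 y)%:~R <= y < (round0 y)%:~R + 1) \/
  (y < 0 /\ (round0 y)%:~R <= 0 :> R /\ (round0 y)%:~R - 1 < y <= (round0 y)%:~R).
Proof.
rewrite /round0; case: (leP 0 y) => y0.
  left; have /andP[h1 h2] := floor_itv y; rewrite intrD in h2.
  by rewrite ler0z floor_ge0 y0 h1 h2.
right; have /andP[h1 h2] := floor_itv (- y); rewrite intrD in h2.
rewrite mulrNz; split => //; split.
  by rewrite oppr_le0 ler0z floor_ge0; lra.
by apply/andP; split; lra.
Qed.

Lemma round0_dist y : `|(round0 y)%:~R - y| <= 1.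
Proof.
by rewrite ler_norml; case: (round0P y) => [[h0 [h1 /andP[h2 h3]]]|[h0 [h1 /andP[h2 h3]]]];
  apply/andP; split; lra.
Qed.

Lemma round0_lt y (N : nat) : `|y| < N%:R -> `|round0 y| < N%:Z.
Proof.
rewrite !ltr_norml => /andP[y1 y2]; apply/andP; split; apply: intlt;
  rewrite ?mulrNz -?pmulrn;
  by case: (round0P y) => [[h0 [h1 /andP[h2 h3]]]|[h0 [h1 /andP[h2 h3]]]]; lra.
Qed.

Lemma round0_king x y : `|x - y| <= 1 -> `|round0 x - round0 y| <= 1.
Proof.
rewrite !ler_norml => /andP[h1 h2].
suff [H1 H2] : round0 x < round0 y + 2 /\ round0 y < round0 x + 2 by apply/andP; split; lia.
split; apply: intlt; rewrite intrD;
 (case: (round0P y) => [[a0 [a1 /andP[a2 a3]]]|[a0 [a1 /andP[a2 a3]]]];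
  case: (round0P x) => [[b0 [b1 /andP[b2 b3]]]|[b0 [b1 /andP[b2 b3]]]]; lra).
Qed.

Lemma round0_double y : `|round0 (2 * y) - 2 * round0 y| <= 1.
Proof.
rewrite ler_norml.
suff [H1 H2] : round0 (2 * y) < 2 * round0 y + 2 /\ 2 * round0 y < round0 (2 * y) + 2.
  by apply/andP; split; lia.
split; apply: intlt; rewrite intrD intrM;
 (case: (round0P y) => [[a0 [a1 /andP[a2 a3]]]|[a0 [a1 /andP[a2 a3]]]];
  case: (round0P (2 * y)) => [[b0 [b1 /andP[b2 b3]]]|[b0 [b1 /andP[b2 b3]]]]; lra).
Qed.

Lemma round0_int (z : int) : round0 z%:~R = z.
Proof.
suff [H1 H2] : round0 z%:~R < z + 1 /\ z < round0 z%:~R + 1 by lia.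
split; apply: intlt; rewrite intrD;
 by case: (round0P z%:~R) => [[a0 [a1 /andP[a2 a3]]]|[a0 [a1 /andP[a2 a3]]]]; lra.
Qed.

End rounding.

Section lattice_points.
Context {R : realType} {d : nat}.
Local Notation V := 'rV[R]_d.

Lemma pow2_gt0 n : (0 : R) < 2 ^+ n. Proof. exact: exprn_gt0. Qed.

Lemma pow2_inv_gt0 n : (0 : R) < 2 ^- n. Proof. by rewrite invr_gt0 pow2_gt0. Qed.

Definition site_of (n : nat) (x : V) : site d := [ffun i => round0 (x ord0 i * 2 ^+ n)].

Lemma site_of_dist n x : `|dyadic_point n (site_of n x) - x| <= 2 ^- n.
Proof.
have p0 := pow2_gt0 n; apply: rV_norm_le; first by rewrite invr_ge0 ltW.
move=> i; rewrite !mxE ffunE.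
rewrite -[X in _ / _ - X](mulfK (lt0r_neq0 p0)) -mulrBl normrM (gtr0_norm (pow2_inv_gt0 n)).
by rewrite ler_piMl ?invr_ge0 ?(ltW p0)//; exact: round0_dist.
Qed.

Lemma site_of_box n x : ball (0 : V) 2 x -> in_box (2 ^ n) (site_of n x).
Proof.
rewrite -ball_normE/= sub0r normrN => x2; apply/forallP => i; rewrite ffunE.
apply: round0_lt; rewrite normrM (gtr0_norm (pow2_gt0 n)).
rewrite natrM natrX ltr_pM2r ?pow2_gt0//; exact: le_lt_trans (rV_coord_le x i) x2.
Qed.

Lemma dyadic_point_ball n (u : site d) : in_box (2 ^ n) u -> ball (0 : V) 2 (dyadic_point n u).
Proof.
move=> /forallP uN; rewrite -ball_normE/= sub0r normrN; apply: rV_norm_lt => // i.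
rewrite mxE normrM (gtr0_norm (pow2_inv_gt0 n)).
rewrite ltr_pdivrMr ?pow2_gt0//.
have := uN i; rewrite -(ltr_int R) intr_norm => /lt_le_trans; apply.
by rewrite -pmulrn natrM natrX.
Qed.

Lemma site_of_king n x y : `|x - y| <= 2 ^- n -> king (site_of n x) (site_of n y).
Proof.
move=> xy; apply/forallP => i; rewrite !ffunE; apply: round0_king.
rewrite -mulrBl normrM (gtr0_norm (pow2_gt0 n)).
rewrite -ler_pdivlMr ?pow2_gt0// mul1r; apply: le_trans xy.
by have := rV_coord_le (x - y) i; rewrite !mxE.
Qed.

Lemma king_dist n (u v : site d) : king u v ->
  `|dyadic_point n u - dyadic_point n v| <= 2 ^- n :> R.
Proof.
have p0 := pow2_gt0 n.
move=> /forallP uv; apply: rV_norm_le; first by rewrite invr_ge0 ltW.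
move=> i; rewrite !mxE -mulrBl normrM (gtr0_norm (pow2_inv_gt0 n)).
rewrite ler_piMl ?invr_ge0 ?(ltW p0)// -intrB -intr_norm.
by have := uv i; rewrite -(ler_int R).
Qed.

(** Rounding at two successive scales differs by at most one fine step. *)
Lemma site_of_refine n x : king (site_of n.+1 x) [ffun i => 2 * site_of n x i].
Proof.
apply/forallP => i; rewrite !ffunE exprS mulrCA; exact: round0_double.
Qed.

Lemma dyadic_point_double n (u : site d) :
  dyadic_point n.+1 [ffun i => 2 * u i] = dyadic_point n u :> V.
Proof.
apply/rowP => i; rewrite !mxE ffunE intrM exprS invfM.
by rewrite mulrACA divff ?mul1r// pnatr_eq0.
Qed.

Lemma site_of_point n (u : site d) : site_of n (dyadic_point n u : V) = u.
Proof.
apply/ffunP => i; rewrite ffunE mxE divfK ?round0_int// gt_eqF// pow2_gt0//.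
Qed.

End lattice_points.

(** * Comparison of the distance with the lattice cost *)
Section lattice_distance.
Context {R : realType} {d : nat}.
Local Notation V := 'rV[R]_d.
Variables (xi s : R) (h : V -> R) (n : nat) (i0 : 'I_d).
Hypotheses (ch : continuous h) (xi0 : 0 <= xi) (s0 : 0 <= s) (i00 : val i0 = 0%N).
Let U : set V := ball (0 : V) 2.
Hypothesis osc : forall x y, U x -> U y -> `|y - x| <= 2 ^- n -> `|h y - h x| <= s.
Let E := expR (xi * s).
Let delta : R := 2 ^- n.
Let D := exp_dist xi h 0 e1 U.
Let T := crossing xi i0 (2 ^ n) (fun u => h (dyadic_point n u)).
Let w (x : V) := expR (xi * h x).

Let delta0 : 0 < delta. Proof. exact: pow2_inv_gt0. Qed.
Let E1 : 1 <= E. Proof. by rewrite -expR0 ler_expR mulr_ge0. Qed.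
Let w0 x : 0 < w x. Proof. exact: expR_gt0. Qed.
Let N0 : (0 < 2 ^ n)%N. Proof. by rewrite expn_gt0. Qed.

Let wE x y : U x -> U y -> `|y - x| <= delta -> w y <= E * w x.
Proof.
move=> Ux Uy xy; rewrite /w /E -expRD ler_expR -mulrDr ler_wpM2l//.
have := osc Ux Uy xy; rewrite ler_norml => /andP[_ h1]; lra.
Qed.

Lemma dyadic_origin : dyadic_point n (axis_site i0 0) = 0 :> V.
Proof. by apply/rowP => i; rewrite !mxE ffunE; case: eqP => _; rewrite mul0r. Qed.

Lemma dyadic_e1 : dyadic_point n (axis_site i0 (2 ^ n)) = e1 :> V.
Proof.
apply/rowP => i; rewrite !mxE ffunE -i00 (inj_eq val_inj); case: eqP => _; last by rewrite mul0r.
by rewrite -pmulrn natrX divff// gt_eqF// pow2_gt0.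
Qed.

Let U0 : U 0. Proof. by rewrite /U -ball_normE/= subr0 normr0. Qed.

Let Ue1 : U e1.
Proof.
rewrite -dyadic_e1; apply: dyadic_point_ball; apply/forallP => j; rewrite ffunE.
by case: ifP => _; lia.
Qed.

(** A king path is a chain with steps at most [delta] in the maximum norm, hence at most
    [d * delta] in the Euclidean norm. *)
Lemma exp_dist_le_crossing : D <= d%:R * delta * E * T.
Proof.
have [sq [/and3P[ps /eqP ls bs] us hs]] := crossing_attained xi i0 N0 (fun u => h (dyadic_point n u)).
pose c := [seq (dyadic_point n u : V) | u <- sq].
have fc : fine_chain delta U 0 e1 c.
  split.
  - by rewrite -dyadic_origin /c last_map ls dyadic_e1.
  - rewrite -dyadic_origin; apply: homo_path ps => u v uv.
    by apply: king_dist; rewrite king_sym.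
  - move=> v /mapP[u usq ->]; apply: dyadic_point_ball.
    by apply: (allP bs); rewrite inE usq orbT.
have c0 : (0 < size c)%N.
  rewrite size_map; case: (sq) ls => // /ffunP/(_ i0); rewrite !ffunE eqxx.
  by move/eqP; rewrite eqz_nat eq_sym expn_eq0.
have oscE x y : U x -> U y -> `|y - x| <= delta -> xi * h y <= xi * h x + xi * s.
  move=> Ux Uy xy; rewrite -mulrDr ler_wpM2l//.
  have := osc Ux Uy xy; rewrite ler_norml => /andP[_ h1]; lra.
apply: (le_trans (exp_dist_le_chain ch c0 U0 fc oscE)); rewrite -/E.
rewrite [leRHS]mulrAC [leRHS]mulrC; apply: ler_wpM2l; first by rewrite expR_ge0.
apply: (@le_trans _ _ (d%:R * delta * sites_cost xi (fun u => h (dyadic_point n u)) (axis_site i0 0 :: sq))); last first.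
  by rewrite ler_wpM2l// mulr_ge0// ltW.
move: ps; rewrite -dyadic_origin /c /sites_cost.
elim: (sq) (axis_site i0 0) => [|v q IH] u /=.
  by move=> _; rewrite big_cons big_nil addr0 mulr_ge0 ?expR_ge0// mulr_ge0// ltW.
move=> /andP[uv vq]; rewrite big_cons mulrDr lerD//; last exact: IH.
rewrite /segment_cost mulrC; apply: ler_wpM2r; first exact: expR_ge0.
apply: (le_trans (euclid_le_norm _)); rewrite ler_wpM2l//.
by apply: king_dist; rewrite king_sym.
Qed.

Let segment_lower a z v : U a -> U z -> `|z - a| <= delta / 2 ->
  E^-1 * w a * `|v - z| <= segment_cost xi h z v.
Proof.
move=> Ua Uz za; rewrite /segment_cost; apply: ler_pM => //.
- by rewrite mulr_ge0 ?invr_ge0 ?expR_ge0.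
- rewrite ler_pdivrMl ?expR_gt0//; apply: wE => //; rewrite distrC (le_trans za)//.
  by rewrite ler_pdivrMr// ler_pMr// ler1n.
- by apply: rV_norm_le; [exact: euclid_norm_ge0|move=> i; exact: coord_le_euclid].
Qed.

(** A new anchor is chosen each time the chain has moved by more than [delta / 2] from the last
    one. Until then the weight is comparable to the weight at the anchor [a], so that the chain
    has spent at least [E^-1 * w a * delta / 2], which pays for the next anchor. In the induction
    [E^-1 * w a * |z - a|] stands for what has been spent since the last anchor. *)
Let anchors (c : seq V) z a : (forall x, x \in z :: c -> U x) -> U a ->
  `|z - a| <= delta / 2 -> path (fun u v => `|v - u| <= delta / 2) z c ->
  exists A : seq V, [/\ path (fun u v => `|v - u| <= delta) a A, last a A = last z c,
    forall x, x \in A -> U x &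
    \sum_(x <- A) w x <= 2 / delta * E ^+ 3 * (E^-1 * w a * `|z - a| + chain_cost xi h z c) + E * w a].
Proof.
elim: c z a => [|v c IH] z a Uc Ua za pc.
  exists [:: z]; have Uz : U z by apply: Uc; rewrite mem_head.
  have za' : `|z - a| <= delta by apply: (le_trans za); rewrite ler_pdivrMr// ler_pMr// ler1n.
  split => //; first by rewrite /= za'.
  rewrite big_cons big_nil !addr0; apply: (le_trans (wE Ua Uz za')).
  by rewrite lerDr !mulr_ge0 ?invr_ge0 ?exprn_ge0 ?expR_ge0 ?(ltW delta0).
have Uz : U z by apply: Uc; rewrite mem_head.
have Uv : U v by apply: Uc; rewrite !inE eqxx orbT.
have Uc' x : x \in v :: c -> U x by move=> xc; apply: Uc; rewrite inE xc orbT.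
move: pc => /= /andP[vz pc].
have seg := segment_lower v Ua Uz za.
have tri : `|v - a| <= `|z - a| + `|v - z|.
  by rewrite [leRHS]addrC (le_trans _ (ler_normD _ _))// addrA subrK.
have Kc : 0 <= 2 / delta * E ^+ 3 by rewrite !mulr_ge0 ?invr_ge0 ?exprn_ge0 ?expR_ge0 ?(ltW delta0).
have Ewa : 0 <= E^-1 * w a by rewrite mulr_ge0 ?invr_ge0 ?expR_ge0.
have [va|va] := leP `|v - a| (delta / 2).
  have [A [pA lA UA hA]] := IH v a Uc' Ua va pc.
  exists A; split => //; apply: (le_trans hA); rewrite lerD2r ler_wpM2l// addrA lerD2r.
  apply: (le_trans (ler_wpM2l Ewa tri)); rewrite mulrDr lerD2l; exact: seg.
have vv : `|v - v| <= delta / 2 by rewrite subrr normr0 divr_ge0// ltW.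
have [A [pA lA UA hA]] := IH v v Uc' Uv vv pc.
have va' : `|v - a| <= delta.
  by apply: (le_trans tri); rewrite [leRHS]splitr lerD.
exists (v :: A); split => //.
- by rewrite /= va'.
- by move=> x; rewrite inE => /orP[/eqP ->|/UA].
rewrite big_cons; rewrite subrr normr0 mulr0 add0r in hA.
have wva := wE Ua Uv va'.
set k := 2 / delta * E ^+ 3 in hA *.
have pay : E ^+ 2 * w a <= k * (E^-1 * w a * `|z - a| + segment_cost xi h z v).
  apply: (@le_trans _ _ (k * (E^-1 * w a * (delta / 2)))).
    by rewrite /k le_eqVlt; apply/orP; left; apply/eqP; field; rewrite !gt_eqF ?expR_gt0.
  rewrite ler_wpM2l//; apply: (@le_trans _ _ (E^-1 * w a * (`|z - a| + `|v - z|))).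
    by rewrite ler_wpM2l// (le_trans (ltW va)).
  by rewrite mulrDr lerD2l.
have : (1 + E) * w v <= (1 + E) * (E * w a) by rewrite ler_wpM2l// addr_ge0// expR_ge0.
move: hA pay; rewrite !mulrDr !mulrDl; move: (k * _) (k * _) (k * _) => k1 k2 k3.
have : E * w a <= E * w a + 0 by rewrite addr0.
move: (w0 a); move: (w a) (w v) (\sum_(x <- A) w x) => wa wv SA wa0.
rewrite mul1r; lra.
Qed.

(** The chain ends at distance at least [delta / 2] from [a], and while it is closer its weight
    is at least [E^-1 * w a]. *)
Let far_lower (c : seq V) z a : (forall x, x \in z :: c -> U x) -> U a ->
  `|z - a| <= delta / 2 -> delta / 2 <= `|last z c - a| ->
  E^-1 * w a * (delta / 2 - `|z - a|) <= chain_cost xi h z c.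
Proof.
elim: c z => [|v c IH] z Uc Ua za far /=.
  by rewrite mulr_ge0_le0 ?subr_le0// mulr_ge0 ?invr_ge0 ?expR_ge0.
have Uz : U z by apply: Uc; rewrite mem_head.
have Uc' x : x \in v :: c -> U x by move=> xc; apply: Uc; rewrite inE xc orbT.
have seg := segment_lower v Ua Uz za.
have tri : `|v - a| <= `|z - a| + `|v - z|.
  by rewrite [leRHS]addrC (le_trans _ (ler_normD _ _))// addrA subrK.
have Ewa : 0 <= E^-1 * w a by rewrite mulr_ge0 ?invr_ge0 ?expR_ge0.
have [va|va] := leP `|v - a| (delta / 2).
  have := IH v Uc' Ua va far.
  have := ler_wpM2l Ewa tri; rewrite !mulrBr mulrDr; lra.
have := chain_cost_ge0 xi h v c.
have : E^-1 * w a * (delta / 2) <= E^-1 * w a * (`|z - a| + `|v - z|).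
  by rewrite ler_wpM2l// (le_trans (ltW va)).
rewrite mulrBr mulrDr; lra.
Qed.

Lemma crossing_le_exp_dist : T <= 6 * 2 ^+ n * E ^+ 4 * D.
Proof.
have k0 : 0 < 6 * 2 ^+ n * E ^+ 4 by rewrite !mulr_gt0 ?exprn_gt0 ?expR_gt0.
apply/ler_addgt0Pr => e e0.
pose e' := e / (6 * 2 ^+ n * E ^+ 4); have e'0 : 0 < e' by rewrite divr_gt0.
have d2 : 0 < delta / 2 by rewrite divr_gt0.
have [c [lc pc Uc] hc] := exp_dist_chain xi ch U0 Ue1 d2 e'0.
have Uc' x : x \in 0 :: c -> U x by rewrite inE => /orP[/eqP ->|/Uc].
have z0 : `|0 - 0 : V| <= delta / 2 by rewrite subrr normr0 ltW.
have [A [pA lA UA hA]] := anchors Uc' U0 z0 pc.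
(* The origin itself is paid for by the first departure from it, as [e1] is far away. *)
have far : delta / 2 <= `|last 0 c - 0 : V|.
  rewrite lc subr0; apply: (@le_trans _ _ `|(e1 : V) ord0 i0|); last exact: rV_coord_le.
  rewrite mxE i00 normr1 ler_pdivrMr// mul1r.
  by apply: (@le_trans _ _ 1); rewrite ?ler1n// invf_le1 ?exprn_gt0// exprn_ege1// ler1n.
have low := far_lower Uc' U0 z0 far.
rewrite !subrr normr0 subr0 in low; rewrite subrr normr0 mulr0 add0r in hA.
pose sq := [seq site_of n x | x <- A].
have kp : king_path (2 ^ n) (axis_site i0 0) (axis_site i0 (2 ^ n)) sq.
  rewrite -(@site_of_point R d n (axis_site i0 0)) dyadic_origin.
  apply/and3P; split.
  - apply: homo_path pA => x y xy; apply: site_of_king; by rewrite distrC.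
  - by rewrite /sq last_map lA lc -dyadic_e1 site_of_point.
  - apply/allP => u; rewrite inE => /orP[/eqP ->|/mapP[x xA ->]]; first exact: site_of_box.
    by apply: site_of_box; exact: UA.
apply: (le_trans (crossing_le xi _ kp)).
rewrite /sites_cost big_cons dyadic_origin big_map -/(w 0).
have le2 : \sum_(x <- A) expR (xi * h (dyadic_point n (site_of n x))) <= E * \sum_(x <- A) w x.
  rewrite mulr_sumr !big_seq; apply: ler_sum => x xA.
  apply: wE; [exact: UA| |exact: site_of_dist].
  by apply: dyadic_point_ball; apply: site_of_box; exact: UA.
have w0le : w 0 <= 2 / delta * E * chain_cost xi h 0 c.
  rewrite -ler_pdivrMl; last by rewrite mulr_gt0 ?divr_gt0 ?expR_gt0.
  apply: le_trans low; rewrite le_eqVlt; apply/orP; left; apply/eqP.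
  by field; rewrite !gt_eqF ?expR_gt0.
set C := chain_cost _ _ _ _ in hc hA w0le low *.
have C0 : 0 <= C by exact: chain_cost_ge0.
have total : w 0 + E * \sum_(x <- A) w x <= 6 * 2 ^+ n * E ^+ 4 * C.
  have dE : 2 / delta = 2 * 2 ^+ n by rewrite /delta invrK.
  rewrite dE in w0le hA.
  set p := 2 ^+ n in w0le hA *; have p0 : 0 < p by exact: exprn_gt0.
  have E0 : 0 < E by exact: expR_gt0.
  have h1 : E * \sum_(x <- A) w x <= E * (2 * p * E ^+ 3 * C + E * w 0).
    by rewrite ler_wpM2l// (ltW E0).
  have h2 : E ^+ 2 * w 0 <= E ^+ 2 * (2 * p * E * C) by rewrite ler_wpM2l// exprn_ge0// (ltW E0).
  have pC : 0 <= 2 * p * C by rewrite !mulr_ge0// ltW.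
  have h3 : E <= E ^+ 4 by rewrite -[leLHS]expr1; apply: ler_weXn2l.
  have h4 : E ^+ 3 <= E ^+ 4 by apply: ler_weXn2l.
  have h5 := ler_wpM2l pC h3; have h6 := ler_wpM2l pC h4.
  move: h1 h2 h5 h6 w0le; move: (\sum_(x <- A) w x) (w 0) => SA W.
  rewrite !exprS expr0; lra.
apply: (le_trans (lerD (lexx _) le2)); apply: (le_trans total).
apply: (le_trans (ler_wpM2l (ltW k0) hc)); rewrite mulrDr lerD2l /e'.
by rewrite mulrC divfK// gt_eqF.
Qed.

End lattice_distance.

(** * Union bounds *)
Section union_bounds.
Context {R : realType} {dO : measure_display} {Omega : measurableType dO}.
Variable P : probability Omega R.

Lemma measurable_ge_set (f : Omega -> R) (c : R) : measurable_fun setT f ->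
  measurable [set w | c <= f w].
Proof.
by move=> mf; rewrite -[X in measurable X]setTI; exact: measurable_fun_le.
Qed.

Lemma measurable_le_set (f : Omega -> R) (c : R) : measurable_fun setT f ->
  measurable [set w | f w <= c].
Proof.
by move=> mf; rewrite -[X in measurable X]setTI; exact: measurable_fun_le.
Qed.

Lemma measurable_exists (J : finType) (E : J -> set Omega) : (forall j, measurable (E j)) ->
  measurable [set w | exists j, E j w].
Proof.
move=> mE; rewrite (_ : [set w | _] = \bigcup_(j in [set: J]) E j).
  by apply: fin_bigcup_measurable.
by apply/seteqP; split => w /=; [move=> [j Ej]; exists j|move=> [j _ Ej]; exists j].
Qed.

Lemma union_bound (J : finType) (E : J -> set Omega) (p : R) : (forall j, measurable (E j)) ->
  (forall j, (P (E j) <= p%:E)%E) -> (P [set w | exists j, E j w] <= (#|J|%:R * p)%:E)%E.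
Proof.
move=> mE hE.
have H (s : seq J) : measurable [set w | exists2 j, j \in s & E j w] /\
    (P [set w | exists2 j, j \in s & E j w] <= ((size s)%:R * p)%:E)%E.
  elim: s => [|j s [ms hs]].
    rewrite (_ : [set w | _] = set0); first by split => //; rewrite measure0 mul0r.
    by apply/seteqP; split => w // [].
  have -> : [set w | exists2 i, i \in j :: s & E i w] =
      E j `|` [set w | exists2 i, i \in s & E i w].
    apply/seteqP; split => w /=.
      by move=> [i]; rewrite inE => /orP[/eqP ->|si Ei]; [left|right; exists i].
    by case=> [Ej|[i si Ei]]; [exists j; rewrite ?mem_head|exists i; rewrite // inE si orbT].
  split; first exact: measurableU.
  apply: (le_trans (measureU2 _ (mE j) ms)).
  by rewrite /= -natr1 mulrDl mul1r addrC EFinD leeD.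
have [_] := H (enum J); rewrite -cardT; congr (_ <= _)%E; congr (P _).
apply/seteqP; split => w /=; first by move=> [j _ Ej]; exists j.
by move=> [j Ej]; exists j => //; rewrite mem_enum.
Qed.

Lemma exists_outside (A B : set Omega) (a b : R) : measurable A -> measurable B ->
  (a%:E <= P A)%E -> (P B <= b%:E)%E -> b < a -> exists w, A w /\ ~ B w.
Proof.
move=> mA mB aA Bb ba; apply: contrapT => h.
suff AB : A `<=` B.
  have := le_trans aA (le_trans (le_measure P (mem_set mA) (mem_set mB) AB) Bb).
  by rewrite lee_fin leNgt ba.
by move=> w Aw; apply: contrapT => Bw; apply: h; exists w.
Qed.

End union_bounds.

(** * The field *)
Section log_field.
Context {R : realType} {d : nat} {dO : measure_display} {Omega : measurableType dO}.
Local Notation V := 'rV[R]_d.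
Variable P : probability Omega R.

Record log_field (K : V -> R) (r0 : R) (W : (V * R -> R) -> {RV P >-> R})
    (h : nat -> Omega -> V -> R) : Prop := {
  lf_r0 : 0 < r0;
  lf_smooth : smooth K;
  lf_radial : radial K;
  lf_supp : forall x : V, ~ ball (0 : V) r0 x -> K x = 0;
  lf_norm : (\int[lebesgue_rV d]_x (K x ^+ 2)%:E = 1)%E;
  lf_noise : white_noise W;
  lf_field : forall n, (1 <= n)%N -> smooth_modification W K n (h n) }.

Variables (K : V -> R) (r0 : R) (W : (V * R -> R) -> {RV P >-> R}) (h : nat -> Omega -> V -> R).
Hypothesis lf : log_field K r0 W h.

Lemma ln2_gt0 : (0 : R) < ln 2. Proof. by rewrite ln_gt0 ?ltr1n. Qed.

Lemma ln_pow2 n : ln (2 ^+ n : R) = n%:R * ln 2.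
Proof. by rewrite lnXn// mulr_natl. Qed.

Lemma field_measurable n x : (1 <= n)%N -> measurable_fun setT (fun w => h n w x).
Proof. by move=> n1; have [_ hm] := lf_field lf n1; have [] := hm x. Qed.

Lemma pow2_inv_lt1 n : (1 <= n)%N -> (2 ^- n : R) < 1.
Proof. by move=> n1; rewrite invf_lt1 ?exprn_gt0// exprn_egt1// ?ltr1n// -lt0n. Qed.

Lemma field_ae n x : (1 <= n)%N ->
  {ae P, forall w, h n w x = W (band_kernel K `[2 ^- n, 1] x) w}.
Proof. by move=> n1; have [_ hm] := lf_field lf n1; rewrite -field_kernelE; have [] := hm x. Qed.

Lemma L2_field n x : (1 <= n)%N -> L2_spacetime (band_kernel K `[2 ^- n, 1] x).
Proof.
move=> n1; apply: (L2_band (lf_smooth lf) (lf_norm lf)); last exact: pow2_inv_lt1.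
exact: pow2_inv_gt0.
Qed.

(** A modification agrees almost surely, at each point, with the noise of the kernel. *)
Lemma field_family (I : finType) (x : I -> V) n : (1 <= n)%N ->
  gaussian_family P (fun i w => h n w (x i))
    (fun a => l2norm2 (combine (fun i => band_kernel K `[2 ^- n, 1] (x i)) a)).
Proof.
move=> n1; apply: (white_noise_gaussian_family (lf_noise lf)).
- by move=> i; exact: L2_field.
- by move=> i; exact: field_measurable.
- by move=> i; exact: field_ae.
Qed.

Lemma field_variance n x : (1 <= n)%N ->
  l2norm2 (band_kernel K `[2 ^- n, 1] x) = n%:R * ln 2.
Proof.
move=> n1; rewrite (l2norm2_band (lf_smooth lf) (lf_norm lf)) ?pow2_inv_gt0 ?pow2_inv_lt1//.
by rewrite ln1 sub0r lnV ?posrE ?pow2_gt0// opprK ln_pow2.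
Qed.

Let lincomb_unit (a : unit -> R) (y : unit -> R) : lincomb a y = a tt * y tt.
Proof. by rewrite /lincomb (bigD1 tt)//= big1 ?addr0; last by case. Qed.

Lemma field_tail n x t : (1 <= n)%N -> 0 <= t ->
  (P [set w | (t <= `|h n w x|)%R] <= (2 * expR (- (t ^+ 2 / (2 * (n%:R * ln 2)))))%:E)%E.
Proof.
move=> n1 t0; apply: gaussian_tail => //; first exact: field_measurable.
  move=> b; have := gaussian_family_expR (fun j => (j == tt)%:R) b (field_family (fun _ : unit => x) n1).
  rewrite combine_delta field_variance// => <-.
  rewrite le_eqVlt; apply/orP; left; apply/eqP; apply: eq_integral => w _.
  by rewrite lincomb_unit eqxx mul1r.
by rewrite mulr_gt0 ?ln2_gt0// ltr0n.
Qed.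

(** The squared [L^2] distance of the kernels at [x] and [y] is at most [C * (2^n * |x - y|)^2]:
    the smallest scale [2^-n] is the least regular. *)
Lemma field_increment_tail : exists2 C : R, 0 < C & forall n x y t, (1 <= n)%N -> 0 <= t -> x != y ->
  (P [set w | (t <= `|h n w x - h n w y|)%R] <=
    (2 * expR (- (t ^+ 2 / (2 * (C * `|x - y| ^+ 2 * (2 ^+ n) ^+ 2)))))%:E)%E.
Proof.
have [C C0 hC] := l2norm2_band_diff (lf_r0 lf) (lf_smooth lf) (lf_supp lf).
exists (C + 1); first by rewrite ltr_wpDl.
move=> n x y t n1 t0 xy.
have xy0 : 0 < `|x - y| by rewrite normr_gt0 subr_eq0.
apply: gaussian_tail => //; first by apply: measurable_funB; exact: field_measurable.
  move=> b; pose p (k : bool) := if k then x else y.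
  pose a (k : bool) : R := if k then 1 else -1.
  have := gaussian_family_expR a b (field_family p n1).
  have -> : combine (fun i => band_kernel K `[2 ^- n, 1] (p i)) a =
      (fun z => band_kernel K `[2 ^- n, 1] x z - band_kernel K `[2 ^- n, 1] y z).
    by apply/funext => z; rewrite /combine big_bool/= mul1r mulN1r.
  move=> E; apply: (@le_trans _ _ (\int[P]_w (expR (b * lincomb a (fun i => h n w (p i))))%:E)%E).
    rewrite le_eqVlt; apply/orP; left; apply/eqP; apply: eq_integral => w _.
    by rewrite /lincomb big_bool/= mul1r mulN1r.
  rewrite E lee_fin ler_expR ler_wpM2r// ler_wpM2l ?sqr_ge0//.
  apply: (le_trans (hC _ _ _ _ (pow2_inv_gt0 n) (pow2_inv_lt1 n1))).
  rewrite exprVn invrK; apply: ler_wpM2r; first by rewrite sqr_ge0.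
  by apply: ler_wpM2r; rewrite ?sqr_ge0// lerDl.
by rewrite !mulr_gt0 ?exprn_gt0// ltr_wpDl.
Qed.

End log_field.

(** * Oscillation of the field below its smallest scale *)
(** The increments are controlled along the refinements of the lattice of scale [2^-n]. At level
    [k] the standard deviation is of order [2^-k], and the threshold [a * (3/4)^k] is summable
    but exceeds it by the factor [(3/2)^k], which compensates for the [2^(O(n + k))] pairs of
    neighbouring sites. *)
Section chaining.
Context {R : realType} {d : nat}.
Local Notation V := 'rV[R]_d.
Variables (g : V -> R) (n : nat) (a : R).
Hypotheses (cg : continuous g) (a0 : 0 <= a).
Let U : set V := ball (0 : V) 2.
Hypothesis small : forall k u v, in_box (2 ^ (n + k)) u -> in_box (2 ^ (n + k)) v -> king u v ->
  `|g (dyadic_point (n + k) u) - g (dyadic_point (n + k) v)| <= a * (3 / 4) ^+ k.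

Let level (x : V) k := g (dyadic_point (n + k) (site_of (n + k) x)).

Let level_diff x k : U x -> `|level x k - level x 0| <= 3 * a * (1 - (3 / 4) ^+ k).
Proof.
move=> Ux; elim: k => [|k IH]; first by rewrite subrr normr0 expr0 subrr mulr0.
have step : `|level x k.+1 - level x k| <= a * (3 / 4) ^+ k.+1.
  rewrite /level -[X in _ - g X]dyadic_point_double addnS -addnS; apply: small.
  - by rewrite addnS; exact: site_of_box.
  - have /forallP h := site_of_box (n + k) Ux; apply/forallP => i; rewrite ffunE addnS expnS.
    by have := h i; rewrite !ltr_norml => /andP[h1 h2]; lia.
  - by rewrite addnS; exact: site_of_refine.
have -> : level x k.+1 - level x 0 = (level x k.+1 - level x k) + (level x k - level x 0).
  by rewrite addrA subrK.
apply: (le_trans (ler_normD _ _)); move: step IH; rewrite exprS.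
by move: (_ ^+ k : R) `|level x k.+1 - _| `|level x k - _| => q A B; lra.
Qed.

(** Two errors [3 * a] come from the chains of refinements towards [x] and [y], and one more [a]
    from their roundings at the coarsest level, which are neighbours. *)
Lemma chaining_bound x y : U x -> U y -> `|y - x| <= 2 ^- n -> `|g y - g x| <= 7 * a.
Proof.
have lim z : U z -> `|g z - level z 0| <= 3 * a.
  move=> Uz; apply/ler_addgt0Pr => e e0.
  have /cvgrPdist_lt/(_ _ e0)/nbhs_ballP[r /= rp hr] := @cg z.
  have [k hk] : exists k, 2 ^- (n + k) < r.
    exists (Num.truncn r^-1); rewrite invf_plt ?posrE ?exprn_gt0//.
    apply: (lt_le_trans (truncnS_gt _)); rewrite -natrX ler_nat.
    by apply: (leq_trans (ltn_expl _ (isT : 1 < 2)%N)); rewrite leq_exp2l// leq_addl.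
  have h1 : `|g z - level z k| < e.
    apply: hr; rewrite -ball_normE/= distrC; apply: le_lt_trans hk; exact: site_of_dist.
  have h2 := level_diff k Uz.
  have -> : g z - level z 0 = (g z - level z k) + (level z k - level z 0) by rewrite addrA subrK.
  apply: (le_trans (ler_normD _ _)); rewrite addrC; apply: lerD; last exact: ltW.
  apply: (le_trans h2); rewrite ler_piMr ?mulr_ge0// lerBlDr lerDl exprn_ge0//.
move=> Ux Uy xy; have hx := lim _ Ux; have hy := lim _ Uy.
have h0 : `|level y 0 - level x 0| <= a.
  rewrite -[leRHS]mulr1 -(expr0 (3 / 4)); apply: small.
  - exact: site_of_box.
  - exact: site_of_box.
  - by rewrite addn0; exact: site_of_king.
move: hx hy h0; rewrite !ler_norml => /andP[? ?] /andP[? ?] /andP[? ?]; apply/andP; split; lra.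
Qed.

End chaining.

Section oscillation.
Context {R : realType} {d : nat} {dO : measure_display} {Omega : measurableType dO}.
Local Notation V := 'rV[R]_d.
Variable P : probability Omega R.
Variables (K : V -> R) (r0 : R) (W : (V * R -> R) -> {RV P >-> R}) (h : nat -> Omega -> V -> R).
Hypothesis lf : log_field K r0 W h.

Lemma expR_ln2 (q : nat) : expR (- (q%:R * ln 2)) = 2 ^- q :> R.
Proof. by rewrite expRN -ln_pow2 lnK// posrE pow2_gt0. Qed.

Lemma card_box N : (0 < N)%N -> (#|{: box d N}| <= (4 * N) ^ d)%N.
Proof. move=> N0; rewrite card_ffun !card_ord; have [->|d0] := posnP d; first by rewrite !expn0.
by rewrite leq_exp2r// leq_pred. Qed.

Let nat_ineq (n k : nat) : (1 <= n)%N ->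
  ((n + k + 2) * (2 * d) + 1 + (n + k + 5) <= (6 * d + 7) * (n + k))%N.
Proof. by move=> n1; nia. Qed.

Let rate (n k : nat) : (1 <= n)%N -> (n + k)%:R <= n%:R * (9 / 4) ^+ k :> R.
Proof.
move=> n1; apply: (@le_trans _ _ (n%:R * (1 + k%:R))).
  by rewrite -[1 + _]addrC natr1 -natrM ler_nat; nia.
rewrite ler_wpM2l//; elim: k => [|k IH]; first by rewrite expr0 addr0.
rewrite exprS -natr1; have : (1 : R) <= (9 / 4) ^+ k by rewrite exprn_ege1//; lra.
move: IH; move: (_ ^+ k) => q; lra.
Qed.

Lemma field_oscillation : exists2 B : R, 0 < B & forall n, (1 <= n)%N -> exists Bad : set Omega,
  [/\ measurable Bad, (P Bad <= (2 ^- n / 16)%:E)%E &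
    forall w, ~ Bad w -> forall x y, ball (0 : V) 2 x -> ball (0 : V) 2 y -> `|y - x| <= 2 ^- n ->
      `|h n w y - h n w x| <= B * Num.sqrt n%:R].
Proof.
have [C C0 tail] := field_increment_tail lf.
(* Each of the at most [2^((n + k + 2) * 2 * d)] pairs fails with probability at most
   [2 * 2^-((6 * d + 7) * (n + k))]; the exponent leaves room to sum over [k]. *)
pose beta : R := (6 * d + 7)%:R * ln 2.
have beta0 : 0 < beta by rewrite mulr_gt0 ?ln2_gt0// ltr0n addn_gt0 orbT.
pose b := Num.sqrt (2 * C * beta).
have b0 : 0 < b by rewrite sqrtr_gt0 mulr_gt0// mulr_gt0.
exists (7 * b); first by rewrite mulr_gt0.
move=> n n1; pose a := b * Num.sqrt n%:R.
have a0 : 0 <= a by rewrite mulr_ge0// ltW.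
pose t k := a * (3 / 4) ^+ k.
have t0 k : 0 <= t k by rewrite mulr_ge0// exprn_ge0//; lra.
pose pt k (f : box d (2 ^ (n + k))) : V := dyadic_point (n + k) (box_site f).
pose E k (fg : box d (2 ^ (n + k)) * box d (2 ^ (n + k))) : set Omega :=
  if king (box_site fg.1) (box_site fg.2) && (pt k fg.1 != pt k fg.2) then
    [set w | t k <= `|h n w (pt k fg.1) - h n w (pt k fg.2)|] else set0.
have mE k fg : measurable (E k fg).
  rewrite /E; case: ifP => // _; apply: measurable_ge_set.
  apply: (measurableT_comp (@normr_measurable R setT)).
  by apply: measurable_funB; exact: (field_measurable lf).
have PE k fg : (P (E k fg) <= (2 * 2 ^- ((6 * d + 7) * (n + k)))%:E)%E.
  rewrite /E; case: ifPn => [/andP[kfg ne]|_]; last first.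
    by rewrite measure0 lee_fin mulr_ge0// ltW// pow2_inv_gt0.
  apply: (le_trans (tail n _ _ _ n1 (t0 k) ne)); rewrite lee_fin ler_pM2l//.
  rewrite -expR_ln2 ler_expR lerN2 natrM mulrAC -/beta.
  set D := `|_ - _|; have D0 : 0 < D by rewrite normr_gt0 subr_eq0.
  have Dk : D <= 2 ^- (n + k) by exact: king_dist.
  have v0 : 0 < C * D ^+ 2 * (2 ^+ n) ^+ 2 by rewrite !mulr_gt0 ?exprn_gt0.
  rewrite ler_pdivlMr ?mulr_gt0//.
  have p0 := @pow2_gt0 R n; have q0 := @pow2_gt0 R k.
  have E1 : t k ^+ 2 = 2 * C * beta * n%:R * ((3 / 4) ^+ k) ^+ 2.
    have cb : 0 <= 2 * C * beta by rewrite ltW// mulr_gt0// mulr_gt0.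
    by rewrite /t /a /b !exprMn !sqr_sqrtr.
  have D2 : D * 2 ^+ n <= 2 ^- k.
    by rewrite -ler_pdivlMr// -invfM -exprD addnC.
  have D3 : (D * 2 ^+ n) ^+ 2 <= (2 ^- k) ^+ 2.
    by rewrite lerXn2r ?nnegrE ?mulr_ge0 ?(ltW D0) ?(ltW p0) ?invr_ge0 ?(ltW q0).
  rewrite E1 -mulrA -exprMn.
  apply: (@le_trans _ _ (beta * (n%:R * (9 / 4) ^+ k) * (2 * (C * (2 ^- k) ^+ 2)))).
    apply: ler_pM.
    - by apply: mulr_ge0 => //; exact: ltW.
    - by apply: mulr_ge0 => //; apply: mulr_ge0; [exact: ltW|exact: sqr_ge0].
    - by rewrite ler_pM2l//; exact: rate.
    - by rewrite ler_pM2l// ler_pM2l.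
  rewrite le_eqVlt; apply/orP; left; apply/eqP.
  have -> : (9 / 4 : R) ^+ k = (3 / 2) ^+ k ^+ 2 by rewrite -exprM mulnC exprM; congr (_ ^+ k); field.
  have -> : (3 / 4 : R) ^+ k = (3 / 2) ^+ k * 2 ^- k by rewrite -exprVn -exprMn; congr (_ ^+ k); field.
  ring.
pose F k := [set w | exists fg, E k fg w].
have mF k : measurable (F k) by exact: measurable_exists.
have PF k : (P (F k) <= (2 ^- n / 16 / (2 ^ k.+1)%:R)%:E)%E.
  apply: (le_trans (union_bound (mE k) (PE k))); rewrite lee_fin.
  have N0 : (0 < 2 ^ (n + k))%N by rewrite expn_gt0.
  have cnt : (#|{: box d (2 ^ (n + k)) * box d (2 ^ (n + k))}| <= 2 ^ ((n + k + 2) * (2 * d)))%N.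
    rewrite card_prod -[X in (_ <= X)%N](_ : (4 * 2 ^ (n + k)) ^ d * (4 * 2 ^ (n + k)) ^ d = _)%N.
      by apply: leq_mul; exact: card_box.
    by rewrite -expnD -(expnD 2 2) -expnM; congr (2 ^ _)%N; lia.
  apply: (@le_trans _ _ ((2 ^ ((n + k + 2) * (2 * d)))%:R * (2 * 2 ^- ((6 * d + 7) * (n + k))))).
    by rewrite ler_wpM2r ?ler_nat// mulr_ge0// ltW// pow2_inv_gt0.
  have -> : 2 ^- n / 16 / (2 ^ k.+1)%:R = 2 ^- (n + k + 5) :> R.
    have -> : (n + k + 5)%N = (n + 4 + k.+1)%N by lia.
    have -> : 16 = 2 ^+ 4 :> R by rewrite -natrX.
    by rewrite natrX !exprD !invfM.
  rewrite natrX mulrA -exprSr ler_pdivrMr ?pow2_gt0// mulrC ler_pdivlMr ?pow2_gt0// -exprD.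
  apply: ler_weXn2l; first by rewrite ler1n.
  by have := nat_ineq k n1; lia.
exists (\bigcup_k F k); split.
- exact: bigcupT_measurable.
- apply: (@le_trans _ _ (\sum_(0 <= k <oo) P (F k))%E).
    by apply: measure_sigma_subadditive => //; exact: bigcupT_measurable.
  apply: le_trans (epsilon_trick0 xpredT _); last by rewrite divr_ge0// ltW// pow2_inv_gt0.
  by apply: lee_nneseries => // k _; exact: PF.
move=> w nb x y Ux Uy xy.
suff : `|h n w y - h n w x| <= 7 * a by rewrite /a mulrA.
have ch : continuous (h n w) by have [hs _] := lf_field lf n1; have [] := hs w [::].
have CB := @chaining_bound R d (h n w) n a ch a0.
apply: CB => //.
move=> k u v uN vN uv.
have [f fu] := box_siteP uN; have [g gv] := box_siteP vN.
have [->|ne] := eqVneq (dyadic_point (n + k) u : V) (dyadic_point (n + k) v).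
  by rewrite subrr normr0 t0.
apply: ltW; rewrite ltNge; apply/negP => bad; apply: nb; exists k => //; exists (f, g).
by rewrite /E/= /pt/= fu gv uv ne.
Qed.

End oscillation.

(** * Replacing a coarse path by a fine one *)
(** The lattice is refined [M] times, and the field on the fine lattice is [f + H], where at
    fine sites within [r] coarse steps of a coarse site [v] the function [H] exceeds [g v] by at
    most [r * s].
    [G w j] says that the coarse edge from [w] in direction [j] has a fine path that is cheap
    for [f] alone. *)
Section detour.
Context {R : realType} {d : nat}.
Variables (xi s B : R) (i0 i1 : 'I_d) (N M rad : nat) (f H g : site d -> R).
Variable G : site d -> 'I_d -> Prop.
Hypotheses (xi0 : 0 <= xi) (s0 : 0 <= s) (B0 : 0 <= B) (i01 : i0 != i1) (M0 : (0 < M)%N).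
Hypothesis radN : (rad + 4 <= N)%N.
Let F (u : site d) := expR (xi * f u).
Let coarse (w : site d) : site d := [ffun k => M%:Z * w k].
Hypothesis good : forall w j, G w j ->
  good_edge (fun u => forall k, `|u k - M%:Z * w k| <= (2 * M)%:Z) F M B w j.
Hypothesis osc : forall v u (r : nat), in_box N v -> in_box (N * M) u ->
  (forall k, `|u k - M%:Z * v k| <= (r * M)%:Z) -> H u <= g v + r%:R * s.

Definition near_site (v w : site d) := forall i, v i - 1 <= w i <= v i + rad.+1%:Z.

(** Inside such a slab a walk can move cheaply in all directions but [k]. *)
Definition clear_slab k (v : site d) (a : nat) := forall w j,
  near_site v w -> w k = v k + a%:Z -> j != k -> G w j.

Let L : int := (2 * N)%:Z - (rad + 4)%:Z.
Hypothesis nice : forall v : site d, (forall i, `|v i| <= L) ->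
  forall k, exists2 a : nat, (a <= rad)%N & clear_slab k v a.
Hypothesis start_clear : forall w j, near_site (axis_site i0 0) w -> G w j.
Hypothesis end_clear : forall w j, near_site (axis_site i0 N) w -> G w j.

(* Coarse sites near the boundary are moved inwards, so that the slabs near them and the fine
   paths stay in the box. *)
Let clamp (v : site d) : site d := [ffun i => Num.max (- L) (Num.min L (v i))].

Let clampL v i : `|clamp v i| <= L.
Proof. by rewrite ffunE ler_norml; apply/andP; split; rewrite /L; lia. Qed.

Let clamp_dist v i : in_box N v -> `|clamp v i - v i| <= (rad + 3)%:Z.
Proof.
move=> /forallP/(_ i); rewrite ffunE ltr_norml ler_norml /L => /andP[h1 h2].
by apply/andP; split; lia.
Qed.

Let clamp_king u v i : king u v -> `|clamp u i - clamp v i| <= 1.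
Proof.
move=> /forallP/(_ i); rewrite !ffunE !ler_norml => /andP[h1 h2].
by apply/andP; split; lia.
Qed.

Let clamp_axis k : (k <= N)%N -> clamp (axis_site i0 k) = axis_site i0 k.
Proof. by move=> kN; apply/ffunP => i; rewrite !ffunE /L; case: ifP => _; lia. Qed.

Let axis_box k : (k <= N)%N -> in_box N (axis_site i0 k).
Proof. by move=> kN; apply/forallP => i; rewrite ffunE; case: ifP => _; lia. Qed.

(* [rad + 3] for clamping, [rad + 2] for the detour and 2 for the extent of the fine paths,
   with some room to spare. *)
Let RR := (2 * rad + 10)%N.
Let Reg (v u : site d) := in_box (N * M) u /\ forall k, `|u k - M%:Z * v k| <= (RR * M)%:Z.

Let region (v w u : site d) : in_box N v -> (forall i, `|w i - clamp v i| <= (rad + 2)%:Z) ->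
  (forall i, `|w i| <= (2 * N)%:Z - 3) -> (forall k, `|u k - M%:Z * w k| <= (2 * M)%:Z) -> Reg v u.
Proof.
move=> vN wv wN uw.
have M1 : 0 < M%:Z by lia.
split.
  apply/forallP => k; have h1 := uw k; have h2 := wN k.
  have : `|M%:Z * w k| <= M%:Z * ((2 * N)%:Z - 3) by rewrite normrM ger0_norm ?ler_pM2l//; lia.
  have h3 : M%:Z * ((2 * N)%:Z - 3) = (2 * (N * M))%:Z - (3 * M)%:Z by rewrite !PoszM; ring.
  rewrite h3; move: h1; move: (M%:Z * w k) => y.
  rewrite ler_norml => /andP[a1 a2]; rewrite ler_norml => /andP[a3 a4]; rewrite ltr_norml.
  by apply/andP; split; lia.
move=> k; have h1 := uw k.
have h2 : `|w k - v k| <= (2 * rad + 5)%:Z.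
  by have := wv k; have := clamp_dist k vN; rewrite !ler_norml => /andP[a1 a2] /andP[a3 a4];
   apply/andP; split; lia.
have : `|M%:Z * (w k - v k)| <= M%:Z * (2 * rad + 5)%:Z by rewrite normrM ger0_norm ?ler_pM2l//; lia.
rewrite mulrBr -PoszM; move: h1; move: (M%:Z * w k) (M%:Z * v k) => y z.
rewrite !ler_norml => /andP[a1 a2] /andP[a3 a4].
have E : (RR * M = 2 * M + M * (2 * rad + 5) + 3 * M)%N by rewrite /RR; lia.
by rewrite E; apply/andP; split; lia.
Qed.

(* A coordinate of a walk between two points, each close to one of the neighbours [p], [p'],
   remains close to both. *)
Let between (p p' q q' e e' w : int) (r : nat) : `|p - p'| <= 1 ->
  p <= q <= p + r%:Z -> p' <= q' <= p' + r%:Z -> (e = q \/ e = q') -> (e' = q \/ e' = q') ->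
  Num.min e e' <= w <= Num.max e e' ->
  [/\ p - 1 <= w <= p + r.+1%:Z, p' - 1 <= w <= p' + r.+1%:Z & `|e - e'| <= r.+1%:Z].
Proof.
clear; rewrite !ler_norml => /andP[a1 a2] /andP[a3 a4] /andP[a5 a6] he he' /andP[a7 a8].
by split; apply/andP; split; lia.
Qed.

Let near_refl v : near_site v v.
Proof. by clear; move=> i; apply/andP; split; lia. Qed.

Let good_edge_sub (P P' : site d -> Prop) w j : (forall u, P u -> P' u) ->
  good_edge P F M B w j -> good_edge P' F M B w j.
Proof. by move=> PP [sq [h1 h2 h3 h4]]; exists sq; split => // u /h3 /PP. Qed.

Let near_good v v' w j : in_box N v -> king v v' -> near_site (clamp v') w -> G w j ->
  good_edge (Reg v) F M B w j.
Proof.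
move=> vN vv nw Gw; apply: good_edge_sub (good Gw) => u uw.
apply: region uw => // i.
  have := nw i; have := clamp_king i vv; rewrite !ler_norml => /andP[a1 a2] /andP[a3 a4].
  by apply/andP; split; lia.
have := nw i; have := clampL v' i; rewrite /L !ler_norml => /andP[a1 a2] /andP[a3 a4].
by apply/andP; split; lia.
Qed.

Let start_reg v w : in_box N v -> near_site (clamp v) w -> Reg v (coarse w).
Proof.
move=> vN nw; apply: (@region v w) => // i.
- by have := nw i; rewrite !ler_norml => /andP[a3 a4]; apply/andP; split; lia.
- have := nw i; have := clampL v i; rewrite /L !ler_norml => /andP[a1 a2] /andP[a3 a4].
  by apply/andP; split; lia.
- by rewrite ffunE subrr normr0.
Qed.

Let Psi (u : site d) := expR (xi * (f u + H u)).

(** Throughout the region attached to [v] the coarse field is comparable to its value at [v]. *)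
Let link_field v a b c : in_box N v -> link (Reg v) F a b c ->
  link (fun u => is_true (in_box (N * M) u)) Psi a b (c * expR (xi * (g v + RR%:R * s))).
Proof.
move=> vN [sq [h1 h2 h3 h4]]; exists sq; split => // [u /h3[]//|].
apply: (@le_trans _ _ (\sum_(u <- sq) F u * expR (xi * (g v + RR%:R * s)))); last first.
  by rewrite -mulr_suml ler_wpM2r// expR_ge0.
rewrite big_seq [leRHS]big_seq; apply: ler_sum => u us.
have [uN uv] : Reg v u by apply: h3; rewrite inE us orbT.
by rewrite /Psi mulrDr expRD ler_wpM2l ?expR_ge0// ler_expR ler_wpM2l//; exact: osc.
Qed.

Let l1dist_le (a b : site d) (r : nat) : (forall i, `|a i - b i| <= r%:Z) -> (l1dist a b <= d * r)%N.
Proof.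
move=> ab; apply: (@leq_trans (\sum_(i < d) r)%N); last by rewrite sum_nat_const card_ord.
by apply: leq_sum => i _; have := ab i; lia.
Qed.

Let route_link (a b : site d) P (r : nat) : (forall i, `|a i - b i| <= r%:Z) ->
  link P F (coarse a) (coarse b) ((l1dist a b)%:R * B) ->
  link P F (coarse a) (coarse b) ((d * r)%:R * B).
Proof. by move=> ab; apply: link_le; rewrite ler_wpM2r// ler_nat; exact: l1dist_le. Qed.

(** To each coarse site [v] of an optimal path a hub [c v] nearby is attached, which lies on a
    clear slab orthogonal to [i0] and on a clear slab orthogonal to [i1]. From the hub of [v]
    one reaches the hub of the next site [v'] along cheap edges: first all coordinates but [i0]
    are adjusted inside the [i0]-slab of [v]; the point [e] so reached lies on the [i1]-slab of
    [v'], in which the coordinate [i0] can then be adjusted. This is where two dimensions are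
    needed. The coarse field costs a factor [exp (xi * (g v + RR * s))] on each stretch, and
    the sum of [exp (xi * g v)] over the path is the coarse cost. *)
Theorem detour : crossing xi i0 (N * M) (fun u => f u + H u) <=
  (4 * d * (rad + 2))%:R * B * expR (xi * (RR%:R * s)) * crossing xi i0 N g.
Proof.
have [al hal] : {al : site d -> 'I_d -> nat & forall v k, (al v k <= rad)%N /\ clear_slab k (clamp v) (al v k)}.
  have /choice[al h] : forall vk : site d * 'I_d, exists a : nat, (a <= rad)%N /\ clear_slab vk.2 (clamp vk.1) a.
    by move=> [v k]; have [a a1 a2] := nice (clampL v) k; exists a.
  by exists (fun v k => al (v, k)) => v k; exact: (h (v, k)).
pose c v : site d := [ffun i => clamp v i + (if i == i0 then (al v i0)%:Z else
  if i == i1 then (al v i1)%:Z else 0)].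
have cE v : [/\ c v i0 = clamp v i0 + (al v i0)%:Z, c v i1 = clamp v i1 + (al v i1)%:Z &
    forall i, clamp v i <= c v i <= clamp v i + rad%:Z].
  have [h0 _] := hal v i0; have [h1 _] := hal v i1.
  split; rewrite ?[c v _]ffunE ?eqxx//.
    by rewrite (negbTE (_ : i1 != i0)) // eq_sym.
  by move=> i; rewrite [c v i]ffunE; case: ifP => _; [lia|case: ifP => _; lia].
have c_near v : near_site (clamp v) (c v).
  by move=> i; have [_ _ /(_ i) /andP[a b]] := cE v; apply/andP; split; lia.
set D := (d * rad.+1)%:R * B.
have D0 : 0 <= D by rewrite mulr_ge0.
set Y := expR (xi * (RR%:R * s)).
have step v v' : in_box N v -> in_box N v' -> king v v' ->
    link (fun u => is_true (in_box (N * M) u)) Psi (coarse (c v)) (coarse (c v')) (2 * D * Y * expR (xi * g v)).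
  move=> vN v'N vv.
  have -> : 2 * D * Y * expR (xi * g v) = (D + D) * expR (xi * (g v + RR%:R * s)).
    by rewrite mulrDr expRD /Y; ring.
  apply: link_field => //.
  have [h1 h2 h3] := cE v; have [k1 k2 k3] := cE v'.
  have [_ slab0] := hal v i0; have [_ slab1] := hal v' i1.
  (* The corner between the two slabs. *)
  pose e : site d := [ffun i => if i == i0 then c v i0 else c v' i].
  have eE i : e i = c v i \/ e i = c v' i by rewrite [e i]ffunE; case: eqP => [->|_]; [left|right].
  have btw i x y z := @between _ _ _ _ x y z rad (clamp_king i vv) (h3 i) (k3 i).
  have mm (x y : int) : Num.min x y <= x <= Num.max x y by rewrite ge_min le_max lexx.
  have e_dist i : `|c v i - e i| <= rad.+1%:Z /\ `|e i - c v' i| <= rad.+1%:Z.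
    split; first by have [] := btw i (c v i) (e i) (c v i) (or_introl erefl) (eE i) (mm _ _).
    by have [] := btw i (e i) (c v' i) (e i) (eE i) (or_intror erefl) (mm _ _).
  apply: (@link_trans _ _ _ _ _ (coarse e)).
    apply: route_link; first by move=> i; have [] := e_dist i.
    apply: axis_route => //; first by move=> u; exact: expR_ge0.
      by apply: start_reg => //; exact: c_near.
    move=> w j hw _ jne.
    have nw : near_site (clamp v) w.
      by move=> i; have [] := btw i _ _ _ (or_introl erefl) (eE i) (hw i).
    apply: (near_good vN (king_refl v) nw); apply: slab0 => //.
      by move: (hw i0); rewrite [e i0]ffunE eqxx h1; clear; lia.
    by apply: contra_neq jne => ->; rewrite [e i0]ffunE eqxx.
  apply: route_link; first by move=> i; have [] := e_dist i.
  apply: axis_route => //; first by move=> u; exact: expR_ge0.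
    have ne : near_site (clamp v) e.
      by move=> i; have [] := btw i _ _ _ (eE i) (eE i) (mm _ _).
    exact: start_reg.
  move=> w j hw _ jne.
  have j0 : j = i0 by apply/eqP; apply: contraNT jne => j0; rewrite [e j]ffunE (negbTE j0) eqxx.
  have nw : near_site (clamp v') w.
    by move=> i; have [] := btw i _ _ _ (eE i) (or_intror erefl) (hw i).
  apply: (near_good vN vv nw); apply: slab1 => //.
    have := hw i1; rewrite [e i1]ffunE (negbTE (_ : i1 != i0)) 1?eq_sym// k2 => h; clear -h; lia.
  by rewrite j0.
have ends k : (k <= N)%N -> (forall w j, near_site (axis_site i0 k) w -> G w j) ->
    link (Reg (axis_site i0 k)) F (coarse (axis_site i0 k)) (coarse (c (axis_site i0 k))) D /\
    link (Reg (axis_site i0 k)) F (coarse (c (axis_site i0 k))) (coarse (axis_site i0 k)) D.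
  move=> kN clear; have cl := clamp_axis kN; have aN := axis_box kN.
  have [h1 h2 h3] := cE (axis_site i0 k).
  have nn : near_site (clamp (axis_site i0 k)) (axis_site i0 k).
    by move=> i; rewrite cl; apply/andP; split; lia.
  split; (apply: route_link; first by move=> i; have := h3 i; rewrite cl ler_norml => /andP[a1 a2]; apply/andP; split; lia);
    (apply: axis_route => //; first by move=> u; exact: expR_ge0).
  - exact: start_reg.
  - move=> w j hw _ _; have nw : near_site (axis_site i0 k) w.
      by move=> i; have := hw i; have := h3 i; rewrite cl => /andP[a1 a2] /andP[a3 a4]; apply/andP; split; lia.
    by apply: (near_good aN (king_refl _)); rewrite ?cl//; exact: clear.
  - by apply: start_reg => //; exact: c_near.
  - move=> w j hw _ _; have nw : near_site (axis_site i0 k) w.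
      by move=> i; have := hw i; have := h3 i; rewrite cl => /andP[a1 a2] /andP[a3 a4]; apply/andP; split; lia.
    by apply: (near_good aN (king_refl _)); rewrite ?cl//; exact: clear.
have [sq [/and3P[ps /eqP ls bs] us hs]] := crossing_attained xi i0 (leq_trans (ltn0Sn _) (leq_trans (leq_addl rad 4) radN) : (0 < N)%N) g.
set z0 := axis_site i0 0 in ps ls bs us hs *; set zN := axis_site i0 N in ls *.
have chain (z : site d) (t : seq (site d)) : path (@king d) z t -> all (in_box N) (z :: t) ->
    link (fun u => is_true (in_box (N * M) u)) Psi (coarse (c z)) (coarse (c (last z t)))
      (2 * D * Y * \sum_(v <- belast z t) expR (xi * g v)).
  elim: t z => [|v t IH] z /=.
    move=> _ /andP[zb _]; rewrite big_nil mulr0; apply: link_refl.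
    by have [] := start_reg zb (@c_near z).
  move=> /andP[zv pt] /and3P[zb vb tb]; rewrite big_cons mulrDr; apply: link_trans.
    exact: step zv.
  by apply: IH => //=; rewrite vb.
have [st _] := ends 0%N (leq0n _) start_clear; have [_ en] := ends N (leqnn _) end_clear.
have st' := link_field (axis_box (leq0n _)) st; have en' := link_field (axis_box (leqnn _)) en.
have ch := chain _ _ ps bs; rewrite ls in ch.
have [sq' [p1 p2 p3 p4]] := link_trans (link_trans st' ch) en'.
have co0 : coarse z0 = axis_site i0 0 by apply/ffunP => i; rewrite !ffunE; case: ifP; rewrite mulr0.
have coN : coarse zN = axis_site i0 (N * M).
  by apply/ffunP => i; rewrite !ffunE; case: ifP => _; rewrite ?mulr0// PoszM mulrC.
rewrite co0 in p1 p2 p3; rewrite coN in p2.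
have kp : king_path (N * M) (axis_site i0 0) (axis_site i0 (N * M)) sq'.
  by apply/and3P; split => //; [exact/eqP|apply/allP => u /p3].
apply: (le_trans (crossing_le xi _ kp)); rewrite /sites_cost big_cons.
(* The starting point is part of a cheap edge, which pays for it. *)
have start_cost : expR (xi * (f (axis_site i0 0) + H (axis_site i0 0))) <= B * (Y * expR (xi * g z0)).
  have [sq2 [_ _ q3 q4]] : good_edge (Reg z0) F M B z0 i1.
    apply: (near_good (axis_box (leq0n _)) (king_refl z0)).
      by rewrite clamp_axis//; exact: near_refl.
    by apply: start_clear; exact: near_refl.
  have [bz rz] : Reg z0 (axis_site i0 0).
    by rewrite -co0; apply: q3; rewrite mem_head.
  rewrite mulrDr expRD; apply: ler_pM; rewrite ?expR_ge0//.
    apply: le_trans q4; rewrite big_cons -/(coarse z0) co0 lerDl.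
    by apply: sumr_ge0 => u _; exact: expR_ge0.
  by rewrite /Y -expRD -mulrDr ler_expR ler_wpM2l// addrC; apply: osc => //; exact: axis_box.
set S := \sum_(u <- z0 :: sq) expR (xi * g u).
have S0 : 0 <= S by apply: sumr_ge0 => u _; exact: expR_ge0.
have z0S : expR (xi * g z0) <= S.
  by rewrite /S big_cons lerDl sumr_ge0// => u _; exact: expR_ge0.
have zNS : expR (xi * g zN) <= S.
  rewrite /S -ls (big_rem (last z0 sq) (mem_last _ _))/= lerDl.
  by apply: sumr_ge0 => u _; exact: expR_ge0.
have bS : \sum_(v <- belast z0 sq) expR (xi * g v) <= S.
  by rewrite /S lastI -cats1 big_cat/= lerDl sumr_ge0// => u _; exact: expR_ge0.
have Y0 : 0 <= Y by exact: expR_ge0.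
have X1 z : expR (xi * g z) <= S -> D * expR (xi * (g z + RR%:R * s)) <= D * (Y * S).
  by move=> zS; rewrite mulrDr expRD ler_wpM2l// mulrC ler_wpM2l.
apply: (@le_trans _ _ ((B + 4 * D) * (Y * S))).
  apply: (le_trans (lerD start_cost p4)).
  have := X1 _ z0S; have := X1 _ zNS.
  have : B * (Y * expR (xi * g z0)) <= B * (Y * S) by rewrite ler_wpM2l// ler_wpM2l.
  have : 2 * D * Y * \sum_(v <- belast z0 sq) expR (xi * g v) <= 2 * (D * (Y * S)).
    have := ler_wpM2l D0 (ler_wpM2l Y0 bS).
    rewrite (_ : 2 * D * Y * _ = 2 * (D * (Y * \sum_(v <- belast z0 sq) expR (xi * g v)))); last by rewrite !mulrA.
    by move: (D * (Y * \sum_(_ <- _) _)) (D * (Y * S)) => q1 q2; lra.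
  have -> : (B + 4 * D) * (Y * S) = B * (Y * S) + 4 * (D * (Y * S)) by ring.
  move: (D * (Y * S)) (B * (Y * S)) (D * _) (D * _) (B * _) (_ * D * Y * _) => q1 q2 q3 q5 q6 q7; lra.
have d0 : (0 < d)%N by case: d i0 => // -[].
rewrite -[in leRHS]mulrA; apply: ler_pM.
- by rewrite addr_ge0// mulr_ge0.
- exact: mulr_ge0.
- rewrite /D mulrA -natrM -[X in X + _]mul1r -mulrDl ler_wpM2r// -[1]/(1%:R) -natrD ler_nat.
  have -> : (rad + 2 = rad.+1 + 1)%N by rewrite addn2 addn1.
  by rewrite mulnDr muln1 mulnA addnC leq_add2l muln_gt0.
- by rewrite ler_wpM2l.
Qed.

End detour.

(** * The crossing costs of the field *)
Lemma measurable_gt_set {R : realType} {dO : measure_display} {Omega : measurableType dO}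
  (f : Omega -> R) (c : R) : measurable_fun setT f -> measurable [set w | c < f w].
Proof.
move=> mf; rewrite (_ : [set w | _] = ~` [set w | f w <= c]).
  by apply: measurableC; exact: measurable_le_set.
by apply/seteqP; split => w /=; [move=> /lt_geF ->|move=> /negP; rewrite -ltNge].
Qed.

Section field_crossing.
Context {R : realType} {d : nat} {dO : measure_display} {Omega : measurableType dO}.
Local Notation V := 'rV[R]_d.
Variable P : probability Omega R.
Variables (K : V -> R) (r0 : R) (W : (V * R -> R) -> {RV P >-> R}) (h : nat -> Omega -> V -> R).
Hypothesis lf : log_field K r0 W h.
Variables (xi : R) (i0 : 'I_d).
Hypothesis xi0 : 0 < xi.

Definition field_crossing (m : nat) (w : Omega) : R :=
  crossing xi i0 (2 ^ m) (fun v => h m w (dyadic_point m v)).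

Let pow0 m : (0 < 2 ^ m)%N. Proof. by rewrite expn_gt0. Qed.

Lemma field_crossing_gt0 m w : 0 < field_crossing m w.
Proof. exact: crossing_gt0. Qed.

Lemma measurable_field_crossing m : (1 <= m)%N -> measurable_fun setT (field_crossing m).
Proof. by move=> m1; apply: measurable_passage => f; exact: (field_measurable lf). Qed.

Lemma field_crossing_concentration m (A t : R) : (1 <= m)%N -> 0 < A -> 0 < t ->
  (P [set w | (field_crossing m w <= A)%R] * P [set w | (A * expR t <= field_crossing m w)%R] <=
   (2 * expR (- (t ^+ 2 / (8 * xi ^+ 2 * (m%:R * ln 2)))))%:E)%E.
Proof.
move=> m1; apply: (passage_concentration (field_family lf (fun f => dyadic_point m (box_site f)) m1)).
- by move=> a b c s; apply: combine_rotate => f; exact: (L2_field lf).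
- by rewrite mulr_gt0 ?ln2_gt0// ltr0n.
- exact: xi0.
- by move=> f; rewrite combine_delta (field_variance lf).
- exact: full_connecting.
- exact: set0_connecting.
Qed.

Section fine_scale.
Variables n m : nat.
Hypotheses (n1 : (1 <= n)%N) (m1 : (1 <= m)%N).

(** The part of the field from the scales between [2^-(n + m)] and [2^-n]. *)
Definition fine_field (w : Omega) (x : V) : R := h (n + m) w x - h n w x.

Let I : interval R := `[2 ^- (n + m), 2 ^- n[.
Let nm1 : (1 <= n + m)%N. Proof. exact: leq_trans n1 (leq_addr _ _). Qed.
Let pow_lt : (2 ^- (n + m) : R) < 2 ^- n.
Proof.
by rewrite ltf_pV2 ?posrE ?pow2_gt0// exprD ltr_pMr ?pow2_gt0// exprn_egt1// ?ltr1n// -lt0n.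
Qed.

Let cK : continuous K. Proof. by have [] := lf_smooth lf [::]. Qed.

Lemma measurable_fine_field x : measurable_fun setT (fun w => fine_field w x).
Proof. by apply: measurable_funB; exact: (field_measurable lf). Qed.

Let L2_fine x : L2_spacetime (band_kernel K I x).
Proof. exact: (L2_bando (lf_smooth lf) (lf_norm lf) _ (pow2_inv_gt0 _) pow_lt). Qed.

Let fine_ae x : {ae P, forall w, fine_field w x = W (band_kernel K I x) w}.
Proof.
have E1 := field_ae lf x n1; have E2 := field_ae lf x nm1.
have E3 := white_noise_linear (lf_noise lf) 1 (L2_fine x) (L2_field lf x n1).
apply: filterS3 E1 E2 E3 => w e1 e2 e3; rewrite /fine_field e1 e2.
have -> : band_kernel K `[2 ^- (n + m), 1] x =
    (fun z => 1 * band_kernel K I x z + band_kernel K `[2 ^- n, 1] x z).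
  apply/funext => z; rewrite mul1r; apply: band_kernel_split => //.
  exact: ltW (pow2_inv_lt1 _).
by rewrite e3 mul1r addrK.
Qed.

Let fine_family (J : finType) (x : J -> V) :
  gaussian_family P (fun i w => fine_field w (x i))
    (fun a => l2norm2 (combine (fun i => band_kernel K I (x i)) a)).
Proof.
apply: (white_noise_gaussian_family (lf_noise lf)).
- by move=> i; exact: L2_fine.
- by move=> i; exact: measurable_fine_field.
- by move=> i; exact: fine_ae.
Qed.

(** The fine sites around the coarse edge from [w] in direction [j]: the box is translated, and
    the direction [i0] of the standard crossing is exchanged with [j]. *)
Definition edge_site (j : 'I_d) (w v : site d) : site d :=
  [ffun k => (2 ^ m)%N%:Z * w k + v (tperm i0 j k)].

Definition edge_cost (j : 'I_d) (w : site d) (o : Omega) : R :=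
  crossing xi i0 (2 ^ m) (fun v => fine_field o (dyadic_point (n + m) (edge_site j w v))).

Lemma measurable_edge_cost j w : measurable_fun setT (edge_cost j w).
Proof. by apply: measurable_passage => f; exact: measurable_fine_field. Qed.

Let edge_point j w v : dyadic_point (n + m) (edge_site j w v) =
  2 ^- n *: swap_coords (tperm i0 j) (dyadic_point m v) + dyadic_point n w :> V.
Proof.
apply/rowP => k; rewrite !mxE ffunE intrD intrM -pmulrn natrX exprD.
by field; rewrite !gt_eqF ?pow2_gt0.
Qed.

Let scaled t : (2 ^- n * t \in I) = (t \in (`[2 ^- m, 1[ : interval R)).
Proof.
rewrite !in_itv/= exprD invfM ler_pM2l ?pow2_inv_gt0//.
by rewrite -[X in _ < X]mulr1 ltr_pM2l ?pow2_inv_gt0.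
Qed.

(** The quadratic form of the fine field at these points is that of [h m] at the points of the
    standard box, by invariance of bands under scaling, translations and, as [K] is radial,
    exchanges of coordinates. *)
Lemma edge_cost_law j w (B : R) :
  P [set o | B < edge_cost j w o] = P [set o | B < field_crossing m o].
Proof.
pose A : set (paramspace R (box d (2 ^ m))) :=
  [set z | B < passage xi (connecting i0 (2 ^ m)) [set: box d (2 ^ m)]%SET z].
have mA : measurable A.
  apply: measurable_gt_set.
  have := @measurable_passage _ (box d (2 ^ m)) _ (paramspace R (box d (2 ^ m)))
    (fun f z => z f) xi (connecting i0 (2 ^ m)) [set: box d (2 ^ m)]%SET.
  by apply => f; exact: measurable_param.
pose x1 (f : box d (2 ^ m)) : V := dyadic_point (n + m) (edge_site j w (box_site f)).
pose Q2 (a : box d (2 ^ m) -> R) := l2norm2 (combine (fun i => band_kernel K `[2 ^- m, 1]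
  (dyadic_point m (box_site i))) a).
have g2 : gaussian_family P (fun f o => h m o (dyadic_point m (box_site f))) Q2 :=
  field_family lf (fun f : box d (2 ^ m) => dyadic_point m (box_site f)) m1.
suff QE a : l2norm2 (combine (fun i => band_kernel K I (x1 i)) a) = Q2 a.
  have g1 : gaussian_family P (fun f o => fine_field o (x1 f)) Q2.
    by rewrite -(funext QE); exact: fine_family.
  exact: (gaussian_family_law g1 g2 mA).
apply: (congr1 fine).
have I0 t : t \in (`[2 ^- m, 1[ : interval R) -> 0 < t.
  by rewrite in_itv/= => /andP[t1 _]; apply: lt_le_trans t1; exact: pow2_inv_gt0.
have -> : (fun i => band_kernel K I (x1 i)) =
    (fun i => band_kernel K I (2 ^- n *: (swap_coords (tperm i0 j) (dyadic_point m (box_site i))) + dyadic_point n w)).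
  by apply/funext => i; rewrite /x1 edge_point.
rewrite (sqr_integral_band_scale cK a _ _ (pow2_inv_gt0 n) I0 scaled).
rewrite (sqr_integral_band_swap cK a _ I0 (tpermK i0 j)); last first.
  by move=> v; apply: radial_swap (lf_radial lf) _; exact: tpermK.
by rewrite sqr_integral_band_bndr// pow2_inv_gt0.
Qed.

Lemma edge_cost_good j w o (B : R) : edge_cost j w o <= B ->
  good_edge (fun u => forall k, `|u k - (2 ^ m)%N%:Z * w k| <= (2 * 2 ^ m)%N%:Z)
    (fun u => expR (xi * fine_field o (dyadic_point (n + m) u))) (2 ^ m) B w j.
Proof.
move=> eB; have [s [/and3P[ps /eqP ls bs] _ hs]] := crossing_attained xi i0 (pow0 m)
  (fun v => fine_field o (dyadic_point (n + m) (edge_site j w v))).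
have e0 : edge_site j w (axis_site i0 0) = [ffun k => (2 ^ m)%N%:Z * w k].
  by apply/ffunP => k; rewrite !ffunE if_same addr0.
exists [seq edge_site j w v | v <- s]; rewrite -e0; split.
- apply: homo_path ps => u v /forallP uv; apply/forallP => k; rewrite !ffunE.
  by have := uv (tperm i0 j k); rewrite opprD addrACA subrr add0r.
- rewrite last_map ls; apply/ffunP => k; rewrite !ffunE mulrDr; congr (_ + _).
  rewrite -(inj_eq (@perm_inj _ (tperm i0 j))) tpermK tpermL.
  by case: eqP => _; rewrite ?mulr1 ?mulr0.
- move=> u; rewrite -map_cons => /mapP[v vs ->] k; rewrite ffunE addrAC subrr add0r.
  by have /forallP/(_ (tperm i0 j k)) := allP bs _ vs; exact: ltW.
- by rewrite -map_cons big_map; exact: le_trans eB.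
Qed.

(** The kernels of distinct families have disjoint supports, as all scales are below [2^-n];
    induction on the number of families. *)
Lemma fine_field_indep (J : finType) (x : nat -> J -> V) (A : nat -> set (paramspace R J)) (c : 'I_d)
    (p : R) : 0 <= p -> (forall k, measurable (A k)) ->
  (forall k l i j, (k < l)%N -> 2 * r0 * 2 ^- n <= `|x k i ord0 c - x l j ord0 c|) ->
  (forall k, (P [set o | A k (fun i => fine_field o (x k i))] <= p%:E)%E) ->
  forall N, (P [set o | forall k : 'I_N, A k (fun i => fine_field o (x k i))] <= (p ^+ N)%:E)%E.
Proof.
move=> p0 mA far hA N; elim: N => [|N IH]; first by rewrite expr0; apply: probability_le1;
  rewrite (_ : [set o | _] = setT)//; apply/seteqP; split => // o _ [].
pose X (ki : 'I_N * J) o := fine_field o (x ki.1 ki.2).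
pose Y i o := fine_field o (x N i).
pose fX (ki : 'I_N * J) := band_kernel K I (x ki.1 ki.2).
pose fY i := band_kernel K I (x N i).
pose BX : set (paramspace R ('I_N * J)%type) :=
  [set z | forall k : 'I_N, A k (fun i => z (k, i))].
have mBX : measurable BX.
  rewrite (_ : BX = \bigcap_(k in [set: 'I_N]) [set z | A k (fun i => z (k, i))]); last first.
    by apply/seteqP; split => z h1 k; [move=> _; exact: h1|exact: (h1 k Logic.I)].
  apply: fin_bigcap_measurable => // k _; rewrite -[X in measurable X]setTI.
  by apply: (measurable_fun_param (fun i => measurable_param ((k, i) : 'I_N * J))).
have gX : gaussian_family P X (fun a => l2norm2 (combine fX a)) := fine_family _.
have gY : gaussian_family P Y (fun a => l2norm2 (combine fY a)) := fine_family _.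
have gXY : gaussian_family P (join_field X Y)
    (fun a => l2norm2 (combine fX (a \o inl)) + l2norm2 (combine fY (a \o inr))).
  have := fine_family (fun k : ('I_N * J) + J => match k with inl ki => x ki.1 ki.2 | inr j => x N j end).
  have -> : (fun (k : ('I_N * J) + J) w => fine_field w (match k with inl ki => x ki.1 ki.2 | inr j => x N j end)) =
      join_field X Y by apply/funext => -[].
  congr (gaussian_family _ _ _); apply/funext => a; rewrite -combine_join.
  - by congr (l2norm2 (combine _ _)); apply/funext => -[].
  - by move=> i; exact: L2_fine.
  - by move=> i; exact: L2_fine.
  - move=> [k i] j z; apply: (band_disjoint (lf_r0 lf) (lf_supp lf) (i := c)).
      exact: pow2_inv_gt0.
    exact: far.
have := gaussian_family_indep gXY gX gY mBX (mA N).
have -> : [set w | BX (X ^~ w)] `&` [set w | A N (Y ^~ w)] =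
    [set o | forall k : 'I_N.+1, A k (fun i => fine_field o (x k i))].
  apply/seteqP; split => o /=.
    move=> [h1 h2] k; have [kN|kN] := ltnP k N; first exact: (h1 (Ordinal kN)).
    have -> : (k : nat) = N by apply/eqP; rewrite eqn_leq kN andbT -ltnS.
    exact: h2.
  by move=> h1; split; [move=> k; exact: (h1 (widen_ord (leqnSn N) k))|exact: (h1 ord_max)].
move=> ->; rewrite exprSr EFinM; apply: lee_pmul => //; exact: measure_ge0.
Qed.

Section slabs.
Variables (rho : nat) (B p : R).
Hypotheses (rho_ge : 2 * r0 + 4 <= rho%:R) (p0 : 0 <= p).
Hypothesis hp : (P [set o | (B < field_crossing m o)%R] <= p%:E)%E.
Variable KK : nat.
Let rad := (rho * KK)%N.

(** All edges of the coarse lattice starting in the neighbourhood of a site, given by relative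
    position and direction. *)
Definition local_edge : finType := ({ffun 'I_d -> 'I_(rad.+3)} * 'I_d)%type.

Let local_site (v : site d) (e : local_edge) : site d := [ffun i => v i - 1 + (e.1 i)%:Z].
Let slab_site k (v : site d) (a : nat) (e : local_edge) : site d :=
  [ffun i => if i == k then v i + a%:Z else local_site v e i].

Let local_siteP v w j : near_site rad v w -> exists2 e : local_edge, local_site v e = w & e.2 = j.
Proof.
move=> nw; have le i : (`|(w i - v i + 1)%R|%N < rad.+3)%N.
  by have /andP[h1 h2] := nw i; clear -h1 h2; lia.
exists ([ffun i => Ordinal (le i)], j) => //; apply/ffunP => i; rewrite !ffunE/=.
by have /andP[h1 h2] := nw i; clear -h1 h2; lia.
Qed.

Let bad j w := [set o | B < edge_cost j w o].

Let mbad j w : measurable (bad j w).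
Proof. by apply: measurable_gt_set; exact: measurable_edge_cost. Qed.

Let Pbad j w : (P (bad j w) <= p%:E)%E. Proof. by rewrite /bad edge_cost_law. Qed.

Let slab_bad k v a := [set o | exists e : local_edge, bad e.2 (slab_site k v a e) o].

(** The boxes around the edges extend by at most 2 coarse steps to each side, so that between
    slabs at distance [rho] there remains [2 * r0], which makes them independent. *)
Let slabs_bound k v :
  (P [set o | forall a : 'I_KK, slab_bad k v (rho * a) o] <= ((#|local_edge|%:R * p) ^+ KK)%:E)%E.
Proof.
pose x (a : nat) (ef : local_edge * box d (2 ^ m)) : V :=
  dyadic_point (n + m) (edge_site ef.1.2 (slab_site k v (rho * a) ef.1) (box_site ef.2)).
pose A (a : nat) : set (paramspace R (local_edge * box d (2 ^ m))%type) :=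
  [set z | exists e : local_edge, B < passage xi (connecting i0 (2 ^ m)) [set: box d (2 ^ m)]%SET (fun f => z (e, f))].
apply: (@fine_field_indep _ x A k).
- by rewrite mulr_ge0.
- move=> a; apply: measurable_exists => e; apply: measurable_gt_set.
  have := @measurable_passage _ (box d (2 ^ m)) _ (paramspace R (local_edge * box d (2 ^ m))%type)
    (fun f z => z (e, f)) xi (connecting i0 (2 ^ m)) [set: box d (2 ^ m)]%SET.
  by apply => f; exact: measurable_param.
- have xk a e (f : box d (2 ^ m)) : x a (e, f) ord0 k =
      ((2 ^ m)%N%:Z * (v k + (rho * a)%N%:Z) + box_site f (tperm i0 e.2 k))%:~R / 2 ^+ (n + m).
    by rewrite mxE [edge_site _ _ _ _]ffunE [slab_site _ _ _ _ _]ffunE eqxx.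
  move=> a b [e f] [e' f'] ab; rewrite !xk.
  set y := box_site f _; set y' := box_site f' _.
  have yb : `|y| < (2 * 2 ^ m)%N%:Z by have /forallP := in_box_site f; apply.
  have yb' : `|y'| < (2 * 2 ^ m)%N%:Z by have /forallP := in_box_site f'; apply.
  rewrite -mulrBl normrM (gtr0_norm (pow2_inv_gt0 _)) ler_pdivlMr ?pow2_gt0//.
  rewrite exprD mulrA mulfVK ?gt_eqF ?pow2_gt0//.
  rewrite -intrB -intr_norm.
  have far : ((rho - 4) * 2 ^ m)%N%:Z <=
      `|(2 ^ m)%N%:Z * (v k + (rho * a)%N%:Z) + y - ((2 ^ m)%N%:Z * (v k + (rho * b)%N%:Z) + y')|.
    have E : (rho * b = rho * a + rho + rho * (b - a.+1))%N.
      by rewrite -mulnSr -mulnDr; congr (_ * _)%N; clear -ab; lia.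
    have q0 : 0 <= (2 ^ m)%N%:Z * (rho * (b - a.+1))%N%:Z by rewrite -PoszM.
    rewrite E !PoszD !mulrDr PoszM.
    have r4 : (4 <= rho)%N.
      by rewrite -(ler_nat R); apply: le_trans rho_ge; rewrite lerDr mulr_ge0// ltW// (lf_r0 lf).
    rewrite -subzn// mulrBl.
    move: q0 yb yb'; rewrite [rho%:Z * _]mulrC.
    move: ((2 ^ m)%N%:Z * v k) ((2 ^ m)%N%:Z * (rho * a)%N%:Z) ((2 ^ m)%N%:Z * rho%:Z) ((2 ^ m)%N%:Z * (rho * (b - a.+1))%N%:Z) (2 ^ m)%N y y'.
    clear => q1 q2 q3 q4 q5 y y'; rewrite !ltr_norml => h0 /andP[h1 h2] /andP[h3 h4].
    lia.
  have far' : (((rho - 4) * 2 ^ m)%N%:Z)%:~R <= `|(2 ^ m)%N%:Z * (v k + (rho * a)%N%:Z) + y - ((2 ^ m)%N%:Z * (v k + (rho * b)%N%:Z) + y')|%:~R :> R by rewrite ler_int.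
  apply: le_trans far'; rewrite -pmulrn natrM natrX ler_wpM2r ?(ltW (pow2_gt0 _))//.
  have r4 : (4 <= rho)%N.
    by rewrite -(ler_nat R); apply: le_trans rho_ge; rewrite lerDr mulr_ge0// ltW// (lf_r0 lf).
  by rewrite natrB// lerBrDr.
- by move=> a; apply: (union_bound (fun e : local_edge => mbad e.2 (slab_site k v (rho * a) e))).
Qed.

Let mslab k v : measurable [set o | forall a : 'I_KK, slab_bad k v (rho * a) o].
Proof.
rewrite (_ : [set o | _] = \bigcap_(a in [set: 'I_KK]) slab_bad k v (rho * a)).
  by apply: fin_bigcap_measurable => // a _; apply: measurable_exists => e; exact: mbad.
by apply/seteqP; split => o h1 a; [move=> _; exact: h1|exact: (h1 a Logic.I)].
Qed.

(** The probability that all slabs near some site fail decays exponentially in their number, which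
    beats the number of sites. Around the two sites [zs], where the path has to start and to
    end, all edges are required to be cheap; two neighbourhoods allow for a simple union bound. *)
Lemma clear_slabs (N : nat) (zs : bool -> site d) : exists Bad : set Omega,
  [/\ measurable Bad,
     (P Bad <= (#|{: box d N * 'I_d}|%:R * (#|local_edge|%:R * p) ^+ KK +
        2 * (#|local_edge|%:R * p))%:E)%E &
     forall o, ~ Bad o -> let G w j := edge_cost j w o <= B in
       (forall v, in_box N v -> forall k, exists2 a : nat, (a <= rad)%N & clear_slab rad G k v a) /\
       (forall b w j, near_site rad (zs b) w -> G w j)].
Proof.
pose B1 := [set o | exists vk : box d N * 'I_d, forall a : 'I_KK, slab_bad vk.2 (box_site vk.1) (rho * a) o].
pose B2 := [set o | exists b : bool, exists e : local_edge, bad e.2 (local_site (zs b) e) o].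
have mB1 : measurable B1 by apply: measurable_exists => vk; exact: mslab.
have mB2 : measurable B2 by apply: measurable_exists => b; apply: measurable_exists => e; exact: mbad.
exists (B1 `|` B2); split; first exact: measurableU.
- apply: (le_trans (measureU2 _ mB1 mB2)); rewrite EFinD; apply: leeD.
    by apply: (union_bound (fun vk => mslab vk.2 (box_site vk.1))) => vk; exact: slabs_bound.
  have h2 b : (P [set o | exists e : local_edge, bad e.2 (local_site (zs b) e) o] <= (#|local_edge|%:R * p)%:E)%E.
    by apply: (union_bound (fun e : local_edge => mbad e.2 (local_site (zs b) e))).
  have := union_bound (fun b => measurable_exists (fun e : local_edge => mbad e.2 (local_site (zs b) e))) h2.
  by rewrite card_bool.
move=> o nb G; split.
  move=> v vN k; have [f fv] := box_siteP vN.
  have [a ha] : exists a : 'I_KK, ~ slab_bad k v (rho * a) o.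
    apply: contrapT => h1; apply: nb; left; exists (f, k) => a /=; rewrite fv.
    by apply: contrapT => h2; apply: h1; exists a.
  exists (rho * a)%N; first by rewrite /rad leq_mul2l (ltnW (ltn_ord a)) orbT.
  move=> w j nw wk jk; rewrite /G leNgt; apply/negP => bd; apply: ha.
  have [e ew ej] := local_siteP j nw; exists e; rewrite ej.
  suff -> : slab_site k v (rho * a) e = w by [].
  apply/ffunP => i; rewrite ffunE ew; by case: eqP => // ->.
move=> b w j nw; rewrite /G leNgt; apply/negP => bd; apply: nb; right; exists b.
by have [e ew ej] := local_siteP j nw; exists e; rewrite ej ew.
Qed.

End slabs.
End fine_scale.
End field_crossing.

(** * Nearly subadditive sequences *)
(** Splitting into halves repeatedly, the errors [n^th] form a geometric sum that is dominated
    by the smallest parts; therefore only the order of magnitude of the error at [n0] matters for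
    multiples of [n0]. *)
Section near_subadditive.
Context {R : realType}.
Variables (a : nat -> R) (C th B : R) (N0 : nat).
Hypotheses (C0 : 0 <= C) (th0 : 0 < th) (th1 : th < 1) (N01 : (1 <= N0)%N).
Hypothesis sub : forall n m, (1 <= n)%N -> (1 <= m)%N -> (N0 <= n + m)%N ->
  a (n + m)%N <= a n + a m + C * (n + m)%:R `^ th.
Hypothesis low : forall n, (N0 <= n)%N -> - (B * n%:R) <= a n.

Let t0 : 0 < 1 - th. Proof. by rewrite subr_gt0. Qed.

Let c : R := (3 / 2) `^ (1 - th).
Let c1 : 1 < c.
Proof. have := @gt0_ltr_powR R (1 - th) t0 1 (3 / 2); rewrite powR1; apply; rewrite ?nnegrE//; lra. Qed.

Let E := C / (c - 1).
Let E0 : 0 <= E.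
Proof. by apply: divr_ge0; [exact: C0|rewrite subr_ge0; exact: ltW]. Qed.

Let powE (x : R) : 0 < x -> x `^ th = x * x `^ (th - 1).
Proof. by move=> x0; rewrite -[X in X * _]powRr1 ?(ltW x0)// -powRD ?subrKC ?gt_eqF ?implybT. Qed.

(** Each of two comparable parts [x] and [y] is at most [2/3] of the whole. *)
Let split_gain (x y : R) : 0 < x -> 0 < y -> x <= 2 * y -> y <= 2 * x ->
  c * (x + y) `^ th <= x `^ th + y `^ th.
Proof.
move=> x0 y0 xy yx.
have z0 : 0 < x + y by rewrite addr_gt0.
have key (t : R) : 0 < t -> 3 * t <= 2 * (x + y) -> t * (c * (x + y) `^ (th - 1)) <= t `^ th.
  move=> t1 tz; rewrite (powE t1) ler_pM2l//.
  have -> : c * (x + y) `^ (th - 1) = (2 / 3 * (x + y)) `^ (th - 1).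
    rewrite powRM ?(ltW z0)//; congr (_ * _).
    have -> : 2 / 3 = (3 / 2)^-1 :> R by field.
    rewrite -powR_inv1; last by lra.
    by rewrite -powRrM mulN1r opprB.
  rewrite -[th - 1]opprB !powRN lef_pV2 ?posrE ?powR_gt0//; last by rewrite mulr_gt0.
  apply: ge0_ler_powR; rewrite ?nnegrE ?(ltW t0) ?(ltW t1)//.
    - by apply: mulr_ge0; [exact: divr_ge0|exact: ltW].
    - by move: tz; move: (x + y) => w; lra.
have kx : 3 * x <= 2 * (x + y) by move: yx xy; lra.
have ky : 3 * y <= 2 * (x + y) by move: yx xy; lra.
by have := lerD (key x x0 kx) (key y y0 ky); rewrite -mulrDl (powE z0) [c * (_ * _)]mulrCA.
Qed.

(** Induction on [j] by halving. The correction [- E * (j * n0)^th] absorbs the error of the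
    next splitting, because the corrections of the two halves together exceed that of the whole
    by the factor [c]; this is what fixes [E * (c - 1) = C]. *)
Let multiples n0 j : (N0 <= n0)%N -> (1 <= j)%N ->
  a (j * n0)%N <= j%:R * (a n0 + E * n0%:R `^ th) - E * (j * n0)%:R `^ th.
Proof.
move=> nN; have n0_gt0 : (0 < n0)%N by exact: leq_trans nN.
elim/ltn_ind: j => j IH j1; have [j2|j2] := leqP j 1.
  have -> : j = 1%N by apply/eqP; rewrite eqn_leq j2.
  by rewrite mul1n mul1r addrK.
have jj : (j = j./2 + (j - j./2))%N by rewrite subnKC//; have := odd_double_half j; lia.
have h1 : (1 <= j./2)%N by rewrite half_gt0.
set j1' := j./2 in jj h1 *; set j2' := (j - j./2)%N in jj *.
have hb : (j2' <= j1'.+1)%N /\ (j1' <= j2')%N.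
  by rewrite /j2' /j1'; have := odd_double_half j; case: (odd j); lia.
have h2 : (1 <= j2')%N by lia.
have i1 := IH j1' ltac:(lia) h1; have i2 := IH j2' ltac:(lia) h2.
have s : a (j * n0)%N <= a (j1' * n0)%N + a (j2' * n0)%N + C * (j * n0)%:R `^ th.
  have h3 : (j * n0 = j1' * n0 + j2' * n0)%N by rewrite -mulnDl -jj.
  rewrite h3; apply: sub; rewrite ?muln_gt0 ?n0_gt0 ?h1 ?h2// -h3.
  by apply: (leq_trans nN); rewrite leq_pmull.
have g := @split_gain (j1' * n0)%:R (j2' * n0)%:R.
have {}g : c * (j * n0)%:R `^ th <= (j1' * n0)%:R `^ th + (j2' * n0)%:R `^ th.
  have -> : (j * n0)%:R = (j1' * n0)%:R + (j2' * n0)%:R :> R by rewrite -natrD -mulnDl -jj.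
  by apply: g; rewrite ?ltr0n ?muln_gt0 ?h1 ?h2// -natrM ler_nat mulnA leq_mul2r; apply/orP; right; case: hb => hb1 hb2; clear -h1 hb1 hb2; lia.
have jR : j%:R = j1'%:R + j2'%:R :> R by rewrite -natrD -jj.
have cE : C = E * c - E.
  have -> : E * c - E = E * (c - 1) by ring.
  by rewrite /E divfK// subr_eq0 gt_eqF.
have := ler_wpM2l E0 g; move: s i1 i2; rewrite jR cE {jR cE}.
set P := (_ * n0)%:R `^ th; set P1 := (_ * n0)%:R `^ th; set P2 := (_ * n0)%:R `^ th.
move: (a n0) (E * n0%:R `^ th) (a (j * n0)%N) (a (j1' * n0)%N) (a (j2' * n0)%N) (j1'%:R : R) (j2'%:R : R).
move=> q1 q2 q3 q4 q5 q6 q7.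
have -> : E * (c * P) = (E * c - E) * P + E * P by ring.
have -> : E * (P1 + P2) = E * P1 + E * P2 by ring.
move: ((E * c - E) * P) (E * P) (E * P1) (E * P2) => p1 p2 p3 p4; rewrite mulrDl.
by move: (q6 * _) (q7 * _) => p6 p7; lra.
Qed.

Let f (n : nat) := a n / n%:R.
Let dec (n : nat) : R := n%:R `^ (th - 1).

Let dec_cvg : dec n @[n --> \oo] --> (0 : R).
Proof.
apply/cvgrPdist_le => e e0; pose A := e^-1 `^ (1 - th)^-1.
have eA : e^-1 = A `^ (1 - th) by rewrite /A -powRrM mulVf ?powRr1 ?gt_eqF// ltW// invr_gt0.
near=> n.
have An : A <= n%:R by near: n; exact: nbhs_infty_ger.
have A0 : 0 < A by rewrite powR_gt0// invr_gt0.
have nR := lt_le_trans A0 An.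
rewrite sub0r normrN ger0_norm ?powR_ge0// /dec -[th - 1]opprB powRN -[e]invrK eA.
rewrite lef_pV2 ?posrE ?powR_gt0 ?invr_gt0//.
by apply: ge0_ler_powR; rewrite ?nnegrE ?(ltW A0)//; exact: ltW.
Unshelve. all: by end_near.
Qed.

(** The limit is the infimum of [f n + E * n^(th - 1)]: by division with remainder a large
    [k] is a multiple of a nearly optimal [n0] plus a bounded rest. *)
Theorem near_subadditive_limit : exists l : R, (a n / n%:R) @[n --> \oo] --> l.
Proof.
pose S := [set x : R | exists2 n : nat, (N0 <= n)%N & x = f n + E * dec n].
have dec0 n : 0 <= dec n by exact: powR_ge0.
have fB n : (N0 <= n)%N -> - B <= f n.
  move=> nN; rewrite /f ler_pdivlMr ?mulNr ?low//.
  by rewrite ltr0n; exact: leq_trans nN.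
have hS : has_inf S.
  split; first by exists (f N0 + E * dec N0), N0.
  by exists (- B) => _ [n nN ->]; apply: ler_wpDr; [by apply: mulr_ge0; [exact: E0|exact: dec0]|exact: fB].
have lowf n : (N0 <= n)%N -> inf S - E * dec n <= f n.
  by move=> nN; rewrite lerBlDr; apply: ge_inf; [case: hS|exists n].
exists (inf S); apply/cvgrPdist_le => e e0; have e3 : 0 < e / 3 by lra.
have [_ [n0 n0N ->] hn0] := inf_adherent e3 hS.
have n00 : (0 < n0)%N by exact: leq_trans n0N.
set g := f n0 + E * dec n0 in hn0.
have ng : n0%:R * g = a n0 + E * n0%:R `^ th.
  rewrite /g /dec mulrDr [X in _ + X]mulrCA -powE ?ltr0n//; congr (_ + _).
  by rewrite /f mulrCA divff ?mulr1// pnatr_eq0 -lt0n.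
pose Mx := \sum_(r < n0.+1) `|a r|.
pose X := n0%:R * `|g| + Mx.
have upf k : (n0 < k)%N -> f k <= g + X / k%:R + C * dec k.
  move=> nk; have k0 : (0 < k)%N by exact: leq_trans nk.
  (* The remainder lies between 1 and [n0], since the inequality concerns positive integers. *)
  pose j := ((k - 1) %/ n0)%N; pose r := ((k - 1) %% n0).+1.
  have kE : k = (j * n0 + r)%N by rewrite /r addnS -divn_eq subn1 prednK.
  have rn : (r <= n0)%N by rewrite /r ltn_pmod.
  have j1 : (1 <= j)%N by rewrite divn_gt0//; lia.
  have h1 : a k <= a (j * n0)%N + a r + C * k%:R `^ th.
    by rewrite [in leLHS]kE [in k%:R]kE; apply: sub; rewrite ?muln_gt0 ?j1// -kE (leq_trans n0N)// ltnW.
  have h2 := multiples n0N j1; rewrite -ng in h2.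
  have h3 : a r <= Mx.
    apply: (le_trans (ler_norm _)); rewrite /Mx (bigD1 (inord r : 'I_n0.+1))//= inordK ?ltnS//.
    by rewrite lerDl sumr_ge0.
  have h4 : 0 <= E * (j * n0)%:R `^ th by rewrite mulr_ge0// powR_ge0.
  have h5 : j%:R * (n0%:R * g) <= k%:R * g + n0%:R * `|g|.
    have -> : k%:R = j%:R * n0%:R + r%:R :> R by rewrite kE natrD natrM.
    rewrite mulrDl -!mulrA -addrA lerDl.
    have q1 : r%:R * `|g| <= n0%:R * `|g| by rewrite ler_wpM2r// ler_nat.
    have q2 : - (r%:R * `|g|) <= r%:R * g by rewrite -mulrN ler_wpM2l// lerNl -normrN ler_norm.
    by move: q1 q2; lra.
  have kk : k%:R * (g + X / k%:R + C * dec k) = k%:R * g + (n0%:R * `|g| + Mx) + C * k%:R `^ th.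
    rewrite !mulrDr [_ * (X / _)]mulrC divfK ?pnatr_eq0 -?lt0n//; congr (_ + _).
    by rewrite mulrCA /dec -powE// ltr0n.
  rewrite /f ler_pdivrMr ?ltr0n// [leRHS]mulrC kk.
  by move: h1 h2 h3 h4 h5; lra.
have q0 : 0 < e / 3 / (C + E + 1) by rewrite divr_gt0// ltr_wpDl ?addr_ge0.
near=> k.
have kN : (N0 <= k)%N by near: k; exact: nbhs_infty_ge.
have kn : (n0 < k)%N by near: k; exact: nbhs_infty_gt.
have k0 : 0 < k%:R :> R by rewrite ltr0n; exact: leq_trans kn.
have dk : dec k <= e / 3 / (C + E + 1).
  rewrite -[dec k]ger0_norm// -[dec k]subr0 distrC.
  by near: k; exact: (cvgrPdist_le _ _).1 dec_cvg _ q0.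
have Xk : X / (e / 3) <= k%:R by near: k; exact: nbhs_infty_ger.
have {}dk : (C + E + 1) * dec k <= e / 3 by rewrite mulrC -ler_pdivlMr// ltr_wpDl ?addr_ge0.
have {}Xk : X / k%:R <= e / 3 by rewrite ler_pdivrMr// mulrC -ler_pdivrMr.
have u := upf k kn; have l := lowf k kN; have d0 := dec0 k.
have c0 := mulr_ge0 C0 d0; have ee0 := mulr_ge0 E0 d0.
move: dk; rewrite !mulrDl mul1r -/(f k) => dk.
rewrite ler_norml; apply/andP; split; move: u l d0 c0 ee0 dk Xk hn0;
  move: (f k) (inf S) (C * dec k) (E * dec k) (dec k) (X / k%:R) (g) => q1 q2 q3 q4 q5 q6 q7; lra.
Unshelve. all: by end_near.
Qed.

End near_subadditive.

(** * Medians of the distance and typical crossing costs *)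
Section median.
Context {R : realType} {d : nat} {dO : measure_display} {Omega : measurableType dO}.
Local Notation V := 'rV[R]_d.
Variable P : probability Omega R.
Variables (K : V -> R) (r0 : R) (W : (V * R -> R) -> {RV P >-> R}) (h : nat -> Omega -> V -> R).
Hypothesis lf : log_field K r0 W h.
Variables (i0 : 'I_d) (B : R).
Hypotheses (i00 : val i0 = 0%N) (B0 : 0 < B).

Definition tame n w := forall x y, ball (0 : V) 2 x -> ball (0 : V) 2 y -> `|y - x| <= 2 ^- n ->
  `|h n w y - h n w x| <= B * Num.sqrt n%:R.

Hypothesis osc : forall n, (1 <= n)%N -> exists Bad : set Omega,
  [/\ measurable Bad, (P Bad <= (2 ^- n / 16)%:E)%E & forall w, ~ Bad w -> tame n w].

Variables (xi : R) (lam : nat -> R).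
Hypothesis xi0 : 0 < xi.
Let D n w := exp_dist xi (h n w) 0 e1 (ball (0 : V) 2).
Hypothesis med : forall n, (1 <= n)%N -> is_median P (D n) (lam n).
Let E n := expR (xi * (B * Num.sqrt n%:R)).
Local Notation T := (field_crossing h xi i0).

(** The factor is the number of lattice steps per unit length, which makes the median comparable
    to the crossing cost. *)
Definition scaled_median n := 2 ^+ n * lam n.

Let e1E : e1 = dyadic_point 0 (axis_site i0 1) :> V.
Proof. by have := dyadic_e1 (R := R) 0 i00; rewrite expn0 => <-. Qed.

Let ball0 : ball (0 : V) 2 0. Proof. exact: ballxx. Qed.

Let ball1 : ball (0 : V) 2 e1.
Proof.
rewrite e1E; apply: dyadic_point_ball; apply/forallP => i; rewrite ffunE expn0.
by case: ifP.
Qed.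

Let e1_neq0 : (0 : V) != e1.
Proof.
apply/eqP => /rowP/(_ i0); rewrite !mxE i00 eqxx => /eqP.
by rewrite eq_sym oner_eq0.
Qed.

Let fieldC n w : (1 <= n)%N -> continuous (h n w).
Proof. by move=> n1; have [hs _] := lf_field lf n1; have [] := hs w [::]. Qed.

Let D_gt0 n w : (1 <= n)%N -> 0 < D n w.
Proof. by move=> n1; apply: exp_dist_gt0 => //; exact: fieldC. Qed.

Let measurable_D n : (1 <= n)%N -> measurable_fun setT (D n).
Proof.
move=> n1; apply: measurable_exp_dist => //.
- by move=> w; exact: fieldC.
- by move=> x; exact: (field_measurable lf).
- by move=> m; apply/rowP => i; rewrite !mxE mulr0 floor0 mul0r.
- move=> m; apply/rowP => i; rewrite !mxE.
  have -> : 2 ^+ m * (val i == 0%N)%:R = ((2 ^ m * (val i == 0))%N%:Z)%:~R :> R.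
    by rewrite -pmulrn natrM natrX.
  by rewrite intrKfloor -pmulrn natrM natrX mulrAC divff ?mul1r// gt_eqF// exprn_gt0.
Qed.

Let E_gt0 n : 0 < E n. Proof. exact: expR_gt0. Qed.

Let sn n : 0 <= B * Num.sqrt n%:R. Proof. by rewrite mulr_ge0 ?(ltW B0)// sqrtr_ge0. Qed.

Let T_le_D n w : (1 <= n)%N -> tame n w -> T n w <= 6 * 2 ^+ n * E n ^+ 4 * D n w.
Proof. by move=> n1 tw; apply: crossing_le_exp_dist => //; [exact: fieldC|exact: ltW]. Qed.

Let D_le_T n w : (1 <= n)%N -> tame n w -> D n w <= d%:R * 2 ^- n * E n * T n w.
Proof. by move=> n1 tw; apply: exp_dist_le_crossing => //; [exact: fieldC|exact: ltW]. Qed.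

Lemma median_gt0 n : (1 <= n)%N -> 0 < lam n.
Proof.
move=> n1; have [h1 _] := med n1.
have z : (P set0 <= 0%:E)%E by rewrite measure0.
have half0 : 0 < 2^-1 :> R by rewrite invr_gt0.
have [w [/= Dw _]] := exists_outside (measurable_le_set (lam n) (measurable_D n1)) measurable0 h1 z half0.
exact: lt_le_trans (D_gt0 w n1) Dw.
Qed.

Lemma scaled_median_gt0 n : (1 <= n)%N -> 0 < scaled_median n.
Proof. by move=> n1; rewrite mulr_gt0 ?exprn_gt0// median_gt0. Qed.

Let A n := 6 * E n ^+ 4 * scaled_median n.

Let A_gt0 n : (1 <= n)%N -> 0 < A n.
Proof. by move=> n1; rewrite mulr_gt0 ?scaled_median_gt0// mulr_gt0// exprn_gt0. Qed.

Let small n : (1 <= n)%N -> 2 ^- n / 16 <= 32^-1 :> R.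
Proof.
move=> n1; have -> : 32 = 2 * 16 :> R by rewrite -natrM.
rewrite invfM ler_pM2r ?invr_gt0// lef_pV2 ?posrE ?exprn_gt0//.
by rewrite -{1}[2]expr1; apply: ler_weXn2l => //; rewrite ler1n.
Qed.

(** The distance is at most its median with probability at least 1/2, and at a tame outcome the
    crossing cost is then at most [A n]. *)
Let T_low n : (1 <= n)%N -> ((4^-1)%:E <= P [set w | (T n w <= A n)%R])%E.
Proof.
move=> n1; have [h1 _] := med n1; have [Bad [mB PB hB]] := osc n1.
have mT := measurable_le_set (A n) (measurable_field_crossing lf xi i0 n1).
have mD := measurable_le_set (lam n) (measurable_D n1).
have sub : [set w | D n w <= lam n] `<=` [set w | T n w <= A n] `|` Bad.
  move=> w Dw; have [bw|bw] := pselect (Bad w); [by right|left].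
  apply: (le_trans (T_le_D n1 (hB w bw))); rewrite /A /scaled_median.
  have -> : 6 * E n ^+ 4 * (2 ^+ n * lam n) = 6 * 2 ^+ n * E n ^+ 4 * lam n by ring.
  by apply: ler_wpM2l => //; apply: ltW; rewrite !mulr_gt0 ?exprn_gt0.
have mU := measurableU _ _ mT mB.
have h2 := le_trans h1 (le_measure P (mem_set mD) (mem_set mU) sub).
have h3 := le_trans h2 (measureU2 P mT mB).
have h4 : ((2^-1)%:E <= P [set w | (T n w <= A n)%R] + (32^-1)%:E)%E.
  apply: (le_trans h3); apply: leeD => //; apply: (le_trans PB); rewrite lee_fin; exact: small.
have : ((2^-1 - 32^-1)%:E <= P [set w | (T n w <= A n)%R])%E by rewrite EFinB leeBlDr.
by apply: le_trans; rewrite lee_fin; lra.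
Qed.

(** The crossing cost is at most [A n] with probability at least 1/4, so that concentration bounds
    the probability of its upper deviations. *)
Lemma crossing_upper_tail n t : (1 <= n)%N -> 0 < t ->
  (P [set w | (A n * expR t <= T n w)%R] <= (8 * expR (- (t ^+ 2 / (8 * xi ^+ 2 * (n%:R * ln 2)))))%:E)%E.
Proof.
move=> n1 t0; have := field_crossing_concentration lf i0 xi0 n1 (A_gt0 n1) t0.
set q := expR (- _); set S := [set w | _ <= T n w]; move=> h1.
have mS : measurable S by apply: measurable_ge_set; exact: (measurable_field_crossing lf).
have h2 : ((4^-1)%:E * P S <= (2 * q)%:E)%E.
  by apply: le_trans h1; apply: lee_wpmul2r => //; exact: T_low.
have -> : (8 * q)%:E = (4%:E * (2 * q)%:E)%E by rewrite -EFinM; congr (_%:E); ring.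
have -> : P S = (4%:E * ((4^-1)%:E * P S))%E by rewrite muleA -EFinM divff ?mul1e.
exact: lee_wpmul2l.
Qed.

(** The distance is at least its median with probability 1/2, which exceeds 3/8 plus the
    probability that the outcome is not tame. *)
Lemma median_outside n (Bad : set Omega) : (1 <= n)%N -> measurable Bad -> (P Bad <= (3 / 8)%:E)%E ->
  exists w, [/\ ~ Bad w, tame n w & scaled_median n <= d%:R * E n * T n w].
Proof.
move=> n1 mB PB; have [_ h1] := med n1; have [Osc [mO PO hO]] := osc n1.
have mD := measurable_ge_set (lam n) (measurable_D n1).
have PU : (P (Bad `|` Osc) <= (3 / 8 + 32^-1)%:E)%E.
  apply: (le_trans (measureU2 P mB mO)); rewrite EFinD; apply: leeD => //.
  by apply: (le_trans PO); rewrite lee_fin; exact: small.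
have lt_half : 3 / 8 + 32^-1 < 2^-1 :> R by lra.
have [w [/= Dw nw]] := exists_outside mD (measurableU _ _ mB mO) h1 PU lt_half.
have tw : tame n w by apply: hO => Ow; apply: nw; right.
exists w; split => //; first by move=> Bw; apply: nw; left.
rewrite /scaled_median; apply: (@le_trans _ _ (2 ^+ n * (d%:R * 2 ^- n * E n * T n w))).
  by rewrite ler_pM2l ?exprn_gt0//; apply: (le_trans Dw); exact: D_le_T.
rewrite le_eqVlt; apply/orP; left; apply/eqP.
have p0 : 2 ^+ n != 0 :> R by rewrite gt_eqF// exprn_gt0.
by field.
Qed.

End median.

(** * Near submultiplicativity of the medians *)
Section elementary_exp.
Context {R : realType}.

Lemma nat_le_expR (k : nat) : k%:R <= expR k%:R :> R.
Proof. by apply: le_trans (expR_ge1Dx _); rewrite lerDr. Qed.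

Lemma expR_nat (k : nat) : expR k%:R = expR 1 ^+ k :> R.
Proof. by rewrite -[k%:R]mulr1 expRM_natl. Qed.

Lemma pow2_le_expR (k : nat) : 2 ^+ k <= expR k%:R :> R.
Proof.
rewrite expR_nat lerXn2r ?nnegrE ?expR_ge0//.
by apply: le_trans (expR_ge1Dx 1); lra.
Qed.

Lemma nat_pow_le_expR (k l : nat) : (k ^ l)%:R <= expR (l * k)%:R :> R.
Proof.
by rewrite natrX natrM expRM_natl lerXn2r ?nnegrE ?expR_ge0//; exact: nat_le_expR.
Qed.

End elementary_exp.

Section rare.
Context {R : realType} (d rho q : nat).
Hypotheses (d0 : (0 < d)%N) (q0 : (0 < q)%N).

(** The summands [8 * d * (rho + 3)^d] and [2 * d] beat the number of local edges, which is
    polynomial in [q]; the remaining [4 * d + 5] beats, after [q^2] slabs, the number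
    [2^(O(q^6))] of coarse sites. *)
Definition edge_rate := (8 * d * (rho + 3) ^ d + 6 * d + 5)%N.
Let edges := (((rho * q ^ 2).+3) ^ d * d)%N.
Let p : R := 8 * expR (- (edge_rate * q ^ 4)%:R).

Lemma rare_edges : edges%:R * p <= expR (- ((4 * d + 5) * q ^ 4)%:R).
Proof.
have n1 : (edges * 8 <= (8 * d * (rho + 3) ^ d) * q ^ (2 * d))%N.
  rewrite /edges [X in (X * 8)%N]mulnC mulnAC [(d * 8)%N]mulnC -[leqRHS]mulnA leq_mul2l.
  apply/orP; right; rewrite expnM -expnMn leq_exp2r// mulnDl -addn3 leq_add2l -{1}[3%N]muln1 leq_mul2l/=.
  by rewrite expn_gt0 q0.
set c1 := (8 * d * (rho + 3) ^ d)%N in n1.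
have q4 : (1 <= q ^ 4)%N by rewrite expn_gt0 q0.
rewrite /p mulrA -natrM -[leRHS]mul1r.
have -> : (edge_rate * q ^ 4)%:R = (c1 * q ^ 4 + (2 * d) * q ^ 4)%:R + ((4 * d + 5) * q ^ 4)%:R :> R.
  by rewrite -natrD; congr (_%:R); rewrite /edge_rate -/c1; ring.
rewrite opprD expRD mulrA ler_wpM2r ?expR_ge0// expRN ler_pdivrMr ?expR_gt0// mul1r natrD expRD.
apply: (@le_trans _ _ ((c1 * q ^ (2 * d))%:R)); first by rewrite ler_nat.
rewrite natrM; apply: ler_pM => //.
  by apply: (le_trans (nat_le_expR c1)); rewrite ler_expR ler_nat leq_pmulr.
apply: (le_trans (nat_pow_le_expR q (2 * d))); rewrite ler_expR ler_nat leq_mul2l.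
by apply/orP; right; rewrite -[leqLHS]expn1 leq_pexp2l.
Qed.

Let e5 : expR (- 5%:R) <= 32^-1 :> R.
Proof.
rewrite expRN lef_pV2 ?posrE ?expR_gt0//; apply: le_trans (pow2_le_expR 5).
by rewrite -natrX ler_nat.
Qed.

Lemma rare_edges_le : edges%:R * p <= 32^-1.
Proof.
apply: (le_trans rare_edges); apply: le_trans e5; rewrite ler_expR lerN2 ler_nat.
have : (1 <= q ^ 4)%N by rewrite expn_gt0 q0.
by move=> h; rewrite mulnDl (leq_trans _ (leq_addl _ _))// leq_pmulr.
Qed.

Lemma rare_tail : p <= 32^-1.
Proof.
apply: le_trans rare_edges_le; rewrite ler_peMl//.
  by rewrite mulr_ge0// expR_ge0.
by rewrite ler1n muln_gt0 expn_gt0 d0.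
Qed.

Lemma rare_slabs n : (n <= q ^ 6)%N ->
  ((4 * 2 ^ n) ^ d * d)%:R * (edges%:R * p) ^+ (q ^ 2) <= 32^-1 :> R.
Proof.
move=> nq; have q6 : (1 <= q ^ 6)%N by rewrite expn_gt0 q0.
have p0 : 0 <= edges%:R * p by rewrite mulr_ge0// mulr_ge0// expR_ge0.
apply: (@le_trans _ _ (expR (4 * d * q ^ 6)%:R * expR (- ((4 * d + 5) * q ^ 6)%:R))).
  apply: ler_pM => //; first exact: exprn_ge0.
    rewrite natrM natrX natrM natrX -[4]/(2 * 2)%:R.
    have -> : ((2 * 2)%:R * 2 ^+ n) ^+ d = 2 ^+ (d * (n + 2)) :> R.
      by rewrite mulnC exprM; congr (_ ^+ _); rewrite exprD natrM mulrC expr2.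
    apply: (le_trans (ler_pM _ _ (pow2_le_expR _) (nat_le_expR d))) => //.
    rewrite -expRD -natrD ler_expR ler_nat.
    by rewrite -mulnSr mulnC [leqRHS]mulnAC leq_mul2r; apply/orP; right; clear -nq q6; lia.
  have -> : expR (- ((4 * d + 5) * q ^ 6)%:R) = expR (- ((4 * d + 5) * q ^ 4)%:R) ^+ (q ^ 2) :> R.
    by rewrite -expRM_natl mulrN -natrM; congr (expR (- _%:R)); rewrite mulnCA -expnD.
  rewrite lerXn2r ?nnegrE ?expR_ge0//; exact: rare_edges.
rewrite -expRD mulnDl natrD opprD addrA subrr sub0r.
by apply: le_trans e5; rewrite ler_expR lerN2 ler_nat leq_pmulr.
Qed.

End rare.

Section submultiplicative.
Context {R : realType} {d : nat} {dO : measure_display} {Omega : measurableType dO}.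
Local Notation V := 'rV[R]_d.
Variable P : probability Omega R.
Variables (K : V -> R) (r0 : R) (W : (V * R -> R) -> {RV P >-> R}) (h : nat -> Omega -> V -> R).
Hypothesis lf : log_field K r0 W h.
Variables (i0 i1 : 'I_d) (B : R).
Hypotheses (i00 : val i0 = 0%N) (i01 : i0 != i1) (B0 : 0 < B).
Hypothesis osc : forall n, (1 <= n)%N -> exists Bad : set Omega,
  [/\ measurable Bad, (P Bad <= (2 ^- n / 16)%:E)%E & forall w, ~ Bad w -> tame h B n w].
Variables (xi : R) (lam : nat -> R).
Hypothesis xi0 : 0 < xi.
Hypothesis med : forall n, (1 <= n)%N ->
  is_median P (fun w => exp_dist xi (h n w) 0 e1 (ball (0 : V) 2)) (lam n).
Local Notation T := (field_crossing h xi i0).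
Local Notation L := (scaled_median lam).
Let E n := expR (xi * (B * Num.sqrt n%:R)).

(** The segment is divided into [r] steps. *)
Let tame_steps n w x y (r : nat) : tame h B n w -> ball (0 : V) 2 x -> ball (0 : V) 2 y ->
  `|y - x| <= r%:R * 2 ^- n -> `|h n w y - h n w x| <= r%:R * (B * Num.sqrt n%:R).
Proof.
move=> tw Ux; elim: r y => [|r IH] y Uy.
  by rewrite !mul0r normr_le0 subr_eq0 => /eqP ->; rewrite subrr normr0.
move=> yx; pose c : R := r%:R / r.+1%:R.
have r1 : 0 < r.+1%:R :> R by rewrite ltr0n.
have c01 : 0 <= c <= 1.
  by rewrite divr_ge0//= ler_pdivrMr// mul1r ler_nat.
pose z := x + c *: (y - x); have Uz : ball (0 : V) 2 z by exact: ball_segment.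
have zx : `|z - x| <= r%:R * 2 ^- n.
  rewrite /z addrAC subrr add0r normrZ ger0_norm; last by case/andP: c01.
  apply: (@le_trans _ _ (c * (r.+1%:R * 2 ^- n))); first by apply: ler_wpM2l => //; case/andP: c01.
  by rewrite mulrA /c divfK// gt_eqF.
have yz : `|y - z| <= 2 ^- n.
  have -> : y - z = (r.+1%:R^-1) *: (y - x).
    rewrite /z opprD addrA -{1}[y - x]scale1r -scalerBl; congr (_ *: _).
    by rewrite /c -[X in X - _](divff (lt0r_neq0 r1)) -mulrBl -natrB// subSnn mul1r.
  by rewrite normrZ gtr0_norm ?invr_gt0// mulrC ler_pdivrMr// mulrC.
have -> : h n w y - h n w x = (h n w y - h n w z) + (h n w z - h n w x) by rewrite addrA subrK.
apply: (le_trans (ler_normD _ _)).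
by rewrite -natr1 mulrDl mul1r addrC lerD//; [exact: IH|exact: tw].
Qed.

Variable rho : nat.
Hypothesis rho_ge : 2 * r0 + 4 <= rho%:R.
Let d0 : (0 < d)%N. Proof. exact: leq_ltn_trans (leq0n i0) (ltn_ord i0). Qed.
Let kap := edge_rate d rho.
(* Chosen such that a deviation [tau * q^5] of [ln T m], whose variance is of order
   [m <= q^6], has probability [exp (- kap * q^4)]. *)
Let tau := Num.sqrt (8 * xi ^+ 2 * ln 2 * kap%:R).

Let tau0 : 0 < tau.
Proof.
rewrite sqrtr_gt0 !mulr_gt0 ?exprn_gt0 ?ln2_gt0// ltr0n /kap /edge_rate.
by rewrite addnS.
Qed.

Let A n := 6 * E n ^+ 4 * L n.

Let tail m q : (1 <= m)%N -> (1 <= q)%N -> (m <= q ^ 6)%N ->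
  (P [set w | (A m * expR (tau * (q ^ 5)%:R) <= T m w)%R] <= (8 * expR (- (kap * q ^ 4)%:R))%:E)%E.
Proof.
move=> m1 q1 mq; have q5 : 0 < tau * (q ^ 5)%:R by rewrite mulr_gt0// ltr0n expn_gt0 q1.
have /le_trans := crossing_upper_tail lf i00 B0 osc xi0 med m1 q5; apply.
rewrite lee_fin ler_pM2l// ler_expR lerN2.
have x2 : 0 < 8 * xi ^+ 2 * ln 2 by rewrite !mulr_gt0 ?exprn_gt0 ?ln2_gt0.
have m0 : 0 < m%:R :> R by rewrite ltr0n.
have -> : 8 * xi ^+ 2 * (m%:R * ln 2) = 8 * xi ^+ 2 * ln 2 * m%:R by ring.
have t2 : tau ^+ 2 = 8 * xi ^+ 2 * ln 2 * kap%:R by rewrite sqr_sqrtr// mulr_ge0// ltW.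
have -> : (tau * (q ^ 5)%:R) ^+ 2 = tau ^+ 2 * (q ^ 5)%:R ^+ 2 by ring.
rewrite t2 ler_pdivlMr; last exact: mulr_gt0.
rewrite [leLHS]mulrCA -[leRHS]mulrA ler_pM2l// natrM -mulrA ler_wpM2l//.
rewrite -natrM -natrX ler_nat -expnM (_ : (5 * 2 = 4 + 6)%N)// expnD leq_mul2l mq orbT//.
Qed.

(* Of the first summand, [144 * d^2 * (rho + 2)] bounds the numerical factors of the
   comparisons and of the detour, and 2 the number of slabs. The second one comes from the
   oscillation of the coarse field: nine factors [E] and the detour over [2 * rad + 10] coarse
   steps. The last one is due to the deviations of [T n] and [T m]. *)
Let constant := ((144 * d ^ 2 * (rho + 2) + 2)%:R + xi * B * (2 * rho + 19)%:R + 2 * tau).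

(** At a common outcome the cost for the [n + m] scales is at least what its median predicts,
    every coarse site has clear slabs, and the coarse cost is not much larger than its median
    predicts; the detour compares these costs. The detour has a length of order [q^2] and the
    coarse field oscillates by [O(q^3)] per step, so that it costs [exp (O(q^5))], as does the
    deviation of an edge. *)
Lemma submultiplicative n m q : (1 <= n)%N -> (1 <= m)%N -> (1 <= q)%N ->
  (n + m <= q ^ 6)%N -> (rho * q ^ 2 + 4 <= 2 ^ n)%N ->
  L (n + m) <= expR (constant * (q ^ 5)%:R) * L n * L m.
Proof.
move=> n1 m1 q1 nmq rn.
have nq : (n <= q ^ 6)%N := leq_trans (leq_addr _ _) nmq.
have mq : (m <= q ^ 6)%N := leq_trans (leq_addl _ _) nmq.
have nm1 : (1 <= n + m)%N := leq_trans n1 (leq_addr _ _).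
pose t := tau * (q ^ 5)%:R; pose Bm := A m * expR t; pose p : R := 8 * expR (- (kap * q ^ 4)%:R).
have p0 : 0 <= p by rewrite mulr_ge0// expR_ge0.
pose rad := (rho * q ^ 2)%N.
have mT k : (1 <= k)%N -> measurable_fun setT (T k) by exact: (measurable_field_crossing lf).
have hp : (P [set w | (Bm < T m w)%R] <= p%:E)%E.
  apply: le_trans (tail m1 q1 mq); apply: le_measure; rewrite ?inE.
  - by apply: measurable_gt_set; exact: mT.
  - by apply: measurable_ge_set; exact: mT.
  - by move=> w /ltW.
pose zs (b : bool) := if b then axis_site i0 0 else axis_site i0 (2 ^ n) : site d.
have [Slab [mS PS hS]] := clear_slabs lf n1 m1 rho_ge p0 hp (q ^ 2) (2 ^ n) zs.
have [Osc [mO PO hO]] := osc n1.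
pose Up := [set w | A n * expR t <= T n w].
have mU : measurable Up by apply: measurable_ge_set; exact: mT.
have card_e : #|@local_edge d rho (q ^ 2)| = (((rho * q ^ 2).+3) ^ d * d)%N.
  by rewrite card_prod card_ffun !card_ord.
have PB : (P (Slab `|` Osc `|` Up) <= (3 / 8)%:E)%E.
  apply: (le_trans (measureU2 P (measurableU _ _ mS mO) mU)).
  apply: (@le_trans _ _ ((3 / 32)%:E + (32^-1)%:E + (32^-1)%:E)%E); last first.
    by rewrite -!EFinD lee_fin; lra.
  apply: leeD; last first.
    by apply: (le_trans (tail n1 q1 nq)); rewrite lee_fin; exact: rare_tail.
  apply: (le_trans (measureU2 P mS mO)); apply: leeD.
    apply: (le_trans PS); rewrite lee_fin card_e.
    have h1 := @rare_slabs R d rho q d0 q1 n nq; have h2 := @rare_edges_le R d rho q d0 q1.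
    apply: (@le_trans _ _ (32^-1 + 2 * 32^-1)); last by lra.
    apply: lerD; last by rewrite ler_pM2l.
    apply: le_trans h1; rewrite ler_wpM2r ?exprn_ge0 ?mulr_ge0//.
    rewrite ler_nat card_prod card_ord leq_mul2r card_box ?orbT// expn_gt0//.
  apply: (le_trans PO); rewrite lee_fin.
  have -> : 32 = 2 * 16 :> R by rewrite -natrM.
  rewrite invfM ler_pM2r ?invr_gt0// lef_pV2 ?posrE ?exprn_gt0//.
  by rewrite -{1}[2]expr1; apply: ler_weXn2l => //; rewrite ler1n.
have [w [nB tw Lw]] := median_outside lf i00 osc xi0 med nm1 (measurableU _ _ (measurableU _ _ mS mO) mU) PB.
have [clear ends] := hS w (fun b => nB (or_introl (or_introl b))).
have tn := hO w (fun b => nB (or_introl (or_intror b))).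
have Tn : T n w <= A n * expR t by rewrite leNgt; apply/negP => /ltW b; apply: nB; right.
have L0 k : (1 <= k)%N -> 0 < L k by exact: (scaled_median_gt0 lf i00 med).
have E0 k : 0 < E k by exact: expR_gt0.
have A0 k : (1 <= k)%N -> 0 < A k by move=> k1; apply: mulr_gt0; [apply: mulr_gt0 => //; exact: exprn_gt0|exact: L0].
have Bm0 : 0 < Bm by apply: mulr_gt0; [exact: A0|exact: expR_gt0].
have s0 : 0 <= B * Num.sqrt n%:R by rewrite mulr_ge0 ?(ltW B0)// sqrtr_ge0.
pose f (u : site d) := fine_field h n m w (dyadic_point (n + m) u).
pose H (u : site d) := h n w (dyadic_point (n + m) u).
pose g (v : site d) := h n w (dyadic_point n v).
pose G (v : site d) j := edge_cost h xi i0 n m j v w <= Bm.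
have M0 : (0 < 2 ^ m)%N by rewrite expn_gt0.
have good (v : site d) j : G v j -> good_edge (fun u => forall k, `|u k - (2 ^ m)%N%:Z * v k| <= (2 * 2 ^ m)%N%:Z)
    (fun u => expR (xi * f u)) (2 ^ m) Bm v j by exact: edge_cost_good.
have oscH (v u : site d) (r : nat) : in_box (2 ^ n) v -> in_box (2 ^ n * 2 ^ m) u ->
    (forall k, `|u k - (2 ^ m)%N%:Z * v k| <= (r * 2 ^ m)%N%:Z) ->
    H u <= g v + r%:R * (B * Num.sqrt n%:R).
  move=> vN uN uv; rewrite -lerBlDl; apply: (le_trans (ler_norm _)); apply: tame_steps => //.
  - exact: dyadic_point_ball.
  - by apply: dyadic_point_ball; rewrite expnD.
  apply: rV_norm_le; first by rewrite mulr_ge0// invr_ge0 exprn_ge0.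
  move=> k; rewrite !mxE.
  have -> : (u k)%:~R / 2 ^+ (n + m) - (v k)%:~R / 2 ^+ n = (u k - (2 ^ m)%N%:Z * v k)%:~R / 2 ^+ (n + m) :> R.
    rewrite intrB intrM -pmulrn natrX exprD; field.
    by rewrite !gt_eqF ?pow2_gt0.
  rewrite normrM (gtr0_norm (pow2_inv_gt0 _)) -intr_norm ler_pdivrMr ?pow2_gt0//.
  rewrite exprD mulrA mulfVK ?gt_eqF ?pow2_gt0//.
  have := uv k; rewrite -(ler_int R) => /le_trans; apply.
  by rewrite -pmulrn natrM natrX.
have Dt := detour (ltW xi0) s0 (ltW Bm0) i01 M0 rn good oscH _ (ends true) (ends false).
have {}Dt : T (n + m) w <= (4 * d * (rad + 2))%:R * Bm * expR (xi * ((2 * rad + 10)%:R * (B * Num.sqrt n%:R))) * T n w.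
  have -> : T (n + m) w = crossing xi i0 (2 ^ n * 2 ^ m) (fun u => f u + H u).
    rewrite /field_crossing expnD; congr crossing; apply/funext => u.
    by rewrite /f /H /fine_field subrK.
  apply: Dt => v vL k; apply: clear; apply/forallP => i.
  by apply: le_lt_trans (vL i) _; clear; lia.
pose X := expR (xi * B * (q ^ 3)%:R).
have EX k : (k <= q ^ 6)%N -> E k <= X.
  move=> kq; rewrite ler_expR mulrA ler_wpM2l ?mulr_ge0 ?(ltW xi0) ?(ltW B0)//.
  have -> : (q ^ 3)%:R = Num.sqrt ((q ^ 6)%:R) :> R.
    by rewrite -[LHS]ger0_norm// -sqrtr_sqr -natrX -expnM.
  by rewrite ler_wsqrtr// ler_nat.
have X0 : 0 < X by exact: expR_gt0.
pose Y := expR (xi * ((2 * rad + 10)%:R * (B * Num.sqrt n%:R))).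
apply: (le_trans Lw).
apply: (@le_trans _ _ (d%:R * X * ((4 * d * (rad + 2))%:R * (6 * X ^+ 4 * L m * expR t) * Y * (6 * X ^+ 4 * L n * expR t)))).
  have AX k : (1 <= k)%N -> (k <= q ^ 6)%N -> A k <= 6 * X ^+ 4 * L k.
    move=> k1 kq; rewrite ler_wpM2r ?(ltW (L0 _ _))// ler_wpM2l//.
    by apply: lerXn2r; rewrite ?nnegrE; [exact: (ltW (E0 k))|exact: (ltW X0)|exact: EX].
  apply: ler_pM.
  - by rewrite mulr_ge0// ltW.
  - by rewrite ltW// field_crossing_gt0.
  - by rewrite ler_wpM2l//; exact: EX.
  apply: (le_trans Dt); apply: ler_pM.
  - by apply: mulr_ge0; [apply: mulr_ge0 => //; exact: ltW|exact: expR_ge0].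
  - by rewrite ltW// field_crossing_gt0.
  - apply: ler_wpM2r; first exact: expR_ge0.
    apply: ler_wpM2l => //; apply: ler_wpM2r; first exact: expR_ge0.
    exact: AX.
  - by apply: (le_trans Tn); rewrite ler_wpM2r ?expR_ge0//; exact: AX.
have -> : d%:R * X * ((4 * d * (rad + 2))%:R * (6 * X ^+ 4 * L m * expR t) * Y * (6 * X ^+ 4 * L n * expR t)) =
    (144 * d ^ 2 * (rad + 2))%:R * (X ^+ 9 * Y * expR t ^+ 2) * L n * L m.
  by rewrite !natrM; ring.
suff main : (144 * d ^ 2 * (rad + 2))%:R * (X ^+ 9 * Y * expR t ^+ 2) <= expR (constant * (q ^ 5)%:R).
  by do 2! (apply: ler_wpM2r; first by apply: ltW; exact: L0).
have q5 : (q ^ 3 <= q ^ 5)%N by rewrite leq_pexp2l.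
have xB : 0 <= xi * B by rewrite mulr_ge0// ltW.
have -> : expR (constant * (q ^ 5)%:R) = expR ((144 * d ^ 2 * (rho + 2) + 2) * q ^ 5)%:R *
    (expR (xi * B * 9 * (q ^ 5)%:R) * expR (xi * B * (2 * rho + 10)%:R * (q ^ 5)%:R) * expR (2 * t)).
  rewrite -!expRD /constant /t; congr expR.
  by rewrite natrM (_ : (2 * rho + 19 = 2 * rho + 10 + 9)%N) ?natrD -?addnA//; ring.
apply: ler_pM => //.
- by rewrite !mulr_ge0 ?exprn_ge0 ?expR_ge0.
- apply: (@le_trans _ _ ((144 * d ^ 2 * (rho + 2) * q ^ 2)%:R)).
    rewrite ler_nat -[leqRHS]mulnA leq_mul2l; apply/orP; right.
    by rewrite /rad mulnDl leq_add2l -{1}[2%N]muln1 leq_mul2l/= expn_gt0 q1.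
  rewrite natrM mulnDl natrD expRD; apply: ler_pM => //.
    by apply: (le_trans (nat_le_expR _)); rewrite ler_expR ler_nat leq_pmulr// expn_gt0 q1.
  apply: (le_trans (nat_pow_le_expR q 2)); rewrite ler_expR ler_nat leq_mul2l/=.
  by rewrite -{1}[q]expn1 leq_pexp2l.
- apply: ler_pM; rewrite ?mulr_ge0 ?exprn_ge0 ?expR_ge0//; last by rewrite -expRM_natl.
  apply: ler_pM; rewrite ?exprn_ge0 ?expR_ge0//.
    rewrite -expRM_natl ler_expR -[leRHS]mulrA mulrCA ler_wpM2l// ler_wpM2l// ler_nat//.
  rewrite ler_expR (_ : xi * _ = xi * B * ((2 * rad + 10)%:R * Num.sqrt n%:R)); last by ring.
  rewrite -[leRHS]mulrA ler_wpM2l//; apply: (@le_trans _ _ (((2 * rho + 10) * q ^ 2)%:R * (q ^ 3)%:R)).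
    apply: ler_pM => //.
      rewrite ler_nat /rad mulnDl mulnA leq_add2l -{1}[10%N]muln1 leq_mul2l/=.
      by rewrite expn_gt0 q1.
    rewrite -[leRHS]ger0_norm// -sqrtr_sqr ler_wsqrtr// -natrX ler_nat -expnM.
    exact: nq.
  by rewrite -!natrM ler_nat -mulnA -expnD.
Qed.

End submultiplicative.

(** * Comparison of crossing costs *)
Section crossing_bounds.
Context {R : realType} {d : nat} (i0 : 'I_d) (N : nat).
Hypothesis N0 : (0 < N)%N.
Implicit Types (xi eta M : R) (phi : site d -> R).

(** The straight path is a candidate. *)
Lemma crossing_le_axis xi phi M : 0 <= xi ->
  (forall k : 'I_N.+1, phi (axis_site i0 k) <= M) ->
  crossing xi i0 N phi <= N.+1%:R * expR (xi * M).
Proof.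
move=> xi0 hM; apply: (le_trans (crossing_le xi phi (axis_king_path i0 N0))).
rewrite /sites_cost (_ : axis_site i0 0 :: _ = [seq axis_site i0 k | k <- iota 0 N.+1])//.
rewrite big_map; apply: (@le_trans _ _ (\sum_(k <- iota 0 N.+1) expR (xi * M))).
  rewrite big_seq [leRHS]big_seq; apply: ler_sum => k; rewrite mem_iota => /andP[_ kN].
  by rewrite ler_expR ler_wpM2l//; exact: (hM (Ordinal kN)).
by rewrite big_const_seq count_predT iter_addr_0 size_iota -[leLHS]mulr_natl.
Qed.

Let path_length (a : site d) s : path (@king d) a s -> `|last a s i0 - a i0| <= (size s)%:Z.
Proof.
elim: s a => [|b s IH] a /=; first by rewrite subrr.
move=> /andP[/forallP/(_ i0) ab /IH]; rewrite !ler_norml => /andP[h1 h2].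
by move: ab; rewrite ler_norml => /andP[h3 h4]; apply/andP; split; lia.
Qed.

(** A path needs at least [N] steps to cover the distance [N]. *)
Lemma crossing_ge_box xi phi M : 0 <= xi ->
  (forall f : box d N, - M <= phi (box_site f)) ->
  N%:R * expR (- (xi * M)) <= crossing xi i0 N phi.
Proof.
move=> xi0 hM; have [s [/and3P[ps /eqP ls /allP bs] us hs]] := crossing_attained xi i0 N0 phi.
apply: le_trans hs; have := path_length ps; rewrite ls !ffunE eqxx subr0 => Ns.
rewrite /sites_cost big_cons; apply: ler_wpDl; first exact: expR_ge0.
apply: (@le_trans _ _ (\sum_(u <- s) expR (- (xi * M)))).
  rewrite big_const_seq count_predT iter_addr_0 -[leRHS]mulr_natl ler_wpM2r ?expR_ge0// ler_nat.
  by move: Ns; rewrite lez_nat.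
rewrite big_seq [leRHS]big_seq; apply: ler_sum => u us'; rewrite ler_expR -mulrN ler_wpM2l//.
by have [|f <-] := box_siteP (bs u _); [rewrite inE us' orbT|exact: hM].
Qed.

(** On each site the weights differ by the factor [exp (|eta - xi| * M)] at most. *)
Lemma crossing_lipschitz xi eta phi M :
  (forall f : box d N, `|phi (box_site f)| <= M) ->
  crossing eta i0 N phi <= expR (`|eta - xi| * M) * crossing xi i0 N phi.
Proof.
move=> hM; have [s [kp us hs]] := crossing_attained xi i0 N0 phi.
apply: (le_trans (crossing_le eta phi kp)); apply: (le_trans _ (ler_wpM2l (expR_ge0 _) hs)).
rewrite /sites_cost mulr_sumr big_seq [leRHS]big_seq; apply: ler_sum => u us'.
have /and3P[_ _ /allP bs] := kp; have [f fu] := box_siteP (bs u us').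
rewrite -expRD ler_expR -lerBlDr -mulrBl; apply: (le_trans (ler_norm _)).
by rewrite normrM ler_wpM2l// -fu.
Qed.

(** On an optimal path for [xi], [sum (y i)^p <= (sum y i)^p] for [p = eta / xi >= 1], since each
    [y i] is at most the sum. *)
Lemma crossing_power xi eta phi : 0 < xi -> xi <= eta ->
  crossing eta i0 N phi <= crossing xi i0 N phi `^ (eta / xi).
Proof.
move=> xi0 xe; have [s [kp us hs]] := crossing_attained xi i0 N0 phi.
apply: (le_trans (crossing_le eta phi kp)).
set S := sites_cost xi phi _ in hs; have r1 : 0 <= eta / xi - 1.
  by rewrite subr_ge0 ler_pdivlMr// mul1r.
have r0 : 0 <= eta / xi by rewrite divr_ge0 ?(le_trans (ltW xi0) xe)// ltW.
have S0 : 0 < S.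
  rewrite /S /sites_cost big_cons; apply: ltr_wpDr; last exact: expR_gt0.
  by apply: sumr_ge0 => u _; exact: expR_ge0.
have T0 := crossing_gt0 xi i0 N0 phi.
apply: (@le_trans _ _ (S `^ (eta / xi))); last first.
  by apply: ge0_ler_powR; rewrite ?nnegrE ?(ltW S0) ?(ltW T0).
have pS (x : R) : 0 < x -> x `^ (eta / xi) = x * x `^ (eta / xi - 1).
  by move=> x0; rewrite mulr_powRB1 ?(ltW x0)// divr_gt0// (lt_le_trans xi0).
rewrite (pS S)// {1}/S /sites_cost mulr_suml big_seq [leRHS]big_seq; apply: ler_sum => u us'.
have -> : expR (eta * phi u) = expR (xi * phi u) `^ (eta / xi).
  rewrite /powR gt_eqF ?expR_gt0// expRK; congr expR.
  by rewrite mulrA divfK ?gt_eqF.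
rewrite pS ?expR_gt0// ler_wpM2l ?expR_ge0//; apply: ge0_ler_powR; rewrite ?nnegrE ?expR_ge0 ?(ltW S0)//.
rewrite /S /sites_cost (big_rem u us')/= lerDl.
by apply: sumr_ge0 => v _; exact: expR_ge0.
Qed.

End crossing_bounds.

(** * Maxima of the field *)
Section field_max.
Context {R : realType} {d : nat} {dO : measure_display} {Omega : measurableType dO}.
Local Notation V := 'rV[R]_d.
Variable P : probability Omega R.
Variables (K : V -> R) (r0 : R) (W : (V * R -> R) -> {RV P >-> R}) (h : nat -> Omega -> V -> R).
Hypothesis lf : log_field K r0 W h.

(** The field has variance [n * ln 2], so that a value exceeds [c * n * ln 2] with probability of
    order [2^-(c^2 / 2 * n)], and there are [2^(k * n + b)] values. *)
Lemma field_max (J : nat -> finType) (x : forall n, J n -> V) (k b : nat) (c : R) :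
  (forall n, (#|J n| <= 2 ^ (k * n + b))%N) -> Num.sqrt (2 * k%:R) < c ->
  exists N : nat, forall n, (N <= n)%N -> (1 <= n)%N ->
    measurable [set w | exists j : J n, c * (n%:R * ln 2) <= `|h n w (x n j)|] /\
    (P [set w | exists j : J n, (c * (n%:R * ln 2) <= `|h n w (x n j)|)%R] <= (8^-1)%:E)%E.
Proof.
move=> cJ kc; have c0 : 0 < c by apply: le_lt_trans kc; exact: sqrtr_ge0.
have l2 := @ln2_gt0 R.
pose del := (c ^+ 2 / 2 - k%:R) * ln 2.
have del0 : 0 < del.
  rewrite mulr_gt0// subr_gt0 ltr_pdivlMr// mulrC.
  rewrite -[ltLHS]sqr_sqrtr ?mulr_ge0// ltrXn2r ?nnegrE ?sqrtr_ge0// ltW//.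
(* From here on [exp (n * del)], which is at least [n * del], exceeds [2^(b + 4)]. *)
exists (Num.bound ((2 ^ (b + 4))%:R / del)) => n nN n1.
have mE j : measurable [set w | c * (n%:R * ln 2) <= `|h n w (x n j)|].
  apply: measurable_ge_set; apply: (measurableT_comp (@normr_measurable _ setT)).
  exact: (field_measurable lf).
split; first exact: measurable_exists.
have n0 : 0 < n%:R :> R by rewrite ltr0n.
have t0 : 0 <= c * (n%:R * ln 2) by rewrite !mulr_ge0// ltW.
have := union_bound mE (fun j => field_tail lf (x n j) n1 t0).
move=> /le_trans; apply; rewrite lee_fin.
have -> : (c * (n%:R * ln 2)) ^+ 2 / (2 * (n%:R * ln 2)) = c ^+ 2 / 2 * (n%:R * ln 2).
  by field; rewrite !gt_eqF.
apply: (@le_trans _ _ ((2 ^ (k * n + b))%:R * (2 * expR (- (c ^+ 2 / 2 * (n%:R * ln 2)))))).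
  by rewrite ler_wpM2r ?mulr_ge0 ?expR_ge0// ler_nat.
have -> : (2 ^ (k * n + b))%:R * (2 * expR (- (c ^+ 2 / 2 * (n%:R * ln 2)))) =
    (2 ^ (b + 1))%:R * expR (- (n%:R * del)) :> R.
  rewrite expnD natrM natrX -[2 ^+ (k * n)]lnK ?posrE ?exprn_gt0// ln_pow2 addn1 expnSr natrM.
  have -> : - (n%:R * del) = (k * n)%:R * ln 2 + - (c ^+ 2 / 2 * (n%:R * ln 2)) by rewrite natrM /del; ring.
  by rewrite !natrM expRD; ring.
rewrite expRN ler_pdivrMr ?expR_gt0//.
have -> : (2 ^ (b + 1))%:R = 8^-1 * (2 ^ (b + 4))%:R :> R.
  have -> : (2 ^ (b + 4) = 8 * 2 ^ (b + 1))%N by rewrite -(expnD 2 3); congr (2 ^ _)%N; lia.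
  by rewrite natrM mulrA mulVf ?mul1r// pnatr_eq0.
rewrite ler_wpM2l// ?invr_ge0//; apply: le_trans (expR_ge1Dx _); apply: ler_wpDl => //.
rewrite -ler_pdivrMr//; apply: (le_trans (ltW (archi_boundP _))); last by rewrite ler_nat.
by rewrite divr_ge0// ltW.
Qed.

End field_max.

(** * Choosing the number of slabs *)
Section sixth_root.

Lemma sixth_rootP (s : nat) : (2 <= s)%N -> exists q : nat,
  [/\ (2 <= q)%N, (s <= q ^ 6)%N & (q.-1 ^ 6 < s)%N].
Proof.
move=> s2; have ex : exists q, (s <= q ^ 6)%N.
  by exists s; rewrite -{1}[s]expn1 leq_pexp2l// ltnW.
exists (ex_minn ex); case: ex_minnP => q sq hq; split => //.
  by case: q sq hq => [|[|q]]//; rewrite ?exp1n => h; move: (leq_trans s2 h).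
rewrite ltnNge; apply/negP => /hq; case: q sq {hq} => [|q] sq /=; last by rewrite ltnn.
by move: (leq_trans s2 sq).
Qed.

Lemma sixth_root_le (q : nat) : (2 <= q)%N -> (q ^ 6 <= 64 * q.-1 ^ 6)%N.
Proof.
move=> q2; have -> : (64 = 2 ^ 6)%N by [].
by rewrite -expnMn leq_exp2r//; lia.
Qed.

Lemma linear_le_pow2 (c n : nat) : (4 * c <= n)%N -> (c * n <= 2 ^ n)%N.
Proof.
move=> cn; have h1 : (n./2.+1 <= 2 ^ n./2)%N by exact: ltn_expl.
have h2 : (2 ^ n./2 * 2 ^ n./2 <= 2 ^ n)%N.
  by rewrite -expnD leq_pexp2l// addnn -{2}[n]odd_double_half leq_addl.
apply: leq_trans h2; apply: (leq_trans _ (leq_mul h1 h1)).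
have h3 : (n <= n./2.*2.+1)%N by rewrite -{1}[n]odd_double_half; case: (odd n).
move: h3; rewrite -muln2; move: (n./2) => e h3; nia.
Qed.

End sixth_root.

(** * Growth rates of the medians *)
Section rate_comparison.
Context {R : realType}.

(** After division by [n] the inequality passes to the limit, and [Num.sqrt n / n] tends to 0. *)
Lemma rate_le (u v : nat -> R) (l l' al be ga : R) (N : nat) :
  (u n / n%:R) @[n --> \oo] --> l -> (v n / n%:R) @[n --> \oo] --> l' -> 0 <= al ->
  (forall n, (N <= n)%N -> u n <= al * v n + be * n%:R + ga * Num.sqrt n%:R) -> l <= al * l' + be.
Proof.
move=> ul vl al0 uv; apply/ler_addgt0Pr => e e0.
pose e1 := e / (2 + al); have a2 : 0 < 2 + al by rewrite ltr_wpDr.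
have e10 : 0 < e1 by rewrite divr_gt0.
pose A := (`|ga| / e1) ^+ 2.
near \oo => n.
have nN : (N <= n)%N by near: n; exact: nbhs_infty_ge.
have n0 : 0 < n%:R :> R by rewrite ltr0n; near: n; exact: nbhs_infty_gt.
have nA : A <= n%:R by near: n; exact: nbhs_infty_ger.
have hu : `|l - u n / n%:R| <= e1 by near: n; exact: (cvgrPdist_le _ _).1 ul _ e10.
have hv : `|l' - v n / n%:R| <= e1 by near: n; exact: (cvgrPdist_le _ _).1 vl _ e10.
have hs : ga * Num.sqrt n%:R <= e1 * n%:R.
  have s1 : `|ga| / e1 <= Num.sqrt n%:R.
    have g0 : 0 <= `|ga| / e1 by rewrite divr_ge0// ltW.
    by rewrite -[leLHS](ger0_norm g0) -sqrtr_sqr; exact: ler_wsqrtr.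
  rewrite -[X in _ <= _ * X]sqr_sqrtr ?(ltW n0)// expr2 mulrA ler_wpM2r ?sqrtr_ge0//.
  by apply: (le_trans (ler_norm _)); rewrite mulrC -ler_pdivrMr.
have h := uv n nN.
have h' : u n / n%:R <= al * (v n / n%:R) + be + e1.
  rewrite ler_pdivrMr// 2!mulrDl -mulrA divfK ?gt_eqF//; apply: (le_trans h).
  by rewrite lerD2l.
have ale : al * e1 + 2 * e1 = e by rewrite -mulrDl addrC /e1 mulrC divfK// gt_eqF.
have hav : al * (v n / n%:R) <= al * l' + al * e1.
  by rewrite -mulrDr ler_wpM2l//; move: hv; rewrite ler_norml => /andP[hv1 _]; move: hv1;
    move: (v n / n%:R) => q; lra.
move: hu; rewrite ler_norml => /andP[_ hu1]; move: hu1 h' hav; rewrite -ale.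
by move: (u n / _) (al * (v n / _)) (al * l') (al * e1) => q1 q2 q3 q4; lra.
Unshelve. all: by end_near.
Qed.

End rate_comparison.

Section growth.
Context {R : realType} {d : nat} {dO : measure_display} {Omega : measurableType dO}.
Local Notation V := 'rV[R]_d.
Variable P : probability Omega R.
Variables (K : V -> R) (r0 : R) (W : (V * R -> R) -> {RV P >-> R}) (h : nat -> Omega -> V -> R).
Hypothesis lf : log_field K r0 W h.
Variables (i0 i1 : 'I_d) (B : R).
Hypotheses (i00 : val i0 = 0%N) (i01 : i0 != i1) (B0 : 0 < B).
Hypothesis osc : forall n, (1 <= n)%N -> exists Bad : set Omega,
  [/\ measurable Bad, (P Bad <= (2 ^- n / 16)%:E)%E & forall w, ~ Bad w -> tame h B n w].
Variable lam : R -> nat -> R.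
Hypothesis med : forall xi n, 0 < xi -> (1 <= n)%N ->
  is_median P (fun w => exp_dist xi (h n w) 0 e1 (ball (0 : V) 2)) (lam xi n).
Local Notation L xi := (scaled_median (lam xi)).
Local Notation T xi := (field_crossing h xi i0).

Definition log_median xi n := ln (L xi n).
Local Notation a := log_median.

Let L_gt0 xi n : 0 < xi -> (1 <= n)%N -> 0 < L xi n.
Proof. by move=> xi0; exact: (scaled_median_gt0 lf i00 (fun n => med xi0)). Qed.

Let T_gt0 xi n w : 0 < T xi n w. Proof. exact: field_crossing_gt0. Qed.

Let sqrt_ge1 n : (1 <= n)%N -> 1 <= Num.sqrt n%:R :> R.
Proof. by move=> n1; rewrite -[leLHS]sqrtr1 ler_wsqrtr// ler1n. Qed.

Let ln_bound (x y c : R) : 0 < x -> 0 < y -> x <= expR c * y -> ln x <= ln y + c.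
Proof.
move=> x0 y0 xy; rewrite addrC -[c in leRHS]expRK -lnM ?posrE ?expR_gt0//.
by rewrite ler_ln ?posrE// mulr_gt0 ?expR_gt0.
Qed.

(** Inequalities between crossing costs hold at each outcome; this transfers them to medians. The
    event that [T eta] is large has a probability bounded below, while the event that [T xi] is
    much larger than its median predicts can be made as unlikely as necessary, so that some
    outcome combines both and avoids [Bad]. *)
Lemma typical xi eta : 0 < xi -> 0 < eta -> exists c : R, forall n (Bad : set Omega),
  (1 <= n)%N -> measurable Bad -> (P Bad <= (8^-1)%:E)%E -> exists w, [/\ ~ Bad w,
    a eta n <= ln (T eta n w) + c * Num.sqrt n%:R & ln (T xi n w) <= a xi n + c * Num.sqrt n%:R].
Proof.
move=> xi0 eta0; pose tau := Num.sqrt (8 * xi ^+ 2 * ln 2 * 7).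
have l2 := @ln2_gt0 R.
have x2 : 0 < 8 * xi ^+ 2 * ln 2 by rewrite !mulr_gt0 ?exprn_gt0.
have tau0 : 0 < tau by rewrite sqrtr_gt0 mulr_gt0.
have etaB : 0 <= eta * B by rewrite mulr_ge0// ltW.
have xiB : 0 <= xi * B by rewrite mulr_ge0// ltW.
exists (d%:R + eta * B + (6 + 4 * (xi * B) + tau)) => n Bad n1 mB PB.
have s1 := sqrt_ge1 n1; set sq := Num.sqrt n%:R in s1 *.
have sq0 : 0 < sq by exact: lt_le_trans s1.
have n0 : 0 < n%:R :> R by rewrite ltr0n.
have t0 : 0 < tau * sq by rewrite mulr_gt0.
(* With this [tau] the exponent is 7, and [8 * exp (- 7) <= 1 / 16]. *)
have tail := crossing_upper_tail lf i00 B0 osc xi0 (fun n => med xi0) n1 t0.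
set Up := [set w | _ <= T xi n w] in tail.
have mU : measurable Up.
  by apply: measurable_ge_set; exact: (measurable_field_crossing lf).
have PU : (P Up <= (16^-1)%:E)%E.
  apply: (le_trans tail); rewrite lee_fin.
  have -> : (tau * sq) ^+ 2 / (8 * xi ^+ 2 * (n%:R * ln 2)) = 7%:R.
    have -> : (tau * sq) ^+ 2 = tau ^+ 2 * sq ^+ 2 by ring.
    rewrite /tau /sq !sqr_sqrtr ?(ltW n0)//; last by rewrite mulr_ge0// ltW.
    by field; rewrite !gt_eqF.
  rewrite expRN ler_pdivrMr ?expR_gt0//.
  have : 2 ^+ 7 <= expR 7%:R :> R by exact: pow2_le_expR.
  by rewrite -natrX; lra.
have PBU : (P (Bad `|` Up) <= (3 / 8)%:E)%E.
  apply: (le_trans (measureU2 P mB mU)); apply: (@le_trans _ _ ((8^-1)%:E + (16^-1)%:E)%E).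
    exact: leeD.
  by rewrite -EFinD lee_fin; lra.
have [w [nB _ Lw]] := median_outside lf i00 osc eta0 (fun n => med eta0) n1 (measurableU _ _ mB mU) PBU.
have X0 : 0 <= 6 + 4 * (xi * B) + tau by rewrite !addr_ge0 ?mulr_ge0// ltW.
have Y0 : 0 <= d%:R + eta * B by rewrite addr_ge0.
exists w; split; first by move=> Bw; apply: nB; left.
- have Lb : L eta n <= expR ((d%:R + eta * B) * sq) * T eta n w.
    apply: (le_trans Lw); rewrite ler_wpM2r ?(ltW (T_gt0 _ _ _))// mulrDl expRD mulrA.
    rewrite ler_wpM2r ?expR_ge0//; apply: (le_trans (nat_le_expR d)).
    by rewrite ler_expR ler_peMr.
  apply: (le_trans (ln_bound (L_gt0 eta0 n1) (T_gt0 _ _ _) Lb)).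
  by rewrite lerD2l ler_wpM2r ?(ltW sq0)// lerDl.
- have Tb : T xi n w <= expR ((6 + 4 * (xi * B) + tau) * sq) * L xi n.
    have : T xi n w < 6 * expR (xi * (B * sq)) ^+ 4 * L xi n * expR (tau * sq).
      by rewrite ltNge; apply/negP => b; apply: nB; right.
    move=> /ltW /le_trans; apply.
    have -> : expR ((6 + 4 * (xi * B) + tau) * sq) =
        expR (6 * sq) * expR (4 * (xi * B) * sq) * expR (tau * sq).
      by rewrite -!expRD; congr expR; ring.
    rewrite mulrAC; apply: ler_wpM2r; first exact: ltW (L_gt0 xi0 n1).
    apply: ler_wpM2r; first exact: expR_ge0.
    apply: ler_pM => //.
      apply: (le_trans (nat_le_expR 6)); by rewrite ler_expR ler_peMr.
    by rewrite -expRM_natl ler_expR le_eqVlt; apply/orP; left; apply/eqP; ring.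
  apply: (le_trans (ln_bound (T_gt0 _ _ _) (L_gt0 xi0 n1) Tb)).
  by rewrite lerD2l ler_wpM2r ?(ltW sq0)// lerDr.
Qed.

Let boxes n : finType := box d (2 ^ n).
Let box_point n (f : boxes n) : V := dyadic_point n (box_site f).

Let d0 : (0 < d)%N. Proof. exact: leq_ltn_trans (leq0n i0) (ltn_ord i0). Qed.

Let box_event (c : R) : Num.sqrt (2 * d%:R) < c -> exists N : nat, forall n, (N <= n)%N -> (1 <= n)%N ->
  exists Bad : set Omega, [/\ measurable Bad, (P Bad <= (8^-1)%:E)%E &
    forall w, ~ Bad w -> forall f : boxes n, `|h n w (box_point f)| <= c * (n%:R * ln 2)].
Proof.
move=> hc; have [|N hN] := field_max lf (J := boxes) box_point (k := d) (b := 2 * d) _ hc.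
  move=> n; apply: (@leq_trans ((4 * 2 ^ n) ^ d)); first by apply: card_box; rewrite expn_gt0.
  rewrite -(expnD 2 2) -expnM leq_pexp2l//; lia.
exists N => n nN n1; have [mB PB] := hN n nN n1; eexists; split; [exact: mB|exact: PB|].
by move=> w nb f; rewrite leNgt; apply/negP => /ltW b; apply: nb; exists f.
Qed.

Let axis_event (c : R) : Num.sqrt 2 < c -> exists N : nat, forall n, (N <= n)%N -> (1 <= n)%N ->
  exists Bad : set Omega, [/\ measurable Bad, (P Bad <= (8^-1)%:E)%E &
    forall w, ~ Bad w -> forall k : 'I_(2 ^ n).+1, `|h n w (dyadic_point n (axis_site i0 k))| <= c * (n%:R * ln 2)].
Proof.
move=> hc; have [||N hN] := field_max lf (J := fun n => 'I_(2 ^ n).+1)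
  (fun n k => dyadic_point n (axis_site i0 k)) (k := 1) (b := 1) (c := c).
- move=> n; rewrite card_ord mul1n addn1 expnS mul2n -addnn -[X in (X < _)%N]addn0 -addnS leq_add2l.
  by rewrite expn_gt0.
- by rewrite mulr1.
exists N => n nN n1; have [mB PB] := hN n nN n1; eexists; split; [exact: mB|exact: PB|].
by move=> w nb f; rewrite leNgt; apply/negP => /ltW b; apply: nb; exists f.
Qed.

Let sqrt_lt : Num.sqrt (2 * d%:R) < d.+1%:R :> R.
Proof.
rewrite -[ltRHS]ger0_norm// -sqrtr_sqr ltr_sqrt ?exprn_gt0 ?ltr0n//.
by rewrite -natrX -natrM ltr_nat; nia.
Qed.

Let ln_T_low xi n w (M : R) : 0 < xi ->
  (forall f : boxes n, `|h n w (box_point f)| <= M) -> n%:R * ln 2 - xi * M <= ln (T xi n w).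
Proof.
move=> xi0 hM; have N0 : (0 < 2 ^ n)%N by rewrite expn_gt0.
have hM' (f : boxes n) : - M <= h n w (box_point f) by have := hM f; rewrite ler_norml => /andP[].
have := @crossing_ge_box R d i0 (2 ^ n) N0 xi (fun v => h n w (dyadic_point n v)) M (ltW xi0) hM'.
rewrite -/(T xi n w) => hT; rewrite -ln_pow2 -[X in _ - X]opprK -[- (xi * M)]expRK opprK -lnM ?posrE ?expR_gt0 ?exprn_gt0//.
rewrite ler_ln ?posrE ?mulr_gt0 ?expR_gt0 ?exprn_gt0//.
by move: hT; rewrite natrX.
Qed.

Let sqrt_le n : (1 <= n)%N -> Num.sqrt n%:R <= n%:R :> R.
Proof.
move=> n1; rewrite -{2}[n%:R]sqr_sqrtr// expr2 ler_peMr ?sqrtr_ge0//; exact: sqrt_ge1.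
Qed.

(** The field on the box is [O(n)], and a path has at least [2^n] steps. *)
Let linear_lower xi : 0 < xi -> exists (C : R) (N : nat), (1 <= N)%N /\
  forall n, (N <= n)%N -> - (C * n%:R) <= a xi n.
Proof.
move=> xi0; have [c hc] := typical xi0 xi0; have [N hN] := box_event sqrt_lt.
exists (xi * d.+1%:R * ln 2 + `|c|), N.+1; split => // n nN.
have n1 : (1 <= n)%N by exact: leq_trans nN.
have [Bad [mB PB nB]] := hN n (ltnW nN) n1.
have [w [wB _ Tw]] := hc n Bad n1 mB PB.
have := ln_T_low xi0 (nB w wB).
have c1 : c * Num.sqrt n%:R <= `|c| * n%:R.
  apply: (@le_trans _ _ (`|c| * Num.sqrt n%:R)); first by rewrite ler_wpM2r ?sqrtr_ge0 ?ler_norm.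
    by rewrite ler_wpM2l// sqrt_le.
have l2 : 0 <= n%:R * ln 2 :> R by rewrite mulr_ge0// ltW// ln2_gt0.
have -> : xi * (d.+1%:R * (n%:R * ln 2)) = xi * d.+1%:R * ln 2 * n%:R by ring.
move: Tw c1 l2; rewrite mulrDl; move: (ln (T _ _ _)) (a xi n) (c * _) (xi * d.+1%:R * ln 2 * n%:R) (`|c| * n%:R) (n%:R * ln 2).
by move=> q1 q2 q3 q4 q5 q6; lra.
Qed.

(** The larger of [n] and [m], which is at least [q^6 / 128], is taken as the number of coarse
    scales; this makes the coarse box large enough for the detours. *)
Let subadditive xi : 0 < xi -> exists (C : R) (N : nat), 0 <= C /\ forall n m,
  (1 <= n)%N -> (1 <= m)%N -> (N <= n + m)%N ->
  a xi (n + m) <= a xi n + a xi m + C * (n + m)%:R `^ (5 / 6).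
Proof.
move=> xi0.
have [rho rho_ge] : exists rho : nat, 2 * r0 + 4 <= rho%:R.
  have r0' := lf_r0 lf; exists (Num.bound (2 * r0 + 4)); apply/ltW/archi_boundP.
  by rewrite addr_ge0// mulr_ge0// ltW.
have [C C0 hC] : exists2 C : R, 0 <= C & forall n m q, (1 <= n)%N -> (1 <= m)%N -> (1 <= q)%N ->
    (n + m <= q ^ 6)%N -> (rho * q ^ 2 + 4 <= 2 ^ n)%N -> a xi (n + m) <= a xi n + a xi m + C * (q ^ 5)%:R.
  eexists; last first.
    move=> n m q n1 m1 q1 nmq rn.
    have := submultiplicative lf i00 i01 B0 osc xi0 (fun n => med xi0) rho_ge n1 m1 q1 nmq rn.
    have Ln := L_gt0 xi0 n1; have Lm := L_gt0 xi0 m1; have Lnm := L_gt0 xi0 (leq_trans n1 (leq_addr m n)).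
    rewrite -mulrA => h1; have := ln_bound Lnm (mulr_gt0 Ln Lm) h1.
    have -> : ln (L xi n * L xi m) = a xi n + a xi m by apply: lnM; rewrite posrE.
    by move=> h2; exact: h2.
  by rewrite !addr_ge0 ?mulr_ge0 ?sqrtr_ge0// ltW.
pose c := (128 * rho + 4)%N.
exists (C * 32), (8 * c + 8)%N; split; first exact: mulr_ge0.
suff main n m : (1 <= n)%N -> (1 <= m)%N -> (8 * c + 8 <= n + m)%N -> (m <= n)%N ->
    a xi (n + m) <= a xi n + a xi m + C * 32 * (n + m)%:R `^ (5 / 6).
  move=> n m n1 m1 nm; have [mn|/ltnW nm'] := leqP m n; first exact: main.
  by rewrite [(n + m)%N]addnC [a xi n + _]addrC; apply: main => //; rewrite [(m + n)%N]addnC.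
move=> n1 m1 nm mn.
have [|q [q2 q6 q6']] := @sixth_rootP (n + m); first lia.
have r6 := sixth_root_le q2.
have q26 : (q ^ 2 <= q ^ 6)%N by rewrite leq_pexp2l// ltnW.
have q128 : (q ^ 2 <= 128 * n)%N by lia.
have rn : (rho * q ^ 2 + 4 <= 2 ^ n)%N.
  apply: (@leq_trans (c * n)%N); last by apply: linear_le_pow2; lia.
  rewrite /c mulnDl; apply: leq_add; last by rewrite leq_pmulr.
  by rewrite [(128 * rho)%N]mulnC -mulnA leq_mul2l q128 orbT.
apply: (le_trans (hC n m q n1 m1 (ltnW q2) q6 rn)); rewrite lerD2l -mulrA ler_wpM2l//.
have q5 : (q ^ 5 <= 32 * q.-1 ^ 5)%N.
  by have -> : (32 = 2 ^ 5)%N by []; rewrite -expnMn leq_exp2r//; lia.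
apply: (@le_trans _ _ ((32 * q.-1 ^ 5)%:R)); first by rewrite ler_nat.
rewrite natrM ler_wpM2l//.
have -> : (q.-1 ^ 5)%:R = (q.-1 ^ 6)%:R `^ (5 / 6) :> R.
  rewrite !natrX -!powR_mulrn// -powRrM; congr (_ `^ _).
  by rewrite mulrCA divff ?mulr1// pnatr_eq0.
by apply: ge0_ler_powR; rewrite ?nnegrE// ?ler_nat ?(ltnW q6')//; apply: divr_ge0.
Qed.

Lemma growth_exists xi : 0 < xi -> exists l : R, (a xi n / n%:R) @[n --> \oo] --> l.
Proof.
move=> xi0; have [C [N [C0 hC]]] := subadditive xi0; have [C' [N' [N'1 hC']]] := linear_lower xi0.
have h1 : 0 < 5 / 6 :> R by lra.
have h2 : 5 / 6 < 1 :> R by lra.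
apply: (@near_subadditive_limit R (a xi) C (5 / 6) C' (maxn N N')) => //.
- by rewrite (leq_trans N'1)// leq_maxr.
- by move=> n m n1 m1; rewrite geq_max => /andP[nm _]; exact: hC.
- by move=> n; rewrite geq_max => /andP[_ nm]; exact: hC'.
Qed.

Definition growth xi := lim ((a xi n / n%:R) @[n --> \oo]).

Lemma cvg_growth xi : 0 < xi -> (a xi n / n%:R) @[n --> \oo] --> growth xi.
Proof. by move=> xi0; have [l hl] := growth_exists xi0; rewrite /growth (cvg_lim _ hl). Qed.

Let lin_cvg (x : R) : ((x * n%:R) / n%:R) @[n --> \oo] --> x.
Proof.
apply: cvg_near_cst; near=> n; rewrite mulfK// pnatr_eq0 -lt0n.
by near: n; exact: nbhs_infty_gt.
Unshelve. all: by end_near.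
Qed.

(** The field is at least [- c * n * ln 2] on the box, so that each of the [2^n] steps of a path
    costs at least [exp (- xi * c * n * ln 2)]. *)
Lemma growth_ge xi c : 0 < xi -> Num.sqrt (2 * d%:R) < c -> (1 - xi * c) * ln 2 <= growth xi.
Proof.
move=> xi0 hc; have [c' hc'] := typical xi0 xi0; have [N hN] := box_event hc.
have -> : growth xi = 1 * growth xi + 0 by rewrite mul1r addr0.
have H := @rate_le R (fun n => (1 - xi * c) * ln 2 * n%:R) (a xi) _ _ 1 0 c' N.+1 (@lin_cvg ((1 - xi * c) * ln 2)) (cvg_growth xi0) ler01.
apply: H => n nN.
have n1 : (1 <= n)%N by exact: leq_trans nN.
have [Bad [mB PB nB]] := hN n (ltnW nN) n1.
have [w [wB _ Tw]] := hc' n Bad n1 mB PB.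
have := ln_T_low xi0 (nB w wB); rewrite mul1r mul0r addr0 => Tl.
apply: le_trans Tw; apply: le_trans Tl; rewrite le_eqVlt; apply/orP; left; apply/eqP; ring.
Qed.

(** The straight path has [2^n + 1] sites, each of cost at most [exp (xi * c * n * ln 2)]. *)
Lemma growth_le xi c : 0 < xi -> Num.sqrt 2 < c -> growth xi <= (1 + xi * c) * ln 2.
Proof.
move=> xi0 hc; have [c' hc'] := typical xi0 xi0; have [N hN] := axis_event hc.
have -> : (1 + xi * c) * ln 2 = 1 * ((1 + xi * c) * ln 2) + 0 by rewrite mul1r addr0.
have l2 := @ln2_gt0 R.
have H := @rate_le R (a xi) (fun n => (1 + xi * c) * ln 2 * n%:R) _ _ 1 0 (c' + ln 2) N.+1 (cvg_growth xi0) (@lin_cvg ((1 + xi * c) * ln 2)) ler01.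
apply: H => n nN.
have n1 : (1 <= n)%N by exact: leq_trans nN.
have [Bad [mB PB nB]] := hN n (ltnW nN) n1.
have [w [wB Tw _]] := hc' n Bad n1 mB PB.
apply: (le_trans Tw); rewrite mul1r mul0r addr0 [(c' + ln 2) * _]mulrDl [leRHS]addrA [leRHS]addrAC lerD2r.
have N0 : (0 < 2 ^ n)%N by rewrite expn_gt0.
have hM (k : 'I_(2 ^ n).+1) : h n w (dyadic_point n (axis_site i0 k)) <= c * (n%:R * ln 2).
  by have := nB w wB k; rewrite ler_norml => /andP[].
have hT := @crossing_le_axis R d i0 (2 ^ n) N0 xi (fun v => h n w (dyadic_point n v)) _ (ltW xi0) hM.
have p1 : (2 ^ n).+1%:R <= 2 ^+ n.+1 :> R.
  by rewrite -natrX ler_nat expnS mul2n -addnn -addn1 leq_add2l.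
have hT' : T xi n w <= expR (xi * (c * (n%:R * ln 2))) * 2 ^+ n.+1.
  by apply: (le_trans hT); rewrite mulrC ler_wpM2l// expR_ge0.
apply: (le_trans (ln_bound (T_gt0 _ _ _) _ hT')); first by rewrite exprn_gt0.
have s1 := sqrt_ge1 n1; have : ln 2 <= ln 2 * Num.sqrt n%:R :> R by rewrite ler_peMr// ltW.
rewrite ln_pow2 -[n.+1%:R]natr1; move: (Num.sqrt n%:R) => q.
have E2 : (1 + xi * c) * ln 2 * n%:R = n%:R * ln 2 + xi * (c * (n%:R * ln 2)) by ring.
rewrite E2 mulrDl mul1r.
by rewrite addrAC lerD2l.
Qed.

(** The comparison of crossing costs for the same field, transferred to the medians. *)
Lemma growth_power xi eta : 0 < xi -> xi <= eta -> growth eta <= eta / xi * growth xi.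
Proof.
move=> xi0 xe; have eta0 := lt_le_trans xi0 xe.
have [c hc] := typical xi0 eta0.
rewrite -[leRHS]addr0.
have rr : 0 <= eta / xi by rewrite divr_ge0// ltW.
apply: (rate_le (ga := eta / xi * c + c) (N := 1) (cvg_growth eta0) (cvg_growth xi0)) => // n n1.
have [|w [_ h1 h2]] := hc n set0 n1 measurable0; first by rewrite measure0 lee_fin.
have N0 : (0 < 2 ^ n)%N by rewrite expn_gt0.
have := @crossing_power R d i0 (2 ^ n) N0 xi eta (fun v => h n w (dyadic_point n v)) xi0 xe.
rewrite -/(T xi n w) -/(T eta n w) -ler_ln ?posrE ?powR_gt0 ?T_gt0// ln_powR => h3.
rewrite mul0r addr0 mulrDl.
have h4 := ler_wpM2l rr h2; move: h1 h3 h4; rewrite mulrDr -(mulrA _ c).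
move: (ln _) (ln _) => q1 q2; lra.
Qed.

(** The field on the box is at most [(d + 1) * n * ln 2], as [d + 1] exceeds [sqrt (2 * d)]. *)
Lemma growth_lipschitz xi eta : 0 < xi -> 0 < eta ->
  growth eta <= growth xi + `|eta - xi| * (d.+1%:R * ln 2).
Proof.
move=> xi0 eta0; have [c hc] := typical xi0 eta0; have [N hN] := box_event sqrt_lt.
rewrite -[growth xi]mul1r.
apply: (rate_le (ga := c + c) (N := N.+1) (cvg_growth eta0) (cvg_growth xi0)) => // n nN.
have n1 : (1 <= n)%N by exact: leq_trans nN.
have [Bad [mB PB nB]] := hN n (ltnW nN) n1.
have [w [wB h1 h2]] := hc n Bad n1 mB PB.
have N0 : (0 < 2 ^ n)%N by rewrite expn_gt0.
have := @crossing_lipschitz R d i0 (2 ^ n) N0 xi eta (fun v => h n w (dyadic_point n v)) _ (nB w wB).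
rewrite -/(T xi n w) -/(T eta n w) -ler_ln ?posrE ?mulr_gt0 ?expR_gt0 ?T_gt0// lnM ?posrE ?expR_gt0 ?T_gt0//.
rewrite expRK => h3; rewrite mul1r mulrDl.
have -> : `|eta - xi| * (d.+1%:R * ln 2) * n%:R = `|eta - xi| * (d.+1%:R * (n%:R * ln 2)) by ring.
by move: h1 h2 h3; move: (ln _) (ln _) (`|_| * _) (a xi n) (a eta n) (c * _) => q1 q2 q3 q4 q5 q6; lra.
Qed.

End growth.

(** * The exponent *)
Theorem proposition1p1 (R : realType) (d : nat) (d_ge2 : (2 <= d)%N)
    (K : 'rV[R]_d -> R) (r0 : R) (r0_gt0 : 0 < r0)
    (K_smooth : smooth K) (K_ge0 : forall x : 'rV[R]_d, 0 <= K x) (K_radial : radial K)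
    (K_supp : forall x : 'rV[R]_d, ~ ball (0 : 'rV[R]_d) r0 x -> K x = 0)
    (K_norm : (\int[lebesgue_rV d]_x (K x ^+ 2)%:E = 1)%E)
    (dO : measure_display) (Omega : measurableType dO)
    (P : probability Omega R)
    (W : ('rV[R]_d * R -> R) -> {RV P >-> R}) (W_noise : white_noise W)
    (h : nat -> Omega -> 'rV[R]_d -> R)
    (h_field : forall n, (1 <= n)%N -> smooth_modification W K n (h n))
    (lambda : R -> nat -> R)
    (lambda_median : forall (xi : R) (n : nat), 0 < xi -> (1 <= n)%N ->
       is_median P (fun w => exp_dist xi (h n w) 0 e1 (ball 0 2))
         (lambda xi n)) :
  exists Q : R -> R,
    [/\ forall xi : R, 0 < xi -> exists eps : nat -> R,
          eps =o_\oo (fun n => n%:R : R) /\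
          forall n, (1 <= n)%N ->
            lambda xi n = 2 `^ (- (1 - xi * Q xi) * n%:R + eps n),
        {in `]0, +oo[, continuous Q},
        forall x y : R, 0 < x -> x <= y -> Q y <= Q x &
        forall xi : R, 0 < xi ->
          xi^-1 - Num.sqrt (2 * d%:R) <= Q xi <= xi^-1 + Num.sqrt 2].
Proof.
have lf : log_field K r0 W h by split.
have [B B0 osc] := field_oscillation lf.
have d0 : (0 < d)%N := ltnW d_ge2.
pose i0 : 'I_d := Ordinal d0; pose i1 : 'I_d := Ordinal d_ge2.
have i00 : val i0 = 0%N by [].
have i01 : i0 != i1 by [].
have med xi n (xi0 : 0 < xi) (n1 : (1 <= n)%N) := @lambda_median xi n xi0 n1.
have l2 := @ln2_gt0 R.
pose g := growth lambda.
have gcvg := cvg_growth lf i00 i01 B0 osc med.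
have gpow := growth_power lf i00 i01 B0 osc med.
have glip := growth_lipschitz lf i00 i01 B0 osc med.
have glow := growth_ge lf i00 i01 B0 osc med.
have gup := growth_le lf i00 i01 B0 osc med.
exists (fun xi => g xi / (xi * ln 2)); split.
- move=> xi xi0; pose a := log_median lambda xi.
  exists (fun n => (a n - g xi * n%:R) / ln 2); split.
    apply/eqoP => e e0; have e1 : 0 < e * ln 2 by rewrite mulr_gt0.
    near=> n; have n0 : 0 < n%:R :> R by rewrite ltr0n; near: n; exact: nbhs_infty_gt.
    have : `|g xi - a n / n%:R| <= e * ln 2.
      by near: n; exact: (cvgrPdist_le _ _).1 (gcvg xi xi0) _ e1.
    move=> h1; have -> : a n - g xi * n%:R = - ((g xi - a n / n%:R) * n%:R) by field; rewrite gt_eqF.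
    have i2 : 0 < (ln 2 : R)^-1 by rewrite invr_gt0.
    rewrite normrM normrN normrM (gtr0_norm i2) !(gtr0_norm n0) ler_pdivrMr//.
    by rewrite [leRHS]mulrAC ler_pM2r.
  move=> n n1; have lam0 := median_gt0 lf i00 (fun n => med xi n xi0) n1.
  have p0 : 0 < 2 ^+ n :> R by rewrite exprn_gt0.
  rewrite /powR gt_eqF//.
  have -> : (- (1 - xi * (g xi / (xi * ln 2))) * n%:R + (a n - g xi * n%:R) / ln 2) * ln 2 =
      - (n%:R * ln 2) + a n by field; rewrite !gt_eqF.
  rewrite expRD expR_ln2 lnK ?posrE ?mulr_gt0// /scaled_median mulrA mulVf ?mul1r// gt_eqF//.
- move=> x; rewrite in_itv/= andbT => x0.
  have gc : g y @[y --> x] --> g x.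
    have D0 : 0 < d.+1%:R * ln 2 :> R by rewrite mulr_gt0.
    apply/cvgrPdist_le => e e0; near=> y.
    have y0 : 0 < y by near: y; exact: lt_nbhsr.
    have xy : `|x - y| <= e / (d.+1%:R * ln 2).
      by near: y; apply: cvgr_dist_le => //; exact: divr_gt0.
    rewrite ler_pdivlMr// in xy.
    have h1 := glip x y x0 y0; have h2 := glip y x y0 x0; rewrite distrC in h1.
    rewrite ler_norml; apply/andP; split; rewrite /g; lra.
  apply: cvgM => //; apply: cvgV; first by rewrite gt_eqF// mulr_gt0.
  by apply: cvgM; [exact: cvg_id|exact: cvg_cst].
- move=> x y x0 xy; have y0 := lt_le_trans x0 xy.
  have := gpow x y x0 xy; rewrite -/(g y) -/(g x) => h1.
  rewrite !invfM !mulrA ler_pM2r ?invr_gt0// ler_pdivrMr//.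
  by rewrite [leRHS]mulrC mulrA mulrAC.
- move=> xi xi0; have x2 : 0 < xi * ln 2 by rewrite mulr_gt0.
  have e1 (c : R) : (1 - xi * c) * ln 2 / (xi * ln 2) = xi^-1 - c by field; rewrite !gt_eqF.
  have e2 (c : R) : (1 + xi * c) * ln 2 / (xi * ln 2) = xi^-1 + c by field; rewrite !gt_eqF.
  apply/andP; split; apply/ler_addgt0Pr => e e0.
    have := glow xi (Num.sqrt (2 * d%:R) + e) xi0 _; rewrite ltrDl => /(_ e0) h1.
    rewrite -lerBlDr -addrA -opprD -e1 ler_pM2r ?invr_gt0//.
  have := gup xi (Num.sqrt 2 + e) xi0 _; rewrite ltrDl => /(_ e0) h1.
  by rewrite -addrA -e2 ler_pM2r ?invr_gt0.
Unshelve. all: by end_near.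
Qed.
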